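(* Let $A\in\mathrm{SL}(2,\mathbb R)$ and let $I\subset\mathbb R$ be a bounded interval of positive length $|I|$. Then as $\tau\to\infty$, $$N_I(A\Lambda_q,\tau)\sim\frac{|I|}{m_q(R_q)}\tau^2,$$ and the probability measures $\rho_{A\Lambda_q,I,\tau}$ on $\mathscr T^q$ converge weakly to $m_q$ (i.e. $\int f\,d\rho_{A\Lambda_q,I,\tau}\to\int f\,dm_q$ for every bounded continuous $f:\mathscr T^q\to\mathbb R$).
   Context: Fix an integer $q\ge3$, let $\lambda_q=2\cos(\pi/q)$, and let $G_q\subset \mathrm{SL}(2,\mathbb R)$ be the Hecke triangle group generated by $S=\begin{pmatrix}0&-1\\1&0\end{pmatrix}$ and $T_q=\begin{pmatrix}1&\lambda_q\\0&1\end{pmatrix}$, acting linearly on $\mathbb R^2$; $\Lambda_q=G_q(1,0)^T$, $A\Lambda_q=\{A\mathbf v:\mathbf v\in\Lambda_q\}$. Matrices: $h_s=\begin{pmatrix}1&0\\-s&1\end{pmatrix}$, $s_\tau=\mathrm{diag}(\tau,\tau^{-1})$, $g_{a,b}=\begin{pmatrix}a&b\\0&a^{-1}\end{pmatrix}$. $S_\tau=\{(x,y)^T:0<x\le\tau\}$; slope of $(x,y)^T$ is $y/x$. $\mathscr T^q=\{(a,b):0<a\le1,\ 1-\lambda_qa<b\le1\}$ with $m_q=\frac2{\lambda_q}\,da\,db$. $R_q(a,b)$ is the smallest positive slope among vectors of $g_{a,b}\Lambda_q\cap S_1$, and $m_q(R_q)=\int R_q\,dm_q$ (finite). For $\mathbf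 u\in A\Lambda_q\cap S_\tau$, $\mathrm{FTR}_q(A,\tau,\mathbf u)$ is the unique $(a,b)\in\mathscr T^q$ with $s_{1/\tau}h_{\mathrm{slope}(\mathbf u)}A\Lambda_q=g_{a,b}\Lambda_q$ (it exists and is unique). Define $\mathcal F_I(A\Lambda_q,\tau)=\{\mathbf u\in A\Lambda_q\cap S_\tau:\mathrm{slope}(\mathbf u)\in I\}$, $N_I(A\Lambda_q,\tau)=\#\mathcal F_I(A\Lambda_q,\tau)$, and when this set is nonempty $\rho_{A\Lambda_q,I,\tau}=\frac1{N_I(A\Lambda_q,\tau)}\sum_{\mathbf u\in\mathcal F_I(A\Lambda_q,\tau)}\delta_{\mathrm{FTR}_q(A,\tau,\mathbf u)}$. *)

(* Defs.v *)
From Stdlib Require Import Reals Lra List ClassicalEpsilon.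
Open Scope R_scope.

Record mat := Mat { m11 : R; m12 : R; m21 : R; m22 : R }.

Definition mmul (A B : mat) : mat :=
  Mat (m11 A * m11 B + m12 A * m21 B) (m11 A * m12 B + m12 A * m22 B)
      (m21 A * m11 B + m22 A * m21 B) (m21 A * m12 B + m22 A * m22 B).

Definition mapp (A : mat) (v : R * R) : R * R :=
  (m11 A * fst v + m12 A * snd v, m21 A * fst v + m22 A * snd v).

Definition det (A : mat) : R := m11 A * m22 A - m12 A * m21 A.

Definition lambda_q (q : nat) : R := 2 * cos (PI / INR q).

Definition mat_id : mat := Mat 1 0 0 1.
Definition mat_S : mat := Mat 0 (-1) 1 0.
Definition mat_T (q : nat) : mat := Mat 1 (lambda_q q) 0 1.
Definition mat_Tinv (q : nat) : mat := Mat 1 (- lambda_q q) 0 1.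

(* G_q = the subgroup of SL(2,R) generated by S and T_q (S^-1 = S^3). *)
Inductive inHecke (q : nat) : mat -> Prop :=
| hecke_id : inHecke q mat_id
| hecke_S M : inHecke q M -> inHecke q (mmul mat_S M)
| hecke_T M : inHecke q M -> inHecke q (mmul (mat_T q) M)
| hecke_Tinv M : inHecke q M -> inHecke q (mmul (mat_Tinv q) M).

Definition inLambda (q : nat) (v : R * R) : Prop :=
  exists M, inHecke q M /\ v = mapp M (1, 0).

Definition inALambda (q : nat) (A : mat) (u : R * R) : Prop :=
  exists v, inLambda q v /\ u = mapp A v.

Definition mat_h (s : R) : mat := Mat 1 0 (- s) 1.
Definition mat_s (t : R) : mat := Mat t 0 0 (/ t).
Definition mat_g (a b : R) : mat := Mat a b 0 (/ a).

Definition inStrip (tau : R) (u : R * R) : Prop := 0 < fst u <= tau.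
Definition slope (u : R * R) : R := snd u / fst u.

Definition inTq (q : nat) (p : R * R) : Prop :=
  0 < fst p <= 1 /\ 1 - lambda_q q * fst p < snd p <= 1.

Definition Rq_is (q : nat) (a b r : R) : Prop :=
  (exists u, inALambda q (mat_g a b) u /\ inStrip 1 u /\ 0 < slope u /\ slope u = r) /\
  (forall u, inALambda q (mat_g a b) u -> inStrip 1 u -> 0 < slope u -> r <= slope u).

Definition Rq (q : nat) (p : R * R) : R :=
  epsilon (inhabits 0) (fun r => Rq_is q (fst p) (snd p) r).

Definition inF (q : nat) (A : mat) (I : R -> Prop) (tau : R) (u : R * R) : Prop :=
  inALambda q A u /\ inStrip tau u /\ I (slope u).

Definition enumerates (P : R * R -> Prop) (l : list (R * R)) : Prop :=
  NoDup l /\ forall u, In u l <-> P u.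

Definition FTR_is (q : nat) (A : mat) (tau : R) (u : R * R) (p : R * R) : Prop :=
  inTq q p /\
  forall w, inALambda q (mmul (mat_s (/ tau)) (mmul (mat_h (slope u)) A)) w
            <-> inALambda q (mat_g (fst p) (snd p)) w.

Fixpoint rsum (k : nat) (f : nat -> R) : R :=
  match k with O => 0 | S k' => rsum k' f + f k' end.

Definition is_glb (E : R -> Prop) (m : R) : Prop :=
  (forall x, E x -> m <= x) /\ (forall m', (forall x, E x -> m' <= x) -> m' <= m).

Definition Rinf (E : R -> Prop) : R := epsilon (inhabits 0) (is_glb E).

Definition ext0 (q : nat) (g : R * R -> R) (p : R * R) : R :=
  epsilon (inhabits 0) (fun r => (inTq q p -> r = g p) /\ (~ inTq q p -> r = 0)).

(* values of h on the closed dyadic cell (i,j) of level n of the box [0,1]x[-1,1]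
   (which contains T^q since lambda_q < 2) *)
Definition cell_vals (h : R * R -> R) (n i j : nat) (y : R) : Prop :=
  let N := INR (Nat.pow 2 n) in
  exists p, INR i / N <= fst p <= INR (S i) / N /\
            -1 + 2 * INR j / N <= snd p <= -1 + 2 * INR (S j) / N /\ y = h p.

Definition lower_sum (h : R * R -> R) (n : nat) : R :=
  let K := Nat.pow 2 n in
  rsum K (fun i => rsum K (fun j =>
    Rinf (cell_vals h n i j) * (1 / INR K) * (2 / INR K))).

(* "int g dm_q = v": limit of the (monotone) dyadic lower sums of the zero
   extension of g, times the density 2/lambda_q. *)
Definition mq_integral_is (q : nat) (g : R * R -> R) (v : R) : Prop :=
  Un_cv (fun n => 2 / lambda_q q * lower_sum (ext0 q g) n) v.

Definition dist_max (p p' : R * R) : R :=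
  Rmax (Rabs (fst p - fst p')) (Rabs (snd p - snd p')).

Definition bounded_on_Tq (q : nat) (f : R * R -> R) : Prop :=
  exists B, forall p, inTq q p -> Rabs (f p) <= B.

Definition continuous_on_Tq (q : nat) (f : R * R -> R) : Prop :=
  forall p, inTq q p -> forall eps, 0 < eps -> exists delta, 0 < delta /\
    forall p', inTq q p' -> dist_max p p' < delta -> Rabs (f p' - f p) < eps.

Fixpoint lsum (l : list (R * R)) (F : R * R -> R) : R :=
  match l with nil => 0 | u :: l' => F u + lsum l' F end.

(* Main.v *)
(* Write the points of F_I as first columns of matrices A M with M in G_q. Then FTR of such a point records the first row of A M divided by tau, with the second entry read modulo lambda times the first, so everything reduces to counting M in G_q with prescribed first row and with slope of the first column in I.

For a cutoff g of the first row, let Phi_t(z) be t^(-2) times the weighted count for z G_q over the slopes in [0,1). Cutting the slope interval into pieces expresses Phi_(kt) at z as an average of Phi_t over points of the expanded horocycle through z, and Phi_t is equicontinuous in z up to O(t^(-2)). Let c be the limsup of Phi_t, uniformly over points without short vectors. If Phi_(kt) is almost c at such a point, then Phi_t is almost c along most of a long horocycle segment; a segment that is not nearly periodic comes close to every point of a given compact set, so Phi_t is almost at least c on that compact set, and averaging once more gives Phi_T -> c at every point. This maximum principle replaces the mixing or measure classification arguments, and no Haar measure is used.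

Scaling shows that the count of points has quadratic growth with a density kappa; transposing G_q turns the ratio of the first row into a slope, which identifies the limit of the cutoff sums as a multiple of Lebesgue measure on T^q. Finally the gaps between consecutive slopes are R_q(FTR)/tau^2 and fill up I, while long gaps are rare; this gives kappa = 1/m_q(R_q). *)

Require Import Defs.
From Stdlib Require Import Reals List Lra Lia Psatz ZArith ClassicalEpsilon Classical Permutation.
From Coquelicot Require Import Compactness.
Open Scope R_scope.

(** Every a priori bound rests on one fact: two non-parallel vectors of the orbit have determinant
    at least 1 in absolute value, so vectors with positive first coordinates [x] and [x'] have
    slopes at least [1/(x x')] apart. Disjoint intervals around the slopes then bound counts, the
    time spent in the cusp, and the total length of long gaps. The obstacle is the cusp: the space
    of lattices is not compact and [R_q] is unbounded. Therefore cutoffs vanish for small [a], the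
    limsup is taken over points without short vectors, and [R_q] is truncated at a large [B]. For
    rectangles of T^q only lower bounds are proved, because transposition enters as an injection.
    They suffice: T^q has [m_q]-mass 1 and the total count is known, so lower bounds for [f + B] and
    [- f + B] leave no room between them. The same squeeze gives convergence of the dyadic lower
    sums, and the comparison with gaps also shows that kappa is positive. *)

Lemma mmul_assoc (A B C : mat) : mmul A (mmul B C) = mmul (mmul A B) C.
Proof. unfold mmul; simpl; f_equal; ring. Qed.

Lemma mapp_mmul (A B : mat) v : mapp (mmul A B) v = mapp A (mapp B v).
Proof. unfold mapp, mmul; simpl; f_equal; ring. Qed.

Lemma det_mmul (A B : mat) : det (mmul A B) = det A * det B.
Proof. unfold det, mmul; simpl; ring. Qed.

Lemma mmul_id_l (A : mat) : mmul mat_id A = A.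
Proof. destruct A; unfold mmul, mat_id; simpl; f_equal; ring. Qed.

Lemma mmul_id_r (A : mat) : mmul A mat_id = A.
Proof. destruct A; unfold mmul, mat_id; simpl; f_equal; ring. Qed.

Lemma mapp_id v : mapp mat_id v = v.
Proof. destruct v; unfold mapp, mat_id; simpl; f_equal; ring. Qed.

Definition minv (A : mat) : mat := Mat (m22 A) (- m12 A) (- m21 A) (m11 A).
Definition mtr (A : mat) : mat := Mat (m11 A) (m21 A) (m12 A) (m22 A).

Lemma minv_l A : det A = 1 -> mmul (minv A) A = mat_id.
Proof. unfold det; intro H; unfold mmul, minv, mat_id; simpl; f_equal; lra. Qed.

Lemma minv_r A : det A = 1 -> mmul A (minv A) = mat_id.
Proof. unfold det; intro H; unfold mmul, minv, mat_id; simpl; f_equal; lra. Qed.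

Lemma det_minv A : det (minv A) = det A.
Proof. unfold det, minv; simpl; ring. Qed.

Lemma mapp_minv_l A v : det A = 1 -> mapp (minv A) (mapp A v) = v.
Proof. intro; rewrite <- mapp_mmul, minv_l, mapp_id; auto. Qed.

Lemma mapp_minv_r A v : det A = 1 -> mapp A (mapp (minv A) v) = v.
Proof. intro; rewrite <- mapp_mmul, minv_r, mapp_id; auto. Qed.

Lemma mtr_mmul A B : mtr (mmul A B) = mmul (mtr B) (mtr A).
Proof. unfold mtr, mmul; simpl; f_equal; ring. Qed.

Lemma mtr_mtr A : mtr (mtr A) = A.
Proof. destruct A; reflexivity. Qed.

Definition vdet (u v : R * R) : R := fst u * snd v - snd u * fst v.
Definition vneg (v : R * R) : R * R := (- fst v, - snd v).
Definition e1 : R * R := (1, 0).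
Definition e2 : R * R := (0, 1).

Lemma vdet_mapp A u v : vdet (mapp A u) (mapp A v) = det A * vdet u v.
Proof. unfold vdet, mapp, det; simpl; ring. Qed.

Lemma mapp_vneg A v : mapp A (vneg v) = vneg (mapp A v).
Proof. unfold mapp, vneg; simpl; f_equal; ring. Qed.

Lemma mapp_inj A u v : det A = 1 -> mapp A u = mapp A v -> u = v.
Proof.
  intros H E. rewrite <- (mapp_minv_l A u H), <- (mapp_minv_l A v H), E. reflexivity.
Qed.

(** * The Hecke group and its orbit *)

Section Hecke.
Variable q : nat.

Lemma hecke_det M : inHecke q M -> det M = 1.
Proof.
  induction 1; try rewrite det_mmul, IHinHecke;
  unfold det, mat_id, mat_S, mat_T, mat_Tinv; simpl; ring.
Qed.

Lemma hecke_mmul M N : inHecke q M -> inHecke q N -> inHecke q (mmul M N).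
Proof.
  induction 1; intros; rewrite <- ?mmul_assoc.
  - now rewrite mmul_id_l.
  - apply hecke_S; auto.
  - apply hecke_T; auto.
  - apply hecke_Tinv; auto.
Qed.

Lemma hecke_gS : inHecke q mat_S.
Proof. rewrite <- (mmul_id_r mat_S). repeat constructor. Qed.
Lemma hecke_gT : inHecke q (mat_T q).
Proof. rewrite <- (mmul_id_r (mat_T q)). repeat constructor. Qed.
Lemma hecke_gTinv : inHecke q (mat_Tinv q).
Proof. rewrite <- (mmul_id_r (mat_Tinv q)). repeat constructor. Qed.

Lemma hecke_gSinv : inHecke q (minv mat_S).
Proof.
  replace (minv mat_S) with (mmul mat_S (mmul mat_S mat_S)).
  - repeat (apply hecke_mmul || apply hecke_gS).
  - unfold minv, mmul, mat_S; simpl; f_equal; ring.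
Qed.

Lemma minv_mmul A B : minv (mmul A B) = mmul (minv B) (minv A).
Proof. unfold minv, mmul; simpl; f_equal; ring. Qed.

Lemma hecke_minv M : inHecke q M -> inHecke q (minv M).
Proof.
  induction 1; rewrite ?minv_mmul.
  - replace (minv mat_id) with mat_id by (unfold minv, mat_id; simpl; f_equal; ring).
    constructor.
  - apply hecke_mmul; auto using hecke_gSinv.
  - apply hecke_mmul; auto.
    replace (minv (mat_T q)) with (mat_Tinv q); auto using hecke_gTinv.
    unfold minv, mat_T, mat_Tinv; simpl; f_equal; ring.
  - apply hecke_mmul; auto.
    replace (minv (mat_Tinv q)) with (mat_T q); auto using hecke_gT.
    unfold minv, mat_T, mat_Tinv; simpl; f_equal; ring.
Qed.

(** The symmetry behind the duality between rows and columns: the transpose of [S] is [S^-1], and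
    that of [T] is [S T^-1 S^-1]. *)
Lemma hecke_mtr M : inHecke q M -> inHecke q (mtr M).
Proof.
  induction 1; rewrite ?mtr_mmul.
  - constructor.
  - apply hecke_mmul; auto.
    replace (mtr mat_S) with (minv mat_S); auto using hecke_gSinv.
    unfold minv, mtr, mat_S; simpl; f_equal; ring.
  - apply hecke_mmul; auto.
    replace (mtr (mat_T q)) with (mmul mat_S (mmul (mat_Tinv q) (minv mat_S))).
    + repeat (apply hecke_mmul; auto using hecke_gS, hecke_gTinv, hecke_gSinv).
    + unfold minv, mtr, mat_S, mat_T, mat_Tinv, mmul; simpl; f_equal; ring.
  - apply hecke_mmul; auto.
    replace (mtr (mat_Tinv q)) with (mmul mat_S (mmul (mat_T q) (minv mat_S))).
    + repeat (apply hecke_mmul; auto using hecke_gS, hecke_gT, hecke_gSinv).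
    + unfold minv, mtr, mat_S, mat_T, mat_Tinv, mmul; simpl; f_equal; ring.
Qed.

Definition mat_Tn (n : Z) : mat := Mat 1 (IZR n * lambda_q q) 0 1.

Lemma hecke_Tn n : inHecke q (mat_Tn n).
Proof.
  assert (Hn : forall k : nat, inHecke q (mat_Tn (Z.of_nat k)) /\ inHecke q (mat_Tn (- Z.of_nat k))).
  { induction k as [|k [IH1 IH2]].
    - split; replace (mat_Tn _) with mat_id; try constructor;
      unfold mat_Tn, mat_id; simpl; f_equal; ring.
    - split.
      + replace (mat_Tn (Z.of_nat (S k))) with (mmul (mat_T q) (mat_Tn (Z.of_nat k))).
        * apply hecke_T; auto.
        * unfold mat_Tn, mat_T, mmul; simpl m11; simpl m12; simpl m21; simpl m22.
          rewrite Nat2Z.inj_succ, succ_IZR. f_equal; ring.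
      + replace (mat_Tn (- Z.of_nat (S k))) with (mmul (mat_Tinv q) (mat_Tn (- Z.of_nat k))).
        * apply hecke_Tinv; auto.
        * unfold mat_Tn, mat_Tinv, mmul; simpl m11; simpl m12; simpl m21; simpl m22.
          rewrite !opp_IZR, Nat2Z.inj_succ, succ_IZR. f_equal; ring. }
  destruct (Z_le_gt_dec 0 n).
  - rewrite <- (Z2Nat.id n) by lia. apply Hn.
  - replace n with (- Z.of_nat (Z.to_nat (- n)))%Z by lia. apply Hn.
Qed.

Lemma Lam_e1 : inLambda q e1.
Proof. exists mat_id; split; [constructor|]. now rewrite mapp_id. Qed.

Lemma Lam_mapp M v : inHecke q M -> inLambda q v -> inLambda q (mapp M v).
Proof.
  intros HM [N [HN ->]]. exists (mmul M N). split.
  - now apply hecke_mmul.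
  - now rewrite mapp_mmul.
Qed.

Lemma Lam_mapp_e1 M : inHecke q M -> inLambda q (mapp M e1).
Proof. intros; apply Lam_mapp; auto using Lam_e1. Qed.

Lemma mapp_S_e1 : mapp mat_S e1 = e2.
Proof. unfold mapp, mat_S, e1, e2; simpl; f_equal; ring. Qed.

Lemma Lam_e2 : inLambda q e2.
Proof. rewrite <- mapp_S_e1. apply Lam_mapp; auto using hecke_gS, Lam_e1. Qed.

Lemma Lam_mapp_e2 M : inHecke q M -> inLambda q (mapp M e2).
Proof. intros; apply Lam_mapp; auto using Lam_e2. Qed.

Lemma Lam_vneg v : inLambda q v -> inLambda q (vneg v).
Proof.
  intro H. replace (vneg v) with (mapp (mmul mat_S mat_S) v).
  - apply Lam_mapp; auto. apply hecke_mmul; apply hecke_gS.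
  - unfold mapp, mmul, mat_S, vneg; simpl; f_equal; ring.
Qed.

Lemma ALam_mmul A M v : inHecke q M -> inALambda q (mmul A M) v <-> inALambda q A v.
Proof.
  intro HM; split; intros [w [Hw ->]].
  - exists (mapp M w); split; [now apply Lam_mapp | now rewrite mapp_mmul].
  - exists (mapp (minv M) w); split.
    + apply Lam_mapp; auto using hecke_minv.
    + rewrite mapp_mmul, mapp_minv_r; auto using hecke_det.
Qed.
End Hecke.

(** * Discreteness of the orbit: the fan of the first quadrant *)

Section Trig.
Variable q : nat.
Hypothesis hq : (3 <= q)%nat.

(** Chebyshev values: [(sq (i+1), sq i)] is [(T S)^i e1], and as [i] runs from 0 to [q - 1] these
    vectors sweep the quadrant from [e1] to [e2]. *)
Definition sq (i : nat) : R := sin (INR i * (PI / INR q)) / sin (PI / INR q).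

Lemma INRq : 3 <= INR q.
Proof. replace 3 with (INR 3) by (simpl; ring). now apply le_INR. Qed.

Lemma th_pos : 0 < PI / INR q.
Proof. pose proof INRq; pose proof PI_RGT_0. apply Rdiv_lt_0_compat; lra. Qed.

Lemma th_q : INR q * (PI / INR q) = PI.
Proof. pose proof INRq. field. lra. Qed.

Lemma th_le : PI / INR q <= PI / 3.
Proof.
  pose proof INRq; pose proof PI_RGT_0. unfold Rdiv.
  apply Rmult_le_compat_l; [lra|]. apply Rinv_le_contravar; lra.
Qed.

Lemma sin_th_pos : 0 < sin (PI / INR q).
Proof. pose proof th_pos; pose proof th_le; pose proof PI_RGT_0. apply sin_gt_0; lra. Qed.

Lemma lam_bounds : 1 <= lambda_q q < 2.
Proof.
  unfold lambda_q. pose proof th_pos; pose proof th_le; pose proof PI_RGT_0.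
  assert (1/2 <= cos (PI / INR q)).
  { rewrite <- cos_PI3. destruct (Rle_lt_or_eq_dec _ _ th_le) as [h|h].
    - left. apply cos_decreasing_1; lra.
    - rewrite h; lra. }
  assert (cos (PI / INR q) < 1).
  { rewrite <- cos_0. apply cos_decreasing_1; lra. }
  lra.
Qed.

Lemma sq_0 : sq 0 = 0.
Proof. unfold sq. simpl INR. rewrite Rmult_0_l, sin_0. unfold Rdiv; ring. Qed.

Lemma sq_1 : sq 1 = 1.
Proof. unfold sq. simpl INR. rewrite Rmult_1_l. pose proof sin_th_pos. field. lra. Qed.

Lemma sq_rec i : sq (S (S i)) = lambda_q q * sq (S i) - sq i.
Proof.
  unfold sq, lambda_q. pose proof sin_th_pos. rewrite !S_INR.
  set (t := PI / INR q) in *. 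
  replace ((INR i + 1 + 1) * t) with ((INR i + 1) * t + t) by ring.
  replace (INR i * t) with ((INR i + 1) * t - t) by ring.
  rewrite sin_plus, sin_minus. field. lra.
Qed.

Lemma sq_sym i : (i <= q)%nat -> sq (q - i) = sq i.
Proof.
  intro Hi. unfold sq. f_equal. rewrite minus_INR by auto.
  rewrite Rmult_minus_distr_r, th_q. rewrite sin_minus, sin_PI, cos_PI. ring.
Qed.

Lemma sq_q : sq q = 0.
Proof. rewrite <- sq_0, <- (sq_sym 0) by lia. now rewrite Nat.sub_0_r. Qed.

Lemma sq_q1 : sq (q - 1) = 1.
Proof. rewrite sq_sym by lia. apply sq_1. Qed.

Lemma sq_q2 : sq (q - 2) = lambda_q q.
Proof. rewrite sq_sym by lia. rewrite sq_rec, sq_1, sq_0. ring. Qed.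

(** The reflection [i -> q - i] brings the angle into the first quarter turn, where sine increases.
    Strictness singles out the few fan vectors with a coordinate equal to 1. *)
Lemma sq_gt1 i : (2 <= i <= q - 2)%nat -> 1 < sq i.
Proof.
  intros Hi. 
  assert (K : forall j, (2 <= j)%nat -> (2 * j <= q)%nat -> 1 < sq j).
  { intros j Hj1 Hj2. unfold sq. pose proof sin_th_pos as Hs. pose proof th_pos; pose proof th_le.
    apply (Rmult_lt_reg_r (sin (PI / INR q))); [auto|]. 
    replace (sin (INR j * (PI / INR q)) / sin (PI / INR q) * sin (PI / INR q)) with
     (sin (INR j * (PI / INR q))) by (field; lra). rewrite Rmult_1_l.
    assert (2 <= INR j). { replace 2 with (INR 2) by (simpl; ring). apply le_INR; auto. }
    assert (INR j * (PI / INR q) <= PI / 2).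
    { assert (2 * INR j <= INR q).
      { replace 2 with (INR 2) by (simpl; ring). rewrite <- mult_INR. apply le_INR; auto. }
      pose proof th_q. nra. }
    apply sin_increasing_1; try lra; nra. }
  destruct (Nat.le_gt_cases (2 * i) q).
  - apply K; lia.
  - rewrite <- sq_sym by lia. apply K; lia.
Qed.

Lemma sq_ge1 i : (1 <= i <= q - 1)%nat -> 1 <= sq i.
Proof.
  intro Hi. destruct (Nat.eq_dec i 1) as [->|]. { rewrite sq_1; lra. }
  destruct (Nat.eq_dec i (q-1)) as [->|]. { rewrite sq_q1; lra. }
  left. apply sq_gt1. lia.
Qed.

Lemma sq_ge0 i : (i <= q)%nat -> 0 <= sq i.
Proof.
  intro Hi. destruct (Nat.eq_dec i 0) as [->|]. { rewrite sq_0; lra. }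
  destruct (Nat.eq_dec i q) as [->|]. { rewrite sq_q; lra. }
  pose proof (sq_ge1 i ltac:(lia)). lra.
Qed.

Lemma sq_le i : sq i <= / sin (PI / INR q).
Proof.
  unfold sq. pose proof sin_th_pos. rewrite <- (Rmult_1_l (/ _)). unfold Rdiv.
  apply Rmult_le_compat_r. { left; now apply Rinv_0_lt_compat. }
  apply SIN_bound.
Qed.

(* The quadrant is tiled by the cones of consecutive vectors (s_(i+1), s_i); Amat i maps the quadrant onto the i-th one. *)
Definition Amat (i : nat) : mat := Mat (sq (S i)) (sq (S (S i))) (sq i) (sq (S i)).

(** A Stern-Brocot tree for the orbit. Words in [S] and [T] involve cancellation, whereas along this
    tree all coordinates stay nonnegative and can be bounded below by induction. *)
Inductive fan : R * R -> Prop :=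
| fan_e1 : fan e1
| fan_e2 : fan e2
| fan_A i v : (i <= q - 2)%nat -> fan v -> fan (mapp (Amat i) v).

(** The four alternatives are the rotations of the fan by multiples of a quarter turn, that is by
    powers of [S]. *)
Definition psgn (v : R * R) : Prop :=
  exists w, fan w /\ (v = w \/ v = vneg w \/ v = mapp mat_S w \/ v = vneg (mapp mat_S w)).

Lemma psgn_neg v : psgn v -> psgn (vneg v).
Proof.
  intros [w [Hw H]]. exists w; split; auto.
  assert (N : forall a, vneg (vneg a) = a).
  { intros [a b]; unfold vneg; simpl; f_equal; ring. }
  destruct H as [-> | [->|[->| ->]]]; rewrite ?N; auto.
Qed.

Lemma psgn_S v : psgn v -> psgn (mapp mat_S v).
Proof.
  intros [w [Hw H]]. exists w; split; auto.
  destruct H as [-> | [->|[->| ->]]]; auto; unfold vneg, mapp, mat_S; simpl.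
  - right; right; right. f_equal; ring.
  - right; left. f_equal; ring.
  - left. destruct w; simpl; f_equal; ring.
Qed.

Lemma sq_q2' : sq (S (q - 2)) = 1.
Proof. replace (S (q - 2)) with (q - 1)%nat by lia. apply sq_q1. Qed.
Lemma sq_qq : sq (S (S (q - 2))) = 0.
Proof. replace (S (S (q - 2))) with q by lia. apply sq_q. Qed.

Lemma psgn_T_fan w : fan w -> psgn (mapp (mat_T q) w).
Proof.
  intro Hw. exists (mapp (Amat 0) w). split. { constructor; auto; lia. }
  left. unfold Amat. rewrite sq_rec, sq_1, sq_0. unfold mapp, mat_T; simpl; f_equal; ring.
Qed.

(** [T S] sends the i-th cone to the next one, and the last one out of the quadrant:
    [T S Amat (q-2) = S]. Together with [T = Amat 0] and the inverse relations
    [T^-1 Amat (i+1) = S Amat i] and [T^-1 S = S Amat (q-2)], this makes [psgn] stable under all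
    generators. *)
Lemma psgn_TS_fan w : fan w -> psgn (mapp (mat_T q) (mapp mat_S w)).
Proof.
  intro Hw. destruct Hw as [| |i w Hi Hw].
  - exists (mapp (Amat 0) e2). split. { constructor; [lia|constructor]. }
    left. unfold Amat. rewrite sq_rec, sq_1, sq_0. unfold mapp, mat_T, mat_S; simpl; f_equal; ring.
  - exists e1. split; [constructor|]. right; left.
    unfold mapp, mat_T, mat_S, vneg; simpl; f_equal; ring.
  - destruct (Nat.eq_dec i (q - 2)) as [->|].
    + exists w; split; auto. right; right; left. unfold Amat.
      rewrite sq_qq, sq_q2', sq_q2. unfold mapp, mat_T, mat_S; simpl; f_equal; ring.
    + exists (mapp (Amat (S i)) w). split. { constructor; auto; lia. }
      left. unfold Amat. rewrite !sq_rec. unfold mapp, mat_T, mat_S; simpl; f_equal; ring.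
Qed.

Lemma psgn_Tinv_fan w : fan w -> psgn (mapp (mat_Tinv q) w).
Proof.
  intro Hw. destruct Hw as [| |i w Hi Hw].
  - exists e1; split; [constructor|]. left. unfold mapp, mat_Tinv, e1; simpl; f_equal; ring.
  - exists (mapp (Amat (q - 2)) e1). split. { constructor; [lia|constructor]. }
    right; right; left. unfold Amat. rewrite sq_qq, sq_q2', sq_q2.
    unfold mapp, mat_Tinv, mat_S; simpl; f_equal; ring.
  - destruct i as [|i].
    + exists w; split; auto. left. unfold Amat. rewrite sq_rec, sq_1, sq_0.
      destruct w; unfold mapp, mat_Tinv; simpl; f_equal; ring.
    + exists (mapp (Amat i) w). split. { constructor; auto; lia. }
      right; right; left. unfold Amat. rewrite !sq_rec.
      unfold mapp, mat_Tinv, mat_S; simpl; f_equal; ring.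
Qed.

Lemma psgn_TinvS_fan w : fan w -> psgn (mapp (mat_Tinv q) (mapp mat_S w)).
Proof.
  intro Hw. exists (mapp (Amat (q - 2)) w). split. { constructor; auto; lia. }
  right; right; left. unfold Amat. rewrite sq_qq, sq_q2', sq_q2.
  unfold mapp, mat_Tinv, mat_S; simpl; f_equal; ring.
Qed.

Lemma psgn_Lam v : inLambda q v -> psgn v.
Proof.
  intros [M [HM ->]]. induction HM; rewrite ?mapp_mmul.
  - exists e1; split; [constructor|]. left. now rewrite mapp_id.
  - now apply psgn_S.
  - destruct IHHM as [w [Hw [-> | [->|[->| ->]]]]]; rewrite ?mapp_vneg; try apply psgn_neg;
      auto using psgn_T_fan, psgn_TS_fan.
  - destruct IHHM as [w [Hw [-> | [->|[->| ->]]]]]; rewrite ?mapp_vneg; try apply psgn_neg;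
      auto using psgn_Tinv_fan, psgn_TinvS_fan.
Qed.

(** The entries of [Amat i] are 0 or at least 1, so passing down the tree never produces a nonzero
    coordinate below 1. This is the discreteness of the orbit. *)
Lemma fan_cases v : fan v -> v = e1 \/ v = e2 \/ (1 <= fst v /\ 1 <= snd v).
Proof.
  induction 1 as [| |i v Hi Hv IH]; auto.
  assert (G1 : forall j, (1 <= j <= q - 1)%nat -> 1 <= sq j) by apply sq_ge1.
  assert (H1 : 1 <= sq (S i)) by (apply G1; lia).
  assert (H0 : 0 <= sq i) by (apply sq_ge0; lia).
  assert (H2 : 0 <= sq (S (S i))) by (apply sq_ge0; lia).
  destruct IH as [-> | [->|[h1 h2]]].
  - destruct (Nat.eq_dec i 0) as [->|].
    + left. unfold mapp, Amat, e1; simpl. rewrite sq_1, sq_0. f_equal; ring.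
    + right; right. assert (1 <= sq i) by (apply G1; lia).
      unfold mapp, Amat, e1; simpl; lra.
  - destruct (Nat.eq_dec i (q - 2)) as [->|].
    + right; left. unfold mapp, Amat, e2; simpl. rewrite sq_qq, sq_q2'. f_equal; ring.
    + right; right. assert (1 <= sq (S (S i))) by (apply G1; lia).
      unfold mapp, Amat, e2; simpl; lra.
  - right; right. unfold mapp, Amat; simpl. nra.
Qed.

(** Determines the stabiliser of [e1]. A second coordinate 1 is inherited only in the cone of
    [Amat 0 = T], which adds one [lambda_q] to the first coordinate; in the other cones only images
    of [e1] or [e2] can have it. *)
Lemma fan_snd1 v : fan v -> snd v = 1 -> exists n : Z, fst v = IZR n * lambda_q q.
Proof.
  induction 1 as [| |i v Hi Hv IH]; intro E.
  - simpl in E; lra.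
  - exists 0%Z. simpl; ring.
  - pose proof (sq_ge1 (S i) ltac:(lia)) as H1.
    destruct (Nat.eq_dec i 0) as [->|].
    + unfold mapp, Amat in *; simpl in *. rewrite sq_rec, sq_1, sq_0 in *.
      destruct IH as [n Hn]; [lra|]. exists (n + 1)%Z. rewrite plus_IZR, Hn.
      replace (snd v) with 1 by lra. ring.
    + pose proof (sq_ge1 i ltac:(lia)) as H0.
      destruct (fan_cases v Hv) as [-> | [->|[h1 h2]]]; unfold mapp, Amat in *; simpl in *.
      * destruct (Nat.eq_dec i 1) as [->|].
        -- exists 1%Z. rewrite sq_rec, sq_1, sq_0. ring.
        -- pose proof (sq_gt1 i ltac:(lia)). lra.
      * destruct (Nat.eq_dec i (q - 2)) as [->|].
        -- exists 0%Z. rewrite sq_qq. ring.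
        -- pose proof (sq_gt1 (S i) ltac:(lia)). lra.
      * nra.
Qed.

Lemma fan_fst1 v : fan v -> fst v = 1 -> exists n : Z, snd v = IZR n * lambda_q q.
Proof.
  induction 1 as [| |i v Hi Hv IH]; intro E.
  - exists 0%Z. simpl; ring.
  - simpl in E; lra.
  - pose proof (sq_ge1 (S i) ltac:(lia)) as H1.
    destruct (Nat.eq_dec i (q - 2)) as [->|].
    + unfold mapp, Amat in *; simpl in *. rewrite sq_qq, sq_q2', sq_q2 in *.
      destruct IH as [n Hn]; [lra|]. exists (n + 1)%Z. rewrite plus_IZR, Hn.
      replace (fst v) with 1 by lra. ring.
    + pose proof (sq_ge1 (S (S i)) ltac:(lia)) as H0.
      destruct (fan_cases v Hv) as [-> | [->|[h1 h2]]]; unfold mapp, Amat in *; simpl in *.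
      * destruct (Nat.eq_dec i 0) as [->|].
        -- exists 0%Z. rewrite sq_0. ring.
        -- pose proof (sq_gt1 (S i) ltac:(lia)). lra.
      * destruct (Nat.eq_dec (S (S i)) (q - 1)) as [E'|].
        -- exists 1%Z. replace (S i) with (q - 2)%nat by lia. rewrite sq_q2. ring.
        -- pose proof (sq_gt1 (S (S i)) ltac:(lia)). lra.
      * nra.
Qed.

Lemma Lam_snd v : inLambda q v ->
  (snd v = 0 /\ (fst v = 1 \/ fst v = -1)) \/ 1 <= Rabs (snd v).
Proof.
  intro H. destruct (psgn_Lam v H) as [w [Hw Hv]].
  destruct (fan_cases w Hw) as [-> | [->|[h1 h2]]];
  destruct Hv as [-> | [->|[->| ->]]]; unfold vneg, mapp, mat_S, e1, e2 in *; simpl in *.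
  all: try (left; lra). all: right; unfold Rabs; destruct (Rcase_abs _); lra.
Qed.

Lemma Lam_big v : inLambda q v -> 1 <= Rabs (fst v) \/ 1 <= Rabs (snd v).
Proof.
  intro H. destruct (Lam_snd v H) as [[_ [E|E]]|]; auto; left; rewrite E;
  unfold Rabs; destruct (Rcase_abs _); lra.
Qed.

Lemma Lam_snd1 v : inLambda q v -> snd v = 1 -> exists n : Z, fst v = IZR n * lambda_q q.
Proof.
  intros H E. destruct (psgn_Lam v H) as [w [Hw Hv]].
  assert (C := fan_cases w Hw).
  assert (0 <= fst w /\ 0 <= snd w) as [P1 P2].
  { destruct C as [-> | [->|[h1 h2]]]; unfold e1, e2; simpl; lra. }
  destruct Hv as [-> | [->|[->| ->]]]; unfold vneg, mapp, mat_S in *; simpl in *.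
  - now apply fan_snd1.
  - lra.
  - destruct (fan_fst1 w Hw ltac:(lra)) as [n Hn]. exists (- n)%Z. rewrite opp_IZR, Hn. ring.
  - lra.
Qed.

(** Moving [v] to [e1] inside the group turns the determinant into a second coordinate, for which
    the gap between 0 and 1 is known. All packing estimates descend from this. *)
Lemma Lam_vdet v w : inLambda q v -> inLambda q w ->
  (vdet v w = 0 /\ (w = v \/ w = vneg v)) \/ 1 <= Rabs (vdet v w).
Proof.
  intros [M [HM ->]] Hw. pose proof (hecke_det q M HM) as D.
  set (w' := mapp (minv M) w).
  assert (Hw' : inLambda q w') by (apply Lam_mapp; auto using hecke_minv).
  assert (E : w = mapp M w') by (unfold w'; rewrite mapp_minv_r; auto).
  assert (F : vdet (mapp M e1) w = snd w').
  { rewrite E, vdet_mapp, D. unfold vdet, e1; simpl; ring. }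
  fold e1. rewrite F. destruct (Lam_snd w' Hw') as [[E0 E1]|]; auto.
  left; split; auto. rewrite E, <- mapp_vneg.
  destruct E1 as [H|H]; [left|right]; f_equal; rewrite (surjective_pairing w'), H, E0; unfold vneg, e1; simpl; f_equal; lra.
Qed.

Lemma mat_cols (M N : mat) : mapp M e1 = mapp N e1 -> mapp M e2 = mapp N e2 -> M = N.
Proof.
  destruct M, N; unfold mapp, e1, e2; simpl. intros H1 H2.
  injection H1; injection H2; intros. f_equal; lra.
Qed.

(** Seen in the basis given by [M], the second column of [N] is an orbit vector of height 1, hence
    [(n lambda, 1)]. *)
Lemma hecke_same_col M N : inHecke q M -> inHecke q N -> mapp M e1 = mapp N e1 ->
  exists n : Z, N = mmul M (mat_Tn q n).
Proof.
  intros HM HN E. pose proof (hecke_det q M HM) as D. pose proof (hecke_det q N HN) as D'.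
  set (w := mapp (minv M) (mapp N e2)).
  assert (Hw : inLambda q w).
  { apply Lam_mapp; auto using hecke_minv, Lam_mapp_e2. }
  assert (Ew : mapp N e2 = mapp M w) by (unfold w; rewrite mapp_minv_r; auto).
  clearbody w.
  assert (S1 : snd w = 1).
  { assert (vdet (mapp N e1) (mapp N e2) = 1).
    { rewrite vdet_mapp, D'. unfold vdet, e1, e2; simpl; ring. }
    rewrite Ew, <- E, vdet_mapp, D in H. unfold vdet in H; simpl in H. lra. }
  destruct (Lam_snd1 w Hw S1) as [n Hn]. exists n.
  apply mat_cols; rewrite mapp_mmul.
  - rewrite <- E. f_equal. unfold mapp, mat_Tn, e1; simpl; f_equal; ring.
  - rewrite Ew. f_equal. destruct w; unfold mapp, mat_Tn, e2; simpl in *; f_equal; lra.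
Qed.
End Trig.

(** * Finite sums and disjoint intervals *)

Fixpoint Sm {X} (l : list X) (F : X -> R) : R :=
  match l with nil => 0 | x :: l' => F x + Sm l' F end.

Lemma lsum_Sm l F : lsum l F = Sm l F.
Proof. induction l; simpl; congruence. Qed.

Lemma Sm_le {X} (l : list X) F G : (forall x, In x l -> F x <= G x) -> Sm l F <= Sm l G.
Proof.
  induction l as [|x l IH]; simpl; intro H; [lra|].
  apply Rplus_le_compat; auto.
Qed.

Lemma Sm_ext {X} (l : list X) F G : (forall x, In x l -> F x = G x) -> Sm l F = Sm l G.
Proof.
  induction l as [|x l IH]; simpl; intro H; auto.
  rewrite H, IH; auto.
Qed.

Lemma Sm_plus {X} (l : list X) F G : Sm l (fun x => F x + G x) = Sm l F + Sm l G.
Proof. induction l; simpl; [ring|]. rewrite IHl; ring. Qed.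

Lemma Sm_scal {X} (l : list X) c F : Sm l (fun x => c * F x) = c * Sm l F.
Proof. induction l; simpl; [ring|]. rewrite IHl; ring. Qed.

Lemma Sm_minus {X} (l : list X) F G : Sm l (fun x => F x - G x) = Sm l F - Sm l G.
Proof. induction l; simpl; [ring|]. rewrite IHl; ring. Qed.

Lemma Sm_const {X} (l : list X) c : Sm l (fun _ => c) = c * INR (length l).
Proof.
  induction l as [|x l IH]; [simpl; ring|].
  change (length (x :: l)) with (S (length l)). rewrite S_INR. simpl Sm. rewrite IH. ring.
Qed.

Lemma Sm_nonneg {X} (l : list X) F : (forall x, In x l -> 0 <= F x) -> 0 <= Sm l F.
Proof.
  intro H. apply Rle_trans with (Sm l (fun _ => 0)).
  - rewrite Sm_const; lra.
  - apply Sm_le; auto.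
Qed.

Lemma Sm_zero {X} (l : list X) F : (forall x, In x l -> F x = 0) -> Sm l F = 0.
Proof.
  intro H. rewrite (Sm_ext l F (fun _ => 0)) by auto. rewrite Sm_const; ring.
Qed.

Lemma Sm_Rabs {X} (l : list X) F : Rabs (Sm l F) <= Sm l (fun x => Rabs (F x)).
Proof.
  induction l; simpl; [rewrite Rabs_R0; lra|].
  eapply Rle_trans; [apply Rabs_triang|]. lra.
Qed.

Lemma Sm_app {X} (l l' : list X) F : Sm (l ++ l') F = Sm l F + Sm l' F.
Proof. induction l; simpl; [ring|]. rewrite IHl; ring. Qed.

Lemma Sm_map {X Y} (l : list X) (f : X -> Y) F : Sm (map f l) F = Sm l (fun x => F (f x)).
Proof. induction l; simpl; congruence. Qed.

Lemma Sm_swap {X Y} (l : list X) (l' : list Y) F :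
  Sm l (fun x => Sm l' (F x)) = Sm l' (fun y => Sm l (fun x => F x y)).
Proof.
  induction l as [|x l IH]; simpl.
  - symmetry; apply Sm_zero; auto.
  - rewrite IH, Sm_plus. auto.
Qed.

Lemma Sm_perm {X} (l l' : list X) F : Permutation l l' -> Sm l F = Sm l' F.
Proof. induction 1; simpl; lra. Qed.

Lemma Sm_filter {X} (f : X -> bool) (l : list X) F :
  Sm l F = Sm (filter f l) F + Sm (filter (fun x => negb (f x)) l) F.
Proof.
  induction l as [|x l IH]; simpl; [ring|]. destruct (f x); simpl; lra.
Qed.

Lemma Sm_filter_if {X} (f : X -> bool) (l : list X) F :
  Sm (filter f l) F = Sm l (fun x => if f x then F x else 0).
Proof.
  induction l as [|x l IH]; simpl; [ring|]. destruct (f x); simpl; lra.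
Qed.

Lemma Sm_remove {X} (l1 l2 : list X) x F :
  Sm (l1 ++ x :: l2) F = F x + Sm (l1 ++ l2) F.
Proof. rewrite !Sm_app; simpl; ring. Qed.

Lemma Sm_one_le {X} (l : list X) x F : (forall y, In y l -> 0 <= F y) -> In x l -> F x <= Sm l F.
Proof.
  intros H Hx. destruct (in_split _ _ Hx) as [l1 [l2 ->]]. rewrite Sm_remove.
  assert (0 <= Sm (l1 ++ l2) F); [|lra].
  apply Sm_nonneg. intros y Hy. apply H. apply in_app_iff in Hy. apply in_app_iff. simpl. tauto.
Qed.

(** Quicksort induction: the head interval splits the others into those on its left and those on its
    right. The induction is on a bound [n] for the length, as these sublists are not tails. *)
Lemma pack {X} (lo hi : X -> R) : forall (n : nat) (l : list X) L H, (length l <= n)%nat ->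
  L <= H -> NoDup l ->
  (forall x, In x l -> L <= lo x /\ lo x <= hi x /\ hi x <= H) ->
  (forall x y, In x l -> In y l -> x <> y -> hi x <= lo y \/ hi y <= lo x) ->
  Sm l (fun x => hi x - lo x) <= H - L.
Proof.
  induction n as [|n IH]; intros l L H Hn HLH ND Hr Hp.
  - destruct l; [simpl; lra|simpl in Hn; lia].
  - destruct l as [|x l]; [simpl; lra|]. simpl in Hn.
    inversion ND as [|? ? Hx ND']; subst.
    destruct (Hr x (or_introl eq_refl)) as (r1 & r2 & r3).
    set (f := fun y => if Rle_dec (hi y) (lo x) then true else false).
    simpl Sm. rewrite (Sm_filter f l).
    assert (Sm (filter f l) (fun y => hi y - lo y) <= lo x - L).
    { apply IH; auto.
      - pose proof (filter_length_le f l). lia.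
      - now apply NoDup_filter.
      - intros y Hy. apply filter_In in Hy. destruct Hy as [Hy Hf].
        unfold f in Hf. destruct (Rle_dec (hi y) (lo x)); [|discriminate].
        destruct (Hr y (or_intror Hy)) as (?&?&?). auto.
      - intros y z Hy Hz. apply filter_In in Hy. apply filter_In in Hz. apply Hp; simpl; tauto. }
    assert (Sm (filter (fun y => negb (f y)) l) (fun y => hi y - lo y) <= H - hi x).
    { apply IH; auto.
      - pose proof (filter_length_le (fun y => negb (f y)) l). lia.
      - now apply NoDup_filter.
      - intros y Hy. apply filter_In in Hy. destruct Hy as [Hy Hf].
        unfold f in Hf. destruct (Rle_dec (hi y) (lo x)) as [|N]; [discriminate|].
        destruct (Hr y (or_intror Hy)) as (?&?&?).
        assert (x <> y) by (intros ->; auto).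
        destruct (Hp x y); simpl; auto. contradiction.
      - intros y z Hy Hz. apply filter_In in Hy. apply filter_In in Hz. apply Hp; simpl; tauto. }
    lra.
Qed.

(** Induction by removing an interval that contains the left end [L] and continuing from its right
    end. *)
Lemma cover {X} (lo hi : X -> R) : forall (n : nat) (l : list X) L H, (length l <= n)%nat ->
  (forall x, In x l -> lo x <= hi x) ->
  (forall s, L <= s < H -> exists x, In x l /\ lo x <= s < hi x) ->
  H - L <= Sm l (fun x => hi x - lo x).
Proof.
  induction n as [|n IH]; intros l L H Hn Hr Hc.
  - destruct l; [|simpl in Hn; lia]. simpl.
    destruct (Rlt_le_dec L H) as [h|]; [|lra].
    destruct (Hc L ltac:(lra)) as [x [[] _]].
  - destruct (Rlt_le_dec L H) as [h|].
    + destruct (Hc L ltac:(lra)) as [x [Hx [h1 h2]]].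
      destruct (in_split _ _ Hx) as [l1 [l2 ->]]. rewrite Sm_remove.
      assert (H - hi x <= Sm (l1 ++ l2) (fun x => hi x - lo x)); [|lra].
      apply IH.
      * rewrite length_app in *. simpl in Hn. lia.
      * intros y Hy. apply Hr. rewrite in_app_iff in *. simpl; tauto.
      * intros s Hs. destruct (Hc s ltac:(lra)) as [y [Hy Hy']].
        exists y; split; auto. rewrite in_app_iff in *. simpl in Hy.
        destruct Hy as [|[<-|]]; try tauto. lra.
    + apply Rle_trans with 0; [lra|]. apply Sm_nonneg. intros x Hx. specialize (Hr x Hx). lra.
Qed.

(** Greedy extension of a duplicate-free list: the bound on lengths forces it to stop, and it stops
    only when the predicate is exhausted. *)
Lemma bounded_enum {X} (P : X -> Prop) (n : nat) :
  (forall l, NoDup l -> (forall x, In x l -> P x) -> (length l <= n)%nat) ->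
  exists l, NoDup l /\ forall x, In x l <-> P x.
Proof.
  intro Hb.
  assert (K : forall k l, NoDup l -> (forall x, In x l -> P x) -> (n <= length l + k)%nat ->
    exists l, NoDup l /\ forall x, In x l <-> P x).
  { induction k as [|k IH]; intros l ND HP Hk.
    - destruct (classic (exists x, P x /\ ~ In x l)) as [[x [Hx Hn]]|N].
      + assert (length (x :: l) <= n)%nat.
        { apply Hb; [now constructor|]. simpl. intros y [<-|]; auto. }
        simpl in H. lia.
      + exists l; split; auto. intro x; split; auto. intro Hx.
        apply NNPP. intro. apply N; eauto.
    - destruct (classic (exists x, P x /\ ~ In x l)) as [[x [Hx Hn]]|N].
      + apply (IH (x :: l)).
        * now constructor.
        * simpl. intros y [<-|]; auto.
        * simpl. lia.
      + exists l; split; auto. intro x; split; auto. intro Hx.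
        apply NNPP. intro. apply N; eauto. }
  apply (K n nil); simpl; auto; try constructor; tauto.
Qed.

Lemma INR_le_ex (r : R) : exists n : nat, forall m : nat, INR m <= r -> (m <= n)%nat.
Proof.
  destruct (INR_unbounded r) as [n Hn]. exists n. intros m Hm.
  apply INR_le. lra.
Qed.

Lemma bounded_enumR {X} (P : X -> Prop) (r : R) :
  (forall l, NoDup l -> (forall x, In x l -> P x) -> INR (length l) <= r) ->
  exists l, NoDup l /\ forall x, In x l <-> P x.
Proof.
  intro H. destruct (INR_le_ex r) as [n Hn]. apply (bounded_enum P n). auto.
Qed.

(** * Sums of finitely supported functions *)

Definition bdec (P : Prop) : bool := if excluded_middle_informative P then true else false.

Lemma bdec_true P : bdec P = true <-> P.
Proof. unfold bdec; destruct (excluded_middle_informative P); split; auto; discriminate. Qed.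

Lemma bdec_false P : bdec P = false <-> ~ P.
Proof. unfold bdec; destruct (excluded_middle_informative P); split; auto; try discriminate; tauto. Qed.

Lemma bdecT P : bdec P = true -> P.
Proof. apply bdec_true. Qed.

Lemma bdecF P : bdec P = false -> ~ P.
Proof. apply bdec_false. Qed.

Definition supp {X} (F : X -> R) (l : list X) : Prop :=
  NoDup l /\ forall x, F x <> 0 -> In x l.

(** The value does not depend on the chosen list ([Sm_supp]), so weighted counts can be compared and
    reindexed without carrying enumerations. A list in [supp] may contain points where [F] vanishes,
    which lets two functions share one list. *)
Definition fsum {X} (F : X -> R) : R := Sm (epsilon (inhabits nil) (supp F)) F.

Lemma Sm_supp {X} (F : X -> R) l l' : supp F l -> supp F l' -> Sm l F = Sm l' F.
Proof.
  intros [N1 S1] [N2 S2].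
  rewrite (Sm_filter (fun x => bdec (F x = 0)) l), (Sm_filter (fun x => bdec (F x = 0)) l').
  rewrite !(Sm_zero (filter (fun x => bdec (F x = 0)) _)).
  2, 3: intros x Hx; apply filter_In in Hx; now apply bdec_true.
  f_equal. apply Sm_perm. apply NoDup_Permutation; try now apply NoDup_filter.
  intro x. rewrite !filter_In, !Bool.negb_true_iff, !bdec_false. firstorder.
Qed.

Lemma fsum_eq {X} (F : X -> R) l : supp F l -> fsum F = Sm l F.
Proof.
  intro H. apply Sm_supp; auto. apply epsilon_spec. eauto.
Qed.

Lemma eq_dec_cl {X} (x y : X) : {x = y} + {x <> y}.
Proof. apply excluded_middle_informative. Qed.

Lemma supp_common {X} (F G : X -> R) l l' : supp F l -> supp G l' ->
  exists l'', supp F l'' /\ supp G l''.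
Proof.
  intros [N1 S1] [N2 S2]. exists (nodup eq_dec_cl (l ++ l')).
  split; split; try apply NoDup_nodup; intros x Hx; apply nodup_In, in_app_iff; auto.
Qed.

Definition fin {X} (F : X -> R) : Prop := exists l, supp F l.

Lemma fsum_le {X} (F G : X -> R) : fin F -> fin G -> (forall x, F x <= G x) -> fsum F <= fsum G.
Proof.
  intros [l Hl] [l' Hl'] H. destruct (supp_common _ _ _ _ Hl Hl') as [k [K1 K2]].
  rewrite (fsum_eq F k), (fsum_eq G k); auto. apply Sm_le; auto.
Qed.

Lemma fsum_plus {X} (F G : X -> R) : fin F -> fin G ->
  fsum (fun x => F x + G x) = fsum F + fsum G.
Proof.
  intros [l Hl] [l' Hl']. destruct (supp_common _ _ _ _ Hl Hl') as [k [[N K1] [N' K2]]].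
  rewrite (fsum_eq F k), (fsum_eq G k), (fsum_eq (fun x => F x + G x) k); try (split; auto; fail).
  - apply Sm_plus.
  - split; auto. intros x Hx.
    destruct (Req_EM_T (F x) 0) as [E|]; auto. apply K2. lra.
Qed.

Lemma fsum_nonneg {X} (F : X -> R) : fin F -> (forall x, 0 <= F x) -> 0 <= fsum F.
Proof. intros [l Hl] H. rewrite (fsum_eq F l); auto. apply Sm_nonneg; auto. Qed.

Lemma fsum_ext {X} (F G : X -> R) : (forall x, F x = G x) -> fin F -> fsum F = fsum G.
Proof.
  intros H [l Hl]. rewrite (fsum_eq F l), (fsum_eq G l); auto.
  - apply Sm_ext; auto.
  - destruct Hl; split; auto. intros x; rewrite <- H; auto.
Qed.

Lemma fsum_bij {X Y} (F : Y -> R) (f : X -> Y) (g : Y -> X) :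
  (forall x, g (f x) = x) -> (forall y, f (g y) = y) -> fin F ->
  fin (fun x => F (f x)) /\ fsum (fun x => F (f x)) = fsum F.
Proof.
  intros H1 H2 [l [N Hl]].
  assert (K : supp (fun x => F (f x)) (map g l)).
  { split.
    - apply FinFun.Injective_map_NoDup; auto. intros a b E. rewrite <- (H2 a), <- (H2 b), E. auto.
    - intros x Hx. rewrite <- (H1 x). apply in_map. auto. }
  split; [eexists; eauto|].
  rewrite (fsum_eq _ _ K), (fsum_eq F l) by (split; auto).
  rewrite Sm_map. apply Sm_ext. intros; now rewrite H2.
Qed.

Lemma NoDup_map_on {X Y} (f : X -> Y) l :
  (forall x y, In x l -> In y l -> f x = f y -> x = y) -> NoDup l -> NoDup (map f l).
Proof.
  intros Hi ND. induction ND as [|x l Hx ND IH]; simpl; constructor.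
  - intro H. apply in_map_iff in H. destruct H as [y [E Hy]].
    apply Hx. rewrite (Hi x y); simpl; auto.
  - apply IH. intros; apply Hi; simpl; auto.
Qed.

Lemma Sm_incl {X} (l l' : list X) F : NoDup l -> NoDup l' -> (forall x, In x l -> In x l') ->
  (forall x, In x l' -> 0 <= F x) -> Sm l F <= Sm l' F.
Proof.
  intros N N' HI HF.
  rewrite (Sm_filter (fun x => bdec (In x l)) l').
  assert (E : Sm (filter (fun x => bdec (In x l)) l') F = Sm l F).
  { apply Sm_perm, NoDup_Permutation; auto using NoDup_filter.
    intro x. rewrite filter_In, bdec_true. firstorder. }
  rewrite E. assert (0 <= Sm (filter (fun x => negb (bdec (In x l))) l') F); [|lra].
  apply Sm_nonneg. intros x Hx. apply filter_In in Hx. apply HF. tauto.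
Qed.

(** * A priori bounds from the separation of slopes *)

Definition zx (z : mat) (v : R * R) : R := fst (mapp z v).
Definition zsl (z : mat) (v : R * R) : R := slope (mapp z v).

Lemma inv_pos x : 0 < x -> 0 < / x.
Proof. apply Rinv_0_lt_compat. Qed.

Lemma zsl_snd z v : zx z v <> 0 -> snd (mapp z v) = zsl z v * zx z v.
Proof. intro. unfold zsl, slope, zx in *. field. auto. Qed.

(** The slope difference times the product of the first coordinates is the determinant of [v] and
    [w] up to sign; and [v] and [-v] cannot both have a positive first coordinate. *)
Lemma slope_sep q (hq : (3 <= q)%nat) z v w : det z = 1 -> inLambda q v -> inLambda q w ->
  0 < zx z v -> 0 < zx z w -> v <> w -> 1 <= Rabs (zsl z v - zsl z w) * (zx z v * zx z w).
Proof.
  intros D Hv Hw Pv Pw N.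
  assert (E : vdet v w = (zsl z w - zsl z v) * (zx z v * zx z w)).
  { rewrite <- (Rmult_1_l (vdet v w)), <- D, <- vdet_mapp. unfold vdet.
    rewrite !zsl_snd by lra. unfold zx. ring. }
  destruct (Lam_vdet q hq v w Hv Hw) as [[_ [?|H]]|H].
  - congruence.
  - exfalso. subst w. unfold zx in *. rewrite mapp_vneg in Pw. change (fst (vneg (mapp z v))) with (- fst (mapp z v)) in Pw. lra.
  - rewrite E, Rabs_mult, (Rabs_right (zx z v * zx z w)) in H by nra.
    now rewrite Rabs_minus_sym.
Qed.

(** Intervals of radius [r v <= 1/(2 X x)] around the slopes are disjoint, because the first
    coordinate of every competitor is at most [X]; they stick out of [[p, p']] by at most [rho] on
    each side. *)
Lemma pack_slopes q (hq : (3 <= q)%nat) z X p p' (r : R * R -> R) rho l : det z = 1 ->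
  p <= p' -> 0 < X -> 0 <= rho -> NoDup l ->
  (forall v, In v l -> inLambda q v /\ 0 < zx z v <= X /\ p <= zsl z v <= p' /\
     0 <= r v <= rho /\ 2 * r v * (X * zx z v) <= 1) ->
  Sm l (fun v => 2 * r v) <= p' - p + 2 * rho.
Proof.
  intros D Hp HX Hrho ND H.
  rewrite (Sm_ext l _ (fun v => (zsl z v + r v) - (zsl z v - r v))) by (intros; ring).
  replace (p' - p + 2 * rho) with ((p' + rho) - (p - rho)) by ring.
  apply (pack _ _ (length l)); auto; try lra.
  - intros v Hv. destruct (H v Hv) as (?&?&?&?&?). lra.
  - intros v w Hv Hw N. destruct (H v Hv) as (v1&v2&v3&v4&v5).
    destruct (H w Hw) as (w1&w2&w3&w4&w5).
    pose proof (slope_sep q hq z v w D v1 w1 (proj1 v2) (proj1 w2) N) as S.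
    assert (r v + r w <= Rabs (zsl z v - zsl z w)).
    { assert (P : 0 < zx z v * zx z w) by nra.
      apply (Rmult_le_reg_r (zx z v * zx z w)); auto. eapply Rle_trans; [|apply S].
      assert (2 * r v * (zx z w * zx z v) <= 1) by nra.
      assert (2 * r w * (zx z v * zx z w) <= 1) by nra. lra. }
    unfold Rabs in H0. destruct (Rcase_abs _); [left|right]; lra.
Qed.

(** Packing with the constant radius [1/(2 X^2)]. For [p = p'] it says that each slope is taken at
    most once. *)
Lemma count_slopes q (hq : (3 <= q)%nat) z X p p' l : det z = 1 ->
  p <= p' -> 0 < X -> NoDup l ->
  (forall v, In v l -> inLambda q v /\ 0 < zx z v <= X /\ p <= zsl z v <= p') ->
  INR (length l) <= (p' - p) * X ^ 2 + 1.
Proof.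
  intros D Hp HX ND H.
  assert (HX2 : 0 < X ^ 2) by nra.
  assert (Sm l (fun v => 2 * (/ (2 * X ^ 2))) <= p' - p + 2 * / (2 * X ^ 2)).
  { apply (pack_slopes q hq z X p p' (fun _ => / (2 * X ^ 2)) (/ (2 * X ^ 2))); auto.
    - left; apply inv_pos; lra.
    - intros v Hv. destruct (H v Hv) as (?&?&?). repeat split; try tauto; try lra.
      + left; apply inv_pos; lra.
      + apply (Rmult_le_reg_r (X ^ 2)); auto. 
        replace (2 * / (2 * X ^ 2) * (X * zx z v) * X ^ 2) with (X * zx z v) by (field; lra).
        nra. }
  rewrite Sm_const in H0.
  apply (Rmult_le_reg_r (/ X ^ 2)); [now apply inv_pos|].
  replace (((p' - p) * X ^ 2 + 1) * / X ^ 2) with (p' - p + 2 * / (2 * X ^ 2)) by (field; lra).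
  eapply Rle_trans; [|apply H0]. right. field. lra.
Qed.

Lemma enum_slopes q (hq : (3 <= q)%nat) z X p p' : det z = 1 -> 0 < X ->
  exists l, NoDup l /\ forall v, In v l <->
    (inLambda q v /\ 0 < zx z v <= X /\ p <= zsl z v <= p').
Proof.
  intros D HX. destruct (Rle_lt_dec p p') as [h|h].
  - apply (bounded_enumR _ ((p' - p) * X ^ 2 + 1)). intros l ND H.
    apply (count_slopes q hq z X p p'); auto.
  - exists nil. split; [constructor|]. simpl. intro v; split; [tauto|]. intros (_&_&?); lra.
Qed.

(** * Cutoffs on the first row and weighted counts *)

(* The column of a group element determines its second column up to multiples of lambda: partner v is one choice. *)
Definition colmat q (v : R * R) : mat :=
  epsilon (inhabits mat_id) (fun M => inHecke q M /\ v = mapp M e1).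
Definition partner q (v : R * R) : R * R := mapp (colmat q v) e2.
Definition beta q (z : mat) (v : R * R) : R := zx z (partner q v) / zx z v.

Lemma colmat_spec q v : inLambda q v -> inHecke q (colmat q v) /\ v = mapp (colmat q v) e1.
Proof. intro H. unfold colmat. apply epsilon_spec. exact H. Qed.

Lemma partner_vdet q z v : det z = 1 -> inLambda q v ->
  vdet (mapp z v) (mapp z (partner q v)) = 1.
Proof.
  intros D H. destruct (colmat_spec q v H) as [H1 H2].
  rewrite vdet_mapp, D. unfold partner. rewrite H2 at 1.
  rewrite vdet_mapp, (hecke_det q) by auto. unfold vdet, e1, e2; simpl; ring.
Qed.

Lemma beta_spec q (hq : (3 <= q)%nat) z M : inHecke q M -> zx z (mapp M e1) <> 0 ->
  exists n : Z, zx z (mapp M e2) / zx z (mapp M e1) = beta q z (mapp M e1) + IZR n * lambda_q q.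
Proof.
  intros HM Hx.
  destruct (colmat_spec q (mapp M e1) (Lam_mapp_e1 q M HM)) as [H1 H2].
  destruct (hecke_same_col q hq (colmat q (mapp M e1)) M H1 HM (eq_sym H2)) as [n Hn].
  exists n. unfold beta, partner. set (C := colmat q (mapp M e1)) in *.
  assert (E : mapp M e2 = (fst (mapp C e2) + IZR n * lambda_q q * fst (mapp M e1),
                           snd (mapp C e2) + IZR n * lambda_q q * snd (mapp M e1))).
  { rewrite H2, Hn. unfold mapp, mmul, mat_Tn, e1, e2; simpl; f_equal; ring. }
  rewrite E. clearbody C. unfold zx, mapp in *. simpl in *. field. intro K; apply Hx; lra.
Qed.

(** The second argument of [g] is the ratio of the entries of the first row, so periodicity removes
    the choice of [partner]. Vanishing for [a <= d] is what allows equicontinuity: a perturbation of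
    the point moves this ratio by an amount of order [1/x^2]. *)
Record adm (q : nat) (g : R -> R -> R) (d L : R) : Prop := {
  adm_d : 0 < d < 1;
  adm_L : 0 <= L;
  adm_rng : forall a b, 0 <= g a b <= 1;
  adm_lo : forall a b, a <= d -> g a b = 0;
  adm_hi : forall a b, 1 <= a -> g a b = 0;
  adm_lip : forall a b a' b', Rabs (g a b - g a' b') <= L * (Rabs (a - a') + Rabs (b - b'));
  adm_per : forall a b, g a (b + lambda_q q) = g a b }.

Lemma adm_perZ q g d L a b n : adm q g d L -> g a (b + IZR n * lambda_q q) = g a b.
Proof.
  intro H.
  assert (K : forall k b, g a (b + INR k * lambda_q q) = g a b).
  { induction k; intro b'.
    - simpl. f_equal; ring.
    - rewrite S_INR. replace (b' + (INR k + 1) * lambda_q q) with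
       ((b' + INR k * lambda_q q) + lambda_q q) by ring.
      rewrite (adm_per _ _ _ _ H). auto. }
  destruct (Z_le_gt_dec 0 n).
  - rewrite <- (Z2Nat.id n), <- INR_IZR_INZ by lia. apply K.
  - rewrite <- (K (Z.to_nat (- n)) (b + IZR n * lambda_q q)).
    f_equal. rewrite INR_IZR_INZ, Z2Nat.id, opp_IZR by lia. ring.
Qed.

(** Half-open slope windows make [W] exactly additive over adjacent windows. *)
Definition Fw q g z t p p' (v : R * R) : R :=
  if bdec (inLambda q v /\ 0 < zx z v /\ p <= zsl z v < p')
  then g (zx z v / t) (beta q z v) else 0.
Definition W q g z t p p' : R := fsum (Fw q g z t p p').
Definition Phi q g t z : R := W q g z t 0 1 / t ^ 2.

Lemma Fw_rng q g d L z t p p' v : adm q g d L -> 0 <= Fw q g z t p p' v <= 1.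
Proof.
  intro H. unfold Fw. destruct (bdec _); [apply (adm_rng _ _ _ _ H)|lra].
Qed.

Lemma Fw_nz q g d L z t p p' v : adm q g d L -> 0 < t -> Fw q g z t p p' v <> 0 ->
  inLambda q v /\ d * t <= zx z v <= t /\ p <= zsl z v < p'.
Proof.
  intros H Ht. unfold Fw.
  destruct (bdec _) eqn:E; [|tauto]. apply bdecT in E. intro N.
  destruct E as (E1&E2&E3). repeat split; try tauto.
  - apply Rnot_lt_le. intro. apply N. apply (adm_lo _ _ _ _ H).
    apply (Rmult_le_reg_r t); auto. unfold Rdiv. rewrite Rmult_assoc, Rinv_l, Rmult_1_r; lra.
  - apply Rnot_lt_le. intro. apply N. apply (adm_hi _ _ _ _ H).
    apply (Rmult_le_reg_r t); auto. unfold Rdiv. rewrite Rmult_assoc, Rinv_l, Rmult_1_r; lra.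
Qed.

Lemma Fw_supp q (hq : (3 <= q)%nat) g d L z t p p' : adm q g d L -> 0 < t -> det z = 1 ->
  exists l, supp (Fw q g z t p p') l /\ NoDup l /\
   forall v, In v l <-> inLambda q v /\ 0 < zx z v <= t /\ p <= zsl z v <= p'.
Proof.
  intros H Ht D. destruct (enum_slopes q hq z t p p' D Ht) as [l [ND Hl]].
  exists l. repeat split; auto; try (intros; apply Hl; auto; fail).
  intros v Hv. apply Hl. destruct (Fw_nz _ _ _ _ _ _ _ _ _ H Ht Hv) as (?&?&?).
  pose proof (adm_d _ _ _ _ H). repeat split; try tauto; try lra. nra.
Qed.

Lemma Fw_fin q (hq : (3 <= q)%nat) g d L z t p p' : adm q g d L -> 0 < t -> det z = 1 ->
  fin (Fw q g z t p p').
Proof. intros. destruct (Fw_supp q hq g d L z t p p') as [l [? _]]; auto. exists l; auto. Qed.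

Lemma W_nonneg q (hq : (3 <= q)%nat) g d L z t p p' : adm q g d L -> 0 < t -> det z = 1 ->
  0 <= W q g z t p p'.
Proof.
  intros. apply fsum_nonneg; [eapply Fw_fin; eauto|]. intro. eapply Fw_rng; eauto.
Qed.

Lemma W_bound q (hq : (3 <= q)%nat) g d L z t p p' : adm q g d L -> 0 < t -> det z = 1 ->
  p <= p' -> W q g z t p p' <= (p' - p) * t ^ 2 + 1.
Proof.
  intros H Ht D Hp. destruct (Fw_supp q hq g d L z t p p' H Ht D) as [l [S [ND Hl]]].
  unfold W. rewrite (fsum_eq _ _ S).
  apply Rle_trans with (Sm l (fun _ => 1)).
  - apply Sm_le. intros. eapply Fw_rng; eauto.
  - rewrite Sm_const, Rmult_1_l. apply (count_slopes q hq z t p p'); auto. intros; apply Hl; auto.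
Qed.

Lemma W_add q (hq : (3 <= q)%nat) g d L z t p s p' : adm q g d L -> 0 < t -> det z = 1 ->
  p <= s <= p' -> W q g z t p p' = W q g z t p s + W q g z t s p'.
Proof.
  intros H Ht D Hs. unfold W. rewrite <- fsum_plus; try (eapply Fw_fin; eauto).
  apply fsum_ext; [|eapply Fw_fin; eauto].
  intro v. unfold Fw.
  destruct (bdec (inLambda q v /\ 0 < zx z v /\ p <= zsl z v < p')) eqn:E1;
  destruct (bdec (inLambda q v /\ 0 < zx z v /\ p <= zsl z v < s)) eqn:E2;
  destruct (bdec (inLambda q v /\ 0 < zx z v /\ s <= zsl z v < p')) eqn:E3; try ring;
  repeat match goal with E : bdec _ = true |- _ => apply bdecT in E
    | E : bdec _ = false |- _ => apply bdecF in E end; exfalso.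
  - destruct E2 as (?&?&?), E3 as (?&?&?). lra.
  - destruct E1 as (?&?&?). destruct (Rlt_le_dec (zsl z v) s);
      [apply E2|apply E3]; repeat split; auto; lra.
  - destruct E2 as (?&?&?), E3 as (?&?&?). lra.
  - apply E1; destruct E2 as (?&?&?); repeat split; auto; lra.
  - apply E1; destruct E3 as (?&?&?); repeat split; auto; lra.
Qed.

Lemma W_mono q (hq : (3 <= q)%nat) g d L z t p p' r r' : adm q g d L -> 0 < t -> det z = 1 ->
  r <= p -> p' <= r' -> W q g z t p p' <= W q g z t r r'.
Proof.
  intros H Ht D H1 H2. apply fsum_le; try (eapply Fw_fin; eauto).
  intro v. unfold Fw at 1. destruct (bdec _) eqn:E; [|eapply Fw_rng; eauto].
  apply bdecT in E. destruct E as (?&?&?). unfold Fw.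
  rewrite (proj2 (bdec_true _)); [lra|]. repeat split; auto; lra.
Qed.

Lemma zx_sh r s z v : zx (mmul (mat_s r) (mmul (mat_h s) z)) v = r * zx z v.
Proof. unfold zx. rewrite !mapp_mmul. unfold mapp, mat_s, mat_h; simpl; ring. Qed.

Lemma zsl_sh r s z v : 0 < r -> zx z v <> 0 ->
  zsl (mmul (mat_s r) (mmul (mat_h s) z)) v = (zsl z v - s) / r ^ 2.
Proof.
  intros Hr Hx. unfold zsl, slope, zx in *. rewrite !mapp_mmul.
  unfold mapp, mat_s, mat_h in *; simpl in *. field. split; auto. lra.
Qed.

Lemma beta_sh q r s z v : 0 < r -> beta q (mmul (mat_s r) (mmul (mat_h s) z)) v = beta q z v.
Proof.
  intros Hr. unfold beta. rewrite !zx_sh. unfold Rdiv. 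
  rewrite Rinv_mult. replace (r * zx z (partner q v) * (/ r * / zx z v)) with
   (r * / r * (zx z (partner q v) * / zx z v)) by ring. rewrite Rinv_r; [ring|lra].
Qed.

Lemma bdec_ext P Q : (P <-> Q) -> bdec P = bdec Q.
Proof.
  intro H. destruct (bdec P) eqn:E; symmetry; [apply bdec_true|apply bdec_false];
  rewrite ?bdec_true, ?bdec_false in E; tauto.
Qed.

Lemma det_sh r s z : r <> 0 -> det (mmul (mat_s r) (mmul (mat_h s) z)) = det z.
Proof. intro. rewrite !det_mmul. unfold det at 1 2, mat_s, mat_h; simpl. field; auto. Qed.

Lemma det_g a b : a <> 0 -> det (mat_g a b) = 1.
Proof. intro. unfold det, mat_g; simpl. field; auto. Qed.

(** Renormalisation: the shear translates slopes, the diagonal matrix divides them by [r^2] and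
    multiplies first coordinates by [r], and the row ratio is unchanged. Counts over short windows
    at a larger scale thus become counts over the unit window at another point. *)
Lemma W_sh q (hq : (3 <= q)%nat) g d L z t p p' r s : adm q g d L -> 0 < t -> det z = 1 -> 0 < r ->
  W q g (mmul (mat_s r) (mmul (mat_h s) z)) t p p' = W q g z (t / r) (s + r ^ 2 * p) (s + r ^ 2 * p').
Proof.
  intros H Ht D Hr. apply fsum_ext.
  - intro v. unfold Fw. rewrite zx_sh, beta_sh by auto.
    assert (R2 : 0 < r ^ 2) by nra.
    rewrite (bdec_ext _ (inLambda q v /\ 0 < zx z v /\ s + r ^ 2 * p <= zsl z v < s + r ^ 2 * p')).
    + destruct (bdec _); auto. f_equal. field. lra.
    + split; intros (h1&h2&h3).
      * assert (0 < zx z v) by nra. rewrite zsl_sh in h3 by lra.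
        repeat split; auto.
        -- destruct h3 as [h3 _]. apply (Rmult_le_compat_r (r ^ 2)) in h3; [|lra].
           unfold Rdiv in h3. rewrite (Rmult_assoc (_ - _)), Rinv_l in h3 by lra. lra.
        -- destruct h3 as [_ h3]. apply (Rmult_lt_compat_r (r ^ 2)) in h3; [|lra].
           unfold Rdiv in h3. rewrite (Rmult_assoc (_ - _)), Rinv_l in h3 by lra. lra.
      * rewrite zsl_sh by lra. repeat split; auto.
        -- nra.
        -- apply (Rmult_le_reg_r (r ^ 2)); [lra|].
           unfold Rdiv. rewrite (Rmult_assoc (_ - _)), Rinv_l by lra. lra.
        -- apply (Rmult_lt_reg_r (r ^ 2)); [lra|].
           unfold Rdiv. rewrite (Rmult_assoc (_ - _)), Rinv_l by lra. lra.
  - eapply Fw_fin; eauto. rewrite det_sh; lra.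
Qed.

Lemma beta_gam q (hq : (3 <= q)%nat) z M v : inHecke q M -> inLambda q v -> zx z (mapp M v) <> 0 ->
  exists n : Z, beta q (mmul z M) v = beta q z (mapp M v) + IZR n * lambda_q q.
Proof.
  intros HM Hv Hx. destruct (colmat_spec q v Hv) as [H1 H2].
  destruct (beta_spec q hq z (mmul M (colmat q v))) as [n Hn].
  - now apply hecke_mmul.
  - rewrite mapp_mmul, <- H2. auto.
  - exists n. rewrite (mapp_mmul M _ e1), <- H2 in Hn. rewrite <- Hn.
    unfold beta, partner, zx. now rewrite !mapp_mmul.
Qed.

(** [M] permutes the orbit. It changes the chosen partner, hence the row ratio, by a multiple of
    [lambda_q], to which [g] is blind; so [W] lives on lattices rather than on matrices. *)
Lemma W_gam q (hq : (3 <= q)%nat) g d L z t p p' M : adm q g d L -> 0 < t -> det z = 1 ->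
  inHecke q M -> W q g (mmul z M) t p p' = W q g z t p p'.
Proof.
  intros H Ht D HM. pose proof (hecke_det q M HM) as DM.
  destruct (fsum_bij (Fw q g z t p p') (mapp M) (mapp (minv M))) as [h1 h2].
  - intro; now apply mapp_minv_l.
  - intro; now apply mapp_minv_r.
  - eapply Fw_fin; eauto.
  - unfold W. rewrite <- h2. apply fsum_ext.
    + intro v. unfold Fw. unfold zsl. rewrite mapp_mmul. fold (zsl z (mapp M v)).
      assert (Ex : zx (mmul z M) v = zx z (mapp M v)) by (unfold zx; now rewrite mapp_mmul).
      rewrite Ex.
      rewrite (bdec_ext _ (inLambda q (mapp M v) /\ 0 < zx z (mapp M v) /\ p <= zsl z (mapp M v) < p')).
      * destruct (bdec _) eqn:E; auto. apply bdecT in E. destruct E as (E1&E2&E3).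
        destruct (beta_gam q hq z M v) as [n Hn]; auto; try lra.
        -- rewrite <- (mapp_minv_l M v DM). apply Lam_mapp; auto using hecke_minv.
        -- rewrite Hn. apply (adm_perZ _ _ _ _ _ _ _ H).
      * split; intros (k1&k2); split; auto.
        -- now apply Lam_mapp.
        -- rewrite <- (mapp_minv_l M v DM). apply Lam_mapp; auto using hecke_minv.
    + eapply Fw_fin; eauto. rewrite det_mmul, D, DM. ring.
Qed.

Lemma Phi_rng q (hq : (3 <= q)%nat) g d L z t : adm q g d L -> 1 <= t -> det z = 1 ->
  0 <= Phi q g t z <= 2.
Proof.
  intros H Ht D. unfold Phi. assert (1 <= t ^ 2) by nra. split.
  - apply Rmult_le_pos; [eapply W_nonneg; eauto; lra|]. left; apply inv_pos; lra.
  - pose proof (W_bound q hq g d L z t 0 1 H ltac:(lra) D ltac:(lra)).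
    apply (Rmult_le_reg_r (t ^ 2)); [lra|]. unfold Rdiv. rewrite Rmult_assoc, Rinv_l by lra. lra.
Qed.

Lemma Phi_gam q (hq : (3 <= q)%nat) g d L z t M : adm q g d L -> 0 < t -> det z = 1 ->
  inHecke q M -> Phi q g t (mmul z M) = Phi q g t z.
Proof. intros. unfold Phi. erewrite W_gam; eauto. Qed.

Lemma Phi_sh q (hq : (3 <= q)%nat) g d L z t r s : adm q g d L -> 0 < t -> det z = 1 -> 0 < r ->
  Phi q g t (mmul (mat_s r) (mmul (mat_h s) z)) = W q g z (t / r) s (s + r ^ 2) / t ^ 2.
Proof. intros. unfold Phi. erewrite W_sh; eauto. f_equal. f_equal; ring. Qed.

(** * Equicontinuity of the weighted counts *)

Definition close (k : mat) (e : R) : Prop :=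
  Rabs (m11 k - 1) <= e /\ Rabs (m12 k) <= e /\ Rabs (m21 k) <= e /\ Rabs (m22 k - 1) <= e.

Lemma Rabs_le_iff x e : Rabs x <= e <-> - e <= x <= e.
Proof.
  split; [intro H|intros []; now apply Rabs_le].
  unfold Rabs in H; destruct (Rcase_abs x); lra.
Qed.

Lemma fst_mapp k w : fst (mapp k w) = m11 k * fst w + m12 k * snd w.
Proof. reflexivity. Qed.
Lemma snd_mapp k w : snd (mapp k w) = m21 k * fst w + m22 k * snd w.
Proof. reflexivity. Qed.

Lemma close_minv k e : close k e -> close (minv k) e.
Proof.
  unfold close, minv; simpl. rewrite !Rabs_Ropp. tauto.
Qed.

Lemma minv_cancel k z : det k = 1 -> mmul (minv k) (mmul k z) = z.
Proof. intro. now rewrite mmul_assoc, minv_l, mmul_id_l. Qed.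

Lemma close_act k e z v : close k e -> e <= 1 / 16 -> 0 < zx z v -> -2 <= zsl z v <= 2 ->
  let m := m11 k + m12 k * zsl z v in
  zx (mmul k z) v = zx z v * m /\ 1 - 3 * e <= m <= 1 + 3 * e /\
  Rabs (zsl (mmul k z) v - zsl z v) <= 16 * e.
Proof.
  intros (K1 & K2 & K3 & K4) He Hx Hs m.
  assert (0 <= e) by (eapply Rle_trans; [apply Rabs_pos|apply K1]).
  rewrite Rabs_le_iff in K1, K2, K3, K4.
  assert (Ex : zx (mmul k z) v = zx z v * m).
  { unfold m, zx at 1. rewrite mapp_mmul, fst_mapp, (zsl_snd z v) by lra. unfold zx. ring. }
  assert (M : 1 - 3 * e <= m <= 1 + 3 * e) by (unfold m; split; nra).
  split; auto. split; auto.
  set (s := zsl z v) in *.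
  assert (Es : zsl (mmul k z) v = (m21 k + m22 k * s) / m).
  { unfold zsl, slope. fold (zx (mmul k z) v). rewrite Ex.
    rewrite mapp_mmul, snd_mapp, (zsl_snd z v) by lra.
    fold s. fold (zx z v). field. split; lra. }
  rewrite Es. replace ((m21 k + m22 k * s) / m - s) with ((m21 k + (m22 k - 1) * s - (m11 k - 1) * s - m12 k * (s * s)) / m).
  2: { unfold m. field. unfold m in M; lra. }
  assert (N : Rabs (m21 k + (m22 k - 1) * s - (m11 k - 1) * s - m12 k * (s * s)) <= 9 * e).
  { apply Rabs_le.
    assert (-(2*e) <= (m22 k - 1) * s <= 2 * e) by (split; nra).
    assert (-(2*e) <= (m11 k - 1) * s <= 2 * e) by (split; nra).
    assert (0 <= s * s <= 4) by (split; nra).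
    assert (-(4*e) <= m12 k * (s * s) <= 4 * e) by (split; nra).
    lra. }
  unfold Rdiv. rewrite Rabs_mult, Rabs_inv, (Rabs_right m) by lra.
  apply (Rmult_le_reg_r m); [lra|]. rewrite Rmult_assoc, Rinv_l, Rmult_1_r by lra. nra.
Qed.

Lemma beta_close q k e z v : close k e -> e <= 1 / 16 -> det z = 1 -> inLambda q v ->
  0 < zx z v -> -2 <= zsl z v <= 2 ->
  Rabs (beta q (mmul k z) v - beta q z v) * (zx z v * zx (mmul k z) v) <= e.
Proof.
  intros HK He D Hv Hx Hs.
  destruct (close_act k e z v HK He Hx Hs) as (Ex & M & _).
  pose proof HK as (K1 & K2 & _).
  assert (0 <= e) by (eapply Rle_trans; [apply Rabs_pos|apply K1]).
  assert (Hx' : 0 < zx (mmul k z) v) by (rewrite Ex; nra).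
  (* After clearing denominators the terms with [m11 k] cancel, and the factor of [m12 k] is the
     determinant of the basis, equal to 1. *)
  assert (E : (beta q (mmul k z) v - beta q z v) * (zx z v * zx (mmul k z) v) = m12 k).
  { unfold beta. pose proof (partner_vdet q z v D Hv) as P.
    assert (E1 : forall u, zx (mmul k z) u = m11 k * zx z u + m12 k * snd (mapp z u)).
    { intro u. unfold zx. rewrite mapp_mmul. reflexivity. }
    rewrite (E1 (partner q v)). rewrite (E1 v) in *.
    unfold vdet in P. fold (zx z v) in P. fold (zx z (partner q v)) in P.
    transitivity (m12 k * (zx z v * snd (mapp z (partner q v)) - snd (mapp z v) * zx z (partner q v))).
    - field. split; lra.
    - rewrite P. ring. }
  rewrite <- (Rabs_right (zx z v * zx (mmul k z) v)) by nra.
  rewrite <- Rabs_mult, E. auto.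
Qed.

Lemma Sm_indic_count {X} (l : list X) (P : X -> Prop) c :
  (forall l', NoDup l' -> (forall x, In x l' -> In x l /\ P x) -> INR (length l') <= c) -> NoDup l ->
  Sm l (fun x => if bdec (P x) then 1 else 0) <= c.
Proof.
  intros H ND. rewrite <- (Sm_filter_if (fun x => bdec (P x)) l (fun _ => 1)).
  rewrite Sm_const, Rmult_1_l. apply H; [now apply NoDup_filter|].
  intros x Hx. apply filter_In in Hx. destruct Hx as [h1 h2]. split; auto. now apply bdecT.
Qed.

(** The counts at [z] and [k z] differ in two ways: vectors with slope within [16 e] of an end of
    the window may enter or leave, and [count_slopes] makes them few; the others have their weight
    changed by [O(e)] through the Lipschitz bound. *)
Lemma Phi_equi q (hq : (3 <= q)%nat) g d L : adm q g d L ->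
  exists C, 0 < C /\ forall e t k z, e <= 1 / 16 -> 1 <= t -> det z = 1 -> det k = 1 -> close k e ->
    Rabs (Phi q g t (mmul k z) - Phi q g t z) <= C * (e + / t ^ 2).
Proof.
  intro H. pose proof (adm_d _ _ _ _ H) as Hd. pose proof (adm_L _ _ _ _ H) as HL.
  (* Since [x / t <= 2], the first argument of [g] changes by at most [6 e]; the row ratio changes
     by at most [16 e / d^2]. *)
  set (L' := L * (6 + 16 / d ^ 2)).
  assert (HL' : 0 <= L').
  { apply Rmult_le_pos; auto. assert (0 < / d ^ 2) by (apply inv_pos; nra). unfold Rdiv. lra. }
  exists (256 + 13 * L'). split; [lra|].
  intros e t k z He Ht D Dk HK.
  assert (Ht0 : 0 < t) by lra.
  assert (He0 : 0 <= e).
  { destruct HK as (K1 & _). eapply Rle_trans; [apply Rabs_pos|apply K1]. }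
  (* A window large enough to contain the supports for both [z] and [k z]. *)
  destruct (enum_slopes q hq z (2 * t) (-1) 2 D ltac:(lra)) as [l [ND Hl]].
  assert (D' : det (mmul k z) = 1) by (rewrite det_mmul, D, Dk; ring).
  assert (S1 : supp (Fw q g z t 0 1) l).
  { split; auto. intros v Hv. apply Hl.
    destruct (Fw_nz _ _ _ _ _ _ _ _ _ H Ht0 Hv) as (h1&h2&h3).
    repeat split; auto; nra. }
  assert (S2 : supp (Fw q g (mmul k z) t 0 1) l).
  { split; auto. intros v Hv. apply Hl.
    destruct (Fw_nz _ _ _ _ _ _ _ _ _ H Ht0 Hv) as (h1&h2&h3).
    assert (Hx' : 0 < zx (mmul k z) v) by nra.
    destruct (close_act (minv k) e (mmul k z) v) as (E1 & M & E2); auto using close_minv; try lra.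
    rewrite minv_cancel in E1, E2 by auto.
    apply Rabs_le_iff in E2. rewrite E1. repeat split; auto; nra. }
  unfold Phi, W. rewrite (fsum_eq _ _ S1), (fsum_eq _ _ S2).
  assert (T2 : 1 <= t ^ 2) by nra.
  replace (Sm l (Fw q g (mmul k z) t 0 1) / t ^ 2 - Sm l (Fw q g z t 0 1) / t ^ 2) with
   (Sm l (fun v => Fw q g (mmul k z) t 0 1 v - Fw q g z t 0 1 v) * / t ^ 2)
   by (rewrite Sm_minus; unfold Rdiv; ring).
  rewrite Rabs_mult, (Rabs_right (/ t ^ 2)).
  2: { apply Rle_ge. left. apply inv_pos; lra. }
  set (E0 := fun v => if bdec (Rabs (zsl z v) <= 16 * e) then 1 else 0).
  set (E1 := fun v => if bdec (Rabs (zsl z v - 1) <= 16 * e) then 1 else 0).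
  assert (B : forall v, In v l -> Rabs (Fw q g (mmul k z) t 0 1 v - Fw q g z t 0 1 v) <=
     E0 v + E1 v + L' * e).
  { intros v Hv. apply Hl in Hv. destruct Hv as (v1 & v2 & v3).
    destruct (close_act k e z v HK He ltac:(lra) ltac:(lra)) as (x1 & M & x2).
    set (m := m11 k + m12 k * zsl z v) in *.
    assert (Hx' : 0 < zx (mmul k z) v) by (rewrite x1; apply Rmult_lt_0_compat; lra).
    apply Rabs_le_iff in x2.
    assert (T1 : Rabs (Fw q g (mmul k z) t 0 1 v - Fw q g z t 0 1 v) <= 1).
    { pose proof (Fw_rng q g d L (mmul k z) t 0 1 v H). pose proof (Fw_rng q g d L z t 0 1 v H).
      apply Rabs_le. lra. }
    assert (P0 : 0 <= L' * e) by nra.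
    unfold E0. destruct (bdec (Rabs (zsl z v) <= 16 * e)) eqn:F0.
    { unfold E1; destruct (bdec (Rabs (zsl z v - 1) <= 16 * e)); lra. }
    unfold E1. destruct (bdec (Rabs (zsl z v - 1) <= 16 * e)) eqn:F1; [lra|].
    apply bdecF in F0. apply bdecF in F1. rewrite Rabs_le_iff in F0, F1.
    unfold Fw. 
    destruct (bdec (inLambda q v /\ 0 < zx z v /\ 0 <= zsl z v < 1)) eqn:G.
    - apply bdecT in G. destruct G as (_&_&G).
      assert (16 * e < zsl z v /\ zsl z v < 1 - 16 * e) as [G1 G2].
      { split; apply Rnot_le_lt; intro.
        - apply F0; lra.
        - apply F1; lra. }
      rewrite (proj2 (bdec_true _)) by (repeat split; auto; lra).
      destruct (Rle_lt_dec (zx z v / t) (d / 2)) as [h|h].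
      + assert (0 < / t) by (apply inv_pos; lra).
        rewrite !(adm_lo _ _ _ _ H); try lra.
        * rewrite Rminus_diag, Rabs_R0. lra.
        * rewrite x1. replace (zx z v * m / t) with (zx z v / t * m) by (field; lra).
          assert (0 <= zx z v / t) by (unfold Rdiv; nra). nra.
      + eapply Rle_trans; [apply (adm_lip _ _ _ _ H)|].
        unfold L'. rewrite !Rplus_0_l. rewrite Rmult_assoc. apply Rmult_le_compat_l; auto.
        rewrite Rmult_plus_distr_r. apply Rplus_le_compat.
        * rewrite x1. replace (zx z v * m / t - zx z v / t) with (zx z v / t * (m - 1)) by (field; lra).
          assert (0 < / t) by (apply inv_pos; lra).
          assert (0 <= zx z v / t <= 2).
          { split; [lra|]. apply (Rmult_le_reg_r t); [lra|]. unfold Rdiv.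
            rewrite Rmult_assoc, Rinv_l by lra. lra. }
          rewrite Rabs_mult, (Rabs_right (zx z v / t)) by lra.
          assert (Rabs (m - 1) <= 3 * e) by (apply Rabs_le; lra).
          pose proof (Rabs_pos (m - 1)). nra.
        * pose proof (beta_close q k e z v HK He D v1 (proj1 v2) ltac:(lra)) as Bc.
          assert (h1 : d * t / 2 < zx z v).
          { apply (Rmult_lt_compat_r t) in h; [|lra]. unfold Rdiv in h. 
            rewrite (Rmult_assoc (zx z v)), Rinv_l in h by lra. lra. }
          assert (h2 : d * t / 4 < zx (mmul k z) v).
          { rewrite x1. assert (1 / 2 <= m) by lra. nra. }
          assert (d ^ 2 / 16 <= zx z v * zx (mmul k z) v).
          { assert (d <= d * t) by nra. 
            assert (d / 4 * (d / 4) <= zx z v * zx (mmul k z) v).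
            { apply Rmult_le_compat; lra. }
            simpl. lra. }
          pose proof (Rabs_pos (beta q (mmul k z) v - beta q z v)).
          assert (0 < d ^ 2) by nra.
          apply (Rmult_le_reg_r (d ^ 2 / 16)); [lra|].
          replace (16 / d ^ 2 * e * (d ^ 2 / 16)) with e by (field; lra).
          eapply Rle_trans; [|apply Bc]. apply Rmult_le_compat_l; auto.
    - apply bdecF in G.
      rewrite (proj2 (bdec_false _)).
      + rewrite Rminus_diag, Rabs_R0. lra.
      + intros (_&_&G'). apply G. repeat split; auto; try lra; apply Rnot_lt_le || apply Rnot_le_lt;
          intro; solve [apply F0; lra | apply F1; lra]. }
  assert (T : Sm l (fun v => Rabs (Fw q g (mmul k z) t 0 1 v - Fw q g z t 0 1 v)) <=
    (32 * e * (2 * t) ^ 2 + 1) + (32 * e * (2 * t) ^ 2 + 1) + L' * e * (3 * (2 * t) ^ 2 + 1)).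
  { eapply Rle_trans; [apply Sm_le; apply B|]. rewrite !Sm_plus, Sm_const.
    assert (C0 : Sm l E0 <= 32 * e * (2 * t) ^ 2 + 1).
    { apply (Sm_indic_count l (fun v => Rabs (zsl z v) <= 16 * e)); auto.
      intros l' ND' H'. replace (32 * e) with (16 * e - (- (16 * e))) by ring.
      apply (count_slopes q hq z); auto; try lra.
      intros v Hv. destruct (H' v Hv) as [h1 h2]. apply Hl in h1. apply Rabs_le_iff in h2. tauto. }
    assert (C1 : Sm l E1 <= 32 * e * (2 * t) ^ 2 + 1).
    { apply (Sm_indic_count l (fun v => Rabs (zsl z v - 1) <= 16 * e)); auto.
      intros l' ND' H'. replace (32 * e) with ((1 + 16 * e) - (1 - 16 * e)) by ring.
      apply (count_slopes q hq z); auto; try lra.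
      intros v Hv. destruct (H' v Hv) as [h1 h2]. apply Hl in h1. apply Rabs_le_iff in h2.
      repeat split; try tauto; lra. }
    assert (C2 : INR (length l) <= (2 - -1) * (2 * t) ^ 2 + 1).
    { apply (count_slopes q hq z); auto; try lra. intros; now apply Hl. }
    assert (L' * e * INR (length l) <= L' * e * (3 * (2 * t) ^ 2 + 1)).
    { apply Rmult_le_compat_l; [nra|]. lra. }
    lra. }
  apply (Rmult_le_reg_r (t ^ 2)); [lra|].
  rewrite Rmult_assoc, Rinv_l, Rmult_1_r by lra.
  eapply Rle_trans; [apply Sm_Rabs|]. eapply Rle_trans; [apply T|].
  replace ((256 + 13 * L') * (e + / t ^ 2) * t ^ 2) with ((256 + 13 * L') * (e * t ^ 2) + (256 + 13 * L'))
    by (field; lra).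
  assert (0 <= L' * e) by nra.
  assert (L' * e <= L' * e * t ^ 2) by nra.
  replace ((2 * t) ^ 2) with (4 * t ^ 2) by ring. nra.
Qed.

(** * Short vectors and cusp excursions *)

Definition boxfree q z al be : Prop :=
  forall v, inLambda q v -> ~ (Rabs (zx z v) <= al /\ Rabs (snd (mapp z v)) <= be).

Lemma nat_count (l : list nat) a b : a <= b -> NoDup l -> (forall i, In i l -> a <= INR i <= b) ->
  INR (length l) <= b - a + 1.
Proof.
  intros Hab ND H.
  replace (INR (length l)) with (Sm l (fun i => (INR i + 1 / 2) - (INR i - 1 / 2))).
  2: { rewrite (Sm_ext l _ (fun _ => 1)) by (intros; field). rewrite Sm_const; ring. }
  replace (b - a + 1) with ((b + 1 / 2) - (a - 1 / 2)) by field.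
  apply (pack (fun i => INR i - 1 / 2) (fun i => INR i + 1 / 2) (length l)); auto; try lra.
  - intros i Hi. specialize (H i Hi). lra.
  - intros i j _ _ N. destruct (Nat.lt_total i j) as [h|[h|h]]; [left|contradiction|right];
    apply le_INR in h; rewrite S_INR in h; lra.
Qed.

Lemma union_count {X Y} (l : list X) (V : list Y) (P : Y -> X -> Prop) :
  (forall x, In x l -> exists y, In y V /\ P y x) ->
  INR (length l) <= Sm V (fun y => Sm l (fun x => if bdec (P y x) then 1 else 0)).
Proof.
  intro H. rewrite <- (Rmult_1_l (INR _)), <- (Sm_const l 1).
  rewrite <- (Sm_swap l V (fun x y => if bdec (P y x) then 1 else 0)).
  apply Sm_le. intros x Hx. destruct (H x Hx) as [y [Hy Py]].
  apply Rle_trans with (if bdec (P y x) then 1 else 0).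
  - rewrite (proj2 (bdec_true _)); auto; lra.
  - apply (Sm_one_le V y (fun y => if bdec (P y x) then 1 else 0)); auto.
    intros; destruct (bdec _); lra.
Qed.

Lemma snd_sh r s z v : snd (mapp (mmul (mat_s r) (mmul (mat_h s) z)) v) =
  / r * (snd (mapp z v) - s * zx z v).
Proof. unfold zx. rewrite !mapp_mmul. unfold mat_s, mat_h. rewrite !snd_mapp, !fst_mapp. simpl. ring. Qed.

Lemma zx_vneg z v : zx z (vneg v) = - zx z v.
Proof. unfold zx. rewrite mapp_vneg. reflexivity. Qed.
Lemma snd_vneg z v : snd (mapp z (vneg v)) = - snd (mapp z v).
Proof. rewrite mapp_vneg. reflexivity. Qed.

(* A long horocycle segment spends little time in the cusp: the slopes of short vectors are the centres of disjoint intervals much longer than the intervals of bad parameters. The bound k0 depends on the starting point only through d. *)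
Lemma excursions q (hq : (3 <= q)%nat) d al be : 0 < d -> 0 < al -> 0 < be ->
  exists k0, 1 <= k0 /\ forall k z (m : nat) (l : list nat), k0 <= k -> det z = 1 -> (1 <= m)%nat ->
    boxfree q z d d -> NoDup l ->
    (forall i, In i l -> INR i <= INR m * k ^ 2 /\
      ~ boxfree q (mmul (mat_s (/ k)) (mmul (mat_h (INR i / (INR m * k ^ 2))) z)) al be) ->
    INR (length l) <= 3 * al * (2 * be * INR m + al) * k ^ 2.
Proof.
  intros Hd Hal Hbe.
  assert (K1 : 0 < 8 * be / d) by (apply Rdiv_lt_0_compat; lra).
  assert (K2 : 0 < 2 / (al * d)) by (apply Rdiv_lt_0_compat; nra).
  exists (1 + 8 * be / d + 2 / (al * d)). split; [lra|].
  intros k z m l Hk D Hm BF ND Hl.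
  assert (Hk1 : 1 <= k) by lra.
  assert (Hkd : 8 * be <= k * d).
  { assert (h : 8 * be / d <= k) by lra. apply (Rmult_le_compat_r d) in h; [|lra].
    unfold Rdiv in h. rewrite Rmult_assoc, Rinv_l in h by lra. lra. }
  assert (Hkad : 2 <= k * (al * d)).
  { assert (h : 2 / (al * d) <= k) by lra. apply (Rmult_le_compat_r (al * d)) in h; [|nra].
    unfold Rdiv in h. rewrite Rmult_assoc, Rinv_l in h by nra. lra. }
  assert (Hm' : 1 <= INR m) by (replace 1 with (INR 1) by reflexivity; now apply le_INR).
  assert (Hmk : 0 < INR m * k ^ 2) by (apply Rmult_lt_0_compat; nra).
  set (sg := fun i : nat => INR i / (INR m * k ^ 2)) in *.
  (* Only these vectors can be contracted into the box along the segment; [boxfree] at the starting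
     point excludes first coordinates below [d / 2]. *)
  destruct (enum_slopes q hq z (al * k) (- (1 / 4)) (5 / 4) D ltac:(nra)) as [V [NV HV]].
  set (V' := filter (fun v => bdec (d / 2 <= zx z v)) V).
  set (P := fun v i => Rabs (sg i - zsl z v) * (k * zx z v) <= be).
  assert (HP : forall i, In i l -> exists v, In v V' /\ P v i).
  { intros i Hi. destruct (Hl i Hi) as [h1 h2].
    assert (S : 0 <= sg i <= 1).
    { unfold sg. pose proof (pos_INR i). split.
      - unfold Rdiv. apply Rmult_le_pos; auto. left; now apply inv_pos.
      - apply (Rmult_le_reg_r (INR m * k ^ 2)); auto. unfold Rdiv.
        rewrite Rmult_assoc, Rinv_l by lra. lra. }
    assert (exists v, inLambda q v /\ 0 <= zx z v <= al * k /\
       Rabs (snd (mapp z v) - sg i * zx z v) * k <= be) as [v (v1 & v2 & v3)].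
    { unfold boxfree in h2. apply not_all_ex_not in h2. destruct h2 as [v h2].
      apply imply_to_and in h2. destruct h2 as [v1 v2]. apply NNPP in v2.
      rewrite zx_sh, snd_sh, Rinv_inv in v2. fold (sg i) in v2. destruct v2 as [v2 v3].
      rewrite Rabs_mult, (Rabs_right (/ k)) in v2 by (left; apply inv_pos; lra).
      rewrite Rabs_mult, (Rabs_right k) in v3 by lra.
      apply (Rmult_le_compat_l k) in v2; [|lra]. rewrite <- Rmult_assoc, Rinv_r, Rmult_1_l in v2 by lra.
      destruct (Rle_lt_dec 0 (zx z v)).
      - exists v. rewrite Rabs_right in v2 by lra. repeat split; auto; lra.
      - exists (vneg v). rewrite Rabs_left in v2 by lra. rewrite zx_vneg, snd_vneg.
        replace (- snd (mapp z v) - sg i * - zx z v) with (- (snd (mapp z v) - sg i * zx z v)) by ring.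
        rewrite Rabs_Ropp. repeat split; auto using Lam_vneg; lra. }
    assert (X2 : d / 2 <= zx z v).
    { apply Rnot_lt_le. intro h. apply (BF v v1). split; [apply Rabs_le; lra|].
      assert (Rabs (snd (mapp z v) - sg i * zx z v) <= d / 8).
      { pose proof (Rabs_pos (snd (mapp z v) - sg i * zx z v)).
        apply (Rmult_le_reg_r k); [lra|]. lra. }
      apply Rabs_le_iff in H. apply Rabs_le. split; nra. }
    assert (X3 : snd (mapp z v) - sg i * zx z v = - (sg i - zsl z v) * zx z v).
    { rewrite zsl_snd by lra. ring. }
    rewrite X3, Rabs_mult, Rabs_Ropp, (Rabs_right (zx z v)) in v3 by lra.
    exists v. split; [|unfold P; lra].
    apply filter_In. split; [|now apply bdec_true]. apply HV.
    assert (Rabs (sg i - zsl z v) <= 1 / 4).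
    { pose proof (Rabs_pos (sg i - zsl z v)).
      apply (Rmult_le_reg_r (zx z v * k)); [nra|]. rewrite <- Rmult_assoc. nra. }
    apply Rabs_le_iff in H. repeat split; auto; lra. }
  eapply Rle_trans; [apply (union_count l V' P HP)|].
  assert (HV' : forall v, In v V' -> inLambda q v /\ d / 2 <= zx z v <= al * k /\ - (1 / 4) <= zsl z v <= 5 / 4).
  { intros v Hv. apply filter_In in Hv. destruct Hv as [h1 h2]. apply bdecT in h2. apply HV in h1. tauto. }
  (* A vector accounts for at most [2 be m k / x + 1] grid indices, hence for at most
     [(2 be m + al) k / x] since [x <= al k]. This is a fixed multiple of the length [1/(al k x)] of
     its interval in [pack_slopes]. *)
  apply Rle_trans with (Sm V' (fun v => (2 * be * INR m + al) * (al * k ^ 2) * (2 * / (2 * (al * k) * zx z v)))).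
  - apply Sm_le. intros v Hv. destruct (HV' v Hv) as (v1 & v2 & v3).
    set (c := INR m * k ^ 2 * zsl z v). set (r := be * INR m * k / zx z v).
    assert (Hr : 0 <= r).
    { unfold r, Rdiv. apply Rmult_le_pos; [|left; apply inv_pos; lra]. apply Rmult_le_pos; nra. }
    apply Rle_trans with ((c + r) - (c - r) + 1).
    + apply Sm_indic_count; auto. intros l' ND' H'. apply nat_count; auto; [lra|].
      intros i Hi. destruct (H' i Hi) as [_ Pi]. unfold P in Pi.
      assert (Rabs (sg i - zsl z v) * (INR m * k ^ 2) <= r).
      { unfold r. apply (Rmult_le_reg_r (zx z v)); [lra|].
        replace (be * INR m * k / zx z v * zx z v) with (be * (INR m * k)) by (field; lra).
        replace (Rabs (sg i - zsl z v) * (INR m * k ^ 2) * zx z v) with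
          (Rabs (sg i - zsl z v) * (k * zx z v) * (INR m * k)) by ring.
        apply Rmult_le_compat_r; auto. nra. }
      rewrite <- (Rabs_right (INR m * k ^ 2)) in H by lra. rewrite <- Rabs_mult in H.
      apply Rabs_le_iff in H.
      replace ((sg i - zsl z v) * (INR m * k ^ 2)) with (INR i - c) in H.
      2: { unfold sg, c. field. split; lra. }
      lra.
    + unfold r. apply (Rmult_le_reg_r (zx z v)); [lra|].
      replace ((c + be * INR m * k / zx z v - (c - be * INR m * k / zx z v) + 1) * zx z v)
       with (2 * be * INR m * k + zx z v) by (field; lra).
      replace ((2 * be * INR m + al) * (al * k ^ 2) * (2 * / (2 * (al * k) * zx z v)) * zx z v)
       with (2 * be * INR m * k + al * k) by (field; repeat split; lra). lra.
  - rewrite Sm_scal.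
    assert (Sm V' (fun v => 2 * / (2 * (al * k) * zx z v)) <= 5 / 4 - - (1 / 4) + 2 * (/ (2 * (al * k) * (d / 2)))).
    { apply (pack_slopes q hq z (al * k)); auto; try lra; try nra.
      - left; apply inv_pos. apply Rmult_lt_0_compat; nra.
      - now apply NoDup_filter.
      - intros v Hv. destruct (HV' v Hv) as (v1 & v2 & v3).
        assert (A : 0 < 2 * (al * k)) by nra.
        repeat split; auto; try lra.
        + left; apply inv_pos; nra.
        + apply Rinv_le_contravar; nra.
        + right. field. repeat split; lra. }
    assert (/ (2 * (al * k) * (d / 2)) <= 1 / 2).
    { replace (1 / 2) with (/ 2) by field. apply Rinv_le_contravar; lra. }
    assert (0 <= (2 * be * INR m + al) * (al * k ^ 2)) by (apply Rmult_le_pos; nra).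
    replace (3 * al * (2 * be * INR m + al) * k ^ 2) with ((2 * be * INR m + al) * (al * k ^ 2) * 3) by ring.
    apply Rmult_le_compat_l; auto. lra.
Qed.

(** * Reduction theory and density of directions *)

Definition nrm2 (v : R * R) : R := fst v ^ 2 + snd v ^ 2.
Definition dot (u v : R * R) : R := fst u * fst v + snd u * snd v.

Lemma zshift lam x r : 0 < lam -> exists n : Z, r <= x + IZR n * lam < r + lam.
Proof.
  intro Hl. destruct (archimed ((r - x) / lam)) as [h1 h2].
  set (n := up ((r - x) / lam)) in *.
  assert (E : (r - x) / lam * lam = r - x) by (field; lra).
  set (y := (r - x) / lam) in *.
  destruct (Req_EM_T (IZR n - y) 1) as [e|e].
  - exists (n - 1)%Z. rewrite minus_IZR.
    replace ((IZR n - 1) * lam) with (r - x) by (rewrite <- E; f_equal; lra). lra.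
  - exists n.
    assert (y * lam < IZR n * lam) by (apply Rmult_lt_compat_r; lra).
    assert (IZR n * lam < (y + 1) * lam) by (apply Rmult_lt_compat_r; lra). lra.
Qed.

(** Lagrange reduction of the second basis vector: adding multiples of the first moves the inner
    product in steps of [lambda_q * nrm2 u] into any window of that length. The position [r] of the
    window is free because [slope_dense] asks for a sign rather than for a centred window. *)
Lemma basis_shift q z M r : inHecke q M -> det z = 1 -> 0 < lambda_q q ->
  let u := mapp z (mapp M e1) in
  exists w, inLambda q w /\ vdet u (mapp z w) = 1 /\
   (exists n, mapp (mmul M (mat_Tn q n)) e1 = mapp M e1 /\ mapp (mmul M (mat_Tn q n)) e2 = w) /\
   r * nrm2 u <= dot u (mapp z w) < (r + lambda_q q) * nrm2 u.
Proof.
  intros HM D Hl u. pose proof (hecke_det q M HM) as DM.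
  set (w0 := mapp z (mapp M e2)).
  assert (V0 : vdet u w0 = 1).
  { unfold u, w0. rewrite !vdet_mapp, D, DM. unfold vdet, e1, e2; simpl; ring. }
  assert (Nu : 0 < nrm2 u).
  { unfold nrm2. unfold vdet in V0. 
    destruct (Req_EM_T (fst u) 0) as [E|E]; [|nra].
    destruct (Req_EM_T (snd u) 0) as [E'|E']; [|nra]. rewrite E, E' in V0. lra. }
  destruct (zshift (lambda_q q * nrm2 u) (dot u w0) (r * nrm2 u) (Rmult_lt_0_compat _ _ Hl Nu)) as [n Hn].
  exists (mapp (mmul M (mat_Tn q n)) e2).
  assert (E1 : mapp (mmul M (mat_Tn q n)) e1 = mapp M e1).
  { rewrite mapp_mmul. f_equal. unfold mapp, mat_Tn, e1; simpl; f_equal; ring. }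
  assert (E2 : mapp z (mapp (mmul M (mat_Tn q n)) e2) =
     (fst w0 + IZR n * lambda_q q * fst u, snd w0 + IZR n * lambda_q q * snd u)).
  { unfold u, w0, mapp, mmul, mat_Tn, e1, e2; simpl; f_equal; ring. }
  split.
  { apply Lam_mapp_e2, hecke_mmul; auto using hecke_Tn. }
  rewrite E2. clearbody u w0. split; [|split].
  - unfold vdet in *; simpl. lra.
  - exists n; auto.
  - unfold dot, nrm2 in *; simpl in *. lra.
Qed.

Lemma dot_vdet u w : vdet u w = 1 ->
  nrm2 u * nrm2 w = dot u w ^ 2 + 1 /\
  fst w * nrm2 u = dot u w * fst u - snd u /\ snd w * nrm2 u = dot u w * snd u + fst u.
Proof.
  intro H.
  assert (E : fst u * snd w = 1 + snd u * fst w) by (unfold vdet in H; lra).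
  unfold vdet, dot, nrm2 in *. repeat split.
  - replace 1 with ((fst u * snd w - snd u * fst w) ^ 2) by (rewrite H; ring). ring.
  - replace (snd u) with (snd u * (fst u * snd w - snd u * fst w)) at 3 by (rewrite H; ring). ring.
  - replace (fst u) with (fst u * (fst u * snd w - snd u * fst w)) at 3 by (rewrite H; ring). ring.
Qed.

Lemma nrm2_nonneg v : 0 <= nrm2 v.
Proof. unfold nrm2. nra. Qed.

(** Every orbit vector has a coordinate of size at least 1, and the inverse of [z] can enlarge a
    vector at most in proportion to its entries. *)
Lemma boxfree_ex q (hq : (3 <= q)%nat) z : det z = 1 -> exists d, 0 < d /\ boxfree q z d d.
Proof.
  intro D. set (c := Rabs (m11 z) + Rabs (m12 z) + Rabs (m21 z) + Rabs (m22 z)).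
  pose proof (Rabs_pos (m11 z)); pose proof (Rabs_pos (m12 z)).
  pose proof (Rabs_pos (m21 z)); pose proof (Rabs_pos (m22 z)).
  assert (Hc : 0 <= c) by (unfold c; lra).
  assert (Hd : 0 < / (2 * (c + 1))) by (apply inv_pos; lra).
  exists (/ (2 * (c + 1))). split; auto.
  set (d := / (2 * (c + 1))) in *.
  assert (cd : (c + 1) * d = 1 / 2) by (unfold d; field; lra).
  intros v Hv [h1 h2].
  assert (E : v = mapp (minv z) (mapp z v)) by (now rewrite mapp_minv_l).
  assert (T : forall a b, Rabs a <= c -> Rabs b <= c -> Rabs a + Rabs b <= c ->
    Rabs (a * zx z v + b * snd (mapp z v)) < 1).
  { intros a b Ha Hb Hab. eapply Rle_lt_trans; [apply Rabs_triang|]. rewrite !Rabs_mult.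
    pose proof (Rabs_pos a); pose proof (Rabs_pos b).
    assert (Rabs a * Rabs (zx z v) <= Rabs a * d) by (apply Rmult_le_compat_l; auto).
    assert (Rabs b * Rabs (snd (mapp z v)) <= Rabs b * d) by (apply Rmult_le_compat_l; auto).
    nra. }
  destruct (Lam_big q hq v Hv) as [B|B]; rewrite E in B; [rewrite fst_mapp in B|rewrite snd_mapp in B];
  unfold minv in B; simpl m11 in B; simpl m12 in B; simpl m21 in B; simpl m22 in B; fold (zx z v) in B.
  - assert (Rabs (m22 z * zx z v + - m12 z * snd (mapp z v)) < 1); [|lra].
    apply T; rewrite ?Rabs_Ropp; unfold c; lra.
  - assert (Rabs (- m21 z * zx z v + m11 z * snd (mapp z v)) < 1); [|lra].
    apply T; rewrite ?Rabs_Ropp; unfold c; lra.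
Qed.

Lemma boxfree_nrm2 q z d v : 0 < d -> boxfree q z d d -> inLambda q v -> d ^ 2 <= nrm2 (mapp z v).
Proof.
  intros Hd H Hv. apply Rnot_lt_le. intro N. apply (H v Hv).
  unfold nrm2 in N. unfold zx.
  split; apply Rabs_le; split; apply Rnot_lt_le; intro; nra.
Qed.

Definition Cq (q : nat) : R := 2 / (1 - lambda_q q ^ 2 / 4).

Lemma Cq_ge q (hq : (3 <= q)%nat) : 2 <= Cq q.
Proof.
  pose proof (lam_bounds q hq). unfold Cq.
  assert (P : 0 < 1 - lambda_q q ^ 2 / 4) by nra.
  apply (Rmult_le_reg_r (1 - lambda_q q ^ 2 / 4)); auto.
  unfold Rdiv at 2. rewrite Rmult_assoc, Rinv_l by lra. nra.
Qed.

(** As [lambda_q < 2], a reduced second vector [w] satisfies [|u|^2 |w|^2 <= c |u|^4 + 1] with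
    [c < 1]. If [u] is nearly shortest, so that [w] is not much shorter than [u], this bounds
    [u]. *)
Lemma short_vec q (hq : (3 <= q)%nat) z : det z = 1 ->
  exists M, inHecke q M /\ 0 < nrm2 (mapp z (mapp M e1)) <= Cq q.
Proof.
  intro D. destruct (boxfree_ex q hq z D) as [d [Hd BF]].
  pose proof (lam_bounds q hq) as Hl. pose proof (Cq_ge q hq) as HC.
  destruct (completeness (fun x => exists v, inLambda q v /\ x = - nrm2 (mapp z v))) as [s [S1 S2]].
  { exists 0. intros x [v [_ ->]]. pose proof (nrm2_nonneg (mapp z v)). lra. }
  { exists (- nrm2 (mapp z e1)), e1. split; auto. apply Lam_e1. }
  assert (Hm : d ^ 2 <= - s).
  { assert (s <= - d ^ 2); [|lra]. apply S2. intros x [v [Hv ->]].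
    pose proof (boxfree_nrm2 q z d v Hd BF Hv). lra. }
  assert (Hmin : forall v, inLambda q v -> - s <= nrm2 (mapp z v)).
  { intros v Hv. assert (- nrm2 (mapp z v) <= s); [|lra]. apply S1. eauto. }
  (* [th] lies halfway between [c] and 1: a vector within the factor [th] of the infimum is short
     enough, and the price of this slack is the 2 in [Cq]. *)
  set (c := lambda_q q ^ 2 / 4) in *. set (th := (1 + c) / 2).
  assert (Hc : 1 / 4 <= c < 1) by (unfold c; nra).
  assert (Hd2 : 0 < d ^ 2) by nra.
  assert (exists v, inLambda q v /\ th * nrm2 (mapp z v) < - s) as [v [Hv Hv2]].
  { apply NNPP. intro N. assert (s <= s / th).
    - apply S2. intros x [v [Hv ->]]. apply Rnot_lt_le. intro h. apply N. exists v; split; auto.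
      apply (Rmult_lt_compat_l th) in h; [|unfold th; lra].
      replace (th * (s / th)) with s in h by (field; unfold th; lra). lra.
    - apply (Rmult_le_compat_r th) in H; [|unfold th; lra].
      replace (s / th * th) with s in H by (field; unfold th; lra). unfold th in H. nra. }
  destruct Hv as [M [HM ->]]. fold e1 in Hv2. exists M. split; auto.
  set (u := mapp z (mapp M e1)) in *.
  pose proof (Hmin _ (Lam_mapp_e1 q M HM)) as Hu. fold u in Hu.
  split; [lra|].
  destruct (basis_shift q z M (- lambda_q q / 2) HM D ltac:(lra)) as [w (w1 & w2 & _ & w3)].
  fold u in w2, w3. pose proof (Hmin w w1) as Hw. set (w' := mapp z w) in *.
  destruct (dot_vdet u w' w2) as [E _].
  set (N := nrm2 u) in *.
  assert (D2 : dot u w' ^ 2 <= c * N ^ 2).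
  { unfold c. assert (- (lambda_q q / 2 * N) <= dot u w' <= lambda_q q / 2 * N) by lra.
    replace (lambda_q q ^ 2 / 4 * N ^ 2) with ((lambda_q q / 2 * N) ^ 2) by field.
    apply pow_maj_Rabs. apply Rabs_le. lra. }
  assert (HN : 0 < N) by lra.
  assert (th * N * N < c * N ^ 2 + 1) by nra.
  assert (N ^ 2 * (1 - c) < 2) by (unfold th in *; nra).
  apply Rnot_lt_le. intro h.
  assert (Cq q * (1 - c) = 2) by (unfold Cq; fold c; field; lra).
  nra.
Qed.

Definition mbd (z : mat) (C : R) : Prop :=
  Rabs (m11 z) <= C /\ Rabs (m12 z) <= C /\ Rabs (m21 z) <= C /\ Rabs (m22 z) <= C.

Lemma sq_le_abs x C : x ^ 2 <= C -> 1 <= C -> Rabs x <= C.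
Proof. intros. apply Rabs_le. split; apply Rnot_lt_le; intro; nra. Qed.

(** Mahler compactness: away from the cusp, every point has a representative modulo the group in a
    fixed compact set. The lower bound on [nrm2 u] controls the second vector through
    [|u|^2 |w|^2 = (u.w)^2 + 1]. *)
Lemma reduction q (hq : (3 <= q)%nat) z d : det z = 1 -> 0 < d -> boxfree q z d d ->
  exists M, inHecke q M /\ mbd (mmul z M) (Cq q + / d ^ 2).
Proof.
  intros D Hd BF. destruct (short_vec q hq z D) as [M [HM [H1 H2]]].
  pose proof (lam_bounds q hq) as Hl. pose proof (Cq_ge q hq) as HC.
  destruct (basis_shift q z M (- lambda_q q / 2) HM D ltac:(lra)) as [w (w1 & w2 & [n [n1 n2]] & w3)].
  exists (mmul M (mat_Tn q n)). split. { apply hecke_mmul; auto using hecke_Tn. }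
  set (u := mapp z (mapp M e1)) in *. set (w' := mapp z w) in *.
  pose proof (boxfree_nrm2 q z d _ Hd BF (Lam_mapp_e1 q M HM)) as Hu. fold u in Hu.
  destruct (dot_vdet u w' w2) as [E _].
  set (N := nrm2 u) in *.
  assert (Hd2 : 0 < d ^ 2) by nra.
  assert (HI : 0 < / d ^ 2) by now apply inv_pos.
  assert (D2 : dot u w' ^ 2 <= N ^ 2).
  { apply pow_maj_Rabs. apply Rabs_le. nra. }
  assert (NW : nrm2 w' <= Cq q + / d ^ 2).
  { apply (Rmult_le_reg_l N); auto. rewrite E. 
    assert (1 <= N * / d ^ 2).
    { rewrite <- (Rinv_r (d ^ 2)) by lra. apply Rmult_le_compat_r; lra. }
    nra. }
  assert (Eu : mapp (mmul z (mmul M (mat_Tn q n))) e1 = u).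
  { rewrite mapp_mmul, n1. reflexivity. }
  assert (Ew : mapp (mmul z (mmul M (mat_Tn q n))) e2 = w').
  { rewrite mapp_mmul, n2. reflexivity. }
  set (Z := mmul z (mmul M (mat_Tn q n))) in *.
  assert (Z1 : m11 Z = fst u) by (rewrite <- Eu, fst_mapp; unfold e1; simpl; ring).
  assert (Z2 : m21 Z = snd u) by (rewrite <- Eu, snd_mapp; unfold e1; simpl; ring).
  assert (Z3 : m12 Z = fst w') by (rewrite <- Ew, fst_mapp; unfold e2; simpl; ring).
  assert (Z4 : m22 Z = snd w') by (rewrite <- Ew, snd_mapp; unfold e2; simpl; ring).
  unfold mbd. rewrite Z1, Z2, Z3, Z4. unfold N, nrm2 in H2, NW.
  repeat split; apply sq_le_abs; try lra; nra.
Qed.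

(** Zooming in at the slope [t] by a factor [k^2] reduces the claim to finding, for an arbitrary
    lattice, an orbit vector in a fixed cone around the horizontal axis; the aperture [K] of the
    cone does not depend on [k]. *)
Lemma slope_dense q (hq : (3 <= q)%nat) z t e : det z = 1 -> 0 < e ->
  exists v, inLambda q v /\ 0 < zx z v /\ Rabs (zsl z v - t) < e.
Proof.
  intros D He. pose proof (lam_bounds q hq) as Hl. pose proof (Cq_ge q hq) as HC.
  remember (2 * Cq q + 1) as K eqn:EK.
  assert (HK : 0 < K / e) by (apply Rdiv_lt_0_compat; lra).
  remember (1 + K / e) as k eqn:Ek.
  assert (Hk1 : 1 < k) by lra.
  assert (Hk : K < e * k ^ 2).
  { assert (K < e * k).
    { rewrite Ek. replace (e * (1 + K / e)) with (e + K) by (field; lra). lra. }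
    assert (e * k * 1 < e * k * k) by (apply Rmult_lt_compat_l; nra). nra. }
  set (z' := mmul (mat_s (/ k)) (mmul (mat_h t) z)).
  assert (Hik : 0 < / k) by (apply inv_pos; lra).
  assert (D' : det z' = 1) by (unfold z'; rewrite det_sh; lra).
  assert (G : exists v, inLambda q v /\ zx z' v <> 0 /\ Rabs (snd (mapp z' v)) <= K * Rabs (zx z' v)).
  { destruct (short_vec q hq z' D') as [M [HM [H1 H2]]].
    set (u := mapp z' (mapp M e1)) in *.
    assert (Z0 : forall v, Rabs (snd (mapp z' v)) <= K * Rabs (zx z' v) -> 0 < nrm2 (mapp z' v) -> zx z' v <> 0).
    { intros v h1 h2 h3. rewrite h3, Rabs_R0, Rmult_0_r in h1. unfold nrm2 in h2. unfold zx in h3. rewrite h3 in h2.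
      apply Rabs_le_iff in h1. nra. }
    destruct (Rle_lt_dec (Rabs (snd u)) (Rabs (fst u))) as [h|h].
    - assert (Rabs (snd u) <= K * Rabs (fst u)).
      { pose proof (Rabs_pos (fst u)). rewrite EK. nra. }
      exists (mapp M e1). split; [now apply Lam_mapp_e1|]. split; auto.
    (* The short vector [u] is steep, so a neighbour [w] is used. The window gives the inner product
       the sign opposite to that of [fst u * snd u]; then the two terms of
       [fst w * |u|^2 = (u.w) fst u - snd u] do not cancel. *)
    - set (r := if Rle_dec (fst u * snd u) 0 then 0 else - lambda_q q).
      destruct (basis_shift q z' M r HM D' ltac:(lra)) as [w (w1 & w2 & _ & w3)].
      fold u in w2, w3. destruct (dot_vdet u (mapp z' w) w2) as (E & E1 & E2).
      set (N := nrm2 u) in *. set (dt := dot u (mapp z' w)) in *.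
      assert (Rabs (snd (mapp z' w)) <= K * Rabs (zx z' w)).
      { apply (Rmult_le_reg_r N); auto.
        rewrite <- (Rabs_right N) at 1 by lra. rewrite <- Rabs_mult, E2.
        rewrite Rmult_assoc. rewrite <- (Rabs_right N) by lra. rewrite <- Rabs_mult.
        unfold zx. rewrite E1.
        assert (A1 : Rabs (snd u) <= Rabs (dt * fst u - snd u)).
        { assert (dt * fst u * snd u <= 0).
          { unfold r in w3. destruct (Rle_dec (fst u * snd u) 0).
            - assert (0 <= dt) by lra. nra.
            - assert (dt <= 0) by lra. nra. }
          apply Rsqr_le_abs_0. unfold Rsqr. nra. }
        assert (A2 : Rabs dt <= 2 * N).
        { apply Rabs_le. unfold r in w3. destruct (Rle_dec (fst u * snd u) 0); nra. }
        eapply Rle_trans; [apply Rabs_triang|]. rewrite Rabs_mult.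
        pose proof (Rabs_pos (snd u)). pose proof (Rabs_pos dt).
        assert (Rabs dt * Rabs (snd u) <= 2 * Cq q * Rabs (snd u)) by (apply Rmult_le_compat_r; lra).
        rewrite EK. nra. }
      exists w. split; auto. split; auto. apply Z0; auto. pose proof (nrm2_nonneg (mapp z' w)). nra. }
  assert (G' : exists v, inLambda q v /\ 0 < zx z' v /\ Rabs (snd (mapp z' v)) <= K * Rabs (zx z' v)).
  { destruct G as [v (v1 & v2 & v3)]. destruct (Rlt_le_dec 0 (zx z' v)).
    - exists v; auto.
    - exists (vneg v). rewrite zx_vneg, snd_vneg, !Rabs_Ropp. repeat split; auto using Lam_vneg. lra. }
  destruct G' as [v (v1 & v2 & v3)]. exists v. split; auto.
  assert (Hx : 0 < zx z v).
  { unfold z' in v2. rewrite zx_sh in v2. nra. }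
  split; auto.
  rewrite zsl_snd, Rabs_mult in v3 by lra.
  apply Rmult_le_reg_r in v3; [|rewrite Rabs_right; lra].
  unfold z' in v3. rewrite zsl_sh in v3 by lra.
  replace ((zsl z v - t) / (/ k) ^ 2) with ((zsl z v - t) * k ^ 2) in v3 by (field; lra).
  rewrite Rabs_mult, (Rabs_right (k ^ 2)) in v3 by nra.
  apply (Rmult_lt_reg_r (k ^ 2)); nra.
Qed.

Lemma row_dense q (hq : (3 <= q)%nat) p p' r : 0 < r ->
  exists M s, inHecke q M /\ Rabs (s * m21 M - p) < r /\ Rabs (s * m22 M - p') < r.
Proof.
  intro Hr.
  assert (G : exists v s, inLambda q v /\ Rabs (s * fst v - p) < r /\ Rabs (s * snd v - p') < r).
  { destruct (Req_EM_T p 0) as [->|Hp].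
    - exists e2, p'. split; [apply Lam_e2|]. unfold e2; simpl.
      split; [replace (p' * 0 - 0) with 0 by ring|replace (p' * 1 - p') with 0 by ring]; now rewrite Rabs_R0.
    - assert (Hp' : 0 < Rabs p) by now apply Rabs_pos_lt.
      destruct (slope_dense q hq mat_id (p' / p) (r / Rabs p)) as [v (v1 & v2 & v3)].
      { unfold det, mat_id; simpl; ring. }
      { now apply Rdiv_lt_0_compat. }
      unfold zx, zsl, slope in *. rewrite mapp_id in *.
      exists v, (p / fst v). split; auto. split.
      + replace (p / fst v * fst v - p) with 0 by (field; lra). now rewrite Rabs_R0.
      + replace (p / fst v * snd v - p') with ((snd v / fst v - p' / p) * p) by (field; lra).
        rewrite Rabs_mult. apply (Rmult_lt_compat_r (Rabs p)) in v3; auto.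
        replace (r / Rabs p * Rabs p) with r in v3 by (field; lra). auto. }
  destruct G as [v [s ([N [HN ->]] & h1 & h2)]].
  (* The second column of [N S^-1] is the first column of [N]; transposing makes it the second
     row. *)
  exists (mtr (mmul N (minv mat_S))), s. split.
  - apply hecke_mtr, hecke_mmul; auto using hecke_gSinv.
  - unfold mapp, mtr, mmul, minv, mat_S in *; simpl in *.
    split; [match type of h1 with Rabs ?a < _ => match goal with |- Rabs ?b < _ => replace b with a by ring end end
    |match type of h2 with Rabs ?a < _ => match goal with |- Rabs ?b < _ => replace b with a by ring end end]; auto.
Qed.

(** Compactness of the square, with a gauge that serves twice: [d] is a radius of validity, and
    [1/d] bounds the matrix and the multiplier. A positive lower bound for the gauge then yields the
    uniform [D]. *)
Lemma row_dense_unif q (hq : (3 <= q)%nat) C r : 0 < r ->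
  exists D, 0 < D /\ forall p p', Rabs p <= C -> Rabs p' <= C ->
  exists M s, inHecke q M /\ mbd M D /\ Rabs s <= D /\
    Rabs (s * m21 M - p) < r /\ Rabs (s * m22 M - p') < r.
Proof.
  intro Hr.
  assert (G : forall u v, exists d : posreal, d <= r / 2 /\ exists M s, inHecke q M /\ mbd M (/ d) /\ Rabs s <= / d /\
     Rabs (s * m21 M - u) < r / 2 /\ Rabs (s * m22 M - v) < r / 2).
  { intros u v. destruct (row_dense q hq u v (r / 2) ltac:(lra)) as [M [s (h1 & h2 & h3)]].
    set (D := 1 + Rabs (m11 M) + Rabs (m12 M) + Rabs (m21 M) + Rabs (m22 M) + Rabs s + 2 / r).
    pose proof (Rabs_pos (m11 M)); pose proof (Rabs_pos (m12 M)).
    pose proof (Rabs_pos (m21 M)); pose proof (Rabs_pos (m22 M)). pose proof (Rabs_pos s).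
    assert (0 < 2 / r) by (apply Rdiv_lt_0_compat; lra).
    assert (HD : 0 < D) by (unfold D; lra).
    exists (mkposreal (/ D) (inv_pos D HD)). simpl. rewrite Rinv_inv. split.
    - replace (r / 2) with (/ (2 / r)) by (field; lra). apply Rinv_le_contravar; auto. unfold D; lra.
    - exists M, s. split; auto. split; [unfold mbd, D; repeat split; lra|].
      split; [unfold D; lra|]. auto. }
  set (dl := fun u v => epsilon (inhabits (mkposreal 1 Rlt_0_1)) (fun d : posreal => d <= r / 2 /\
     exists M s, inHecke q M /\ mbd M (/ d) /\ Rabs s <= / d /\
     Rabs (s * m21 M - u) < r / 2 /\ Rabs (s * m22 M - v) < r / 2)).
  assert (Hdl := fun u v => epsilon_spec (inhabits (mkposreal 1 Rlt_0_1)) _ (G u v)). fold dl in Hdl.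
  destruct (compactness_value_2d (- C) C (- C) C dl) as [d Hd].
  exists (/ d). split; [apply inv_pos, cond_pos|].
  intros p p' Hp Hp'. apply Rabs_le_iff in Hp. apply Rabs_le_iff in Hp'.
  specialize (Hd p p' Hp Hp'). apply NNPP in Hd. destruct Hd as (u & v & _ & _ & h1 & h2 & h3).
  destruct (Hdl u v) as [k1 [M [s (m1 & m2 & m3 & m4 & m5)]]].
  fold (dl u v) in *. set (dd := pos (dl u v)) in *.
  assert (Hd0 := cond_pos d).
  assert (/ dd <= / d) by (apply Rinv_le_contravar; auto).
  exists M, s. repeat split; auto.
  1-5: destruct m2 as (?&?&?&?); lra.
  - replace (s * m21 M - p) with ((s * m21 M - u) - (p - u)) by ring.
    eapply Rle_lt_trans; [apply Rabs_triang|]. rewrite Rabs_Ropp. lra.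
  - replace (s * m22 M - p') with ((s * m22 M - v) - (p' - v)) by ring.
    eapply Rle_lt_trans; [apply Rabs_triang|]. rewrite Rabs_Ropp. lra.
Qed.

(** * The maximum principle and equidistribution *)

Lemma W_tele q (hq : (3 <= q)%nat) g d L z t a h n : adm q g d L -> 0 < t -> det z = 1 -> 0 <= h ->
  Sm (seq 0 n) (fun i => W q g z t (a + INR i * h) (a + INR i * h + h)) = W q g z t a (a + INR n * h).
Proof.
  intros H Ht D Hh.
  assert (W0 : forall x, W q g z t x x = 0).
  { intro x. pose proof (W_add q hq g d L z t x x x H Ht D ltac:(lra)). lra. }
  induction n as [|n IH].
  - simpl. rewrite Rmult_0_l, Rplus_0_r, W0. reflexivity.
  - rewrite seq_S, Sm_app, IH. simpl Sm. rewrite Rplus_0_r. rewrite S_INR.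
    simpl plus. replace (a + (INR n + 1) * h) with (a + INR n * h + h) by ring.
    symmetry. pose proof (pos_INR n). apply (W_add q hq g d L); auto. nra.
Qed.

(** Each term splits into [m] windows of length [h = 1/(m k^2)]. For a fixed position [dd] inside
    the term, the windows over all [i] fill [[dd h, dd h + 1]], which contains [[1/k^2, 1]]. The
    part of [[0, 1]] that is lost carries at most [2 t^2] at scale [t k], whence the term
    [2 / k^2]. *)
Lemma grid_average q (hq : (3 <= q)%nat) g d L z t (kk m : nat) : adm q g d L -> 1 <= t -> det z = 1 ->
  (1 <= kk)%nat -> (1 <= m)%nat ->
  let k := INR kk in let n := (m * (kk * kk))%nat in
  INR n * (Phi q g (t * k) z - 2 / k ^ 2) <=
  Sm (seq 0 n) (fun i => Phi q g t (mmul (mat_s (/ k)) (mmul (mat_h (INR i / (INR m * k ^ 2))) z))).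
Proof.
  intros H Ht D Hkk Hm k n.
  assert (Hk : 1 <= k) by (replace 1 with (INR 1) by reflexivity; now apply le_INR).
  assert (Hm' : 1 <= INR m) by (replace 1 with (INR 1) by reflexivity; now apply le_INR).
  assert (En : INR n = INR m * k ^ 2) by (unfold n, k; rewrite !mult_INR; ring).
  assert (Hn : 0 < INR m * k ^ 2) by (apply Rmult_lt_0_compat; nra).
  set (h := / (INR m * k ^ 2)).
  assert (Hh : 0 < h) by now apply inv_pos.
  assert (mh : INR m * h = / k ^ 2) by (unfold h; field; split; lra).
  assert (nh : INR n * h = 1) by (unfold h; rewrite En; field; split; lra).
  assert (Htk : 0 < t * k) by nra.
  rewrite (Sm_ext _ _ (fun i => / t ^ 2 * Sm (seq 0 m) (fun dd =>
     W q g z (t * k) (INR dd * h + INR i * h) (INR dd * h + INR i * h + h)))).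
  2: { intros i _. rewrite (Phi_sh q hq g d L) by (auto; try lra; apply inv_pos; lra).
    replace (t / / k) with (t * k) by (field; lra).
    replace ((/ k) ^ 2) with (INR m * h) by (rewrite mh; field; lra).
    replace (INR i / (INR m * k ^ 2)) with (INR i * h) by (unfold h; reflexivity).
    rewrite <- (W_tele q hq g d L) by (auto; lra). unfold Rdiv. rewrite Rmult_comm. f_equal.
    apply Sm_ext. intros dd _. f_equal; ring. }
  rewrite Sm_scal, Sm_swap.
  assert (T : Sm (seq 0 m) (fun _ => t ^ 2 * (k ^ 2 * Phi q g (t * k) z - 2)) <=
    Sm (seq 0 m) (fun dd => Sm (seq 0 n) (fun i => W q g z (t * k) (INR dd * h + INR i * h) (INR dd * h + INR i * h + h)))).
  { apply Sm_le. intros dd Hd. apply in_seq in Hd.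
    rewrite (W_tele q hq g d L) by (auto; lra).
    apply Rle_trans with (W q g z (t * k) (/ k ^ 2) 1).
    - assert (K2 : 0 < / k ^ 2 <= 1).
      { split; [apply inv_pos; nra|]. rewrite <- Rinv_1. apply Rinv_le_contravar; nra. }
      pose proof (W_add q hq g d L z (t * k) 0 (/ k ^ 2) 1 H Htk D ltac:(lra)) as A.
      pose proof (W_bound q hq g d L z (t * k) 0 (/ k ^ 2) H Htk D ltac:(lra)) as B.
      replace ((/ k ^ 2 - 0) * (t * k) ^ 2) with (t ^ 2) in B by (field; lra).
      unfold Phi. replace (t ^ 2 * (k ^ 2 * (W q g z (t * k) 0 1 / (t * k) ^ 2) - 2)) with
        (W q g z (t * k) 0 1 - 2 * t ^ 2) by (field; split; lra). nra.
    - assert (INR dd <= INR m) by (apply le_INR; lia).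
      pose proof (pos_INR dd).
      apply (W_mono q hq g d L); auto; nra. }
  rewrite Sm_const, length_seq in T.
  apply (Rmult_le_compat_l (/ t ^ 2)) in T; [|left; apply inv_pos; nra].
  eapply Rle_trans; [|apply T]. right. rewrite En. field. split; lra.
Qed.

(** Shears of a point of the expanded horocycle stay on it, so grid neighbours differ by shears by
    multiples of [1/m]. *)
Lemma mat_h_s r s s' z : r <> 0 ->
  mmul (mat_h s') (mmul (mat_s r) (mmul (mat_h s) z)) = mmul (mat_s r) (mmul (mat_h (s + s' * r ^ 2)) z).
Proof. intro. unfold mat_h, mat_s, mmul; simpl; f_equal; field; auto. Qed.

Lemma iwasawa Y : det Y = 1 -> m11 Y <> 0 ->
  mmul (mat_h (m21 Y / m11 Y)) Y = mat_g (m11 Y) (m12 Y).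
Proof.
  destruct Y as [a b c d]; unfold det, mmul, mat_h, mat_g; simpl. intros D H.
  f_equal; try ring.
  - field; auto.
  - transitivity ((a * d - b * c) / a); [field; auto|]. rewrite D. field; auto.
Qed.

Lemma shear_entries P et : det P = 1 -> m11 P <> 0 ->
  let k := mmul (mat_h (m21 P / m11 P + et)) P in
  m21 k = - et * m11 P /\ m22 k = / m11 P - et * m12 P /\ m11 k = m11 P /\ m12 k = m12 P.
Proof.
  destruct P as [a b c d]; unfold det, mmul, mat_h; simpl. intros D H. repeat split; try ring.
  - field; auto.
  - transitivity ((a * d - b * c) / a - et * b); [field; auto|]. rewrite D. field; auto.
Qed.

Lemma det_h s z : det (mmul (mat_h s) z) = det z.
Proof. unfold det, mmul, mat_h; simpl; ring. Qed.

Lemma length_flat_map_const {X Y} (f : X -> list Y) l c : (forall x, length (f x) = c) ->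
  length (flat_map f l) = (length l * c)%nat.
Proof.
  intro H. induction l as [|x l IH]; simpl; auto. rewrite length_app, H, IH. reflexivity.
Qed.

Lemma filter_count {X} (P : X -> Prop) l :
  Sm l (fun x => if bdec (P x) then 1 else 0) = INR (length (filter (fun x => bdec (P x)) l)).
Proof. rewrite <- (Sm_filter_if (fun x => bdec (P x)) l (fun _ => 1)), Sm_const. ring. Qed.

Lemma nat_floor (x : R) : 0 <= x -> exists n : nat, x - 1 <= INR n <= x.
Proof.
  intro Hx. destruct (archimed x) as [h1 h2].
  assert (0 < up x)%Z by (apply lt_IZR; simpl; lra).
  exists (Z.to_nat (up x - 1)). rewrite INR_IZR_INZ, Z2Nat.id, minus_IZR by lia. lra.
Qed.

(** For each [d] the bound is uniform over the points without vectors in the [d]-box, while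
    [limsup_ge] asks that the value be approached with a [d] not depending on [T]. Together they say
    that [c] is the supremum over [d] of these uniform limsups. *)
Definition limsup_le q g (c : R) : Prop :=
  forall e d, 0 < e -> 0 < d -> exists T, forall t z, T <= t -> 1 <= t -> det z = 1 ->
    boxfree q z d d -> Phi q g t z <= c + e.
Definition limsup_ge q g (c : R) : Prop :=
  forall e, 0 < e -> exists d, 0 < d /\ forall T, exists t z, T <= t /\ det z = 1 /\
    boxfree q z d d /\ c - e < Phi q g t z.

(** Completeness is applied to the negatives of the admissible upper bounds. Testing at the
    identity, whose lattice has no short vectors, shows that these bounds are nonnegative. *)
Lemma limsup_ex q (hq : (3 <= q)%nat) g d L : adm q g d L ->
  exists c, 0 <= c /\ limsup_le q g c /\ limsup_ge q g c.
Proof.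
  intro H.
  set (E := fun x => forall dl, 0 < dl -> exists T, forall t z, T <= t -> 1 <= t -> det z = 1 ->
    boxfree q z dl dl -> Phi q g t z <= - x).
  assert (Hid : det mat_id = 1) by (unfold det, mat_id; simpl; ring).
  destruct (completeness E) as [s [S1 S2]].
  - exists 0. intros x Hx. destruct (boxfree_ex q hq mat_id Hid) as [dl [Hdl BF]].
    destruct (Hx dl Hdl) as [T HT].
    pose proof (HT (Rmax T 1) mat_id (Rmax_l _ _) (Rmax_r _ _) Hid BF).
    pose proof (Phi_rng q hq g d L mat_id (Rmax T 1) H (Rmax_r _ _) Hid). lra.
  - exists (-2). intros dl _. exists 1. intros t z Ht _ D _.
    pose proof (Phi_rng q hq g d L z t H Ht D). lra.
  - exists (- s). split; [|split].
    + assert (s <= 0); [|lra]. apply S2. intros x Hx.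
      destruct (boxfree_ex q hq mat_id Hid) as [dl [Hdl BF]].
      destruct (Hx dl Hdl) as [T HT].
      pose proof (HT (Rmax T 1) mat_id (Rmax_l _ _) (Rmax_r _ _) Hid BF).
      pose proof (Phi_rng q hq g d L mat_id (Rmax T 1) H (Rmax_r _ _) Hid). lra.
    + intros e dl He Hdl.
      assert (exists x, E x /\ s - e < x) as [x [Hx Hx']].
      { apply NNPP. intro N. assert (s <= s - e); [|lra]. apply S2. intros x Hx.
        apply Rnot_lt_le. intro. apply N. eauto. }
      destruct (Hx dl Hdl) as [T HT]. exists T. intros t z h1 h2 h3 h4.
      specialize (HT t z h1 h2 h3 h4). lra.
    + intros e He.
      assert (N : ~ E (s + e)).
      { intro N. apply S1 in N. lra. }
      unfold E in N. apply not_all_ex_not in N. destruct N as [dl N].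
      apply imply_to_and in N. destruct N as [Hdl N]. exists dl. split; auto.
      intro T. apply NNPP. intro N'. apply N. exists T. intros t z h1 h2 h3 h4.
      apply Rnot_lt_le. intro h5. apply N'. exists t, z. repeat split; auto. lra.
Qed.

(** A union bound on the grid of a horocycle segment through an almost maximal point. The average is
    at least about [c] and almost no value exceeds [c + ep], so values below [c - e] have density at
    most [5 ep / e]; excluding these together with their [Dn] neighbours on either side still leaves
    indices outside the cusp. *)
Lemma good_point q (hq : (3 <= q)%nat) g d L c : adm q g d L -> 0 <= c ->
  limsup_le q g c -> limsup_ge q g c ->
  forall e (m Dn : nat) al be, 0 < e -> (1 <= m)%nat -> 0 < al -> 0 < be ->
  3 * al * (2 * be + al) <= 1 / 4 ->
  forall T, exists t y, T <= t /\ 1 <= t /\ det y = 1 /\ boxfree q y al be /\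
   forall j : Z, (- Z.of_nat Dn <= j <= Z.of_nat Dn)%Z ->
     c - e <= Phi q g t (mmul (mat_h (IZR j / INR m)) y).
Proof.
  intros H Hc HU HL e m Dn al be He Hm Hal Hbe Hab T.
  assert (HDn : 0 <= INR Dn) by apply pos_INR.
  (* Makes [2 Dn + 1] times the number of low indices at most a quarter of the grid, the same share
     as is allowed to the cusp and to the two ends. *)
  set (ep := e / (20 * (2 * INR Dn + 1))).
  assert (Hep : 0 < ep) by (apply Rdiv_lt_0_compat; lra).
  assert (Hep' : 20 * ep * (2 * INR Dn + 1) = e) by (unfold ep; field; lra).
  clearbody ep.
  destruct (HL ep Hep) as [dl [Hdl HL']].
  set (d2 := Rmin 1 ep / 9).
  assert (Hd2 : 0 < d2) by (unfold d2; apply Rdiv_lt_0_compat; [apply Rmin_pos|]; lra).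
  assert (Hd2' : 9 * d2 ^ 2 <= ep).
  { pose proof (Rmin_l 1 ep). pose proof (Rmin_r 1 ep). unfold d2 in *. nra. }
  clearbody d2.
  destruct (excursions q hq dl d2 d2 Hdl Hd2 Hd2) as [k1 [Hk1 EX1]].
  destruct (excursions q hq dl al be Hdl Hal Hbe) as [k2 [Hk2 EX2]].
  destruct (HU ep d2 Hep Hd2) as [T2 HT2].
  destruct (INR_unbounded (k1 + k2 + 2 / ep + 8 * INR Dn + 8)) as [kk Hkk].
  assert (P2 : 0 < 2 / ep) by (apply Rdiv_lt_0_compat; lra).
  assert (Hkk1 : (1 <= kk)%nat) by (apply INR_le; simpl; lra).
  set (k := INR kk) in *.
  assert (Hk0 : 1 <= k) by lra.
  assert (Hkk2 : k <= k ^ 2) by nra.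
  destruct (HL' (k * (Rmax (Rmax T T2) 1))) as (tau & B & Ht & DB & BF & HB).
  set (t := tau / k).
  assert (Et : t * k = tau) by (unfold t; field; lra).
  assert (Ht' : Rmax (Rmax T T2) 1 <= t).
  { apply (Rmult_le_reg_r k); lra. }
  assert (t1 : 1 <= t) by (eapply Rle_trans; [apply Rmax_r|apply Ht']).
  assert (tT : T <= t).
  { eapply Rle_trans; [|apply Ht']. eapply Rle_trans; [|apply Rmax_l]. apply Rmax_l. }
  assert (tT2 : T2 <= t).
  { eapply Rle_trans; [|apply Ht']. eapply Rle_trans; [|apply Rmax_l]. apply Rmax_r. }
  set (n := (m * (kk * kk))%nat).
  assert (Hm' : 1 <= INR m) by (replace 1 with (INR 1) by reflexivity; now apply le_INR).
  assert (En : INR n = INR m * k ^ 2) by (unfold n, k; rewrite !mult_INR; ring).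
  set (y := fun i : nat => mmul (mat_s (/ k)) (mmul (mat_h (INR i / (INR m * k ^ 2))) B)).
  assert (Dy : forall i, det (y i) = 1).
  { intro i. unfold y. rewrite det_sh; auto. apply Rinv_neq_0_compat. lra. }
  pose proof (grid_average q hq g d L B t kk m H t1 DB Hkk1 Hm) as GA.
  cbv zeta in GA. fold k in GA. fold n in GA. rewrite Et in GA.
  set (bad1 := fun i => ~ boxfree q (y i) d2 d2).
  set (low := fun i => Phi q g t (y i) < c - e).
  set (bad2 := fun i => ~ boxfree q (y i) al be).
  set (B1 := filter (fun i => bdec (bad1 i)) (seq 0 n)).
  set (Lo := filter (fun i => bdec (low i)) (seq 0 n)).
  set (B2 := filter (fun i => bdec (bad2 i)) (seq 0 n)).
  assert (In_n : forall i, In i (seq 0 n) -> INR i <= INR m * k ^ 2).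
  { intros i Hi. apply in_seq in Hi. rewrite <- En. apply le_INR. lia. }
  assert (N1 : INR (length B1) <= ep * INR n).
  { eapply Rle_trans.
    - apply (EX1 k B m B1); auto; try lra.
      + apply NoDup_filter, seq_NoDup.
      + intros i Hi. apply filter_In in Hi. destruct Hi as [h1 h2]. apply bdecT in h2. auto.
    - rewrite En. assert (0 <= k ^ 2) by lra.
      assert (3 * d2 * (2 * d2 * INR m + d2) <= ep * INR m) by nra.
      nra. }
  assert (N2 : INR (length B2) <= INR n / 4).
  { eapply Rle_trans.
    - apply (EX2 k B m B2); auto; try lra.
      + apply NoDup_filter, seq_NoDup.
      + intros i Hi. apply filter_In in Hi. destruct Hi as [h1 h2]. apply bdecT in h2. auto.
    - rewrite En. assert (0 <= k ^ 2) by lra.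
      assert (3 * al * (2 * be * INR m + al) <= INR m / 4) by nra.
      nra. }
  assert (S1 : Sm (seq 0 n) (fun i => Phi q g t (y i)) <=
     INR n * (c + ep) + 2 * INR (length B1) - e * INR (length Lo)).
  { unfold B1, Lo. rewrite <- !filter_count, <- !Sm_scal.
    replace (INR n * (c + ep)) with (Sm (seq 0 n) (fun _ => c + ep)) by (rewrite Sm_const, length_seq; ring).
    rewrite <- Sm_plus, <- Sm_minus. apply Sm_le. intros i _.
    pose proof (Phi_rng q hq g d L (y i) t H t1 (Dy i)) as R.
    destruct (bdec (low i)) eqn:F1.
    - apply bdecT in F1. unfold low in F1. destruct (bdec (bad1 i)); lra.
    - destruct (bdec (bad1 i)) eqn:F2; [lra|].
      apply bdecF in F2. unfold bad1 in F2. apply NNPP in F2.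
      pose proof (HT2 t (y i) tT2 t1 (Dy i) F2). lra. }
  assert (Hn0 : k <= INR n) by (rewrite En; nra).
  assert (N3 : INR (length Lo) * (2 * INR Dn + 1) <= INR n / 4).
  { assert (I2 : 2 / k ^ 2 <= ep).
    { apply (Rmult_le_reg_r (k ^ 2)); [lra|]. unfold Rdiv. rewrite Rmult_assoc, Rinv_l, Rmult_1_r by lra.
      assert (2 <= ep * k); [|nra].
      assert (2 / ep <= k) by lra. apply (Rmult_le_compat_l ep) in H0; [|lra].
      replace (ep * (2 / ep)) with 2 in H0 by (field; lra). lra. }
    assert (e * INR (length Lo) <= 5 * ep * INR n).
    { unfold y in S1. pose proof (Rle_trans _ _ _ GA S1) as Q.
      assert (INR n * (c - ep - ep) <= INR n * (Phi q g tau B - 2 / k ^ 2)) by (apply Rmult_le_compat_l; lra).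
      nra. }
    apply (Rmult_le_reg_l (20 * ep)); [lra|].
    replace (20 * ep * (INR (length Lo) * (2 * INR Dn + 1))) with ((20 * ep * (2 * INR Dn + 1)) * INR (length Lo)) by ring.
    rewrite Hep'. lra. }
  assert (G : exists i, In i (seq 0 n) /\ (Dn <= i)%nat /\ (i + Dn < n)%nat /\ ~ bad2 i /\
     forall dd, (dd <= 2 * Dn)%nat -> ~ low (i + dd - Dn)%nat).
  (* Without a good index the grid would be covered by its two ends, the cusp indices and the
     translates of the low indices, which together are too few. *)
  { apply NNPP. intro N.
    assert (INC : incl (seq 0 n) (seq 0 Dn ++ seq (n - Dn) Dn ++ B2 ++
       flat_map (fun dd => map (fun l => (l + Dn - dd)%nat) Lo) (seq 0 (2 * Dn + 1)))).
    { intros i Hi. rewrite !in_app_iff.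
      destruct (Nat.lt_ge_cases i Dn) as [h1|h1]; [left; apply in_seq; lia|right].
      pose proof Hi as Hi'. apply in_seq in Hi'.
      destruct (Nat.lt_ge_cases (i + Dn) n) as [h2|h2]; [right|left; apply in_seq; lia].
      destruct (classic (bad2 i)) as [h3|h3].
      { left. apply filter_In. split; auto. now apply bdec_true. }
      right. apply NNPP. intro N'. apply N. exists i. repeat split; auto.
      intros dd Hdd h4. apply N'. apply in_flat_map. exists dd. split; [apply in_seq; lia|].
      apply in_map_iff. exists (i + dd - Dn)%nat. split; [lia|].
      apply filter_In. split; [apply in_seq; lia|now apply bdec_true]. }
    apply NoDup_incl_length in INC; [|apply seq_NoDup].
    rewrite !length_app, !length_seq, (length_flat_map_const _ _ (length Lo)), length_seq in INC
      by (intro; apply length_map).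
    apply le_INR in INC. rewrite !plus_INR, mult_INR, plus_INR, mult_INR in INC. simpl INR in INC.
    nra. }
  destruct G as (i & Hi & i1 & i2 & i3 & i4).
  exists t, (y i). repeat split; auto.
  - unfold bad2 in i3. now apply NNPP.
  - intros j Hj. specialize (i4 (Z.to_nat (j + Z.of_nat Dn)) ltac:(lia)).
    unfold low in i4. apply Rnot_lt_le in i4.
    replace (mmul (mat_h (IZR j / INR m)) (y i)) with (y (i + Z.to_nat (j + Z.of_nat Dn) - Dn)%nat); auto.
    unfold y at 2. rewrite mat_h_s by (apply Rinv_neq_0_compat; lra). unfold y. do 3 f_equal.
    rewrite minus_INR, plus_INR by lia. rewrite (INR_IZR_INZ (Z.to_nat _)), Z2Nat.id by lia.
    rewrite plus_IZR, <- INR_IZR_INZ. field. split; lra.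
Qed.

Lemma nat_above (x : R) : exists n : nat, (1 <= n)%nat /\ x <= INR n.
Proof.
  destruct (INR_unbounded x) as [n Hn]. exists (S n). split; [lia|]. rewrite S_INR. lra.
Qed.

Lemma Rabs_mul_le a b A B : Rabs a <= A -> Rabs b <= B -> Rabs (a * b) <= A * B.
Proof.
  intros. rewrite Rabs_mult. apply Rmult_le_compat; auto using Rabs_pos.
Qed.

(* y has a vector u with first coordinate a in (al, ep]. Shears by T^n make the first row of y M0 T^n run through (a, s) with s in steps of lambda a, and (a, s) M is close to s times the second row of M; such multiples approximate every row. *)
Lemma connect q (hq : (3 <= q)%nat) C e : 1 <= C -> 0 < e <= 1 / 16 ->
  exists al be (m Dn : nat), 0 < al /\ 0 < be /\ (1 <= m)%nat /\ 3 * al * (2 * be + al) <= 1 / 4 /\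
  forall y z, det y = 1 -> boxfree q y al be -> det z = 1 -> mbd z C ->
  exists (j : Z) M k, (- Z.of_nat Dn <= j <= Z.of_nat Dn)%Z /\ inHecke q M /\ det k = 1 /\ close k e /\
    mmul k z = mmul (mmul (mat_h (IZR j / INR m)) y) M.
Proof.
  intros HC He. pose proof (lam_bounds q hq) as Hl. pose proof (Cq_ge q hq) as HCq.
  set (r := e / (32 * C)).
  assert (Hr : 0 < r) by (apply Rdiv_lt_0_compat; lra).
  assert (HrC : r * C = e / 32) by (unfold r; field; lra). clearbody r.
  destruct (row_dense_unif q hq C r Hr) as [D [HD RD]].
  set (ep := r / (3 * D)).
  assert (Hep : 0 < ep) by (apply Rdiv_lt_0_compat; lra).
  assert (HepD : 3 * ep * D = r) by (unfold ep; field; lra). clearbody ep.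
  (* A short vector of the lattice stretched by [rho] has, before stretching, first coordinate at
     most [Cq / rho = ep] and second coordinate at most [Cq * rho = be]. *)
  set (rho := Cq q / ep).
  assert (Hrho : 0 < rho) by (apply Rdiv_lt_0_compat; lra).
  assert (Hrho' : rho * ep = Cq q) by (unfold rho; field; lra). clearbody rho.
  set (be := Cq q * rho).
  assert (Hbe : 0 < be) by (apply Rmult_lt_0_compat; lra).
  (* Small enough for the cusp budget [1/4]; [boxfree] with this [al] keeps the vector found from
     being almost vertical. *)
  set (al := / (12 * (2 * be + 1))).
  assert (Hal : 0 < al) by (apply inv_pos; lra).
  assert (Hal' : 12 * al * (2 * be + 1) = 1) by (unfold al; field; lra). 
  assert (Hal1 : al <= 1) by nra. clearbody al.
  destruct (nat_above (8 / e)) as [m [Hm1 Hm]].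
  (* Bounds the shear [ta + sg] that is left over in the end; [Dn] measures it in steps of [1/m]. *)
  set (Rt := 4 * C * D / al + be / al).
  destruct (nat_above (INR m * Rt + 1)) as [Dn [_ HDn]].
  exists al, be, m, Dn. split; auto. split; auto. split; auto. split; [nra|].
  intros y z Dy BF Dz (z1 & z2 & z3 & z4).
  destruct (RD (m11 z) (m12 z) z1 z2) as [M [s (HM & (M1 & M2 & M3 & M4) & Hs & R1 & R2)]].
  assert (exists M0, inHecke q M0 /\ al < zx y (mapp M0 e1) <= ep /\ Rabs (snd (mapp y (mapp M0 e1))) <= be)
    as [M0 (HM0 & Ha & Hsn)].
  { destruct (short_vec q hq (mmul (mat_s rho) (mmul (mat_h 0) y))) as [N [HN [N1 N2]]].
    { rewrite det_sh; lra. }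
    set (v := mapp N e1) in *.
    assert (Hv : inLambda q v) by now apply Lam_mapp_e1.
    assert (A1 : Rabs (rho * zx y v) <= Cq q).
    { rewrite <- (zx_sh rho 0 y v). unfold zx. apply sq_le_abs; [|lra]. unfold nrm2 in N2.
      pose proof (pow2_ge_0 (snd (mapp (mmul (mat_s rho) (mmul (mat_h 0) y)) v))). lra. }
    assert (A2 : Rabs (/ rho * snd (mapp y v)) <= Cq q).
    { replace (/ rho * snd (mapp y v)) with (snd (mapp (mmul (mat_s rho) (mmul (mat_h 0) y)) v)).
      2: { rewrite snd_sh. f_equal. ring. }
      apply sq_le_abs; [|lra]. unfold nrm2 in N2.
      pose proof (pow2_ge_0 (fst (mapp (mmul (mat_s rho) (mmul (mat_h 0) y)) v))). lra. }
    assert (B1 : Rabs (zx y v) <= ep).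
    { rewrite Rabs_mult, (Rabs_right rho) in A1 by lra. apply (Rmult_le_reg_l rho); lra. }
    assert (B2 : Rabs (snd (mapp y v)) <= be).
    { rewrite Rabs_mult, (Rabs_right (/ rho)) in A2 by (left; now apply inv_pos).
      apply (Rmult_le_compat_l rho) in A2; [|lra].
      rewrite <- Rmult_assoc, Rinv_r, Rmult_1_l in A2 by lra. unfold be. lra. }
    assert (B3 : al < Rabs (zx y v)).
    { apply Rnot_le_lt. intro. apply (BF v Hv). auto. }
    destruct (Rlt_le_dec 0 (zx y v)) as [h|h].
    - exists N. rewrite Rabs_right in B1, B3 by lra. auto.
    - exists (mmul N (mmul mat_S mat_S)). 
      assert (E : mapp (mmul N (mmul mat_S mat_S)) e1 = vneg v).
      { unfold v. rewrite mapp_mmul, <- mapp_vneg. f_equal.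
        unfold mapp, mmul, mat_S, vneg, e1; simpl; f_equal; ring. }
      rewrite E, zx_vneg, snd_vneg, Rabs_Ropp. rewrite Rabs_left1 in B1, B3 by lra.
      split; auto. apply hecke_mmul; auto. apply hecke_mmul; apply hecke_gS. }
  pose proof (hecke_det q M0 HM0) as DM0. pose proof (hecke_det q M HM) as DM.
  set (Y := mmul y M0).
  assert (DY : det Y = 1) by (unfold Y; rewrite det_mmul, Dy, DM0; ring).
  assert (Y1 : zx y (mapp M0 e1) = m11 Y).
  { unfold zx, Y. rewrite <- mapp_mmul, fst_mapp. unfold e1; simpl; ring. }
  assert (Y2 : snd (mapp y (mapp M0 e1)) = m21 Y).
  { unfold Y. rewrite <- mapp_mmul, snd_mapp. unfold e1; simpl; ring. }
  rewrite Y1 in Ha. rewrite Y2 in Hsn.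
  set (a := m11 Y) in *. set (sg := m21 Y / a).
  destruct (zshift (lambda_q q * a) (m12 Y) s ltac:(nra)) as [n Hn].
  set (s' := m12 Y + IZR n * (lambda_q q * a)) in *.
  set (G := mmul (mat_g a s') M).
  assert (EG : G = mmul (mmul (mat_h sg) Y) (mmul (mat_Tn q n) M)).
  { unfold G. rewrite mmul_assoc. f_equal.
    assert (EY := iwasawa Y DY ltac:(fold a; lra)). fold a sg in EY.
    rewrite EY. unfold mmul, mat_g, mat_Tn, s'; simpl. f_equal; ring. }
  assert (DG : det G = 1).
  { unfold G. rewrite det_mmul, det_g, DM by lra. ring. }
  assert (G1 : Rabs (m11 G - m11 z) <= 2 * r).
  { replace (m11 G - m11 z) with (a * m11 M + (s' - s) * m21 M + (s * m21 M - m11 z))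
      by (unfold G, mmul, mat_g; simpl; ring).
    assert (Rabs (a * m11 M) <= ep * D) by (apply Rabs_mul_le; auto; rewrite Rabs_right; lra).
    assert (Rabs ((s' - s) * m21 M) <= (2 * ep) * D).
    { apply Rabs_mul_le; auto. rewrite Rabs_right; nra. }
    eapply Rle_trans; [apply Rabs_triang|]. 
    pose proof (Rabs_triang (a * m11 M) ((s' - s) * m21 M)). lra. }
  assert (G2 : Rabs (m12 G - m12 z) <= 2 * r).
  { replace (m12 G - m12 z) with (a * m12 M + (s' - s) * m22 M + (s * m22 M - m12 z))
      by (unfold G, mmul, mat_g; simpl; ring).
    assert (Rabs (a * m12 M) <= ep * D) by (apply Rabs_mul_le; auto; rewrite Rabs_right; lra).
    assert (Rabs ((s' - s) * m22 M) <= (2 * ep) * D).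
    { apply Rabs_mul_le; auto. rewrite Rabs_right; nra. }
    eapply Rle_trans; [apply Rabs_triang|]. 
    pose proof (Rabs_triang (a * m12 M) ((s' - s) * m22 M)). lra. }
  assert (Ia : 0 < / a <= / al).
  { split; [apply inv_pos; lra|apply Rinv_le_contravar; lra]. }
  assert (G3 : Rabs (m21 G) <= D / al).
  { replace (m21 G) with (m21 M * / a) by (unfold G, mmul, mat_g; simpl; ring).
    apply Rabs_mul_le; auto. rewrite Rabs_right; lra. }
  assert (G4 : Rabs (m22 G) <= D / al).
  { replace (m22 G) with (m22 M * / a) by (unfold G, mmul, mat_g; simpl; ring).
    apply Rabs_mul_le; auto. rewrite Rabs_right; lra. }
  (* Only the first rows of [G] and [z] are close. Hence the first row of [P] is close to [(1, 0)],
     and [P] is close to the identity up to a lower shear by [ta], which the horocycle absorbs after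
     rounding to a multiple of [1/m]. *)
  set (P := mmul G (minv z)).
  assert (DP : det P = 1) by (unfold P; rewrite det_mmul, det_minv, DG, Dz; ring).
  assert (P1 : Rabs (m11 P - 1) <= e / 8).
  { replace (m11 P - 1) with ((m11 G - m11 z) * m22 z + (m12 G - m12 z) * - m21 z).
    2: { unfold det in Dz. unfold P, mmul, minv; simpl. lra. }
    eapply Rle_trans; [apply Rabs_triang|].
    assert (Rabs ((m11 G - m11 z) * m22 z) <= (2 * r) * C) by (apply Rabs_mul_le; auto).
    assert (Rabs ((m12 G - m12 z) * - m21 z) <= (2 * r) * C) by (apply Rabs_mul_le; rewrite ?Rabs_Ropp; auto).
    lra. }
  assert (P2 : Rabs (m12 P) <= e / 8).
  { replace (m12 P) with ((m11 G - m11 z) * - m12 z + (m12 G - m12 z) * m11 z).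
    2: { unfold P, mmul, minv; simpl. ring. }
    eapply Rle_trans; [apply Rabs_triang|].
    assert (Rabs ((m11 G - m11 z) * - m12 z) <= (2 * r) * C) by (apply Rabs_mul_le; rewrite ?Rabs_Ropp; auto).
    assert (Rabs ((m12 G - m12 z) * m11 z) <= (2 * r) * C) by (apply Rabs_mul_le; auto).
    lra. }
  assert (P3 : Rabs (m21 P) <= 2 * (D / al * C)).
  { replace (m21 P) with (m21 G * m22 z + m22 G * - m21 z).
    2: { unfold P, mmul, minv; simpl. ring. }
    eapply Rle_trans; [apply Rabs_triang|].
    assert (Rabs (m21 G * m22 z) <= (D / al) * C) by (apply Rabs_mul_le; auto).
    assert (Rabs (m22 G * - m21 z) <= (D / al) * C) by (apply Rabs_mul_le; rewrite ?Rabs_Ropp; auto).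
    lra. }
  apply Rabs_le_iff in P1. apply Rabs_le_iff in P2.
  set (ta := m21 P / m11 P).
  assert (Hta : Rabs ta <= 4 * C * D / al).
  { unfold ta, Rdiv. rewrite Rabs_mult, Rabs_inv, (Rabs_right (m11 P)) by lra.
    apply (Rmult_le_reg_r (m11 P)); [lra|]. rewrite Rmult_assoc, Rinv_l, Rmult_1_r by lra.
    eapply Rle_trans; [apply P3|].
    replace (2 * (D / al * C)) with (4 * C * D * / al * (1 / 2)) by (field; lra).
    apply Rmult_le_compat_l; [|lra]. 
    assert (0 < / al) by now apply inv_pos. repeat apply Rmult_le_pos; lra. }
  assert (Hsg : Rabs sg <= be / al).
  { unfold sg, Rdiv. apply Rabs_mul_le; auto. rewrite Rabs_right; lra. }
  assert (Hm' : 1 <= INR m) by (replace 1 with (INR 1) by reflexivity; now apply le_INR).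
  destruct (zshift 1 (- (INR m * (ta + sg))) 0 ltac:(lra)) as [j Hj]. rewrite Rmult_1_r in Hj.
  set (et := IZR j / INR m - (ta + sg)).
  assert (Het : 0 <= et <= e / 8).
  { assert (E : et * INR m = IZR j - INR m * (ta + sg)) by (unfold et; field; lra).
    assert (e / 8 * INR m >= 1).
    { apply Rle_ge. apply (Rmult_le_compat_l (e / 8)) in Hm; [|lra].
      replace (e / 8 * (8 / e)) with 1 in Hm by (field; lra). lra. }
    split; apply (Rmult_le_reg_r (INR m)); try lra. }
  set (k := mmul (mat_h (ta + et)) P).
  exists j, (mmul M0 (mmul (mat_Tn q n) M)), k.
  split; [|split; [|split; [|split]]].
  - assert (Rabs (INR m * (ta + sg)) <= INR m * Rt).
    { apply Rabs_mul_le; [rewrite Rabs_right; lra|]. unfold Rt.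
      eapply Rle_trans; [apply Rabs_triang|]. lra. }
    apply Rabs_le_iff in H. rewrite (INR_IZR_INZ Dn) in HDn.
    split; apply le_IZR; rewrite ?opp_IZR; lra.
  - apply hecke_mmul; auto. apply hecke_mmul; auto using hecke_Tn.
  - unfold k. now rewrite det_h.
  - assert (K := shear_entries P et DP ltac:(lra)). fold ta k in K.
    destruct K as (K3 & K4 & K1 & K2).
    assert (1 - e / 4 <= / m11 P <= 1 + e / 4).
    { split.
      - apply (Rmult_le_reg_r (m11 P)); [lra|]. rewrite Rinv_l by lra. nra.
      - apply (Rmult_le_reg_r (m11 P)); [lra|]. rewrite Rinv_l by lra. nra. }
    unfold close. rewrite K1, K2, K3, K4. repeat split; apply Rabs_le; split; nra.
  - unfold k. rewrite <- mmul_assoc. unfold P. rewrite <- (mmul_assoc G), minv_l, mmul_id_r by auto.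
    rewrite EG. unfold Y. rewrite <- !mmul_assoc. 
    replace (IZR j / INR m) with (ta + et + sg) by (unfold et; ring).
    rewrite !mmul_assoc. do 4 f_equal. unfold mmul, mat_h; simpl; f_equal; ring.
Qed.

(** The segment from [good_point] passes near every point of the compact set modulo the group.
    Equicontinuity carries the lower bound over, at a scale large enough for its error term
    [1/t^2]. *)
Lemma lower_uniform q (hq : (3 <= q)%nat) g d L c : adm q g d L -> 0 <= c ->
  limsup_le q g c -> limsup_ge q g c ->
  forall C e, 1 <= C -> 0 < e -> exists t, 1 <= t /\
    forall z, det z = 1 -> mbd z C -> c - 2 * e <= Phi q g t z.
Proof.
  intros H Hc HU HL C e HC He.
  destruct (Phi_equi q hq g d L H) as [Ce [HCe EQ]].
  set (e' := Rmin (1 / 16) (e / (2 * Ce))).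
  assert (He' : 0 < e' <= 1 / 16).
  { split; [apply Rmin_pos; [lra|apply Rdiv_lt_0_compat; lra]|apply Rmin_l]. }
  assert (HCe' : Ce * e' <= e / 2).
  { apply Rle_trans with (Ce * (e / (2 * Ce))).
    - apply Rmult_le_compat_l; [lra|apply Rmin_r].
    - right. field. lra. }
  destruct (connect q hq C e' HC He') as (al & be & m & Dn & h1 & h2 & h3 & h4 & CN).
  destruct (good_point q hq g d L c H Hc HU HL e m Dn al be He h3 h1 h2 h4 (1 + 2 * Ce / e))
    as (t & y & Ht & Ht1 & Dy & BF & GP).
  assert (P2 : 0 < 2 * Ce / e) by (apply Rdiv_lt_0_compat; lra).
  exists t. split; auto. intros z Dz Hz.
  destruct (CN y z Dy BF Dz Hz) as (j & M & k & Hj & HM & Dk & Kc & E).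
  pose proof (EQ e' t k z (proj2 He') Ht1 Dz Dk Kc) as Q.
  rewrite E in Q. rewrite (Phi_gam q hq g d L) in Q; auto; try lra.
  2: { now rewrite det_h. }
  pose proof (GP j Hj) as GPj. apply Rabs_le_iff in Q.
  assert (Ce * / t ^ 2 <= e / 2).
  { assert (t <= t ^ 2) by nra. apply (Rmult_le_reg_r (t ^ 2)); [lra|].
    rewrite Rmult_assoc, Rinv_l by lra.
    assert (2 * Ce / e <= t ^ 2) by lra.
    apply (Rmult_le_compat_l (e / 2)) in H1; [|lra].
    replace (e / 2 * (2 * Ce / e)) with Ce in H1 by (field; lra). lra. }
  lra.
Qed.

(** The upper bound is the choice of [c]. For the lower bound the scale [t0] of the compact estimate
    stays fixed while [t = t0 k] grows: [Phi] at scale [t] averages [Phi] at scale [t0] over about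
    [k^2] points of a horocycle, and only a small share of these lies in the cusp, where 0 serves as
    lower bound. *)
Theorem equidistribution q (hq : (3 <= q)%nat) g d L : adm q g d L ->
  exists c, 0 <= c /\ forall z, det z = 1 -> forall e, 0 < e -> exists T, forall t, T <= t ->
    Rabs (Phi q g t z - c) <= e.
Proof.
  intro H. destruct (limsup_ex q hq g d L H) as (c & Hc & HU & HL).
  exists c. split; auto. intros z Dz e He.
  destruct (boxfree_ex q hq z Dz) as [dl [Hdl BF]].
  destruct (HU e dl He Hdl) as [T1 HT1].
  set (ep := Rmin 1 e / 10).
  assert (Hep : 0 < ep /\ ep <= 1 / 10 /\ 10 * ep <= e).
  { unfold ep. pose proof (Rmin_l 1 e); pose proof (Rmin_r 1 e). assert (0 < Rmin 1 e) by (apply Rmin_pos; lra). lra. }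
  clearbody ep. destruct Hep as (Hep & Hep1 & Hep2).
  set (d0 := ep / 3).
  assert (Hd0 : 0 < d0) by (unfold d0; lra).
  assert (Hd0' : 9 * d0 ^ 2 <= ep) by (unfold d0; nra).
  pose proof (Cq_ge q hq) as HCq.
  assert (Hid : 0 < / d0 ^ 2) by (apply inv_pos; nra).
  destruct (lower_uniform q hq g d L c H Hc HU HL (Cq q + / d0 ^ 2) ep ltac:(lra) Hep) as [t0 [Ht0 LU]].
  assert (LU' : forall y, det y = 1 -> boxfree q y d0 d0 -> c - 2 * ep <= Phi q g t0 y).
  { intros y Dy By. destruct (reduction q hq y d0 Dy Hd0 By) as [M [HM MB]].
    rewrite <- (Phi_gam q hq g d L y t0 M H ltac:(lra) Dy HM). apply LU; auto.
    rewrite det_mmul, Dy, (hecke_det q M HM). ring. }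
  destruct (excursions q hq dl d0 d0 Hdl Hd0 Hd0) as [k0 [Hk0 EX]].
  exists (Rmax T1 (t0 * (k0 + / ep))). intros t Ht.
  assert (Hie : 0 < / ep) by now apply inv_pos.
  assert (Ht1 : T1 <= t) by (eapply Rle_trans; [apply Rmax_l|apply Ht]).
  assert (Ht2 : t0 * (k0 + / ep) <= t) by (eapply Rle_trans; [apply Rmax_r|apply Ht]).
  assert (t1 : 1 <= t) by nra.
  apply Rabs_le. split; [|pose proof (HT1 t z Ht1 t1 Dz BF); lra].
  pose proof (Phi_rng q hq g d L z t H t1 Dz) as PR.
  destruct (Rle_lt_dec (c - 2 * ep) 0) as [hc|hc]; [lra|].
  set (k := t / t0).
  assert (Ek : t0 * k = t) by (unfold k; field; lra).
  assert (Hk : k0 + / ep <= k) by (apply (Rmult_le_reg_l t0); lra).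
  clearbody k. assert (Hk1 : 1 <= k) by lra. assert (Hk2 : k <= k ^ 2) by nra.
  (* Here [k] is real, so the last incomplete window is dropped, which is harmless for a lower
     bound. *)
  assert (exists n : nat, k ^ 2 - 1 <= INR n <= k ^ 2) as [n [Hn1 Hn2]].
  { apply nat_floor. lra. }
  set (y := fun i : nat => mmul (mat_s (/ k)) (mmul (mat_h (INR i / (INR 1 * k ^ 2))) z)).
  assert (Dy : forall i, det (y i) = 1).
  { intro i. unfold y. rewrite det_sh; auto. apply Rinv_neq_0_compat. lra. }
  assert (S1 : Sm (seq 0 n) (fun i => Phi q g t0 (y i)) <= k ^ 2 * Phi q g t z).
  { rewrite (Sm_ext _ _ (fun i => / t0 ^ 2 * W q g z t (0 + INR i * / k ^ 2) (0 + INR i * / k ^ 2 + / k ^ 2))).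
    2: { intros i _. unfold y. rewrite (Phi_sh q hq g d L) by (auto; try lra; apply inv_pos; lra).
      replace (t0 / / k) with t by (rewrite <- Ek; field; lra).
      replace (INR i / (INR 1 * k ^ 2)) with (0 + INR i * / k ^ 2) by (simpl; field; lra).
      replace ((/ k) ^ 2) with (/ k ^ 2) by (field; lra). unfold Rdiv. ring. }
    assert (Hik : 0 < / k ^ 2) by (apply inv_pos; lra).
    rewrite Sm_scal, (W_tele q hq g d L) by (auto; lra).
    apply Rle_trans with (/ t0 ^ 2 * W q g z t 0 1).
    - apply Rmult_le_compat_l; [left; apply inv_pos; nra|].
      apply (W_mono q hq g d L); auto; try lra.
      apply (Rmult_le_compat_r (/ k ^ 2)) in Hn2; [|lra]. rewrite Rinv_r in Hn2 by lra. lra.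
    - right. unfold Phi. rewrite <- Ek. field. split; lra. }
  set (bad := fun i => ~ boxfree q (y i) d0 d0).
  assert (N1 : Sm (seq 0 n) (fun i => if bdec (bad i) then 1 else 0) <= ep * k ^ 2).
  { rewrite filter_count. eapply Rle_trans.
    - apply (EX k z 1%nat); auto; try lra.
      + apply NoDup_filter, seq_NoDup.
      + intros i Hi. apply filter_In in Hi. destruct Hi as [i1 i2]. apply bdecT in i2. split; auto.
        apply in_seq in i1. rewrite Rmult_1_l. apply Rle_trans with (INR n); auto. apply le_INR; lia.
    - simpl INR. nra. }
  assert (S2 : Sm (seq 0 n) (fun i => (c - 2 * ep) * (1 - (if bdec (bad i) then 1 else 0))) <=
    Sm (seq 0 n) (fun i => Phi q g t0 (y i))).
  { apply Sm_le. intros i _. destruct (bdec (bad i)) eqn:F.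
    - pose proof (Phi_rng q hq g d L (y i) t0 H Ht0 (Dy i)). lra.
    - apply bdecF in F. unfold bad in F. apply NNPP in F. specialize (LU' (y i) (Dy i) F). lra. }
  rewrite Sm_scal, Sm_minus, Sm_const, length_seq in S2.
  assert (c <= 2 + 2 * ep).
  { destruct (Rle_lt_dec c (2 + 2 * ep)); auto. exfalso.
    destruct (HL ep Hep) as [d3 [_ HL3]]. destruct (HL3 1) as (t3 & z3 & a1 & a2 & a3 & a4).
    pose proof (Phi_rng q hq g d L z3 t3 H a1 a2). lra. }
  assert (P1 : (c - 2 * ep) * (k ^ 2 - 1 - ep * k ^ 2) <= k ^ 2 * Phi q g t z).
  { eapply Rle_trans; [|apply S1]. eapply Rle_trans; [|apply S2]. apply Rmult_le_compat_l; lra. }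
  assert (I1 : 1 <= ep * k ^ 2).
  { assert (/ ep <= k ^ 2) by lra. apply (Rmult_le_compat_l ep) in H1; [|lra].
    rewrite Rinv_r in H1 by lra. lra. }
  apply (Rmult_le_reg_l (k ^ 2)); [lra|].
  assert ((c - 2 * ep) * (1 + ep * k ^ 2) <= 2 * (2 * ep * k ^ 2)).
  { apply Rmult_le_compat; lra. }
  assert (0 <= k ^ 2 * (e - 10 * ep)) by (apply Rmult_le_pos; lra).
  assert (0 <= ep * k ^ 2) by lra. nra.
Qed.

(** * From weighted counts to counts in an interval *)

Definition enumv q (A : mat) (I : R -> Prop) (tau : R) (l : list (R * R)) : Prop :=
  NoDup l /\ forall v, In v l <-> inLambda q v /\ 0 < zx A v <= tau /\ I (zsl A v).

(** Leaves the endpoints undecided, so that open, closed and half-open intervals are treated at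
    once. *)
Definition itv (I : R -> Prop) (alpha beta : R) : Prop :=
  (forall x, alpha < x < beta -> I x) /\ (forall x, I x -> alpha <= x <= beta).

(** The window [[al, be)] of [A] is the unit window of a sheared and rescaled point with
    [r^2 = be - al]; the a priori count bounds [c] by 1. *)
Lemma W_limit q (hq : (3 <= q)%nat) g d L : adm q g d L ->
  exists c, 0 <= c <= 1 /\ forall A al be e, det A = 1 -> al < be -> 0 < e ->
    exists T, forall t, T <= t -> 0 < t -> Rabs (W q g A t al be / t ^ 2 - (be - al) * c) <= e.
Proof.
  intro H. destruct (equidistribution q hq g d L H) as [c [Hc EQ]].
  assert (G : forall A al be e, det A = 1 -> al < be -> 0 < e ->
    exists T, forall t, T <= t -> 0 < t -> Rabs (W q g A t al be / t ^ 2 - (be - al) * c) <= e).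
  { intros A al be e D Hab He.
    set (r := sqrt (be - al)).
    assert (Hr : 0 < r) by (apply sqrt_lt_R0; lra).
    assert (Hr2 : r ^ 2 = be - al) by (unfold r; simpl; rewrite Rmult_1_r; apply sqrt_sqrt; lra).
    clearbody r.
    set (z := mmul (mat_s r) (mmul (mat_h al) A)).
    destruct (EQ z) with (e := e / (be - al)) as [T HT].
    { unfold z; rewrite det_sh; lra. }
    { apply Rdiv_lt_0_compat; lra. }
    exists (T / r). intros t Ht Ht0.
    assert (Ht' : T <= r * t).
    { apply (Rmult_le_compat_l r) in Ht; [|lra]. replace (r * (T / r)) with T in Ht by (field; lra). auto. }
    specialize (HT (r * t) Ht'). unfold z in HT. 
    rewrite (Phi_sh q hq g d L) in HT; auto; [|nra].
    replace (r * t / r) with t in HT by (field; lra).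
    replace (al + r ^ 2) with be in HT by lra.
    replace ((r * t) ^ 2) with ((be - al) * t ^ 2) in HT by (rewrite <- Hr2; ring).
    replace (W q g A t al be / t ^ 2 - (be - al) * c) with
      ((be - al) * (W q g A t al be / ((be - al) * t ^ 2) - c)) by (field; split; lra).
    rewrite Rabs_mult, Rabs_right by lra.
    apply (Rmult_le_compat_l (be - al)) in HT; [|lra].
    replace ((be - al) * (e / (be - al))) with e in HT by (field; lra). auto. }
  exists c. split; auto. split; auto. apply Rnot_lt_le. intro h.
  destruct (G mat_id 0 1 ((c - 1) / 2)) as [T HT]; try lra.
  { unfold det, mat_id; simpl; ring. }
  set (t := Rmax T (1 + 2 / (c - 1))).
  assert (P2 : 0 < 2 / (c - 1)) by (apply Rdiv_lt_0_compat; lra).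
  assert (Ht : 1 + 2 / (c - 1) <= t) by apply Rmax_r.
  specialize (HT t (Rmax_l _ _) ltac:(lra)). apply Rabs_le_iff in HT.
  pose proof (W_bound q hq g d L mat_id t 0 1 H ltac:(lra) ltac:(unfold det, mat_id; simpl; ring) ltac:(lra)) as B.
  assert (t <= t ^ 2) by nra.
  apply (Rmult_le_compat_r (/ t ^ 2)) in B; [|left; apply inv_pos; lra].
  replace (((1 - 0) * t ^ 2 + 1) * / t ^ 2) with (1 + / t ^ 2) in B by (field; lra).
  unfold Rdiv in HT at 2 3.
  assert (/ t ^ 2 < (c - 1) / 2).
  { replace ((c - 1) / 2) with (/ (2 / (c - 1))) by (field; lra). apply Rinv_lt_contravar; [|lra].
    apply Rmult_lt_0_compat; lra. }
  unfold Rdiv in *. lra.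
Qed.

(** Only vectors whose slope is exactly an endpoint can be treated differently by the two sides, and
    each slope occurs at most once. *)
Lemma W_list q (hq : (3 <= q)%nat) g d L A I al be t l : adm q g d L -> det A = 1 -> 0 < t ->
  al < be -> itv I al be -> enumv q A I t l ->
  Rabs (W q g A t al be - Sm l (fun v => g (zx A v / t) (beta q A v))) <= 2.
Proof.
  intros H D Ht Hab [I1 I2] [ND Hl].
  destruct (Fw_supp q hq g d L A t al be H Ht D) as [l' [S [ND' Hl']]].
  unfold W. rewrite (fsum_eq _ _ S).
  set (F := fun v => g (zx A v / t) (beta q A v)).
  assert (E : Sm l F = Sm l' (fun v => if bdec (In v l) then F v else 0)).
  { rewrite <- (Sm_filter_if (fun v => bdec (In v l)) l' F).
    apply Sm_perm, NoDup_Permutation; auto using NoDup_filter.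
    intro v. rewrite filter_In, bdec_true. split; [|tauto]. intro Hv. split; auto.
    apply Hl in Hv. apply Hl'. destruct Hv as (?&?&h). apply I2 in h. auto. }
  rewrite E, <- Sm_minus.
  eapply Rle_trans; [apply Sm_Rabs|].
  apply Rle_trans with (Sm l' (fun v => (if bdec (zsl A v = al) then 1 else 0) + (if bdec (zsl A v = be) then 1 else 0))).
  - apply Sm_le. intros v Hv. apply Hl' in Hv. destruct Hv as (v1 & v2 & v3).
    pose proof (adm_rng _ _ _ _ H (zx A v / t) (beta q A v)) as R. fold (F v) in R.
    assert (R' : Rabs (Fw q g A t al be v - (if bdec (In v l) then F v else 0)) <= 1).
    { pose proof (Fw_rng q g d L A t al be v H). destruct (bdec (In v l)); apply Rabs_le; lra. }
    destruct (bdec (zsl A v = al)) eqn:E1; [destruct (bdec (zsl A v = be)); lra|].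
    destruct (bdec (zsl A v = be)) eqn:E2; [lra|].
    apply bdecF in E1. apply bdecF in E2.
    assert (al < zsl A v < be) by (split; apply Rnot_le_lt; intro; [apply E1|apply E2]; lra).
    unfold Fw. rewrite (proj2 (bdec_true _)) by (repeat split; auto; lra).
    rewrite (proj2 (bdec_true _)) by (apply Hl; repeat split; auto; lra).
    unfold F. rewrite Rminus_diag, Rabs_R0. lra.
  - rewrite Sm_plus.
    assert (C : forall s, al <= s <= be -> Sm l' (fun v => if bdec (zsl A v = s) then 1 else 0) <= 1).
    { intros s Hs. apply (Sm_indic_count l' (fun v => zsl A v = s)); auto.
      intros l'' ND'' H''. replace 1 with ((s - s) * t ^ 2 + 1) by ring.
      apply (count_slopes q hq A); auto; try lra.
      intros v Hv. destruct (H'' v Hv) as [h1 h2]. apply Hl' in h1. repeat split; try tauto; lra. }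
    pose proof (C al ltac:(lra)). pose proof (C be ltac:(lra)). lra.
Qed.

Lemma big_inv_sq (e : R) : 0 < e -> exists T, 1 <= T /\ forall t, T <= t -> / t ^ 2 <= e.
Proof.
  intro He. assert (0 < / e) by now apply inv_pos.
  exists (1 + / e). split; [lra|]. intros t Ht.
  rewrite <- (Rinv_inv e). apply Rinv_le_contravar; auto. nra.
Qed.

Lemma sum_limit q (hq : (3 <= q)%nat) g d L : adm q g d L ->
  exists c, 0 <= c <= 1 /\
  (forall A al be e, det A = 1 -> al < be -> 0 < e ->
    exists T, forall t, T <= t -> 0 < t -> Rabs (W q g A t al be / t ^ 2 - (be - al) * c) <= e) /\
  forall A I al be e, det A = 1 -> al < be -> itv I al be -> 0 < e ->
    exists T, 1 <= T /\ forall t l, T <= t -> enumv q A I t l ->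
      Rabs (Sm l (fun v => g (zx A v / t) (beta q A v)) / t ^ 2 - (be - al) * c) <= e.
Proof.
  intro H. destruct (W_limit q hq g d L H) as [c [Hc WL]].
  exists c. split; auto. split; auto. intros A I al be e D Hab HI He.
  destruct (WL A al be (e / 2) D Hab ltac:(lra)) as [T1 HT1].
  destruct (big_inv_sq (e / 4) ltac:(lra)) as [T2 [HT2 HT2']].
  exists (Rmax T1 T2). split; [eapply Rle_trans; [apply HT2|apply Rmax_r]|].
  intros t l Ht Hl.
  assert (h1 : T1 <= t) by (eapply Rle_trans; [apply Rmax_l|apply Ht]).
  assert (h2 : T2 <= t) by (eapply Rle_trans; [apply Rmax_r|apply Ht]).
  specialize (HT1 t h1 ltac:(lra)). specialize (HT2' t h2).
  pose proof (W_list q hq g d L A I al be t l H D ltac:(lra) Hab HI Hl) as WL'.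
  apply Rabs_le_iff in HT1. apply Rabs_le_iff in WL'.
  assert (P : 0 < / t ^ 2) by (apply inv_pos; nra).
  apply Rabs_le. unfold Rdiv in *. split; nra.
Qed.

(** * Lipschitz cutoffs *)

Definition clamp (x : R) : R := Rmax 0 (Rmin 1 x).

Lemma clamp_rng x : 0 <= clamp x <= 1.
Proof. unfold clamp, Rmax, Rmin. repeat destruct (Rle_dec _ _); lra. Qed.
Lemma clamp_lo x : x <= 0 -> clamp x = 0.
Proof. unfold clamp, Rmax, Rmin. repeat destruct (Rle_dec _ _); lra. Qed.
Lemma clamp_hi x : 1 <= x -> clamp x = 1.
Proof. unfold clamp, Rmax, Rmin. repeat destruct (Rle_dec _ _); lra. Qed.
Lemma clamp_lip x y : Rabs (clamp x - clamp y) <= Rabs (x - y).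
Proof.
  unfold clamp, Rmax, Rmin, Rabs. repeat destruct (Rle_dec _ _); repeat destruct (Rcase_abs _); lra.
Qed.

Definition tent (K a0 a1 a : R) : R := clamp (K * Rmin (a - a0) (a1 - a)).

Lemma tent_lip K a0 a1 a a' : 0 <= K -> Rabs (tent K a0 a1 a - tent K a0 a1 a') <= K * Rabs (a - a').
Proof.
  intro HK. eapply Rle_trans; [apply clamp_lip|].
  replace (K * Rmin (a - a0) (a1 - a) - K * Rmin (a' - a0) (a1 - a')) with
   (K * (Rmin (a - a0) (a1 - a) - Rmin (a' - a0) (a1 - a'))) by ring.
  rewrite Rabs_mult, (Rabs_right K) by lra. apply Rmult_le_compat_l; auto.
  unfold Rmin, Rabs. repeat destruct (Rle_dec _ _); repeat destruct (Rcase_abs _); lra.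
Qed.

Lemma tent_zero K a0 a1 a : 0 <= K -> a <= a0 \/ a1 <= a -> tent K a0 a1 a = 0.
Proof.
  intros HK H. apply clamp_lo.
  assert (Rmin (a - a0) (a1 - a) <= 0) by (unfold Rmin; destruct (Rle_dec _ _); lra). nra.
Qed.

Lemma tent_one K a0 a1 a : 0 < K -> a0 + / K <= a <= a1 - / K -> tent K a0 a1 a = 1.
Proof.
  intros HK H. apply clamp_hi. rewrite <- (Rinv_r K) by lra. apply Rmult_le_compat_l; [lra|].
  unfold Rmin; destruct (Rle_dec _ _); lra.
Qed.

(* lambda-periodic cutoff of an interval of length w < lambda centred at mid, Lipschitz without choosing representatives *)
Definition pcut (q : nat) (K mid w b : R) : R :=
  clamp (K * (cos (2 * PI * (b - mid) / lambda_q q) - cos (PI * w / lambda_q q))).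

Lemma cos_lip x y : Rabs (cos x - cos y) <= Rabs (x - y).
Proof.
  destruct (MVT_abs cos (fun x => - sin x) y x) as [c [Hc _]].
  { intros c _. apply derivable_pt_lim_cos. }
  rewrite Hc. rewrite <- (Rmult_1_l (Rabs (x - y))) at 2. apply Rmult_le_compat_r; [apply Rabs_pos|].
  rewrite Rabs_Ropp. apply Rabs_le. pose proof (SIN_bound c). lra.
Qed.

Lemma pcut_lip q (hq : (3 <= q)%nat) K mid w b b' : 0 <= K ->
  Rabs (pcut q K mid w b - pcut q K mid w b') <= (K * (2 * PI)) * Rabs (b - b').
Proof.
  intro HK. pose proof (lam_bounds q hq) as Hl. eapply Rle_trans; [apply clamp_lip|].
  set (x := 2 * PI * (b - mid) / lambda_q q). set (y := 2 * PI * (b' - mid) / lambda_q q).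
  replace (K * (cos x - cos (PI * w / lambda_q q)) - K * (cos y - cos (PI * w / lambda_q q)))
    with (K * (cos x - cos y)) by ring.
  rewrite Rabs_mult, (Rabs_right K) by lra. rewrite Rmult_assoc. apply Rmult_le_compat_l; auto.
  eapply Rle_trans; [apply cos_lip|]. 
  replace (x - y) with (2 * PI / lambda_q q * (b - b')) by (unfold x, y; field; lra).
  pose proof PI_RGT_0.
  assert (0 < / lambda_q q <= 1).
  { split; [apply inv_pos; lra|]. rewrite <- Rinv_1. apply Rinv_le_contravar; lra. }
  rewrite Rabs_mult, (Rabs_right (2 * PI / lambda_q q)).
  - apply Rmult_le_compat_r; [apply Rabs_pos|]. unfold Rdiv. nra.
  - apply Rle_ge. unfold Rdiv. apply Rmult_le_pos; lra.
Qed.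

Lemma pcut_per q (hq : (3 <= q)%nat) K mid w b : pcut q K mid w (b + lambda_q q) = pcut q K mid w b.
Proof.
  pose proof (lam_bounds q hq) as Hl. unfold pcut. do 3 f_equal.
  replace (2 * PI * (b + lambda_q q - mid) / lambda_q q) with
   (2 * PI * (b - mid) / lambda_q q + 2 * PI) by (field; lra).
  rewrite cos_plus, cos_2PI, sin_2PI. ring.
Qed.

Lemma cos_abs x : cos (Rabs x) = cos x.
Proof. unfold Rabs; destruct (Rcase_abs x); auto. apply cos_neg. Qed.

(** Once [b] is moved within half a period of [mid], the cosine decreases with the distance to
    [mid], so the clamped difference is positive only at distances below [w / 2]. *)
Lemma pcut_pos q (hq : (3 <= q)%nat) K mid w b : 0 < K -> 0 < w <= lambda_q q ->
  pcut q K mid w b <> 0 -> exists n : Z, Rabs (b + IZR n * lambda_q q - mid) < w / 2.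
Proof.
  intros HK Hw H. pose proof (lam_bounds q hq) as Hl. pose proof PI_RGT_0 as HP.
  destruct (zshift (lambda_q q) (b - mid) (- lambda_q q / 2) ltac:(lra)) as [n Hn].
  exists n. set (x := b + IZR n * lambda_q q - mid).
  assert (Hx : Rabs x <= lambda_q q / 2) by (apply Rabs_le; unfold x; lra).
  assert (E : pcut q K mid w (b + IZR n * lambda_q q) = pcut q K mid w b).
  { assert (K' : forall k b, pcut q K mid w (b + INR k * lambda_q q) = pcut q K mid w b).
    { induction k; intro b'.
      - simpl. f_equal; ring.
      - rewrite S_INR. replace (b' + (INR k + 1) * lambda_q q) with
         ((b' + INR k * lambda_q q) + lambda_q q) by ring. now rewrite pcut_per. }
    destruct (Z_le_gt_dec 0 n).
    - rewrite <- (Z2Nat.id n), <- INR_IZR_INZ by lia. apply K'.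
    - rewrite <- (K' (Z.to_nat (- n)) (b + IZR n * lambda_q q)).
      f_equal. rewrite INR_IZR_INZ, Z2Nat.id, opp_IZR by lia. ring. }
  rewrite <- E in H. apply Rnot_le_lt. intro h. apply H. apply clamp_lo.
  fold x. assert (cos (2 * PI * x / lambda_q q) <= cos (PI * w / lambda_q q)); [|nra].
  rewrite <- cos_abs. unfold Rdiv.
  assert (Il : 0 < / lambda_q q) by (apply inv_pos; lra).
  rewrite !Rabs_mult, (Rabs_right (/ _)), (Rabs_right PI), (Rabs_right 2) by lra.
  assert (B1 : PI * w * / lambda_q q <= 2 * PI * Rabs x * / lambda_q q).
  { apply Rmult_le_compat_r; [lra|]. nra. }
  assert (B2 : 2 * PI * Rabs x * / lambda_q q <= PI).
  { apply (Rmult_le_reg_r (lambda_q q)); [lra|]. rewrite Rmult_assoc, Rinv_l by lra. nra. }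
  assert (0 < PI * w) by nra.
  assert (0 <= PI * w * / lambda_q q) by nra.
  apply cos_decr_1; lra.
Qed.

Lemma pcut_one q (hq : (3 <= q)%nat) mid w e : 0 < e -> 2 * e < w -> w <= lambda_q q ->
  exists K, 0 < K /\ forall b, Rabs (b - mid) <= w / 2 - e -> pcut q K mid w b = 1.
Proof.
  intros He Hw Hw'. pose proof (lam_bounds q hq) as Hl. pose proof PI_RGT_0 as HP.
  assert (Il : 0 < / lambda_q q) by (apply inv_pos; lra).
  set (y := PI * w / lambda_q q). set (x := PI * (w - 2 * e) / lambda_q q).
  assert (Hxy : 0 <= x < y /\ y <= PI).
  { unfold x, y, Rdiv. repeat split.
    - apply Rmult_le_pos; [apply Rmult_le_pos|]; lra.
    - apply Rmult_lt_compat_r; [lra|]. apply Rmult_lt_compat_l; lra.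
    - apply (Rmult_le_reg_r (lambda_q q)); [lra|]. rewrite Rmult_assoc, Rinv_l by lra.
      rewrite Rmult_1_r. apply Rmult_le_compat_l; lra. }
  assert (Hc : cos y < cos x) by (apply cos_decreasing_1; lra).
  exists (/ (cos x - cos y)). split; [apply inv_pos; lra|].
  intros b Hb. apply clamp_hi. fold y.
  apply (Rmult_le_reg_l (cos x - cos y)); [lra|].
  rewrite <- Rmult_assoc, Rinv_r, Rmult_1_l, Rmult_1_r by lra.
  assert (cos x <= cos (2 * PI * (b - mid) / lambda_q q)); [|lra].
  rewrite <- (cos_abs (_ / _)). unfold Rdiv.
  rewrite !Rabs_mult, (Rabs_right (/ _)), (Rabs_right PI), (Rabs_right 2) by lra.
  pose proof (Rabs_pos (b - mid)).
  assert (2 * PI * Rabs (b - mid) * / lambda_q q <= x).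
  { unfold x, Rdiv. apply Rmult_le_compat_r; [lra|]. nra. }
  assert (0 <= 2 * PI * Rabs (b - mid) * / lambda_q q).
  { apply Rmult_le_pos; [|lra]. apply Rmult_le_pos; lra. }
  apply cos_decr_1; lra.
Qed.

Lemma adm_tent q K a0 a1 : 0 < K -> 0 < a0 < 1 -> a1 <= 1 -> adm q (fun a _ => tent K a0 a1 a) a0 K.
Proof.
  intros HK H0 H1. split; auto; try lra.
  - intros; apply clamp_rng.
  - intros. apply tent_zero; auto; lra.
  - intros. apply tent_zero; auto; lra.
  - intros. eapply Rle_trans; [apply tent_lip; lra|]. pose proof (Rabs_pos (b - b')). nra.
Qed.

Lemma adm_rect q (hq : (3 <= q)%nat) K a0 a1 K' mid w : 0 < K -> 0 < a0 < 1 -> a1 <= 1 -> 0 < K' ->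
  adm q (fun a b => tent K a0 a1 a * pcut q K' mid w b) a0 (K + K' * (2 * PI)).
Proof.
  intros HK H0 H1 HK'. pose proof PI_RGT_0.
  assert (0 < K' * (2 * PI)) by nra.
  split; auto; try lra.
  - intros a b. pose proof (clamp_rng (K * Rmin (a - a0) (a1 - a))) as R1.
    pose proof (clamp_rng (K' * (cos (2 * PI * (b - mid) / lambda_q q) - cos (PI * w / lambda_q q)))) as R2.
    fold (tent K a0 a1 a) in R1. fold (pcut q K' mid w b) in R2. nra.
  - intros. rewrite tent_zero; try lra; auto.
  - intros. rewrite tent_zero; try lra; auto.
  - intros.
    replace (tent K a0 a1 a * pcut q K' mid w b - tent K a0 a1 a' * pcut q K' mid w b') with
      ((tent K a0 a1 a - tent K a0 a1 a') * pcut q K' mid w b +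
       tent K a0 a1 a' * (pcut q K' mid w b - pcut q K' mid w b')) by ring.
    eapply Rle_trans; [apply Rabs_triang|].
    assert (Rabs ((tent K a0 a1 a - tent K a0 a1 a') * pcut q K' mid w b) <= (K * Rabs (a - a')) * 1).
    { apply Rabs_mul_le; [apply tent_lip; lra|]. apply Rabs_le.
      pose proof (clamp_rng (K' * (cos (2 * PI * (b - mid) / lambda_q q) - cos (PI * w / lambda_q q)))).
      unfold pcut; lra. }
    assert (Rabs (tent K a0 a1 a' * (pcut q K' mid w b - pcut q K' mid w b')) <= 1 * ((K' * (2 * PI)) * Rabs (b - b'))).
    { apply Rabs_mul_le; [|apply pcut_lip; auto; lra]. apply Rabs_le.
      pose proof (clamp_rng (K * Rmin (a' - a0) (a1 - a'))). unfold tent; lra. }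
    pose proof (Rabs_pos (a - a')); pose proof (Rabs_pos (b - b')). nra.
  - intros. now rewrite pcut_per.
Qed.

Lemma Sm_le_fsum {X} (l : list X) F : NoDup l -> fin F -> (forall x, 0 <= F x) -> Sm l F <= fsum F.
Proof.
  intros ND [l' Hl'] HF.
  assert (S : supp F (nodup eq_dec_cl (l ++ l'))).
  { destruct Hl' as [_ Hl']. split; [apply NoDup_nodup|]. intros x Hx. apply nodup_In, in_app_iff. auto. }
  rewrite (fsum_eq _ _ S). apply Sm_incl; auto.
  - apply NoDup_nodup.
  - intros; apply nodup_In, in_app_iff; auto.
Qed.

Lemma enumv_ex q (hq : (3 <= q)%nat) A I al be t : det A = 1 -> itv I al be -> 0 < t ->
  exists l, enumv q A I t l.
Proof.
  intros D [_ HI] Ht. destruct (enum_slopes q hq A t al be D Ht) as [l [ND Hl]].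
  exists (filter (fun v => bdec (I (zsl A v))) l). split; [now apply NoDup_filter|].
  intro v. rewrite filter_In, bdec_true, Hl. specialize (HI (zsl A v)). tauto.
Qed.

(* The density kappa comes out as a limit of the constants for the cutoffs that equal 1 on [2 eta, 1 - eta]. *)
Lemma kappa_ex q (hq : (3 <= q)%nat) : exists kap, 0 <= kap /\
  forall A I al be e, det A = 1 -> al < be -> itv I al be -> 0 < e ->
    exists T, 1 <= T /\ forall t l, T <= t -> enumv q A I t l ->
      Rabs (INR (length l) / t ^ 2 - (be - al) * kap) <= e.
Proof.
  assert (Step : forall eta, 0 < eta <= 1 / 8 -> exists c, 0 <= c <= 1 /\
    forall A I al be e, det A = 1 -> al < be -> itv I al be -> 0 < e ->
    exists T, 1 <= T /\ forall t l, T <= t -> enumv q A I t l ->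
      (be - al) * c - e <= INR (length l) / t ^ 2 <= (be - al) * (c + 10 * eta) + e).
  { intros eta Heta.
    assert (HK : 0 < / eta) by (apply inv_pos; lra).
    set (g := fun a (b : R) => tent (/ eta) eta 1 a).
    assert (Hg : adm q g eta (/ eta)) by (apply adm_tent; lra).
    destruct (sum_limit q hq g _ _ Hg) as (c & Hc & _ & SL).
    exists c. split; auto. intros A I al be e D Hab HI He.
    destruct (SL A I al be (e / 4) D Hab HI ltac:(lra)) as [T [HT1 HT]].
    destruct (big_inv_sq (e / 4) ltac:(lra)) as [T2 [HT2 HT2']].
    exists (Rmax T T2). split; [eapply Rle_trans; [apply HT1|apply Rmax_l]|].
    intros t l Ht [ND Hl].
    assert (h1 : T <= t) by (eapply Rle_trans; [apply Rmax_l|apply Ht]).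
    assert (h2 : T2 <= t) by (eapply Rle_trans; [apply Rmax_r|apply Ht]).
    assert (t1 : 1 <= t) by lra. assert (Pt : 0 < / t ^ 2) by (apply inv_pos; nra).
    specialize (HT2' t h2). split.
    - pose proof (HT t l h1 (conj ND Hl)) as Q. apply Rabs_le_iff in Q.
      assert (Sm l (fun v => g (zx A v / t) (beta q A v)) <= INR (length l)).
      { rewrite <- (Rmult_1_l (INR _)), <- (Sm_const l 1). apply Sm_le. intros; apply clamp_rng. }
      unfold Rdiv in *. nra.
    (* At the larger scale [t'] the cutoff equals 1 for [2 eta t' <= x <= (1 - eta) t'], and
       [(1 - eta)(1 + 2 eta) >= 1] makes this range reach [t]. The vectors with [x <= 2 eta t'] are
       few by [count_slopes]. *)
    - set (t' := (1 + 2 * eta) * t).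
      assert (tt' : t <= t') by (unfold t'; nra).
      destruct (enumv_ex q hq A I al be t' D HI ltac:(lra)) as [l' [ND' Hl']].
      pose proof (HT t' l' ltac:(lra) (conj ND' Hl')) as Q. apply Rabs_le_iff in Q.
      assert (B : INR (length l) <= Sm l' (fun v => g (zx A v / t') (beta q A v)) + ((be - al) * (2 * eta * t') ^ 2 + 1)).
      { apply Rle_trans with (Sm l (fun v => g (zx A v / t') (beta q A v) + (if bdec (zx A v <= 2 * eta * t') then 1 else 0))).
        - rewrite <- (Rmult_1_l (INR _)), <- (Sm_const l 1). apply Sm_le. intros v Hv.
          apply Hl in Hv. destruct Hv as (v1 & v2 & v3).
          destruct (bdec (zx A v <= 2 * eta * t')) eqn:E.
          + pose proof (clamp_rng (/ eta * Rmin (zx A v / t' - eta) (1 - zx A v / t'))).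
            unfold g, tent. lra.
          + apply bdecF in E. unfold g. rewrite tent_one; [lra|auto|].
            rewrite Rinv_inv. split.
            * apply (Rmult_le_reg_r t'); [lra|]. unfold Rdiv. rewrite Rmult_assoc, Rinv_l by lra. lra.
            * apply (Rmult_le_reg_r t'); [lra|]. unfold Rdiv. rewrite Rmult_assoc, Rinv_l by lra.
              unfold t'. assert (1 <= (1 - eta) * (1 + 2 * eta)) by nra. nra.
        - rewrite Sm_plus. apply Rplus_le_compat.
          + apply Sm_incl; auto.
            * intros v Hv. apply Hl in Hv. apply Hl'. repeat split; try tauto; lra.
            * intros; apply clamp_rng.
          + apply (Sm_indic_count l (fun v => zx A v <= 2 * eta * t')); auto.
            intros l'' ND'' H''. apply (count_slopes q hq A); auto; try lra.
            * apply Rmult_lt_0_compat; lra.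
            * intros v Hv. destruct (H'' v Hv) as [k1 k2]. apply Hl in k1.
              destruct k1 as (k1 & k3 & k4). apply (proj2 HI) in k4. repeat split; auto; lra. }
      apply (Rmult_le_reg_r (t ^ 2)); [nra|]. unfold Rdiv. rewrite Rmult_assoc, Rinv_l by nra.
      rewrite Rmult_1_r.
      assert (Q2 : Sm l' (fun v => g (zx A v / t') (beta q A v)) <= ((be - al) * c + e / 4) * t' ^ 2).
      { apply (Rmult_le_reg_r (/ t' ^ 2)); [apply inv_pos; nra|].
        rewrite (Rmult_assoc _ (t' ^ 2)), Rinv_r by nra. unfold Rdiv in Q. lra. }
      assert (E2 : t' ^ 2 = (1 + 4 * eta + 4 * eta ^ 2) * t ^ 2) by (unfold t'; ring).
      assert (E3 : (2 * eta * t') ^ 2 = 4 * eta ^ 2 * t' ^ 2) by ring.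
      rewrite E3, E2 in B. rewrite E2 in Q2.
      assert (T2' : 1 <= e / 4 * t ^ 2).
      { apply (Rmult_le_reg_r (/ t ^ 2)); auto. rewrite Rmult_assoc, Rinv_r by nra. lra. }
      set (s := t ^ 2) in *. assert (Hs : 1 <= s) by (unfold s; nra). clearbody s.
      assert (F1 : eta ^ 2 <= eta / 8) by nra.
      set (et2 := eta ^ 2) in *. assert (0 <= et2) by (unfold et2; nra). clearbody et2.
      assert (G1 : c * (1 + 4 * eta + 4 * et2) <= c + 5 * eta).
      { assert (c * (4 * eta + 4 * et2) <= 1 * (5 * eta)) by (apply Rmult_le_compat; lra). lra. }
      assert (G2 : 4 * et2 * (1 + 4 * eta + 4 * et2) <= 5 * eta) by nra.
      assert (G3 : e / 4 * (1 + 4 * eta + 4 * et2) <= e / 2) by nra.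
      assert (S1 : (be - al) * (c * (1 + 4 * eta + 4 * et2) + 4 * et2 * (1 + 4 * eta + 4 * et2)) <= (be - al) * (c + 10 * eta)).
      { apply Rmult_le_compat_l; lra. }
      assert (S2 : s * ((be - al) * (c * (1 + 4 * eta + 4 * et2) + 4 * et2 * (1 + 4 * eta + 4 * et2)) + e / 4 * (1 + 4 * eta + 4 * et2)) <= s * ((be - al) * (c + 10 * eta) + e / 2)).
      { apply Rmult_le_compat_l; lra. }
      nra. }
  (* The constants for different [eta] are comparable, since all of them estimate the same counts at
     the identity. Their supremum is kappa, which exceeds each of them by at most [10 eta]. *)
  set (Pc := fun eta c => 0 < eta <= 1 / 8 /\ 0 <= c <= 1 /\
    forall A I al be e, det A = 1 -> al < be -> itv I al be -> 0 < e ->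
    exists T, 1 <= T /\ forall t l, T <= t -> enumv q A I t l ->
      (be - al) * c - e <= INR (length l) / t ^ 2 <= (be - al) * (c + 10 * eta) + e).
  assert (Did : det mat_id = 1) by (unfold det, mat_id; simpl; ring).
  assert (Cmp : forall eta c eta' c', Pc eta c -> Pc eta' c' -> c <= c' + 10 * eta').
  { intros eta c eta' c' (_ & _ & h1) (_ & _ & h2). apply Rnot_lt_le. intro h.
    set (e := (c - c' - 10 * eta') / 4).
    assert (He : 0 < e) by (unfold e; lra).
    assert (HI : itv (fun x => 0 <= x <= 1) 0 1) by (split; intros; lra).
    destruct (h1 mat_id _ 0 1 e Did ltac:(lra) HI He) as [T1 [HT1 HT1']].
    destruct (h2 mat_id _ 0 1 e Did ltac:(lra) HI He) as [T2 [HT2 HT2']].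
    set (t := Rmax T1 T2).
    assert (k1 : T1 <= t) by apply Rmax_l. assert (k2 : T2 <= t) by apply Rmax_r.
    destruct (enumv_ex q hq mat_id _ 0 1 t Did HI ltac:(lra)) as [l Hl].
    pose proof (HT1' t l k1 Hl). pose proof (HT2' t l k2 Hl). unfold e in *. lra. }
  destruct (completeness (fun x => exists eta, Pc eta x)) as [kap [K1 K2]].
  { exists 1. intros x [eta (_ & h & _)]. lra. }
  { destruct (Step (1 / 8) ltac:(lra)) as [c [h1 h2]]. exists c, (1 / 8). repeat split; try lra. apply h2. }
  exists kap. split.
  { destruct (Step (1 / 8) ltac:(lra)) as [c [h1 h2]]. apply Rle_trans with c; [lra|].
    apply K1. exists (1 / 8). repeat split; try lra. apply h2. }
  intros A I al be e D Hab HI He.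
  set (eta := Rmin (1 / 8) (e / (40 * (be - al)))).
  assert (Heta : 0 < eta <= 1 / 8).
  { split; [apply Rmin_pos; [lra|apply Rdiv_lt_0_compat; lra]|apply Rmin_l]. }
  assert (Heta' : 40 * eta * (be - al) <= e).
  { apply Rle_trans with (40 * (e / (40 * (be - al))) * (be - al)).
    - apply Rmult_le_compat_r; [lra|]. apply Rmult_le_compat_l; [lra|apply Rmin_r].
    - right. field. lra. }
  destruct (Step eta Heta) as [c [h1 h2]].
  assert (Pcc : Pc eta c) by (split; auto).
  destruct (h2 A I al be (e / 2) D Hab HI ltac:(lra)) as [T [HT HT']].
  assert (k1 : c <= kap) by (apply K1; exists eta; auto).
  assert (k2 : kap <= c + 10 * eta).
  { apply K2. intros x [eta' Hx]. eapply Cmp; eauto. }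
  exists T. split; auto. intros t l Ht Hl. specialize (HT' t l Ht Hl).
  apply Rabs_le. split; nra.
Qed.

(** * The law of the first row, by transposition *)

Definition is_density q (kap : R) : Prop :=
  forall A I al be e, det A = 1 -> al < be -> itv I al be -> 0 < e ->
    exists T, 1 <= T /\ forall t l, T <= t -> enumv q A I t l ->
      Rabs (INR (length l) / t ^ 2 - (be - al) * kap) <= e.

Lemma det_id : det mat_id = 1.
Proof. unfold det, mat_id; simpl; ring. Qed.

Lemma zx_id v : zx mat_id v = fst v.
Proof. unfold zx. now rewrite mapp_id. Qed.
Lemma zsl_id v : zsl mat_id v = slope v.
Proof. unfold zsl. now rewrite mapp_id. Qed.

(* Transposing M exchanges the slope of its first column with the ratio of the entries of its first row; so the vectors of Lambda with slope in a period, weighted by the row ratio, are dominated by vectors weighted by their slopes. *)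
Lemma transpose_sum q (hq : (3 <= q)%nat) g d L th t l : adm q g d L -> 0 < t -> NoDup l ->
  (forall v, In v l -> inLambda q v /\ 0 < fst v /\ th <= slope v < th + lambda_q q) ->
  Sm l (fun v => g (fst v / t) (slope v)) <= W q g mat_id t 0 (lambda_q q).
Proof.
  intros H Ht ND Hl. pose proof (lam_bounds q hq) as Hlam.
  (* The second column is normalised so that the first column of the transposed matrix, which will
     be the image of [v], has slope in [[0, lambda)]. *)
  set (MM := fun v => epsilon (inhabits mat_id) (fun M => inHecke q M /\ mapp M e1 = v /\
     0 <= m12 M / m11 M < lambda_q q)).
  assert (HMM : forall v, inLambda q v -> 0 < fst v -> inHecke q (MM v) /\ mapp (MM v) e1 = v /\
     0 <= m12 (MM v) / m11 (MM v) < lambda_q q).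
  { intros v Hv Hp. apply epsilon_spec. destruct (colmat_spec q v Hv) as [C1 C2].
    set (M := colmat q v) in *.
    destruct (zshift (lambda_q q) (m12 M / m11 M) 0 ltac:(lra)) as [n Hn].
    assert (Hm : m11 M = fst v) by (rewrite C2, fst_mapp; unfold e1; simpl; ring).
    exists (mmul M (mat_Tn q n)). split; [apply hecke_mmul; auto using hecke_Tn|]. split.
    - rewrite mapp_mmul, C2. f_equal. unfold mapp, mat_Tn, e1; simpl; f_equal; ring.
    - unfold mmul, mat_Tn; simpl.
      replace ((m11 M * (IZR n * lambda_q q) + m12 M * 1) / (m11 M * 1 + m12 M * 0)) with
        (m12 M / m11 M + IZR n * lambda_q q) by (field; lra). lra. }
  set (phi := fun v => mapp (mtr (MM v)) e1).
  assert (Hcol : forall v, inLambda q v -> 0 < fst v -> m11 (MM v) = fst v /\ m21 (MM v) = snd v /\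
     phi v = (fst v, m12 (MM v))).
  { intros v Hv Hp. destruct (HMM v Hv Hp) as (h1 & h2 & h3).
    assert (E1 : m11 (MM v) = fst v) by (rewrite <- h2 at 2; rewrite fst_mapp; unfold e1; simpl; ring).
    assert (E2 : m21 (MM v) = snd v) by (rewrite <- h2 at 2; rewrite snd_mapp; unfold e1; simpl; ring).
    repeat split; auto. unfold phi, mapp, mtr, e1; simpl. rewrite E1. f_equal; ring. }
  apply Rle_trans with (Sm (map phi l) (Fw q g mat_id t 0 (lambda_q q))).
  - rewrite Sm_map. right. apply Sm_ext. intros v Hv.
    destruct (Hl v Hv) as (v1 & v2 & v3). destruct (HMM v v1 v2) as (h1 & h2 & h3).
    destruct (Hcol v v1 v2) as (c1 & c2 & c3).
    unfold Fw. rewrite (proj2 (bdec_true _)).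
    + rewrite zx_id, c3. simpl fst. rewrite <- c3.
      destruct (beta_spec q hq mat_id (mtr (MM v))) as [n Hn].
      { now apply hecke_mtr. }
      { fold (phi v). rewrite zx_id, c3. simpl. lra. }
      fold (phi v) in Hn. 
      rewrite <- (adm_perZ q g d L (fst v / t) (beta q mat_id (phi v)) n H), <- Hn.
      f_equal. rewrite !zx_id, c3. unfold slope. simpl. unfold mtr; simpl. rewrite c2, c1. f_equal. ring.
    + split; [unfold phi; now apply Lam_mapp_e1, hecke_mtr|].
      rewrite zx_id, zsl_id, c3. unfold slope; simpl. rewrite <- c1 at 2 3. split; auto.
  - apply Sm_le_fsum.
    (* Equal images mean that the matrices differ by a transposed translation, which shifts the
       slope of [v] by a multiple of [lambda_q]; within one period this multiple is 0. *)
    + apply NoDup_map_on; auto. intros v w Hv Hw E.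
      destruct (Hl v Hv) as (v1 & v2 & v3). destruct (HMM v v1 v2) as (h1 & h2 & _).
      destruct (Hl w Hw) as (w1 & w2 & w3). destruct (HMM w w1 w2) as (k1 & k2 & _).
      destruct (hecke_same_col q hq (mtr (MM v)) (mtr (MM w))) as [n Hn]; auto using hecke_mtr.
      apply (f_equal mtr) in Hn. rewrite mtr_mmul, !mtr_mtr in Hn.
      rewrite <- k2, Hn, mapp_mmul, h2 in w3. rewrite <- k2, Hn, mapp_mmul, h2.
      assert (Es : slope (mapp (mtr (mat_Tn q n)) v) = slope v + IZR n * lambda_q q).
      { unfold slope, mapp, mtr, mat_Tn; simpl. field. lra. }
      rewrite Es in w3.
      assert (n = 0)%Z as ->.
      { assert (-1 < IZR n) by nra. assert (IZR n < 1) by nra.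
        apply (lt_IZR (-1)) in H0. apply (lt_IZR _ 1) in H1. lia. }
      destruct v; unfold mapp, mtr, mat_Tn; simpl. f_equal; ring.
    + eapply Fw_fin; eauto using det_id.
    + intro v. eapply Fw_rng; eauto.
Qed.

Definition rectP q A t a1 a2 b1 b2 (v : R * R) : Prop :=
  exists n : Z, a1 < zx A v / t < a2 /\ b1 < beta q A v + IZR n * lambda_q q < b2.

(** The limit constant [c] of a cutoff is the same for every [A], so it is computed at the identity.
    There [transpose_sum] bounds it below by a count of orbit vectors with slope slightly inside
    [[b1, b2]] and first coordinate slightly inside [[a1 t, a2 t]], and the density supplies
    [kap (b2 - b1)(a2^2 - a1^2)], spread over one period. *)
Lemma rect_lower q (hq : (3 <= q)%nat) kap : 0 <= kap -> is_density q kap ->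
  forall a1 a2 b1 b2 A I al be e, 0 < a1 -> a1 < a2 -> a2 <= 1 -> b1 < b2 -> b2 - b1 <= lambda_q q ->
  det A = 1 -> al < be -> itv I al be -> 0 < e ->
  exists T, 1 <= T /\ forall t l, T <= t -> enumv q A I t l ->
   (be - al) * (kap / lambda_q q) * ((b2 - b1) * (a2 ^ 2 - a1 ^ 2)) - e <=
   Sm l (fun v => if bdec (rectP q A t a1 a2 b1 b2 v) then 1 else 0) / t ^ 2.
Proof.
  intros Hk DK a1 a2 b1 b2 A I al be e Ha1 Ha12 Ha2 Hb Hbl D Hab HI He.
  pose proof (lam_bounds q hq) as Hlam.
  set (w := b2 - b1) in *. set (mid := (b1 + b2) / 2).
  set (B := 1 + (be - al) * (10 * kap)).
  assert (HB0 : 0 <= (be - al) * (10 * kap)) by (apply Rmult_le_pos; lra).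
  set (eta := Rmin (Rmin (w / 4) ((a2 - a1) / 4)) (e / (4 * B))).
  assert (Heta0 : 0 < eta).
  { apply Rmin_pos; [apply Rmin_pos; unfold w; lra|]. apply Rdiv_lt_0_compat; unfold B; lra. }
  assert (Heta1 : eta <= w / 4).
  { unfold eta. eapply Rle_trans; [apply Rmin_l|apply Rmin_l]. }
  assert (Heta2 : eta <= (a2 - a1) / 4).
  { unfold eta. eapply Rle_trans; [apply Rmin_l|apply Rmin_r]. }
  assert (Heta3 : 4 * eta * B <= e).
  { apply Rle_trans with (4 * (e / (4 * B)) * B).
    - apply Rmult_le_compat_r; [unfold B; lra|]. apply Rmult_le_compat_l; [lra|apply Rmin_r].
    - right. field. unfold B; lra. }
  clearbody eta.
  destruct (pcut_one q hq mid w eta Heta0 ltac:(lra) Hbl) as [K' [HK' PC]].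
  assert (HK : 0 < / eta) by now apply inv_pos.
  set (g := fun a b => tent (/ eta) a1 a2 a * pcut q K' mid w b).
  assert (Hg : adm q g a1 (/ eta + K' * (2 * PI))) by (apply adm_rect; auto; lra).
  destruct (sum_limit q hq g _ _ Hg) as (c & Hc & WL & SL).
  assert (Hclow : kap * (w - 2 * eta) * ((a2 - eta) ^ 2 - (a1 + eta) ^ 2) <= lambda_q q * c).
  { apply Rnot_lt_le. intro Hlt.
    set (gap := kap * (w - 2 * eta) * ((a2 - eta) ^ 2 - (a1 + eta) ^ 2) - lambda_q q * c) in *.
    assert (Hgap : 0 < gap) by (unfold gap; lra).
    destruct (WL mat_id 0 (lambda_q q) (gap / 4) det_id ltac:(lra) ltac:(lra)) as [T1 HT1].
    assert (Hg8 : 0 < gap / 8) by lra.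
    assert (Hbb : b1 + eta < b2 - eta) by (unfold w in *; lra).
    set (J := fun x => b1 + eta <= x <= b2 - eta).
    assert (HJ : itv J (b1 + eta) (b2 - eta)) by (unfold J; split; intros; lra).
    destruct (DK mat_id J (b1 + eta) (b2 - eta) (gap / 8) det_id Hbb HJ Hg8) as [T2 [HT2 HT2']].
    set (t := Rmax (Rmax T1 (T2 / a1)) 1).
    assert (t1 : 1 <= t) by apply Rmax_r.
    assert (tT1 : T1 <= t) by (unfold t; eapply Rle_trans; [|apply Rmax_l]; apply Rmax_l).
    assert (tT2 : T2 <= a1 * t).
    { assert (T2 / a1 <= t) by (unfold t; eapply Rle_trans; [|apply Rmax_l]; apply Rmax_r).
      apply (Rmult_le_compat_l a1) in H; [|lra]. replace (a1 * (T2 / a1)) with T2 in H by (field; lra). auto. }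
    clearbody t.
    specialize (HT1 t tT1 ltac:(lra)). apply Rabs_le_iff in HT1.
    destruct (enumv_ex q hq mat_id J _ _ ((a2 - eta) * t) det_id HJ ltac:(apply Rmult_lt_0_compat; lra)) as [l2 Hl2].
    destruct (enumv_ex q hq mat_id J _ _ ((a1 + eta) * t) det_id HJ ltac:(apply Rmult_lt_0_compat; lra)) as [l1 Hl1].
    pose proof (HT2' ((a2 - eta) * t) l2 ltac:(nra) Hl2) as C2. apply Rabs_le_iff in C2.
    pose proof (HT2' ((a1 + eta) * t) l1 ltac:(nra) Hl1) as C1. apply Rabs_le_iff in C1.
    destruct Hl2 as [ND2 Hl2]. destruct Hl1 as [ND1 Hl1].
    set (l' := filter (fun v => bdec ((a1 + eta) * t < fst v)) l2).
    assert (E1 : INR (length l2) <= INR (length l') + INR (length l1)).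
    { unfold l'. rewrite <- filter_count. rewrite <- (Rmult_1_l (INR (length l1))), <- (Sm_const l1 1).
      rewrite <- (Rmult_1_l (INR (length l2))), <- (Sm_const l2 1).
      rewrite (Sm_filter (fun v => bdec ((a1 + eta) * t < fst v)) l2).
      rewrite (Sm_filter_if (fun v => bdec ((a1 + eta) * t < fst v)) l2).
      apply Rplus_le_compat_l. apply Sm_incl; auto using NoDup_filter; [|intros; lra].
      intros v Hv. apply filter_In in Hv. destruct Hv as [h1 h2].
      apply Bool.negb_true_iff in h2. apply bdecF in h2. apply Hl2 in h1. apply Hl1.
      rewrite zx_id in *. destruct h1 as (h1 & h3 & h4). apply Rnot_lt_le in h2. split; [|split]; auto; lra. }
    assert (E2 : Sm l' (fun v => g (fst v / t) (slope v)) <= W q g mat_id t 0 (lambda_q q)).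
    { apply (transpose_sum q hq g _ _ b1 t l' Hg ltac:(lra)); [now apply NoDup_filter|].
      intros v Hv. apply filter_In in Hv. destruct Hv as [h1 h2]. apply bdecT in h2.
      apply Hl2 in h1. rewrite zx_id, zsl_id in h1. destruct h1 as (h1 & h3 & h4). unfold J in h4.
      unfold w in *. repeat split; auto; lra. }
    assert (E3 : Sm l' (fun v => g (fst v / t) (slope v)) = INR (length l')).
    { rewrite <- (Rmult_1_l (INR _)), <- (Sm_const l' 1). apply Sm_ext.
      intros v Hv. apply filter_In in Hv. destruct Hv as [h1 h2]. apply bdecT in h2.
      apply Hl2 in h1. rewrite zx_id, zsl_id in h1. destruct h1 as (h1 & h3 & h4). unfold J in h4.
      unfold g. rewrite tent_one, PC; try ring; auto.
      - apply Rabs_le. unfold mid, w. lra.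
      - rewrite Rinv_inv. split.
        + apply (Rmult_le_reg_r t); [lra|]. unfold Rdiv. rewrite Rmult_assoc, Rinv_l by lra. lra.
        + apply (Rmult_le_reg_r t); [lra|]. unfold Rdiv. rewrite Rmult_assoc, Rinv_l by lra. lra. }
    assert (C2' : ((b2 - eta - (b1 + eta)) * kap - gap / 8) * ((a2 - eta) * t) ^ 2 <= INR (length l2)).
    { apply (Rmult_le_reg_r (/ ((a2 - eta) * t) ^ 2)).
      - apply inv_pos. assert (0 < (a2 - eta) * t) by (apply Rmult_lt_0_compat; lra). nra.
      - rewrite Rmult_assoc, Rinv_r.
        + unfold Rdiv in C2. lra.
        + assert (0 < (a2 - eta) * t) by (apply Rmult_lt_0_compat; lra). nra. }
    assert (C1' : INR (length l1) <= ((b2 - eta - (b1 + eta)) * kap + gap / 8) * ((a1 + eta) * t) ^ 2).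
    { apply (Rmult_le_reg_r (/ ((a1 + eta) * t) ^ 2)).
      - apply inv_pos. assert (0 < (a1 + eta) * t) by (apply Rmult_lt_0_compat; lra). nra.
      - rewrite (Rmult_assoc _ (((a1 + eta) * t) ^ 2)), Rinv_r.
        + unfold Rdiv in C1. lra.
        + assert (0 < (a1 + eta) * t) by (apply Rmult_lt_0_compat; lra). nra. }
    assert (W' : W q g mat_id t 0 (lambda_q q) <= ((lambda_q q - 0) * c + gap / 4) * t ^ 2).
    { apply (Rmult_le_reg_r (/ t ^ 2)); [apply inv_pos; nra|].
      rewrite (Rmult_assoc _ (t ^ 2)), Rinv_r by nra. unfold Rdiv in HT1. lra. }
    replace (b2 - eta - (b1 + eta)) with (w - 2 * eta) in * by (unfold w; ring).
    assert (X : (kap * (w - 2 * eta) * ((a2 - eta) ^ 2 - (a1 + eta) ^ 2)) * t ^ 2 - gap / 8 * ((a2 - eta) ^ 2 + (a1 + eta) ^ 2) * t ^ 2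
       <= (lambda_q q * c + gap / 4) * t ^ 2) by nra.
    assert (X2 : kap * (w - 2 * eta) * ((a2 - eta) ^ 2 - (a1 + eta) ^ 2) = gap + lambda_q q * c) by (unfold gap; ring).
    rewrite X2 in X.
    assert ((a2 - eta) ^ 2 <= 1) by nra. assert ((a1 + eta) ^ 2 <= 1) by nra.
    assert (gap / 8 * ((a2 - eta) ^ 2 + (a1 + eta) ^ 2) <= gap / 4) by nra.
    assert (0 < t ^ 2) by nra.
    assert (gap / 8 * ((a2 - eta) ^ 2 + (a1 + eta) ^ 2) * t ^ 2 <= gap / 4 * t ^ 2) by (apply Rmult_le_compat_r; lra).
    assert (0 < gap * t ^ 2) by (apply Rmult_lt_0_compat; lra). nra. }
  assert (Hclow2 : (kap / lambda_q q) * (w * (a2 ^ 2 - a1 ^ 2)) - 10 * kap * eta <= c).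
  { apply (Rmult_le_reg_l (lambda_q q)); [lra|].
    replace (lambda_q q * (kap / lambda_q q * (w * (a2 ^ 2 - a1 ^ 2)) - 10 * kap * eta))
      with (kap * (w * (a2 ^ 2 - a1 ^ 2)) - lambda_q q * (10 * kap * eta)) by (field; lra).
    eapply Rle_trans; [|apply Hclow].
    replace (kap * (w - 2 * eta) * ((a2 - eta) ^ 2 - (a1 + eta) ^ 2)) with
      (kap * ((w - 2 * eta) * ((a2 ^ 2 - a1 ^ 2) - 2 * eta * (a1 + a2)))) by ring.
    assert (w * (a2 ^ 2 - a1 ^ 2) - 10 * eta <= (w - 2 * eta) * ((a2 ^ 2 - a1 ^ 2) - 2 * eta * (a1 + a2))).
    { assert (0 <= a2 ^ 2 - a1 ^ 2 <= 1) by nra. 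
      assert (2 * eta * (a1 + a2) * w <= 8 * eta).
      { assert ((a1 + a2) * w <= 2 * 2) by (apply Rmult_le_compat; unfold w in *; lra). nra. }
      assert (0 <= eta * eta * (a1 + a2)) by (apply Rmult_le_pos; nra). nra. }
    apply (Rmult_le_compat_l kap) in H; auto.
    assert (10 * kap * eta <= lambda_q q * (10 * kap * eta)).
    { assert (0 <= 10 * kap * eta) by (apply Rmult_le_pos; nra). nra. }
    lra. }
  destruct (SL A I al be (e / 2) D Hab HI ltac:(lra)) as [T [HT HT']].
  exists T. split; auto. intros t l Ht Hl.
  specialize (HT' t l Ht Hl). apply Rabs_le_iff in HT'.
  assert (S1 : Sm l (fun v => g (zx A v / t) (beta q A v)) <= 
     Sm l (fun v => if bdec (rectP q A t a1 a2 b1 b2 v) then 1 else 0)).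
  { apply Sm_le. intros v Hv. destruct (bdec (rectP q A t a1 a2 b1 b2 v)) eqn:E.
    - apply (adm_rng _ _ _ _ Hg).
    - apply bdecF in E. right.
      destruct (Req_EM_T (tent (/ eta) a1 a2 (zx A v / t)) 0) as [Z|Z].
      { unfold g. rewrite Z. ring. }
      destruct (Req_EM_T (pcut q K' mid w (beta q A v)) 0) as [Z'|Z'].
      { unfold g. rewrite Z'. ring. }
      exfalso. apply E. destruct (pcut_pos q hq K' mid w (beta q A v) HK' ltac:(unfold w in *; lra) Z') as [n Hn].
      exists n. split.
      + split; apply Rnot_le_lt; intro; apply Z; apply tent_zero; lra.
      + apply Rabs_def2 in Hn. unfold mid, w in Hn. lra. }
  assert (P : 0 < / t ^ 2) by (apply inv_pos; nra).
  apply (Rmult_le_compat_r (/ t ^ 2)) in S1; [|lra]. unfold Rdiv in *.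
  assert ((be - al) * (10 * kap * eta) <= e / 4).
  { unfold B in Heta3. nra. }
  assert (X : (be - al) * (kap * / lambda_q q * (w * (a2 ^ 2 - a1 ^ 2)) - 10 * kap * eta) <= (be - al) * c)
   by (apply Rmult_le_compat_l; lra).
  nra.
Qed.

(** * Return coordinates and rectangles of T^q *)

Definition zof (A : mat) tau v : mat := mmul (mat_s (/ tau)) (mmul (mat_h (zsl A v)) A).

Lemma zof_x A tau v w : zx (zof A tau v) w = zx A w / tau.
Proof. unfold zof. rewrite zx_sh. unfold Rdiv; ring. Qed.

Lemma zof_y A tau v : 0 < tau -> zx A v <> 0 -> snd (mapp (zof A tau v) v) = 0.
Proof. intros Ht Hx. unfold zof. rewrite snd_sh, zsl_snd by auto. ring. Qed.

Lemma mat_eta (M : mat) : M = Mat (m11 M) (m12 M) (m21 M) (m22 M).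
Proof. destruct M; reflexivity. Qed.

(** [zof] makes the image of [v] horizontal, so in a basis that starts with [v] the lattice is given
    by an upper triangular matrix. This exhibits the return coordinates: [a = x / tau], and
    [b = a * beta] up to multiples of [lambda_q a]. *)
Lemma zof_colmat q A tau v : 0 < tau -> det A = 1 -> inLambda q v -> 0 < zx A v ->
  mmul (zof A tau v) (colmat q v) = mat_g (zx A v / tau) (zx A v / tau * beta q A v).
Proof.
  intros Ht D Hv Hx. destruct (colmat_spec q v Hv) as [C1 C2].
  set (C := colmat q v) in *. set (z := zof A tau v).
  assert (Dz : det z = 1) by (unfold z, zof; rewrite det_sh; auto; apply Rinv_neq_0_compat; lra).
  assert (DC : det (mmul z C) = 1) by (rewrite det_mmul, Dz, (hecke_det q C C1); ring).
  assert (H1 : m11 (mmul z C) = zx A v / tau).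
  { rewrite <- (zof_x A tau v v). fold z. unfold zx. rewrite C2 at 1. rewrite <- mapp_mmul, fst_mapp.
    unfold e1; simpl. ring. }
  assert (H3 : m21 (mmul z C) = 0).
  { rewrite <- (zof_y A tau v) by lra. fold z. rewrite C2 at 1. rewrite <- mapp_mmul, snd_mapp.
    unfold e1; simpl. ring. }
  assert (H2 : m12 (mmul z C) = zx A v / tau * beta q A v).
  { unfold beta. replace (zx A v / tau * (zx A (partner q v) / zx A v)) with (zx A (partner q v) / tau) by (field; lra).
    rewrite <- (zof_x A tau v). fold z. unfold zx, partner. fold C. rewrite <- mapp_mmul, fst_mapp.
    unfold e2; simpl. ring. }
  rewrite (mat_eta (mmul z C)). unfold det in DC. rewrite H3, Rmult_0_r, Rminus_0_r, H1 in DC.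
  rewrite H1, H2, H3. unfold mat_g. f_equal.
  assert (0 < zx A v / tau) by (apply Rdiv_lt_0_compat; lra).
  apply (Rmult_eq_reg_l (zx A v / tau)); [|lra]. rewrite DC, Rinv_r; lra.
Qed.

Lemma det_zof A tau v : 0 < tau -> det A = 1 -> det (zof A tau v) = 1.
Proof. intros Ht D. unfold zof. rewrite det_sh; auto. apply Rinv_neq_0_compat; lra. Qed.

Lemma g_shift q a b n : mmul (mat_g a b) (mat_Tn q n) = mat_g a (b + IZR n * lambda_q q * a).
Proof. unfold mmul, mat_g, mat_Tn; simpl; f_equal; ring. Qed.

Lemma FTR_ex q (hq : (3 <= q)%nat) A tau v : det A = 1 -> inLambda q v -> 0 < zx A v <= tau ->
  exists p, FTR_is q A tau (mapp A v) p.
Proof.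
  intros D Hv Hx. pose proof (lam_bounds q hq) as Hl.
  set (a := zx A v / tau).
  assert (Ha : 0 < a <= 1).
  { unfold a. split; [apply Rdiv_lt_0_compat; lra|].
    apply (Rmult_le_reg_r tau); [lra|]. unfold Rdiv. rewrite Rmult_assoc, Rinv_l by lra. lra. }
  (* Applied to [-b], because the window [(1 - lambda a, 1]] is closed on the right. *)
  destruct (zshift (lambda_q q * a) (- (a * beta q A v)) (-1) ltac:(apply Rmult_lt_0_compat; lra)) as [n Hn].
  set (b := a * beta q A v + IZR (- n) * lambda_q q * a).
  exists (a, b). split.
  - unfold inTq; simpl. unfold b. rewrite opp_IZR. lra.
  - intro w. simpl. unfold b. rewrite <- g_shift.
    replace (mat_g a (a * beta q A v)) with (mmul (zof A tau v) (colmat q v)) by (apply zof_colmat; auto; lra).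
    rewrite (ALam_mmul q _ (mat_Tn q (- n))) by apply hecke_Tn.
    rewrite (ALam_mmul q _ (colmat q v)) by apply (proj1 (colmat_spec q v Hv)). reflexivity.
Qed.

(** Equality of the lattices recovers [a] from the only orbit vector that is horizontal and points
    right, and [b] modulo [lambda_q a] from the vectors at height [1/a]. *)
Lemma FTR_coords q (hq : (3 <= q)%nat) A tau v p : det A = 1 -> inLambda q v -> 0 < zx A v -> 0 < tau ->
  FTR_is q A tau (mapp A v) p ->
  fst p = zx A v / tau /\ exists n : Z, snd p = fst p * (beta q A v + IZR n * lambda_q q).
Proof.
  intros D Hv Hx Ht [[Hp1 Hp2] HF]. fold (zsl A v) in HF. fold (zof A tau v) in HF.
  pose proof (det_zof A tau v Ht D) as Dz. set (z := zof A tau v) in *.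
  set (a := zx A v / tau).
  assert (Ha : 0 < a) by (apply Rdiv_lt_0_compat; lra).
  assert (Dg : det (mat_g (fst p) (snd p)) = 1) by (apply det_g; lra).
  assert (Ex : zx z v = a) by apply zof_x.
  assert (Ey : snd (mapp z v) = 0) by (apply zof_y; lra).
  assert (E1 : fst p = a).
  { destruct (proj2 (HF (mapp (mat_g (fst p) (snd p)) e1))) as [v' [Hv' E]].
    { exists e1. split; auto using Lam_e1. }
    assert (Ev' : mapp z v' = (fst p, 0)).
    { rewrite <- E. unfold mapp, mat_g, e1; simpl. f_equal; ring. }
    destruct (Lam_vdet q hq v v' Hv Hv') as [[_ [->| ->]]|N].
    - unfold zx in Ex. rewrite Ev' in Ex. auto.
    - rewrite mapp_vneg in Ev'. apply (f_equal fst) in Ev'. 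
      change (fst (vneg (mapp z v))) with (- zx z v) in Ev'. simpl in Ev'. lra.
    - exfalso. assert (vdet v v' = 0).
      { rewrite <- (Rmult_1_l (vdet v v')), <- Dz, <- vdet_mapp. unfold vdet. rewrite Ev', Ey. simpl. ring. }
      rewrite H, Rabs_R0 in N. lra. }
  split; auto.
  destruct (proj2 (HF (mapp (mat_g (fst p) (snd p)) e2))) as [w' [Hw' E]].
  { exists e2. split; auto using Lam_e2. }
  destruct (colmat_spec q v Hv) as [C1 _]. pose proof (hecke_det q _ C1) as DC.
  set (X := mapp (minv (colmat q v)) w').
  assert (HX : inLambda q X) by (apply Lam_mapp; auto using hecke_minv).
  assert (Ew : w' = mapp (colmat q v) X) by (unfold X; rewrite mapp_minv_r; auto).
  rewrite Ew, <- mapp_mmul in E. unfold z in E. rewrite zof_colmat in E by auto. fold a in E. rewrite E1 in E.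
  clearbody X.
  assert (X2 : snd X = 1).
  { apply (f_equal snd) in E. rewrite !snd_mapp in E. unfold mat_g, e2 in E; simpl in E.
    apply (Rmult_eq_reg_l (/ a)); [lra|]. apply Rinv_neq_0_compat; lra. }
  destruct (Lam_snd1 q hq X HX X2) as [n Hn]. exists n. rewrite E1.
  apply (f_equal fst) in E. rewrite !fst_mapp in E. unfold mat_g, e2 in E; simpl in E.
  rewrite X2, Hn in E. lra.
Qed.

Lemma ev_all (n : nat) (P : nat -> R -> Prop) :
  (forall i, (i < n)%nat -> exists T, forall t, T <= t -> P i t) ->
  exists T, forall i, (i < n)%nat -> forall t, T <= t -> P i t.
Proof.
  induction n as [|n IH]; intro H.
  - exists 0. intros; lia.
  - destruct IH as [T1 HT1]. { intros; apply H; lia. }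
    destruct (H n ltac:(lia)) as [T2 HT2].
    exists (Rmax T1 T2). intros i Hi t Ht.
    assert (T1 <= t) by (eapply Rle_trans; [apply Rmax_l|apply Ht]).
    assert (T2 <= t) by (eapply Rle_trans; [apply Rmax_r|apply Ht]).
    destruct (Nat.eq_dec i n) as [->|]; auto. apply HT1; auto; lia.
Qed.

Definition in_open a1 a2 b1 b2 (p : R * R) : Prop := a1 < fst p < a2 /\ b1 < snd p < b2.
Definition in_closed a1 a2 b1 b2 (p : R * R) : Prop := a1 <= fst p <= a2 /\ b1 <= snd p <= b2.

Definition FTRs q A t l (phi : R * R -> R * R) : Prop :=
  forall v, In v l -> FTR_is q A t (mapp A v) (phi v).

(** T^q contains exactly one representative of [b] modulo [lambda_q a]. As the rectangle lies in
    T^q, the translate provided by [rectP] is the one chosen by the return coordinates. *)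
Lemma rectP_in_cell q (hq : (3 <= q)%nat) A I t l phi v a1 a2 b1 b2 s1 s2 c1 c2 : det A = 1 -> 0 < t ->
  enumv q A I t l -> In v l -> FTRs q A t l phi ->
  0 < s1 -> a1 <= s1 -> s2 <= a2 ->
  (forall s, s1 < s < s2 -> b1 <= s * c1 /\ s * c2 <= b2) ->
  (forall p, in_closed a1 a2 b1 b2 p -> inTq q p) ->
  rectP q A t s1 s2 c1 c2 v -> in_open a1 a2 b1 b2 (phi v).
Proof.
  intros D Ht HE Hv HF Hs1 H1 H2 Hs Hcl [n [Ha Hb]].
  pose proof (lam_bounds q hq) as Hl.
  assert (Hv' : inLambda q v /\ 0 < zx A v <= t).
  { apply HE in Hv. tauto. }
  destruct Hv' as [v1 v2].
  pose proof (HF v Hv) as F. pose proof (proj1 F) as T1.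
  destruct (FTR_coords q hq A t v (phi v) D v1 (proj1 v2) Ht F) as [E1 [k E2]].
  rewrite <- E1 in Ha. set (a := fst (phi v)) in *. set (be := beta q A v) in *.
  destruct (Hs a Ha) as [h1 h2].
  assert (g1 : a * c1 < a * (be + IZR n * lambda_q q)) by (apply Rmult_lt_compat_l; lra).
  assert (g2 : a * (be + IZR n * lambda_q q) < a * c2) by (apply Rmult_lt_compat_l; lra).
  assert (T2 : inTq q (a, a * (be + IZR n * lambda_q q))).
  { apply Hcl. unfold in_closed; simpl. lra. }
  unfold inTq in T1, T2. simpl in T2. fold a in T1. rewrite E2 in T1.
  assert (k = n) as ->.
  { destruct T1 as [_ T1], T2 as [_ T2].
    assert (La : 0 < lambda_q q * a) by (apply Rmult_lt_0_compat; lra).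
    assert (U1 : (IZR k - IZR n) * (lambda_q q * a) < 1 * (lambda_q q * a)) by lra.
    assert (U2 : -1 * (lambda_q q * a) < (IZR k - IZR n) * (lambda_q q * a)) by lra.
    apply Rmult_lt_reg_r in U1; auto. apply Rmult_lt_reg_r in U2; auto.
    rewrite <- minus_IZR in U1, U2. apply (lt_IZR (-1)) in U2. apply (lt_IZR _ 1) in U1. lia. }
  unfold in_open. fold a. rewrite E2. lra.
Qed.

(** Adds the slices whose ratio window is empty; for them the claimed bound is negative. *)
Lemma slice_lower q (hq : (3 <= q)%nat) kap : 0 <= kap -> is_density q kap ->
  forall a1 a2 b1 b2 A I al be e, 0 < a1 -> a1 < a2 -> a2 <= 1 -> b2 - b1 <= lambda_q q ->
  det A = 1 -> al < be -> itv I al be -> 0 < e ->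
  exists T, forall t, T <= t -> forall l, enumv q A I t l ->
   (be - al) * (kap / lambda_q q) * ((b2 - b1) * (a2 ^ 2 - a1 ^ 2)) - e <=
   Sm l (fun v => if bdec (rectP q A t a1 a2 b1 b2 v) then 1 else 0) / t ^ 2.
Proof.
  intros Hk DK a1 a2 b1 b2 A I al be e Ha1 Ha12 Ha2 Hbl D Hab HI He.
  pose proof (lam_bounds q hq) as Hlam.
  destruct (Rlt_le_dec b1 b2) as [h|h].
  - destruct (rect_lower q hq kap Hk DK a1 a2 b1 b2 A I al be e) as [T [HT HT']]; auto.
    exists T. intros; apply HT'; auto.
  - exists 1. intros t Ht l _.
    assert (0 <= (be - al) * (kap / lambda_q q)).
    { apply Rmult_le_pos; [lra|]. unfold Rdiv. apply Rmult_le_pos; auto. left; apply inv_pos; lra. }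
    assert (0 <= a2 ^ 2 - a1 ^ 2) by nra.
    assert ((b2 - b1) * (a2 ^ 2 - a1 ^ 2) <= 0) by nra.
    assert ((be - al) * (kap / lambda_q q) * ((b2 - b1) * (a2 ^ 2 - a1 ^ 2)) <= 0) by nra.
    apply Rle_trans with 0; [lra|]. unfold Rdiv. apply Rmult_le_pos; [|left; apply inv_pos; nra].
    apply Sm_nonneg. intros; destruct (bdec _); lra.
Qed.

(** The price of replacing the exact ratio window by the one valid on a whole slice of width [h]. It
    is applied to [b2] and to [- b1], which turns the maximum at the lower end into a minimum. *)
Lemma Rmin_div_bound b x y a1 h : 0 < a1 -> a1 <= x -> y = x + h -> 0 < h -> Rabs b <= 1 ->
  2 * b - h / a1 <= Rmin (b / x) (b / y) * (x + y).
Proof.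
  intros Ha Hx Hy Hh Hb. apply Rabs_le_iff in Hb.
  assert (P1 : 0 < / a1) by now apply inv_pos.
  assert (0 < / x <= / a1) by (split; [apply inv_pos; lra|apply Rinv_le_contravar; lra]).
  assert (0 < / y <= / a1) by (split; [apply inv_pos; lra|apply Rinv_le_contravar; lra]).
  unfold Rmin. destruct (Rle_dec _ _).
  - replace (b / x * (x + y)) with (2 * b + b * (h * / x)) by (rewrite Hy; field; lra).
    unfold Rdiv. assert (0 <= h * / x <= h * / a1) by (split; nra). nra.
  - replace (b / y * (x + y)) with (2 * b - b * (h * / y)) by (subst y; field; lra).
    unfold Rdiv. assert (0 <= h * / y <= h * / a1) by (split; nra). nra.
Qed.

(* In the coordinates (a, b/a) a rectangle of T^q is cut into thin vertical slices. *)
Lemma cell_lower q (hq : (3 <= q)%nat) kap : 0 <= kap -> is_density q kap ->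
  forall a1 a2 b1 b2 A I al be e, a1 < a2 -> b1 <= b2 ->
  (forall p, in_closed a1 a2 b1 b2 p -> inTq q p) ->
  det A = 1 -> al < be -> itv I al be -> 0 < e ->
  exists T, forall t, T <= t -> forall l phi, enumv q A I t l -> FTRs q A t l phi ->
   (be - al) * (2 * kap / lambda_q q) * ((b2 - b1) * (a2 - a1)) - e <=
   Sm l (fun v => if bdec (in_open a1 a2 b1 b2 (phi v)) then 1 else 0) / t ^ 2.
Proof.
  intros Hk DK a1 a2 b1 b2 A I al be e Ha Hb Hcl D Hab HI He.
  pose proof (lam_bounds q hq) as Hlam.
  destruct (Hcl (a1, b1)) as [c1 c2]; [unfold in_closed; simpl; lra|].
  destruct (Hcl (a2, b2)) as [c3 c4]; [unfold in_closed; simpl; lra|].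
  destruct (Hcl (a1, b2)) as [c5 c6]; [unfold in_closed; simpl; lra|].
  simpl in c1, c2, c3, c4, c5, c6.
  assert (Hb1 : Rabs b1 <= 1) by (apply Rabs_le; nra).
  assert (Hb2 : Rabs b2 <= 1) by (apply Rabs_le; nra).
  set (K := (be - al) * (kap / lambda_q q)).
  assert (HK : 0 <= K).
  { apply Rmult_le_pos; [lra|]. unfold Rdiv. apply Rmult_le_pos; auto. left; apply inv_pos; lra. }
  destruct (nat_above (1 + 4 * K / (a1 * e))) as [n [Hn1 Hn]].
  assert (Hn0 : 1 <= INR n) by (replace 1 with (INR 1) by reflexivity; now apply le_INR).
  set (h := (a2 - a1) / INR n).
  assert (Hh : 0 < h) by (apply Rdiv_lt_0_compat; lra).
  assert (nh : INR n * h = a2 - a1) by (unfold h; field; lra).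
  set (s := fun i : nat => a1 + INR i * h).
  assert (sS : forall i, s (S i) = s i + h) by (intro i; unfold s; rewrite S_INR; ring).
  assert (s_ge : forall i, a1 <= s i) by (intro i; unfold s; pose proof (pos_INR i); nra).
  assert (s_le : forall i, (i < n)%nat -> s (S i) <= a2).
  { intros i Hi. unfold s. apply Rle_trans with (a1 + INR n * h); [|lra].
    apply Rplus_le_compat_l, Rmult_le_compat_r; [lra|]. apply le_INR. lia. }
  (* Ratios admissible for every first coordinate in the slice; both ends of the slice enter because
     [b1] and [b2] may have either sign. *)
  set (B1 := fun i => Rmax (b1 / s i) (b1 / s (S i))).
  set (B2 := fun i => Rmin (b2 / s i) (b2 / s (S i))).
  assert (Hwid : forall i, B2 i - B1 i <= lambda_q q).
  { intro i. pose proof (Rmin_l (b2 / s i) (b2 / s (S i))). pose proof (Rmax_l (b1 / s i) (b1 / s (S i))).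
    pose proof (s_ge i). unfold B1, B2. apply Rle_trans with ((b2 - b1) / s i); [unfold Rdiv in *; lra|].
    apply (Rmult_le_reg_r (s i)); [lra|]. unfold Rdiv. rewrite Rmult_assoc, Rinv_l by lra. nra. }
  destruct (ev_all n (fun i t => forall l, enumv q A I t l ->
     K * ((B2 i - B1 i) * (s (S i) ^ 2 - s i ^ 2)) - e / (2 * INR n) <=
     Sm l (fun v => if bdec (rectP q A t (s i) (s (S i)) (B1 i) (B2 i) v) then 1 else 0) / t ^ 2)) as [T HT].
  { intros i Hi. pose proof (s_ge i). pose proof (s_le i Hi). pose proof (sS i).
    apply (slice_lower q hq kap Hk DK); auto; try lra. apply Rdiv_lt_0_compat; lra. }
  exists (Rmax T 1). intros t Ht l phi Hl HF.
  assert (tT : T <= t) by (eapply Rle_trans; [apply Rmax_l|apply Ht]).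
  assert (t1 : 1 <= t) by (eapply Rle_trans; [apply Rmax_r|apply Ht]).
  assert (Pt : 0 < / t ^ 2) by (apply inv_pos; nra).
  apply Rle_trans with (Sm (seq 0 n) (fun i => K * ((B2 i - B1 i) * (s (S i) ^ 2 - s i ^ 2)) - e / (2 * INR n))).
  - apply Rle_trans with (Sm (seq 0 n) (fun i => K * (2 * (b2 - b1) * h) - (K * (2 * h / a1 * h) + e / (2 * INR n)))).
    + rewrite Sm_const, length_seq.
      replace ((K * (2 * (b2 - b1) * h) - (K * (2 * h / a1 * h) + e / (2 * INR n))) * INR n) with
        (K * 2 * (b2 - b1) * (INR n * h) - (K * 2 / a1 * h * (INR n * h) + e / 2)) by (field; split; lra).
      rewrite nh.
      assert (K * 2 / a1 * h * (a2 - a1) <= e / 2).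
      { assert (4 * K / (a1 * e) <= INR n) by lra.
        apply (Rmult_le_compat_r (a1 * e)) in H; [|nra].
        replace (4 * K / (a1 * e) * (a1 * e)) with (4 * K) in H by (field; split; lra).
        assert (Q : 4 * K * h <= a1 * e * (a2 - a1)).
        { rewrite <- nh. replace (a1 * e * (INR n * h)) with (INR n * (a1 * e) * h) by ring.
          apply Rmult_le_compat_r; lra. }
        apply (Rmult_le_reg_r a1); [lra|].
        replace (K * 2 / a1 * h * (a2 - a1) * a1) with (2 * K * h * (a2 - a1)) by (field; lra).
        apply Rle_trans with (2 * K * h * 1).
        - apply Rmult_le_compat_l; [|lra]. apply Rmult_le_pos; lra.
        - assert (a1 * e * (a2 - a1) <= a1 * e * 1) by (apply Rmult_le_compat_l; nra). lra. }
      unfold K in *. unfold Rdiv in *. nra.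
    + apply Sm_le. intros i Hi.
      (* [(B2 - B1)(s'^2 - s^2)] is close to [(b2 - b1)/s * 2 s h]: the Jacobian of the ratio
         cancels and Lebesgue measure appears. *)
      assert (K * (2 * (b2 - b1) * h) - K * (2 * h / a1 * h) <= K * ((B2 i - B1 i) * (s (S i) ^ 2 - s i ^ 2))); [|lra].
      rewrite <- Rmult_minus_distr_l. apply Rmult_le_compat_l; auto.
      replace (s (S i) ^ 2 - s i ^ 2) with ((s i + s (S i)) * h) by (rewrite sS; ring).
      rewrite <- Rmult_assoc.
      replace (2 * (b2 - b1) * h - 2 * h / a1 * h) with ((2 * (b2 - b1) - 2 * h / a1) * h) by (unfold Rdiv; ring).
      apply Rmult_le_compat_r; [lra|].
      pose proof (Rmin_div_bound b2 (s i) (s (S i)) a1 h (proj1 c1) (s_ge i) (sS i) Hh Hb2) as R2.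
      pose proof (Rmin_div_bound (- b1) (s i) (s (S i)) a1 h (proj1 c1) (s_ge i) (sS i) Hh ltac:(rewrite Rabs_Ropp; auto)) as R1.
      replace (Rmin (- b1 / s i) (- b1 / s (S i))) with (- B1 i) in R1.
      2: { unfold B1. rewrite Ropp_Rmax. f_equal; unfold Rdiv; ring. }
      fold (B2 i) in R2. unfold Rdiv in *. nra.
  - eapply Rle_trans; [apply Sm_le; intros i Hi; apply in_seq in Hi; apply (HT i ltac:(lia) t tT l Hl)|].
    unfold Rdiv at 1. rewrite (Sm_ext _ _ (fun i => / t ^ 2 * Sm l (fun v => if bdec (rectP q A t (s i) (s (S i)) (B1 i) (B2 i) v) then 1 else 0))) by (intros; unfold Rdiv; ring).
    rewrite Sm_scal, Rmult_comm. apply Rmult_le_compat_r; [lra|].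
    rewrite Sm_swap. apply Sm_le. intros v Hv.
    (* The slices are disjoint, so a vector is counted at most once, and then its return coordinates
       lie in the rectangle. *)
    destruct (classic (exists i, In i (seq 0 n) /\ rectP q A t (s i) (s (S i)) (B1 i) (B2 i) v)) as [[i [Hi Ri]]|N].
    + assert (Hi' := proj1 (in_seq _ _ _) Hi).
      rewrite (proj2 (bdec_true (in_open a1 a2 b1 b2 (phi v)))).
      * rewrite (Sm_ext _ _ (fun j => if Nat.eqb j i then 1 else 0)).
        -- assert (K1 : forall m k, Sm (seq m k) (fun j => if Nat.eqb j i then 1 else 0) <= 1).
           { intros m k; revert m. induction k as [|k IHk]; intro m; simpl; [lra|].
             destruct (Nat.eqb_spec m i) as [->|]; [|specialize (IHk (S m)); lra].
             rewrite Sm_zero; [lra|]. intros x Hx. apply in_seq in Hx.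
             destruct (Nat.eqb_spec x i); [lia|auto]. }
           apply K1.
        -- intros j Hj. destruct (Nat.eqb_spec j i) as [->|Nji].
           ++ now rewrite (proj2 (bdec_true _)).
           ++ rewrite (proj2 (bdec_false _)); auto. intros [m1 [Rj _]]. destruct Ri as [m2 [Ri _]].
              assert (Mono : forall x y, (x < y)%nat -> s (S x) <= s y).
              { intros x y Hxy. unfold s. apply Rplus_le_compat_l, Rmult_le_compat_r; [lra|]. apply le_INR; lia. }
              destruct (Nat.lt_total i j) as [o|[o|o]]; [|lia|].
              ** specialize (Mono i j o). lra.
              ** specialize (Mono j i o). lra.
      * apply (rectP_in_cell q hq A I t l phi v a1 a2 b1 b2 (s i) (s (S i)) (B1 i) (B2 i)); auto; try lra.
        -- pose proof (s_ge i); lra.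
        -- apply s_le; lia.
        -- intros x Hx. pose proof (s_ge i). pose proof (sS i).
           assert (Q : forall b y, b / y * y = b \/ y = 0) by (intros b y; destruct (Req_EM_T y 0); [right; auto|left; field; auto]).
           split.
           ++ unfold B1. destruct (Rle_lt_dec 0 b1).
              ** apply Rle_trans with (x * (b1 / s i)); [|apply Rmult_le_compat_l; [lra|apply Rmax_l]].
                 destruct (Q b1 (s i)); [|lra]. assert (0 <= b1 / s i) by (unfold Rdiv; apply Rmult_le_pos; auto; left; apply inv_pos; lra). nra.
              ** apply Rle_trans with (x * (b1 / s (S i))); [|apply Rmult_le_compat_l; [lra|apply Rmax_r]].
                 destruct (Q b1 (s (S i))); [|lra]. assert (b1 / s (S i) <= 0).
                 { unfold Rdiv. assert (0 < / s (S i)) by (apply inv_pos; lra). nra. } nra.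
           ++ unfold B2. destruct (Rle_lt_dec 0 b2).
              ** apply Rle_trans with (x * (b2 / s (S i))); [apply Rmult_le_compat_l; [lra|apply Rmin_r]|].
                 destruct (Q b2 (s (S i))); [|lra]. assert (0 <= b2 / s (S i)) by (unfold Rdiv; apply Rmult_le_pos; auto; left; apply inv_pos; lra). nra.
              ** apply Rle_trans with (x * (b2 / s i)); [apply Rmult_le_compat_l; [lra|apply Rmin_l]|].
                 destruct (Q b2 (s i)); [|lra]. assert (b2 / s i <= 0).
                 { unfold Rdiv. assert (0 < / s i) by (apply inv_pos; lra). nra. } nra.
    + rewrite Sm_zero; [destruct (bdec _); lra|]. intros i Hi.
      rewrite (proj2 (bdec_false _)); auto. intro; apply N; eauto.
Qed.

(** * Dyadic lower sums *)

Lemma Rinf_spec (E : R -> Prop) b : (exists x, E x) -> (forall x, E x -> b <= x) -> is_glb E (Rinf E).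
Proof.
  intros [x0 H0] Hb. unfold Rinf. apply epsilon_spec.
  destruct (completeness (fun y => E (- y))) as [s [S1 S2]].
  - exists (- b). intros y Hy. apply Hb in Hy. lra.
  - exists (- x0). now rewrite Ropp_involutive.
  - exists (- s). split.
    + intros x Hx. assert (- x <= s); [|lra]. apply S1. now rewrite Ropp_involutive.
    + intros m' Hm. assert (s <= - m'); [|lra]. apply S2. intros y Hy. apply Hm in Hy. lra.
Qed.

Lemma ext0_in q g p : inTq q p -> ext0 q g p = g p.
Proof.
  intro H. unfold ext0.
  assert (E : exists r, (inTq q p -> r = g p) /\ (~ inTq q p -> r = 0)) by (exists (g p); tauto).
  apply (epsilon_spec (inhabits 0) _ E). auto.
Qed.

Lemma ext0_out q g p : ~ inTq q p -> ext0 q g p = 0.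
Proof.
  intro H. unfold ext0.
  assert (E : exists r, (inTq q p -> r = g p) /\ (~ inTq q p -> r = 0)) by (exists 0; tauto).
  apply (epsilon_spec (inhabits 0) _ E). auto.
Qed.

Lemma rsum_Sm k f : rsum k f = Sm (seq 0 k) f.
Proof.
  induction k as [|k IH]; auto. rewrite seq_S, Sm_app, <- IH. simpl. ring.
Qed.

Definition cells (n : nat) : list (nat * nat) := list_prod (seq 0 (Nat.pow 2 n)) (seq 0 (Nat.pow 2 n)).

Lemma Sm_list_prod {X Y} (l : list X) (l' : list Y) F :
  Sm (list_prod l l') F = Sm l (fun x => Sm l' (fun y => F (x, y))).
Proof.
  induction l as [|x l IH]; simpl; auto. rewrite Sm_app, Sm_map, IH. reflexivity.
Qed.

Definition KN (n : nat) : R := INR (Nat.pow 2 n).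

Lemma KN_ge1 n : 1 <= KN n.
Proof.
  unfold KN. replace 1 with (INR 1) by reflexivity. apply le_INR.
  pose proof (Nat.pow_nonzero 2 n ltac:(lia)). lia.
Qed.

Definition inCell (n : nat) (c : nat * nat) (p : R * R) : Prop :=
  in_closed (INR (fst c) / KN n) (INR (S (fst c)) / KN n) (-1 + 2 * INR (snd c) / KN n) (-1 + 2 * INR (S (snd c)) / KN n) p.
Definition inCello (n : nat) (c : nat * nat) (p : R * R) : Prop :=
  in_open (INR (fst c) / KN n) (INR (S (fst c)) / KN n) (-1 + 2 * INR (snd c) / KN n) (-1 + 2 * INR (S (snd c)) / KN n) p.

Definition cinf (h : R * R -> R) (n : nat) (c : nat * nat) : R := Rinf (cell_vals h n (fst c) (snd c)).

Lemma cell_vals_iff h n c y : cell_vals h n (fst c) (snd c) y <-> exists p, inCell n c p /\ y = h p.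
Proof.
  unfold cell_vals, inCell, in_closed, KN. split.
  - intros [p (h1 & h2 & h3)]; exists p; tauto.
  - intros [p ((h1 & h2) & h3)]; exists p; tauto.
Qed.

Lemma cell_corner n c : inCell n c (INR (fst c) / KN n, -1 + 2 * INR (snd c) / KN n).
Proof.
  pose proof (KN_ge1 n). unfold inCell, in_closed; simpl fst; simpl snd. rewrite !S_INR.
  assert (0 < / KN n) by (apply inv_pos; lra). unfold Rdiv. nra.
Qed.

Lemma cinf_spec h n c b : (forall p, inCell n c p -> b <= h p) ->
  (forall p, inCell n c p -> cinf h n c <= h p) /\
  (forall m, (forall p, inCell n c p -> m <= h p) -> m <= cinf h n c).
Proof.
  intro Hb. unfold cinf.
  assert (G : is_glb (cell_vals h n (fst c) (snd c)) (Rinf (cell_vals h n (fst c) (snd c)))).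
  { apply (Rinf_spec _ b).
    - exists (h (INR (fst c) / KN n, -1 + 2 * INR (snd c) / KN n)). apply cell_vals_iff.
      eexists; split; [apply cell_corner|reflexivity].
    - intros x Hx. apply cell_vals_iff in Hx. destruct Hx as [p [Hp ->]]. auto. }
  destruct G as [G1 G2]. split.
  - intros p Hp. apply G1. apply cell_vals_iff. eauto.
  - intros m Hm. apply G2. intros x Hx. apply cell_vals_iff in Hx. destruct Hx as [p [Hp ->]]. auto.
Qed.

Lemma lower_sum_cells h n : lower_sum h n = 2 / KN n ^ 2 * Sm (cells n) (cinf h n).
Proof.
  unfold lower_sum, cells. rewrite rsum_Sm, Sm_list_prod, <- Sm_scal.
  apply Sm_ext. intros i _. rewrite rsum_Sm, <- Sm_scal. apply Sm_ext. intros j _.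
  unfold cinf. simpl fst; simpl snd. fold (KN n). pose proof (KN_ge1 n). field. lra.
Qed.

Lemma cell_disjoint n c c' p : inCello n c p -> inCello n c' p -> c = c'.
Proof.
  pose proof (KN_ge1 n) as HK. assert (HI : 0 < / KN n) by (apply inv_pos; lra).
  destruct c as [i j], c' as [i' j']. unfold inCello, in_open; simpl fst; simpl snd.
  rewrite !S_INR. unfold Rdiv. intros (h1 & h2) (h3 & h4).
  assert (L : forall x y : nat, INR x < INR y + 1 -> (x <= y)%nat).
  { intros x y Hxy. rewrite <- S_INR in Hxy. apply INR_lt in Hxy. lia. }
  assert (C : forall x y, x * / KN n < y * / KN n -> x < y) by (intros x y; apply Rmult_lt_reg_r; auto).
  f_equal; apply Nat.le_antisymm; apply L; apply C; lra.
Qed.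

Lemma NoDup_prod {X Y} (l : list X) (l' : list Y) : NoDup l -> NoDup l' -> NoDup (list_prod l l').
Proof.
  intros Hl Hl'. induction Hl as [|x l Hx Hl IH]; simpl; [constructor|].
  apply NoDup_app; auto.
  - apply FinFun.Injective_map_NoDup; auto. intros a b E; congruence.
  - intros [a b] Ha Hb. apply in_map_iff in Ha. destruct Ha as [y [E _]]. injection E as <- <-.
    apply in_prod_iff in Hb. tauto.
Qed.

Lemma cells_NoDup n : NoDup (cells n).
Proof. apply NoDup_prod; apply seq_NoDup. Qed.

Lemma ev_all_list {X} (L : list X) (P : X -> R -> Prop) :
  (forall x, In x L -> exists T, forall t, T <= t -> P x t) ->
  exists T, forall x, In x L -> forall t, T <= t -> P x t.
Proof.
  induction L as [|x L IH]; intro H.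
  - exists 0. simpl; tauto.
  - destruct IH as [T1 HT1]. { intros; apply H; simpl; auto. }
    destruct (H x (or_introl eq_refl)) as [T2 HT2].
    exists (Rmax T1 T2). intros y Hy t Ht.
    assert (T1 <= t) by (eapply Rle_trans; [apply Rmax_l|apply Ht]).
    assert (T2 <= t) by (eapply Rle_trans; [apply Rmax_r|apply Ht]).
    destruct Hy as [<-|Hy]; auto.
Qed.

(** A cell on which the zero extension has positive infimum lies inside T^q, so [cell_lower] applies
    to it; the other cells contribute 0. Each cell's error is weighted by its infimum, hence the
    choice [e' = e / (1 + M)]. *)
Lemma sum_lower q (hq : (3 <= q)%nat) kap : 0 <= kap -> is_density q kap ->
  forall h n A I al be e, (forall p, inTq q p -> 0 <= h p) ->
  det A = 1 -> al < be -> itv I al be -> 0 < e ->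
  exists T, forall t l phi, T <= t -> enumv q A I t l -> FTRs q A t l phi ->
   (be - al) * (2 * kap / lambda_q q) * lower_sum (ext0 q h) n - e <=
   Sm l (fun v => h (phi v)) / t ^ 2.
Proof.
  intros Hk DK h n A I al be e Hh D Hab HI He.
  pose proof (KN_ge1 n) as HK1. set (K := (be - al) * (2 * kap / lambda_q q)).
  assert (Hpos : forall p, 0 <= ext0 q h p).
  { intro p. destruct (classic (inTq q p)); [rewrite ext0_in|rewrite ext0_out]; auto; lra. }
  set (m := cinf (ext0 q h) n).
  assert (Hm : forall c, (forall p, inCell n c p -> m c <= ext0 q h p) /\ 0 <= m c).
  { intro c. destruct (cinf_spec (ext0 q h) n c 0) as [m1 m2]; auto. }
  set (M := Sm (cells n) m).
  assert (HM : 0 <= M) by (apply Sm_nonneg; intros; apply Hm).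
  set (e' := e / (1 + M)).
  assert (He' : 0 < e') by (apply Rdiv_lt_0_compat; lra).
  assert (HeM : e' * M <= e).
  { assert (e' * (1 + M) = e) by (unfold e'; field; lra). nra. }
  destruct (ev_all_list (cells n) (fun c t => forall l phi, enumv q A I t l -> FTRs q A t l phi ->
     m c * (K * (2 / KN n ^ 2) - e') <= m c * (Sm l (fun v => if bdec (inCello n c (phi v)) then 1 else 0) / t ^ 2))) as [T HT].
  { intros c Hc. destruct (Hm c) as [m1 m2]. destruct (Req_EM_T (m c) 0) as [E|E].
    - exists 0. intros. rewrite E. lra.
    - assert (G : forall p, inCell n c p -> inTq q p).
      { intros p Hp. apply NNPP. intro Np. specialize (m1 p Hp). rewrite ext0_out in m1 by auto. lra. }
      assert (HI' : 0 < / KN n) by (apply inv_pos; lra).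
      assert (w1 : INR (fst c) / KN n < INR (S (fst c)) / KN n) by (rewrite S_INR; unfold Rdiv; nra).
      assert (w2 : -1 + 2 * INR (snd c) / KN n <= -1 + 2 * INR (S (snd c)) / KN n)
        by (rewrite S_INR; unfold Rdiv; nra).
      destruct (cell_lower q hq kap Hk DK _ _ _ _ A I al be e' w1 w2 G D Hab HI He') as [T HT].
      exists T. intros t Ht l phi Hl HF. apply Rmult_le_compat_l; auto.
      eapply Rle_trans; [|apply (HT t Ht l phi Hl HF)]. right. unfold K. rewrite !S_INR. field.
      pose proof (lam_bounds q hq). split; lra. }
  exists (Rmax T 1). intros t l phi Ht Hl HF.
  assert (tT : T <= t) by (eapply Rle_trans; [apply Rmax_l|apply Ht]).
  assert (t1 : 1 <= t) by (eapply Rle_trans; [apply Rmax_r|apply Ht]).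
  assert (Pt : 0 < / t ^ 2) by (apply inv_pos; nra).
  apply Rle_trans with (Sm (cells n) (fun c => m c * (K * (2 / KN n ^ 2) - e'))).
  - rewrite lower_sum_cells. fold m. rewrite (Sm_ext (cells n) (fun c => m c * (K * (2 / KN n ^ 2) - e')) (fun c => (K * (2 / KN n ^ 2) - e') * m c)) by (intros; ring).
    rewrite Sm_scal. fold M. lra.
  - eapply Rle_trans; [apply Sm_le; intros c Hc; apply (HT c Hc t tT l phi Hl HF)|].
    rewrite (Sm_ext _ _ (fun c => / t ^ 2 * Sm l (fun v => m c * (if bdec (inCello n c (phi v)) then 1 else 0)))).
    2: { intros c _. rewrite (Sm_scal l (m c) (fun v => if bdec (inCello n c (phi v)) then 1 else 0)). unfold Rdiv. ring. }
    rewrite Sm_scal, Rmult_comm. unfold Rdiv. apply Rmult_le_compat_r; [lra|].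
    rewrite Sm_swap. apply Sm_le. intros v Hv.
    pose proof (proj1 (HF v Hv)) as Tv.
    destruct (classic (exists c, In c (cells n) /\ inCello n c (phi v))) as [[c [Hc Pc]]|N].
    + destruct (in_split _ _ Hc) as [l1 [l2 E]]. rewrite E, Sm_remove.
      rewrite (proj2 (bdec_true _) Pc). rewrite Sm_zero.
      * rewrite Rmult_1_r, Rplus_0_r. rewrite <- (ext0_in q h) by auto. apply Hm.
        unfold inCello, in_open in Pc. unfold inCell, in_closed. lra.
      * intros c' Hc'. rewrite (proj2 (bdec_false _)); [ring|]. intro Pc'.
        assert (c' = c) by (eapply cell_disjoint; eauto). subst c'.
        pose proof (cells_NoDup n) as ND. rewrite E in ND. apply NoDup_remove_2 in ND. auto.
    + rewrite Sm_zero; [now apply Hh|]. intros c Hc. rewrite (proj2 (bdec_false _)); [ring|].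
      intro; apply N; eauto.
Qed.

(** * The roof [Rq] and the gaps between consecutive slopes *)

Lemma sq_cassini q (hq : (3 <= q)%nat) i : sq q (S i) ^ 2 - sq q i * sq q (S (S i)) = 1.
Proof.
  induction i as [|i IH].
  - rewrite sq_1, sq_0 by auto. ring.
  - rewrite (sq_rec q hq (S i)). rewrite <- IH. rewrite (sq_rec q hq i). ring.
Qed.

Lemma Lam_w q (hq : (3 <= q)%nat) i : inLambda q (sq q (S i), sq q i).
Proof.
  induction i as [|i IH].
  - rewrite sq_1, sq_0 by auto. apply Lam_e1.
  - replace (sq q (S (S i)), sq q (S i)) with (mapp (mat_T q) (mapp mat_S (sq q (S i), sq q i))).
    + apply Lam_mapp; [apply hecke_gT|]. apply Lam_mapp; auto using hecke_gS.
    + rewrite (sq_rec q hq i). unfold mapp, mat_T, mat_S; simpl; f_equal; ring.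
Qed.

Definition Dq (q : nat) : R := / sin (PI / INR q).

Lemma Dq_ge1 q (hq : (3 <= q)%nat) : 1 <= Dq q.
Proof. rewrite <- (sq_1 q hq). apply sq_le; auto. Qed.

(* w is the first of the fan vectors (s_(i+1), s_i), 2 <= i <= q - 1, that g_(a,b) maps to first coordinate at most 1; a <= 1 forces that coordinate to be positive. *)
Lemma first_in_fan q (hq : (3 <= q)%nat) p : inTq q p ->
  exists w, inLambda q w /\ 0 < zx (mat_g (fst p) (snd p)) w <= 1 /\
    0 < zsl (mat_g (fst p) (snd p)) w /\
    zsl (mat_g (fst p) (snd p)) w * (fst p * zx (mat_g (fst p) (snd p)) w) <= Dq q /\
    1 - Dq q * zx (mat_g (fst p) (snd p)) w <= fst p.
Proof.
  intros [[Ha1 Ha2] [Hb1 Hb2]]. set (a := fst p) in *. set (b := snd p) in *. clearbody a b.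
  set (l := fun i => a * sq q (S i) + b * sq q i).
  assert (E : exists i, (2 <= i <= q - 1)%nat /\ l i <= 1 /\ 1 < l (i - 1)%nat).
  { assert (K : forall j, (1 <= j <= q - 1)%nat -> l j <= 1 ->
      exists i, (2 <= i <= q - 1)%nat /\ l i <= 1 /\ 1 < l (i - 1)%nat).
    { induction j as [|j IH]; intros Hj Hlj; [lia|].
      destruct (Nat.eq_dec j 0) as [->|].
      - unfold l in Hlj. rewrite sq_rec, sq_1, sq_0 in Hlj by auto. lra.
      - destruct (Rle_lt_dec (l j) 1) as [h|h]; [apply IH; auto; lia|].
        exists (S j). repeat split; auto; try lia. now replace (S j - 1)%nat with j by lia. }
    apply (K (q - 1)%nat); [lia|]. unfold l. replace (S (q - 1)) with q by lia.
    rewrite sq_q, sq_q1 by auto. lra. }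
  destruct E as [i (Hi & L1 & L2)]. destruct i as [|i]; [lia|].
  replace (S i - 1)%nat with i in L2 by lia.
  pose proof (sq_ge1 q hq (S i) ltac:(lia)) as S1. pose proof (sq_ge0 q hq i ltac:(lia)) as S0.
  pose proof (sq_le q hq (S i)) as S2. pose proof (sq_le q hq i) as S3. fold (Dq q) in S2, S3.
  assert (Id : a = sq q (S i) * l i - sq q i * l (S i)).
  { unfold l. pose proof (sq_cassini q hq i). 
    replace (sq q (S i) * (a * sq q (S i) + b * sq q i) - sq q i * (a * sq q (S (S i)) + b * sq q (S i)))
     with (a * (sq q (S i) ^ 2 - sq q i * sq q (S (S i)))) by ring. rewrite H. ring. }
  assert (L0 : 0 < l (S i)).
  { apply Rnot_le_lt. intro h. assert (0 <= sq q i * - l (S i)) by (apply Rmult_le_pos; lra). nra. }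
  exists (sq q (S (S i)), sq q (S i)). 
  assert (Ex : zx (mat_g a b) (sq q (S (S i)), sq q (S i)) = l (S i)).
  { unfold zx, mapp, mat_g, l; simpl. ring. }
  assert (Es : zsl (mat_g a b) (sq q (S (S i)), sq q (S i)) = sq q (S i) / (a * l (S i))).
  { unfold zsl, slope. fold (zx (mat_g a b) (sq q (S (S i)), sq q (S i))). rewrite Ex.
    unfold mapp, mat_g; simpl. field. split; lra. }
  rewrite Ex, Es. repeat split; auto using Lam_w; try lra.
  - apply Rdiv_lt_0_compat; [lra|]. apply Rmult_lt_0_compat; lra.
  - replace (sq q (S i) / (a * l (S i)) * (a * l (S i))) with (sq q (S i)) by (field; split; lra). auto.
  - assert (sq q i * l (S i) <= Dq q * l (S i)) by (apply Rmult_le_compat_r; lra). nra.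
Qed.

Lemma list_min {X} (F : X -> R) l : l <> nil -> exists x, In x l /\ forall y, In y l -> F x <= F y.
Proof.
  induction l as [|x l IH]; [congruence|]. intros _.
  destruct l as [|y l].
  - exists x. simpl; split; auto. intros z [<-|[]]; lra.
  - destruct IH as [m [Hm HM]]; [congruence|].
    destruct (Rle_lt_dec (F x) (F m)).
    + exists x. split; [left; auto|]. intros z [<-|Hz]; [lra|]. specialize (HM z Hz). lra.
    + exists m. split; [right; auto|]. intros z [<-|Hz]; [lra|]. auto.
Qed.

(** The fan vector provides one admissible slope, and only finitely many slopes in the unit strip
    lie between 0 and it, so the minimum is attained. *)
Lemma Rq_spec q (hq : (3 <= q)%nat) p : inTq q p -> Rq_is q (fst p) (snd p) (Rq q p).
Proof.
  intro Hp. unfold Rq. apply epsilon_spec.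
  destruct (first_in_fan q hq p Hp) as [w (w1 & w2 & w3 & _)].
  set (z := mat_g (fst p) (snd p)) in *.
  assert (Dz : det z = 1) by (apply det_g; destruct Hp; lra).
  destruct (enum_slopes q hq z 1 0 (zsl z w) Dz ltac:(lra)) as [l [ND Hl]].
  set (l' := filter (fun v => bdec (0 < zsl z v)) l).
  assert (Hl' : forall v, In v l' <-> inLambda q v /\ 0 < zx z v <= 1 /\ 0 < zsl z v <= zsl z w).
  { intro v. unfold l'. rewrite filter_In, bdec_true, Hl. split.
    - intros ((h1 & h2 & h3 & h4) & h5). repeat split; auto; tauto.
    - intros (h1 & h2 & h3 & h4). repeat split; auto; try tauto; lra. }
  assert (Hw : In w l') by (apply Hl'; repeat split; auto; lra).
  destruct (list_min (zsl z) l') as [m [Hm HM]]. { intro E; rewrite E in Hw; destruct Hw. }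
  apply Hl' in Hm. destruct Hm as (m1 & m2 & m3).
  exists (zsl z m). split.
  - exists (mapp z m). split; [exists m; auto|]. unfold inStrip. fold (zx z m) (zsl z m). repeat split; tauto.
  - intros u [v [Hv ->]] Hs Hpos. fold z in Hs, Hpos |- *. fold (zsl z v) in Hpos |- *.
    unfold inStrip in Hs. fold (zx z v) in Hs.
    destruct (Rle_lt_dec (zsl z v) (zsl z w)).
    + apply HM, Hl'. repeat split; auto; tauto.
    + lra.
Qed.

Lemma Rq_pos q (hq : (3 <= q)%nat) p : inTq q p -> 0 < Rq q p.
Proof.
  intro Hp. destruct (Rq_spec q hq p Hp) as [[u (_ & _ & h & <-)] _]. auto.
Qed.

Lemma Rq_le q (hq : (3 <= q)%nat) p w : inTq q p -> inLambda q w ->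
  0 < zx (mat_g (fst p) (snd p)) w <= 1 -> 0 < zsl (mat_g (fst p) (snd p)) w ->
  Rq q p <= zsl (mat_g (fst p) (snd p)) w.
Proof.
  intros Hp Hw H1 H2. destruct (Rq_spec q hq p Hp) as [_ H]. apply H; auto. exists w; auto.
Qed.

Lemma zsl_zof A t v v' : 0 < t -> zx A v' <> 0 -> zsl (zof A t v) v' = (zsl A v' - zsl A v) * t ^ 2.
Proof.
  intros Ht Hx. unfold zof. rewrite zsl_sh; auto using inv_pos. field. lra.
Qed.

(** [zof] sends [v] to slope 0, multiplies slope differences by [t^2] and turns the strip of width
    [t] into the unit strip. The next slope therefore corresponds to the smallest positive slope of
    the normalised lattice. *)
Lemma gap_next q (hq : (3 <= q)%nat) A t v p : det A = 1 -> inLambda q v -> 0 < zx A v -> 0 < t ->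
  FTR_is q A t (mapp A v) p ->
  0 < Rq q p / t ^ 2 /\
  (exists v', inLambda q v' /\ 0 < zx A v' <= t /\ zsl A v' = zsl A v + Rq q p / t ^ 2) /\
  (forall v', inLambda q v' -> 0 < zx A v' <= t -> zsl A v < zsl A v' -> zsl A v + Rq q p / t ^ 2 <= zsl A v').
Proof.
  intros D Hv Hx Ht [Hp HF]. fold (zsl A v) in HF. fold (zof A t v) in HF.
  assert (t2 : 0 < t ^ 2) by nra. assert (it2 : 0 < / t ^ 2) by now apply inv_pos.
  pose proof (Rq_pos q hq p Hp) as RP. destruct (Rq_spec q hq p Hp) as [[u (u1 & u2 & u3 & u4)] Rmin].
  assert (Cx : forall v', 0 < zx A v' <= t <-> 0 < zx (zof A t v) v' <= 1).
  { intro v'. rewrite zof_x. split; intros [h1 h2].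
    - split; [apply Rdiv_lt_0_compat; lra|]. apply (Rmult_le_reg_r t); auto.
      unfold Rdiv. rewrite Rmult_assoc, Rinv_l; lra.
    - replace (zx A v') with (zx A v' / t * t) by (field; lra). split; nra. }
  split; [|split].
  - apply Rdiv_lt_0_compat; auto.
  - apply HF in u1. destruct u1 as [v' [Hv' E]]. rewrite E in *.
    unfold inStrip in u2. fold (zx (zof A t v) v') in u2. apply Cx in u2.
    fold (zsl (zof A t v) v') in u4. rewrite zsl_zof in u4 by lra.
    exists v'. repeat split; try tauto. rewrite <- u4. field. lra.
  - intros v' Hv' Hx' Hs.
    assert (Rq q p <= (zsl A v' - zsl A v) * t ^ 2).
    { rewrite <- zsl_zof by lra. apply Rmin.
      - apply HF. exists v'; auto.
      - unfold inStrip. fold (zx (zof A t v) v'). now apply Cx.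
      - fold (zsl (zof A t v) v'). rewrite zsl_zof by lra. apply Rmult_lt_0_compat; lra. }
    apply (Rmult_le_compat_r (/ t ^ 2)) in H; [|lra]. rewrite Rmult_assoc, Rinv_r in H by lra.
    unfold Rdiv. lra.
Qed.

(* v' is v itself or the image of the fan vector, whichever has the smaller first coordinate. *)
Lemma gap_charge q (hq : (3 <= q)%nat) A t v p dl : det A = 1 -> inLambda q v -> 0 < zx A v -> 0 < t ->
  FTR_is q A t (mapp A v) p -> 0 < dl -> dl <= 1 / 4 -> dl * (2 * Dq q) <= 1 -> Dq q / dl ^ 2 < Rq q p ->
  exists v', inLambda q v' /\ 0 < zx A v' <= dl * t /\
    zsl A v' - 2 * Dq q / (t * zx A v') <= zsl A v /\
    zsl A v + Rq q p / t ^ 2 <= zsl A v' + 2 * Dq q / (t * zx A v').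
Proof.
  intros D Hv Hx Ht HF Hdl Hd4 HdD HR. pose proof (proj1 HF) as Hp.
  destruct (FTR_coords q hq A t v p D Hv Hx Ht HF) as [Ea _].
  pose proof (Dq_ge1 q hq) as HD. pose proof (lam_bounds q hq) as Hlam.
  pose proof (Rq_pos q hq p Hp) as RP.
  destruct (first_in_fan q hq p Hp) as [w (w1 & w2 & w3 & w4 & w5)].
  pose proof (Rq_le q hq p w Hp w1 w2 w3) as Rw.
  set (ll := zx (mat_g (fst p) (snd p)) w) in *.
  destruct Hp as [[Ha1 Ha2] [Hb1 Hb2]].
  (* A large [Rq] forces the product of the two first coordinates [a] and [ll] to be small, so the
     smaller of them is below [dl]; the case split picks that one. *)
  assert (Hprod : fst p * ll < dl ^ 2).
  { assert (0 < dl ^ 2) by nra. assert (Hal : 0 < fst p * ll) by (apply Rmult_lt_0_compat; lra).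
    apply Rnot_le_lt. intro h.
    assert (Rq q p * (fst p * ll) <= Dq q).
    { eapply Rle_trans; [|apply w4]. apply Rmult_le_compat_r; lra. }
    assert (Dq q < Rq q p * dl ^ 2).
    { apply (Rmult_lt_compat_r (dl ^ 2)) in HR; auto. replace (Dq q / dl ^ 2 * dl ^ 2) with (Dq q) in HR by (field; lra). auto. }
    nra. }
  assert (t2 : 0 < t ^ 2) by nra.
  destruct (Rle_lt_dec (fst p) ll) as [h|h].
  - assert (Had : fst p < dl) by nra.
    exists v. assert (Ex : zx A v = fst p * t) by (rewrite Ea; field; lra).
    split; auto. split; [rewrite Ex; nra|].
    assert (C0 : 0 < 2 * Dq q / (t * zx A v)) by (apply Rdiv_lt_0_compat; [lra|apply Rmult_lt_0_compat; lra]).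
    split; [lra|]. apply Rplus_le_compat_l.
    (* For small [a] the condition [b > 1 - lambda a] keeps [b] away from 0, and testing with [e2]
       gives [Rq <= 1/(a b)]. *)
    assert (Hb : 1 / 2 <= snd p) by nra.
    assert (Hx2 : zx (mat_g (fst p) (snd p)) e2 = snd p) by (unfold zx, mapp, mat_g, e2; simpl; ring).
    assert (Hs2 : zsl (mat_g (fst p) (snd p)) e2 = / (fst p * snd p)).
    { unfold zsl, slope. fold (zx (mat_g (fst p) (snd p)) e2). rewrite Hx2. unfold mapp, mat_g, e2; simpl. field. split; lra. }
    assert (Rq q p <= / (fst p * snd p)).
    { rewrite <- Hs2. apply (Rq_le q hq p e2); [unfold inTq; lra|apply Lam_e2|rewrite Hx2; lra|].
      rewrite Hs2. apply inv_pos. nra. }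
    assert (/ (fst p * snd p) <= 2 * / fst p).
    { rewrite Rinv_mult. rewrite Rmult_comm. apply Rmult_le_compat_r; [left; now apply inv_pos|].
      replace 2 with (/ (1 / 2)) by field. apply Rinv_le_contravar; lra. }
    rewrite Ex. replace (2 * Dq q / (t * (fst p * t))) with (2 * Dq q * / fst p * / t ^ 2) by (field; split; lra).
    unfold Rdiv. apply Rmult_le_compat_r; [left; now apply inv_pos|].
    assert (0 < / fst p) by now apply inv_pos. nra.
  - assert (Hld : ll < dl) by nra.
    destruct HF as [_ HF]. fold (zsl A v) in HF. fold (zof A t v) in HF.
    destruct (proj2 (HF (mapp (mat_g (fst p) (snd p)) w))) as [v' [Hv' E]]. { exists w; auto. }
    assert (Ex : zx A v' = ll * t).
    { unfold ll, zx at 2. rewrite E. fold (zx (zof A t v) v'). rewrite zof_x. field. lra. }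
    assert (Hx' : 0 < zx A v') by (rewrite Ex; apply Rmult_lt_0_compat; lra).
    assert (Es : zsl A v' = zsl A v + zsl (mat_g (fst p) (snd p)) w / t ^ 2).
    { unfold zsl at 3. rewrite E. fold (zsl (zof A t v) v'). rewrite zsl_zof by lra. field. lra. }
    exists v'. split; auto. split; [split; auto; rewrite Ex; nra|].
    assert (it2 : 0 < / t ^ 2) by now apply inv_pos.
    assert (Hl0 : 0 < ll) by lra.
    assert (zsl (mat_g (fst p) (snd p)) w / t ^ 2 <= 2 * Dq q / (t * zx A v')).
    { rewrite Ex. replace (2 * Dq q / (t * (ll * t))) with (2 * Dq q / ll * / t ^ 2) by (field; split; lra).
      unfold Rdiv at 1. apply Rmult_le_compat_r; [lra|].
      apply (Rmult_le_reg_r ll); auto. replace (2 * Dq q / ll * ll) with (2 * Dq q) by (field; lra).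
      assert (1 / 2 <= fst p) by nra.
      assert (0 < zsl (mat_g (fst p) (snd p)) w * ll) by (apply Rmult_lt_0_compat; lra). nra. }
    assert (Rq q p / t ^ 2 <= zsl (mat_g (fst p) (snd p)) w / t ^ 2) by (apply Rmult_le_compat_r; lra).
    assert (0 < 2 * Dq q / (t * zx A v')) by (apply Rdiv_lt_0_compat; [lra|apply Rmult_lt_0_compat; lra]).
    split; lra.
Qed.

Lemma enumv_FTR q A I t l phi v : enumv q A I t l -> FTRs q A t l phi -> In v l ->
  inLambda q v /\ 0 < zx A v <= t /\ I (zsl A v) /\ FTR_is q A t (mapp A v) (phi v).
Proof. intros [_ H] HF Hv. specialize (HF v Hv). apply H in Hv. tauto. Qed.

Lemma slopes_neq q (hq : (3 <= q)%nat) A v w : det A = 1 -> inLambda q v -> inLambda q w ->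
  0 < zx A v -> 0 < zx A w -> v <> w -> zsl A v <> zsl A w.
Proof.
  intros D h1 h2 h3 h4 N E. pose proof (slope_sep q hq A v w D h1 h2 h3 h4 N) as S.
  rewrite E, Rminus_diag, Rabs_R0, Rmult_0_l in S. lra.
Qed.

(** Gaps are disjoint and start in the interval; the truncation at [B] limits how far the last one
    overshoots the right end. *)
Lemma gaps_upper q (hq : (3 <= q)%nat) A I al be t l phi B : det A = 1 -> al < be -> itv I al be -> 0 < t ->
  0 <= B -> enumv q A I t l -> FTRs q A t l phi ->
  Sm l (fun v => Rmin (Rq q (phi v)) B) / t ^ 2 <= be - al + B / t ^ 2.
Proof.
  intros D Hab HI Ht HB Hl HF.
  assert (it2 : 0 < / t ^ 2) by (apply inv_pos; nra).
  assert (Hb : 0 <= B / t ^ 2) by (unfold Rdiv; apply Rmult_le_pos; lra).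
  replace (Sm l (fun v => Rmin (Rq q (phi v)) B) / t ^ 2) with
    (Sm l (fun v => (zsl A v + / t ^ 2 * Rmin (Rq q (phi v)) B) - zsl A v)).
  2: { rewrite (Sm_ext l _ (fun v => / t ^ 2 * Rmin (Rq q (phi v)) B)) by (intros; ring).
    rewrite Sm_scal. unfold Rdiv. ring. }
  replace (be - al + B / t ^ 2) with ((be + B / t ^ 2) - al) by ring.
  assert (Hle : forall v, / t ^ 2 * Rmin (Rq q (phi v)) B <= Rq q (phi v) / t ^ 2 /\
     / t ^ 2 * Rmin (Rq q (phi v)) B <= B / t ^ 2).
  { intro v. unfold Rdiv. rewrite !(Rmult_comm _ (/ t ^ 2)). 
    split; apply Rmult_le_compat_l; try lra; [apply Rmin_l|apply Rmin_r]. }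
  apply (pack _ _ (length l)); auto; try lra.
  - apply Hl.
  - intros v Hv. destruct (enumv_FTR q A I t l phi v Hl HF Hv) as (v1 & v2 & v3 & v4).
    apply (proj2 HI) in v3. pose proof (Rq_pos q hq _ (proj1 v4)). specialize (Hle v).
    assert (0 <= / t ^ 2 * Rmin (Rq q (phi v)) B).
    { apply Rmult_le_pos; [lra|]. apply Rmin_glb; lra. }
    lra.
  - assert (K : forall v w, In v l -> In w l -> zsl A v < zsl A w ->
      zsl A v + / t ^ 2 * Rmin (Rq q (phi v)) B <= zsl A w).
    { intros v w Hv Hw Hs.
      destruct (enumv_FTR q A I t l phi v Hl HF Hv) as (v1 & v2 & v3 & v4).
      destruct (enumv_FTR q A I t l phi w Hl HF Hw) as (w1 & w2 & w3 & w4).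
      destruct (gap_next q hq A t v (phi v) D v1 (proj1 v2) Ht v4) as (_ & _ & G).
      specialize (G w w1 w2 Hs). specialize (Hle v). lra. }
    intros v w Hv Hw N.
    destruct (enumv_FTR q A I t l phi v Hl HF Hv) as (v1 & v2 & v3 & v4).
    destruct (enumv_FTR q A I t l phi w Hl HF Hw) as (w1 & w2 & w3 & w4).
    pose proof (slopes_neq q hq A v w D v1 w1 (proj1 v2) (proj1 w2) N) as NE.
    destruct (Rtotal_order (zsl A v) (zsl A w)) as [h|[h|h]]; [left|contradiction|right]; apply K; auto.
Qed.

Lemma union_weight {X Y} (l : list X) (V : list Y) (P : Y -> X -> Prop) (F : X -> R) :
  (forall x, In x l -> 0 <= F x) -> (forall x, In x l -> exists y, In y V /\ P y x) ->
  Sm l F <= Sm V (fun y => Sm l (fun x => if bdec (P y x) then F x else 0)).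
Proof.
  intros HF H.
  rewrite <- (Sm_swap l V (fun x y => if bdec (P y x) then F x else 0)).
  apply Sm_le. intros x Hx. destruct (H x Hx) as [y [Hy Py]].
  apply Rle_trans with (if bdec (P y x) then F x else 0).
  - rewrite (proj2 (bdec_true _)); auto; lra.
  - apply (Sm_one_le V y (fun y => if bdec (P y x) then F x else 0)); auto.
    intros; destruct (bdec _); auto; lra.
Qed.

(** By [gap_charge], long gaps lie in intervals of radius [C/(t x')] about the slopes of vectors
    with [x' <= dl t]. These intervals are [2 C dl] times as long as the disjoint ones of
    [pack_slopes] at level [dl t], so their total length is [O(dl)]. *)
Lemma long_gaps q (hq : (3 <= q)%nat) A I al be e : det A = 1 -> al < be -> itv I al be -> 0 < e ->
  exists B T, 0 < B /\ forall t l phi, T <= t -> 1 <= t -> enumv q A I t l -> FTRs q A t l phi ->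
    Sm (filter (fun v => bdec (B < Rq q (phi v))) l) (fun v => Rq q (phi v) / t ^ 2) <= e.
Proof.
  intros D Hab HI He. pose proof (Dq_ge1 q hq) as HD.
  set (C := 2 * Dq q). assert (HC : 2 <= C) by (unfold C; lra).
  set (w := be - al + 3). assert (Hw : 3 < w) by (unfold w; lra).
  set (dl := Rmin (1 / 4) (Rmin (/ C) (e / (2 * C * w)))).
  assert (Hdl : 0 < dl).
  { repeat apply Rmin_pos; try lra; [apply inv_pos; lra|]. apply Rdiv_lt_0_compat; auto.
    apply Rmult_lt_0_compat; lra. }
  assert (Hdl1 : dl <= 1 / 4) by apply Rmin_l.
  assert (Hdl2 : dl * C <= 1).
  { apply Rle_trans with (/ C * C); [|rewrite Rinv_l; lra]. apply Rmult_le_compat_r; [lra|].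
    unfold dl. eapply Rle_trans; [apply Rmin_r|apply Rmin_l]. }
  assert (Hdl3 : 2 * C * dl * w <= e).
  { apply Rle_trans with (2 * C * (e / (2 * C * w)) * w).
    - apply Rmult_le_compat_r; [lra|]. apply Rmult_le_compat_l; [lra|].
      unfold dl. eapply Rle_trans; [apply Rmin_r|apply Rmin_r].
    - right. field. split; lra. }
  clearbody dl.
  destruct (boxfree_ex q hq A D) as [d [Hd BF]].
  set (M := Rabs al + Rabs be + 1).
  assert (HM : 1 <= M) by (unfold M; pose proof (Rabs_pos al); pose proof (Rabs_pos be); lra).
  (* A lower bound for the first coordinates of the charged vectors, from the absence of short
     vectors in the lattice; for large [t] it keeps their slopes within distance 1 of the
     interval. *)
  set (x0 := Rmin (d / (2 * M)) (d / 2)).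
  assert (Hx0 : 0 < x0).
  { apply Rmin_pos; apply Rdiv_lt_0_compat; lra. }
  assert (Hx0M : x0 * M <= d / 2).
  { apply Rle_trans with (d / (2 * M) * M); [|right; field; lra].
    apply Rmult_le_compat_r; [lra|apply Rmin_l]. }
  assert (Hx0d : x0 <= d / 2) by apply Rmin_r.
  clearbody x0.
  exists (Dq q / dl ^ 2), (2 * C / d + C / x0 + / (dl * x0)).
  assert (Hd2 : 0 < dl ^ 2) by nra.
  split; [apply Rdiv_lt_0_compat; lra|].
  intros t l phi Ht t1 Hl HF.
  assert (Q1 : 0 < 2 * C / d) by (apply Rdiv_lt_0_compat; lra).
  assert (Q2 : 0 < C / x0) by (apply Rdiv_lt_0_compat; lra).
  assert (Q3 : 0 < / (dl * x0)) by (apply inv_pos, Rmult_lt_0_compat; lra).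
  assert (Td : 2 * C <= t * d).
  { assert (h : 2 * C / d <= t) by lra. apply (Rmult_le_compat_r d) in h; [|lra].
    replace (2 * C / d * d) with (2 * C) in h by (field; lra). auto. }
  assert (Tx : C <= t * x0).
  { assert (h : C / x0 <= t) by lra. apply (Rmult_le_compat_r x0) in h; [|lra].
    replace (C / x0 * x0) with C in h by (field; lra). auto. }
  assert (Tdx : 1 <= t * (dl * x0)).
  { assert (h : / (dl * x0) <= t) by lra. apply (Rmult_le_compat_r (dl * x0)) in h; [|nra].
    rewrite Rinv_l in h by nra. auto. }
  destruct (enum_slopes q hq A (dl * t) (al - 1) (be + 1) D ltac:(apply Rmult_lt_0_compat; lra)) as [V [NV HV]].
  set (V' := filter (fun v => bdec (x0 <= zx A v)) V).
  set (P := fun v' v => zsl A v' - C / (t * zx A v') <= zsl A v /\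
     zsl A v + Rq q (phi v) / t ^ 2 <= zsl A v' + C / (t * zx A v')).
  set (lb := filter (fun v => bdec (Dq q / dl ^ 2 < Rq q (phi v))) l).
  assert (Hlb : forall v, In v lb -> In v l /\ Dq q / dl ^ 2 < Rq q (phi v)).
  { intros v Hv. apply filter_In in Hv. destruct Hv as [h1 h2]. apply bdecT in h2. auto. }
  assert (it2 : 0 < / t ^ 2) by (apply inv_pos; nra).
  assert (Rp : forall v, In v l -> 0 < Rq q (phi v) / t ^ 2).
  { intros v Hv. destruct (enumv_FTR q A I t l phi v Hl HF Hv) as (v1 & v2 & v3 & v4).
    apply (gap_next q hq A t v (phi v)); auto; lra. }
  assert (HV' : forall v, In v V' -> inLambda q v /\ x0 <= zx A v <= dl * t /\ al - 1 <= zsl A v <= be + 1).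
  { intros v Hv. apply filter_In in Hv. destruct Hv as [h1 h2]. apply bdecT in h2. apply HV in h1. tauto. }
  eapply Rle_trans; [apply (union_weight lb V' P)|].
  - intros v Hv. destruct (Hlb v Hv) as [h1 _]. left; auto.
  - intros v Hv. destruct (Hlb v Hv) as [h1 h2].
    destruct (enumv_FTR q A I t l phi v Hl HF h1) as (v1 & v2 & v3 & v4).
    destruct (gap_charge q hq A t v (phi v) dl D v1 (proj1 v2) ltac:(lra) v4 Hdl Hdl1 Hdl2 h2)
      as [v' (w1 & w2 & w3 & w4)]. fold C in w3, w4.
    pose proof (Rp v h1) as Rpv. apply (proj2 HI) in v3.
    exists v'. split; [|split; auto].
    assert (Hx' : x0 <= zx A v').
    { apply Rnot_lt_le. intro h. apply (BF v' w1). split; [apply Rabs_le; lra|].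
      rewrite zsl_snd by lra.
      replace (zsl A v' * zx A v') with ((zsl A v' - zsl A v) * zx A v' + zsl A v * zx A v') by ring.
      assert (Rabs (zsl A v' - zsl A v) <= C / (t * zx A v')) by (apply Rabs_le; lra).
      assert (Rabs ((zsl A v' - zsl A v) * zx A v') <= C / t).
      { replace (C / t) with (C / (t * zx A v') * zx A v') by (field; split; lra).
        apply Rabs_mul_le; auto. rewrite Rabs_right; lra. }
      assert (Rabs (zsl A v * zx A v') <= M * x0).
      { apply Rabs_mul_le; [|rewrite Rabs_right; lra]. unfold M.
        unfold Rabs. repeat destruct (Rcase_abs _); lra. }
      assert (C / t <= d / 2).
      { apply (Rmult_le_reg_r t); [lra|]. unfold Rdiv at 1. rewrite Rmult_assoc, Rinv_l by lra. lra. }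
      eapply Rle_trans; [apply Rabs_triang|]. lra. }
    assert (C / (t * zx A v') <= 1).
    { apply (Rmult_le_reg_r (t * zx A v')); [nra|]. unfold Rdiv. rewrite Rmult_assoc, Rinv_l by nra. nra. }
    apply filter_In. split; [|now apply bdec_true]. apply HV. repeat split; auto; lra.
  - apply Rle_trans with (Sm V' (fun v' => 2 * C * dl * (2 * / (2 * (dl * t) * zx A v')))).
    + apply Sm_le. intros v' Hv'. destruct (HV' v' Hv') as (w1 & w2 & w3).
      rewrite <- (Sm_filter_if (fun v => bdec (P v' v)) lb).
      replace (2 * C * dl * (2 * / (2 * (dl * t) * zx A v'))) with
        ((zsl A v' + C / (t * zx A v')) - (zsl A v' - C / (t * zx A v'))) by (field; repeat split; lra).
      rewrite (Sm_ext _ _ (fun v => (zsl A v + Rq q (phi v) / t ^ 2) - zsl A v)) by (intros; ring).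
      assert (0 < C / (t * zx A v')) by (apply Rdiv_lt_0_compat; [lra|apply Rmult_lt_0_compat; lra]).
      apply (pack _ _ (length (filter (fun v => bdec (P v' v)) lb))); auto; try lra.
      * apply NoDup_filter, NoDup_filter, Hl.
      * intros v Hv. apply filter_In in Hv. destruct Hv as [k1 k2]. apply bdecT in k2.
        destruct (Hlb v k1) as [k3 _]. pose proof (Rp v k3). destruct k2. lra.
      * assert (K : forall v w, In v l -> In w l -> zsl A v < zsl A w ->
          zsl A v + Rq q (phi v) / t ^ 2 <= zsl A w).
        { intros v u Hv Hu Hs.
          destruct (enumv_FTR q A I t l phi v Hl HF Hv) as (v1 & v2 & v3 & v4).
          destruct (enumv_FTR q A I t l phi u Hl HF Hu) as (u1 & u2 & u3 & u4).
          destruct (gap_next q hq A t v (phi v) D v1 (proj1 v2) ltac:(lra) v4) as (_ & _ & G).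
          apply G; auto. }
        intros v u Hv Hu N. apply filter_In in Hv, Hu. destruct Hv as [Hv _], Hu as [Hu _].
        apply Hlb in Hv, Hu. destruct Hv as [Hv _], Hu as [Hu _].
        destruct (enumv_FTR q A I t l phi v Hl HF Hv) as (v1 & v2 & v3 & v4).
        destruct (enumv_FTR q A I t l phi u Hl HF Hu) as (u1 & u2 & u3 & u4).
        pose proof (slopes_neq q hq A v u D v1 u1 (proj1 v2) (proj1 u2) N) as NE.
        destruct (Rtotal_order (zsl A v) (zsl A u)) as [h|[h|h]]; [left|contradiction|right]; apply K; auto.
    + rewrite Sm_scal.
      assert (Sm V' (fun v => 2 * / (2 * (dl * t) * zx A v)) <= be + 1 - (al - 1) + 2 * (/ (2 * (dl * t) * x0))).
      { assert (Pd : 0 < dl * t) by (apply Rmult_lt_0_compat; lra).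
        apply (pack_slopes q hq A (dl * t)); auto; try lra.
        - left; apply inv_pos. apply Rmult_lt_0_compat; lra.
        - now apply NoDup_filter.
        - intros v Hv. destruct (HV' v Hv) as (v1 & v2 & v3).
          repeat split; auto; try lra.
          + left; apply inv_pos. apply Rmult_lt_0_compat; lra.
          + apply Rinv_le_contravar; [apply Rmult_lt_0_compat; lra|]. apply Rmult_le_compat_l; lra.
          + right. field. repeat split; lra. }
      assert (/ (2 * (dl * t) * x0) <= 1 / 2).
      { replace (1 / 2) with (/ 2) by field. apply Rinv_le_contravar; nra. }
      apply Rle_trans with (2 * C * dl * w); auto. apply Rmult_le_compat_l; [|unfold w; lra].
      apply Rmult_le_pos; lra.
Qed.

(** Each point from the slope of [v0] up to the right end lies in the gap that begins at the last
    slope not exceeding it, and [slope_dense] puts [v0] near the left end. Truncating at [B] loses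
    only the long gaps. *)
Lemma gaps_lower q (hq : (3 <= q)%nat) A I al be e : det A = 1 -> al < be -> itv I al be -> 0 < e ->
  exists B T, 0 < B /\ 1 <= T /\ forall t l phi, T <= t -> enumv q A I t l -> FTRs q A t l phi ->
    be - al - e <= Sm l (fun v => Rmin (Rq q (phi v)) B) / t ^ 2.
Proof.
  intros D Hab HI He.
  destruct (long_gaps q hq A I al be (e / 2) D Hab HI ltac:(lra)) as (B & T & HB & LG).
  set (e' := Rmin (e / 2) (be - al) / 2).
  assert (He' : 0 < e' /\ e' < e / 2 /\ e' < be - al).
  { assert (0 < Rmin (e / 2) (be - al)) by (apply Rmin_pos; lra).
    pose proof (Rmin_l (e / 2) (be - al)). pose proof (Rmin_r (e / 2) (be - al)). unfold e'. lra. }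
  destruct He' as (He1 & He2 & He3).
  destruct (slope_dense q hq A (al + e' / 2) (e' / 2) D ltac:(lra)) as [v0 (a1 & a2 & a3)].
  apply Rabs_def2 in a3.
  exists B, (Rmax (Rmax T 1) (zx A v0)). split; auto.
  split; [eapply Rle_trans; [|apply Rmax_l]; apply Rmax_r|].
  intros t l phi Ht Hl HF.
  assert (tT : T <= t) by (eapply Rle_trans; [|apply Ht]; eapply Rle_trans; [|apply Rmax_l]; apply Rmax_l).
  assert (t1 : 1 <= t) by (eapply Rle_trans; [|apply Ht]; eapply Rle_trans; [|apply Rmax_l]; apply Rmax_r).
  assert (tv : zx A v0 <= t) by (eapply Rle_trans; [|apply Ht]; apply Rmax_r).
  specialize (LG t l phi tT t1 Hl HF).
  assert (it2 : 0 < / t ^ 2) by (apply inv_pos; nra).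
  assert (Rp : forall v, In v l -> 0 < Rq q (phi v) / t ^ 2).
  { intros v Hv. destruct (enumv_FTR q A I t l phi v Hl HF Hv) as (v1 & v2 & v3 & v4).
    apply (gap_next q hq A t v (phi v)); auto; lra. }
  assert (Hv0 : In v0 l).
  { apply Hl. repeat split; auto. apply (proj1 HI). lra. }
  assert (Cov : be - zsl A v0 <= Sm l (fun v => (zsl A v + Rq q (phi v) / t ^ 2) - zsl A v)).
  { apply (cover _ _ (length l)); auto.
    - intros v Hv. specialize (Rp v Hv). lra.
    - intros s Hs. set (ls := filter (fun v => bdec (zsl A v <= s)) l).
      assert (Hls : forall v, In v ls <-> In v l /\ zsl A v <= s).
      { intro v. unfold ls. rewrite filter_In, bdec_true. tauto. }
      destruct (list_min (fun v => - zsl A v) ls) as [v [Hv Hmax]].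
      { assert (K : In v0 ls) by (apply Hls; split; auto; lra). intro E; rewrite E in K; destruct K. }
      apply Hls in Hv. destruct Hv as [Hv Hvs]. exists v. split; auto. split; auto.
      apply Rnot_le_lt. intro h.
      destruct (enumv_FTR q A I t l phi v Hl HF Hv) as (v1 & v2 & v3 & v4).
      destruct (gap_next q hq A t v (phi v) D v1 (proj1 v2) ltac:(lra) v4) as (_ & [v' (w1 & w2 & w3)] & _).
      specialize (Rp v Hv).
      assert (zsl A v0 <= zsl A v).
      { assert (- zsl A v <= - zsl A v0); [|lra]. apply Hmax, Hls. split; auto; lra. }
      assert (In v' ls).
      { apply Hls. split; [|lra]. apply Hl. repeat split; try tauto. apply (proj1 HI). lra. }
      specialize (Hmax v' H0). lra. }
  rewrite (Sm_ext l _ (fun v => Rq q (phi v) / t ^ 2)) in Cov by (intros; ring).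
  rewrite (Sm_filter (fun v => bdec (B < Rq q (phi v))) l) in Cov.
  assert (G : Sm (filter (fun v => negb (bdec (B < Rq q (phi v)))) l) (fun v => Rq q (phi v) / t ^ 2) <=
    Sm l (fun v => Rmin (Rq q (phi v)) B) / t ^ 2).
  { apply Rle_trans with (Sm (filter (fun v => negb (bdec (B < Rq q (phi v)))) l) (fun v => / t ^ 2 * Rmin (Rq q (phi v)) B)).
    - apply Sm_le. intros v Hv. apply filter_In in Hv. destruct Hv as [_ h].
      apply Bool.negb_true_iff, bdecF in h. rewrite Rmin_left by lra. unfold Rdiv. lra.
    - replace (Sm l (fun v => Rmin (Rq q (phi v)) B) / t ^ 2) with (Sm l (fun v => / t ^ 2 * Rmin (Rq q (phi v)) B))
        by (rewrite Sm_scal; unfold Rdiv; ring).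
      apply Sm_incl.
      + apply NoDup_filter, Hl.
      + apply Hl.
      + intros v Hv. apply filter_In in Hv. tauto.
      + intros v Hv. specialize (Rp v Hv). apply Rmult_le_pos; [lra|]. apply Rmin_glb; [|lra].
        unfold Rdiv in Rp. nra. }
  lra.
Qed.

(** The truncated gaps have total length at least [1/2] and each is at most [B / t^2], so there are
    at least [t^2 / (2 B)] of them. *)
Lemma density_pos q (hq : (3 <= q)%nat) kap : is_density q kap -> 0 < kap.
Proof.
  intros DK.
  assert (HI : itv (fun x => 0 <= x <= 1) 0 1) by (split; intros; lra).
  destruct (gaps_lower q hq mat_id _ 0 1 (1 / 2) det_id ltac:(lra) HI ltac:(lra)) as (B & T1 & HB & HT1 & GL).
  destruct (DK mat_id _ 0 1 (/ (4 * B)) det_id ltac:(lra) HI ltac:(apply inv_pos; lra)) as [T2 [HT2 HT2']].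
  set (t := Rmax T1 T2).
  assert (k1 : T1 <= t) by apply Rmax_l. assert (k2 : T2 <= t) by apply Rmax_r.
  assert (it2 : 0 < / t ^ 2) by (apply inv_pos; nra).
  destruct (enumv_ex q hq mat_id _ 0 1 t det_id HI ltac:(lra)) as [l Hl].
  set (phi := fun v => epsilon (inhabits (0, 0)) (FTR_is q mat_id t (mapp mat_id v))).
  assert (HF : FTRs q mat_id t l phi).
  { intros v Hv. apply epsilon_spec. apply Hl in Hv. apply FTR_ex; auto using det_id; tauto. }
  specialize (GL t l phi k1 Hl HF). specialize (HT2' t l k2 Hl). apply Rabs_le_iff in HT2'.
  assert (Sm l (fun v => Rmin (Rq q (phi v)) B) <= B * INR (length l)).
  { rewrite <- Sm_const. apply Sm_le. intros. apply Rmin_r. }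
  apply (Rmult_le_compat_r (/ t ^ 2)) in H; [|lra]. unfold Rdiv in *.
  assert (INR (length l) * / t ^ 2 <= kap + / (4 * B)) by lra.
  apply (Rmult_le_compat_l B) in H0; [|lra]. 
  replace (B * (kap + / (4 * B))) with (B * kap + 1 / 4) in H0 by (field; lra). nra.
Qed.

(** * Riemann integrability of functions continuous off finitely many lines *)

Definition inBox (p : R * R) : Prop := 0 <= fst p <= 1 /\ -1 <= snd p <= 1.

Definition near (d : R) (p p' : R * R) : Prop := Rabs (fst p' - fst p) < d /\ Rabs (snd p' - snd p) < d.

Definition lineval (L : R * R * R) (p : R * R) : R := fst (fst L) * fst p + snd (fst L) * snd p + snd L.
Definition isline (L : R * R * R) : Prop := fst (fst L) <> 0 \/ snd (fst L) <> 0.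

Lemma in_cells n c : In c (cells n) -> INR (fst c) + 1 <= KN n /\ INR (snd c) + 1 <= KN n.
Proof.
  destruct c as [i j]. unfold cells. intro H. apply in_prod_iff in H. destruct H as [h1 h2].
  apply in_seq in h1, h2. unfold KN. simpl. rewrite <- !S_INR. split; apply le_INR; lia.
Qed.

Lemma cell_box n c p : In c (cells n) -> inCell n c p -> inBox p.
Proof.
  intros Hc Hp. destruct (in_cells n c Hc) as [h1 h2]. pose proof (KN_ge1 n) as HK.
  unfold inCell, in_closed in Hp. rewrite !S_INR in Hp.
  assert (HI : 0 < / KN n) by (apply inv_pos; lra).
  pose proof (pos_INR (fst c)). pose proof (pos_INR (snd c)).
  assert (HH : KN n * / KN n = 1) by (apply Rinv_r; lra).
  unfold Rdiv, inBox in *. nra.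
Qed.

Lemma cell_diam n c p p' : inCell n c p -> inCell n c p' ->
  Rabs (fst p' - fst p) <= 1 / KN n /\ Rabs (snd p' - snd p) <= 2 / KN n.
Proof.
  pose proof (KN_ge1 n) as HK. assert (HI : 0 < / KN n) by (apply inv_pos; lra).
  unfold inCell, in_closed. rewrite !S_INR. unfold Rdiv. intros H H'. split; apply Rabs_le; lra.
Qed.

Lemma Sm_cells_const n x : Sm (cells n) (fun _ => x) = x * KN n ^ 2.
Proof.
  rewrite Sm_const. unfold cells. rewrite length_prod, length_seq, mult_INR. fold (KN n). ring.
Qed.

Lemma line_cells L : isline L -> exists C, 0 < C /\ forall n eta, 0 <= eta ->
  Sm (cells n) (fun c => if bdec (exists p, inCell n c p /\ Rabs (lineval L p) <= eta) then 1 else 0) <=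
  C * (eta + / KN n) * KN n ^ 2.
Proof.
  destruct L as [[x y] z]. unfold isline, lineval; simpl fst; simpl snd. intro H.
  assert (Hco : forall n c eta p, inCell n c p -> Rabs (x * fst p + y * snd p + z) <= eta ->
    Rabs (x * (INR (fst c) / KN n) + y * (-1 + 2 * INR (snd c) / KN n) + z) <= eta + (Rabs x + 2 * Rabs y) / KN n).
  { intros n c eta p Hp He. destruct (cell_diam n c p _ Hp (cell_corner n c)) as [h1 h2]. simpl fst in h1; simpl snd in h2.
    replace (x * (INR (fst c) / KN n) + y * (-1 + 2 * INR (snd c) / KN n) + z) with
     ((x * fst p + y * snd p + z) + (x * (INR (fst c) / KN n - fst p) + y * (-1 + 2 * INR (snd c) / KN n - snd p))) by ring.
    eapply Rle_trans; [apply Rabs_triang|].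
    assert (Rabs (x * (INR (fst c) / KN n - fst p)) <= Rabs x * (1 / KN n)) by (apply Rabs_mul_le; auto; lra).
    assert (Rabs (y * (-1 + 2 * INR (snd c) / KN n - snd p)) <= Rabs y * (2 / KN n)) by (apply Rabs_mul_le; auto; lra).
    pose proof (Rabs_triang (x * (INR (fst c) / KN n - fst p)) (y * (-1 + 2 * INR (snd c) / KN n - snd p))).
    unfold Rdiv in *. lra. }
  assert (Gen : forall n w c0 eta', w <> 0 -> 0 <= eta' -> forall l : list nat, NoDup l ->
    (forall i, In i l -> Rabs (w * (INR i / KN n) + c0) <= eta') -> INR (length l) <= 2 * (eta' * KN n / Rabs w) + 1).
  { intros n w c0 eta' Hw He l ND Hl. pose proof (KN_ge1 n) as HK.
    assert (Hw' : 0 < Rabs w) by now apply Rabs_pos_lt.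
    set (r := eta' * KN n / Rabs w).
    assert (Hr : 0 <= r) by (unfold r, Rdiv; apply Rmult_le_pos; [nra|left; now apply inv_pos]).
    replace (2 * r + 1) with ((- (c0 * KN n / w) + r) - (- (c0 * KN n / w) - r) + 1) by ring.
    apply nat_count; auto; [lra|]. intros i Hi. specialize (Hl i Hi).
    assert (Rabs (INR i + c0 * KN n / w) <= r).
    { replace (INR i + c0 * KN n / w) with ((w * (INR i / KN n) + c0) * (KN n / w)) by (field; split; lra).
      unfold r. replace (eta' * KN n / Rabs w) with (eta' * (KN n / Rabs w)) by (field; lra).
      apply Rabs_mul_le; auto. unfold Rdiv. rewrite Rabs_mult, Rabs_inv, (Rabs_right (KN n)) by lra. lra. }
    apply Rabs_le_iff in H0. lra. }
  pose proof (Rabs_pos x) as Px. pose proof (Rabs_pos y) as Py.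
  destruct (Req_EM_T y 0) as [Ey|Ey].
  - assert (Hx : x <> 0) by tauto. assert (Hx' : 0 < Rabs x) by now apply Rabs_pos_lt.
    exists (2 / Rabs x + 2 * (Rabs x + 2 * Rabs y) / Rabs x + 1). 
    assert (0 <= 2 * (Rabs x + 2 * Rabs y) / Rabs x).
    { unfold Rdiv. apply Rmult_le_pos; [lra|left; now apply inv_pos]. }
    assert (0 < 2 / Rabs x) by (apply Rdiv_lt_0_compat; lra).
    split; [lra|]. intros n eta He. pose proof (KN_ge1 n) as HK.
    assert (HI : 0 < / KN n) by (apply inv_pos; lra).
    set (eta' := eta + (Rabs x + 2 * Rabs y) / KN n).
    assert (He' : 0 <= eta').
    { unfold eta'. assert (0 <= (Rabs x + 2 * Rabs y) / KN n) by (unfold Rdiv; nra). lra. }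
    apply Rle_trans with (Sm (seq 0 (Nat.pow 2 n)) (fun _ => 2 * (eta' * KN n / Rabs x) + 1)).
    + unfold cells. rewrite Sm_list_prod, Sm_swap. apply Sm_le. intros j Hj.
      apply Sm_indic_count; [|apply seq_NoDup]. intros l ND Hl.
      apply (Gen n x (y * (-1 + 2 * INR j / KN n) + z)); auto.
      intros i Hi. destruct (Hl i Hi) as [_ [p [Hp Hpe]]].
      pose proof (Hco n (i, j) eta p Hp Hpe) as Q. simpl fst in Q; simpl snd in Q.
      rewrite <- Rplus_assoc. exact Q.
    + rewrite Sm_const, length_seq. fold (KN n).
      replace ((2 * (eta' * KN n / Rabs x) + 1) * KN n) with ((2 / Rabs x * eta' + / KN n) * KN n ^ 2) by (field; split; lra).
      apply Rmult_le_compat_r; [nra|]. unfold eta'.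
      replace (2 / Rabs x * (eta + (Rabs x + 2 * Rabs y) / KN n) + / KN n) with
        (2 / Rabs x * eta + (2 * (Rabs x + 2 * Rabs y) / Rabs x + 1) * / KN n) by (field; split; lra).
      nra.
  - assert (Hy' : 0 < Rabs y) by now apply Rabs_pos_lt.
    exists (1 / Rabs y + (Rabs x + 2 * Rabs y) / Rabs y + 1). 
    assert (0 <= (Rabs x + 2 * Rabs y) / Rabs y).
    { unfold Rdiv. apply Rmult_le_pos; [lra|left; now apply inv_pos]. }
    assert (0 < 1 / Rabs y) by (apply Rdiv_lt_0_compat; lra).
    split; [lra|]. intros n eta He. pose proof (KN_ge1 n) as HK.
    assert (HI : 0 < / KN n) by (apply inv_pos; lra).
    set (eta' := eta + (Rabs x + 2 * Rabs y) / KN n).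
    assert (He' : 0 <= eta').
    { unfold eta'. assert (0 <= (Rabs x + 2 * Rabs y) / KN n) by (unfold Rdiv; nra). lra. }
    apply Rle_trans with (Sm (seq 0 (Nat.pow 2 n)) (fun _ => 2 * (eta' * KN n / Rabs (2 * y)) + 1)).
    + unfold cells. rewrite Sm_list_prod. apply Sm_le. intros i Hi.
      apply Sm_indic_count; [|apply seq_NoDup]. intros l ND Hl.
      apply (Gen n (2 * y) (x * (INR i / KN n) - y + z)); [lra|auto|auto|].
      intros j Hj. destruct (Hl j Hj) as [_ [p [Hp Hpe]]].
      pose proof (Hco n (i, j) eta p Hp Hpe) as Q. simpl fst in Q; simpl snd in Q.
      replace (2 * y * (INR j / KN n) + (x * (INR i / KN n) - y + z)) with
        (x * (INR i / KN n) + y * (-1 + 2 * INR j / KN n) + z) by (unfold Rdiv; ring). exact Q.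
    + rewrite Sm_const, length_seq. fold (KN n). rewrite Rabs_mult, (Rabs_right 2) by lra.
      replace ((2 * (eta' * KN n / (2 * Rabs y)) + 1) * KN n) with ((1 / Rabs y * eta' + / KN n) * KN n ^ 2) by (field; split; lra).
      apply Rmult_le_compat_r; [nra|]. unfold eta'.
      replace (1 / Rabs y * (eta + (Rabs x + 2 * Rabs y) / KN n) + / KN n) with
        (1 / Rabs y * eta + ((Rabs x + 2 * Rabs y) / Rabs y + 1) * / KN n) by (field; split; lra).
      nra.
Qed.

Lemma lines_cells Ls : (forall L, In L Ls -> isline L) -> exists C, 0 < C /\ forall n eta, 0 <= eta ->
  Sm (cells n) (fun c => if bdec (exists L p, In L Ls /\ inCell n c p /\ Rabs (lineval L p) <= eta) then 1 else 0) <=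
  C * (eta + / KN n) * KN n ^ 2.
Proof.
  induction Ls as [|L Ls IH]; intro H.
  - exists 1. split; [lra|]. intros n eta He. pose proof (KN_ge1 n).
    rewrite Sm_zero.
    + assert (0 < / KN n) by (apply inv_pos; lra). apply Rmult_le_pos; nra.
    + intros c _. rewrite (proj2 (bdec_false _)); auto. intros (L & p & [] & _).
  - destruct IH as [C1 [HC1 B1]]. { intros; apply H; simpl; auto. }
    destruct (line_cells L (H L (or_introl eq_refl))) as [C2 [HC2 B2]].
    exists (C1 + C2). split; [lra|]. intros n eta He.
    specialize (B1 n eta He). specialize (B2 n eta He).
    replace ((C1 + C2) * (eta + / KN n) * KN n ^ 2) with (C1 * (eta + / KN n) * KN n ^ 2 + C2 * (eta + / KN n) * KN n ^ 2) by ring.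
    eapply Rle_trans; [|apply Rplus_le_compat; [apply B1|apply B2]].
    rewrite <- Sm_plus. apply Sm_le. intros c _.
    destruct (bdec (exists L0 p, In L0 (L :: Ls) /\ inCell n c p /\ Rabs (lineval L0 p) <= eta)) eqn:E.
    + apply bdecT in E. destruct E as (L0 & p & [<-|HL0] & Hp).
      * rewrite (proj2 (bdec_true (exists p, inCell n c p /\ Rabs (lineval L p) <= eta))) by eauto.
        destruct (bdec _); lra.
      * rewrite (proj2 (bdec_true (exists L p, In L Ls /\ inCell n c p /\ Rabs (lineval L p) <= eta))) by eauto.
        destruct (bdec (exists p0, inCell n c p0 /\ Rabs (lineval L p0) <= eta)); lra.
    + destruct (bdec (exists L p, In L Ls /\ inCell n c p /\ Rabs (lineval L p) <= eta));
      destruct (bdec (exists p0, inCell n c p0 /\ Rabs (lineval L p0) <= eta)); lra.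
Qed.

(** Lines suffice as exceptional sets, because the boundary of T^q and the places where the
    truncated [Rq] may jump are made of line segments. *)
Definition contoff (h : R * R -> R) (Ls : list (R * R * R)) : Prop :=
  forall p, inBox p -> (forall L, In L Ls -> lineval L p <> 0) ->
  forall e, 0 < e -> exists d, 0 < d /\ forall p', inBox p' -> near d p p' -> Rabs (h p' - h p) < e.

(** Uniform continuity by compactness: around a point on one of the lines the second alternative
    holds, and around any other point continuity gives the first. *)
Lemma uniform_off h Ls e eta : contoff h Ls -> 0 < e -> 0 < eta ->
  exists d, 0 < d /\ forall p p', inBox p -> inBox p' -> near d p p' ->
    Rabs (h p' - h p) <= e \/ exists L, In L Ls /\ Rabs (lineval L p) <= eta.
Proof.
  intros Hc He Heta.
  (* The radius for [p'] is doubled so that two points at distance [d] fit around one centre. *)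
  set (Q := fun (u v : R) (d : posreal) => inBox (u, v) -> forall p p', inBox p -> inBox p' ->
    near d (u, v) p -> near (2 * d) (u, v) p' ->
    Rabs (h p' - h p) <= e \/ exists L, In L Ls /\ Rabs (lineval L p) <= eta).
  assert (G : forall u v, exists d, Q u v d).
  { intros u v. destruct (classic (inBox (u, v))) as [Hb|Hb].
    2: { exists (mkposreal 1 Rlt_0_1). intro; contradiction. }
    destruct (classic (exists L, In L Ls /\ lineval L (u, v) = 0)) as [[L [HL E]]|N].
    - set (s := Rabs (fst (fst L)) + Rabs (snd (fst L)) + 1).
      pose proof (Rabs_pos (fst (fst L))) as P1. pose proof (Rabs_pos (snd (fst L))) as P2.
      assert (Hd : 0 < eta / s) by (apply Rdiv_lt_0_compat; unfold s; lra).
      exists (mkposreal _ Hd). intros _ p p' _ _ [h1 h2] _. right. exists L. split; auto.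
      simpl in h1, h2. 
      replace (lineval L p) with (fst (fst L) * (fst p - u) + snd (fst L) * (snd p - v)).
      2: { unfold lineval in *; simpl in E. lra. }
      eapply Rle_trans; [apply Rabs_triang|].
      assert (Rabs (fst (fst L) * (fst p - u)) <= Rabs (fst (fst L)) * (eta / s)) by (apply Rabs_mul_le; lra).
      assert (Rabs (snd (fst L) * (snd p - v)) <= Rabs (snd (fst L)) * (eta / s)) by (apply Rabs_mul_le; lra).
      assert (s * (eta / s) = eta) by (field; unfold s; lra). unfold s in *. nra.
    - destruct (Hc (u, v) Hb) with (e := e / 2) as [d [Hd HD]]; [|lra|].
      { intros L HL E. apply N. eauto. }
      assert (Hd2 : 0 < d / 2) by lra.
      exists (mkposreal _ Hd2). intros _ p p' Bp Bp' [h1 h2] [h3 h4]. simpl in *. left.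
      assert (A1 := HD p Bp ltac:(split; simpl; lra)). assert (A2 := HD p' Bp' ltac:(split; simpl; lra)).
      replace (h p' - h p) with ((h p' - h (u, v)) - (h p - h (u, v))) by ring.
      eapply Rle_trans; [apply Rabs_triang|]. rewrite Rabs_Ropp. lra. }
  set (dl := fun u v => epsilon (inhabits (mkposreal 1 Rlt_0_1)) (Q u v)).
  assert (Hdl : forall u v, Q u v (dl u v)) by (intros u v; apply epsilon_spec, G).
  destruct (compactness_value_2d 0 1 (-1) 1 dl) as [d Hd].
  exists d. split; [apply cond_pos|]. intros p p' Bp Bp' [n1 n2].
  specialize (Hd (fst p) (snd p) (proj1 Bp) (proj2 Bp)). apply NNPP in Hd.
  destruct Hd as (u & v & Bu & Bv & h1 & h2 & h3).
  apply (Hdl u v); auto; split; simpl; auto.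
  - replace (fst p' - u) with ((fst p' - fst p) + (fst p - u)) by ring.
    eapply Rle_lt_trans; [apply Rabs_triang|]. lra.
  - replace (snd p' - v) with ((snd p' - snd p) + (snd p - v)) by ring.
    eapply Rle_lt_trans; [apply Rabs_triang|]. lra.
Qed.

Lemma KN_large (x : R) : exists N : nat, forall n, (N <= n)%nat -> x <= KN n.
Proof.
  destruct (INR_unbounded x) as [N HN]. exists N. intros n Hn.
  apply Rle_trans with (INR n); [apply Rle_trans with (INR N); [lra|now apply le_INR]|].
  apply le_INR. apply Nat.lt_le_incl, Nat.pow_gt_lin_r. lia.
Qed.

(** The upper sum of [h] is minus the lower sum of [- h], so the claim is that upper and lower sums
    come together: the oscillation is small on most cells and at most [2 B] on the few cells near a
    line. *)
Lemma riemann_off_lines h Ls B : (forall p, Rabs (h p) <= B) -> (forall L, In L Ls -> isline L) ->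
  contoff h Ls -> forall e, 0 < e -> exists N, forall n, (N <= n)%nat ->
  - e <= lower_sum h n + lower_sum (fun p => - h p) n.
Proof.
  intros HB HL Hc e He.
  assert (B0 : 0 <= B) by (eapply Rle_trans; [apply Rabs_pos|apply (HB (0, 0))]).
  destruct (lines_cells Ls HL) as [C [HC LC]].
  set (eta := e / (16 * (B + 1) * C)).
  assert (HBC : 0 < 16 * (B + 1) * C) by (apply Rmult_lt_0_compat; lra).
  assert (Heta : 0 < eta) by (apply Rdiv_lt_0_compat; lra).
  assert (Heta' : 16 * (B + 1) * C * eta = e) by (unfold eta; field; split; lra).
  clearbody eta.
  destruct (uniform_off h Ls (e / 16) eta Hc ltac:(lra) Heta) as [d [Hd UO]].
  destruct (KN_large (3 / d + / eta)) as [N HN]. exists N. intros n Hn. specialize (HN n Hn).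
  pose proof (KN_ge1 n) as HK. assert (HI : 0 < / KN n) by (apply inv_pos; lra).
  assert (P1 : 0 < 3 / d) by (apply Rdiv_lt_0_compat; lra). assert (P2 : 0 < / eta) by now apply inv_pos.
  assert (Kd : 2 / KN n < d).
  { apply (Rmult_lt_reg_r (KN n)); [lra|]. unfold Rdiv. rewrite Rmult_assoc, Rinv_l by lra.
    assert (h1 : 3 / d <= KN n) by lra. apply (Rmult_le_compat_l d) in h1; [|lra].
    replace (d * (3 / d)) with 3 in h1 by (field; lra). lra. }
  assert (Ke : / KN n <= eta).
  { rewrite <- (Rinv_inv eta). apply Rinv_le_contravar; lra. }
  rewrite !lower_sum_cells. rewrite <- Rmult_plus_distr_l, <- Sm_plus.
  set (bad := fun c => exists L p, In L Ls /\ inCell n c p /\ Rabs (lineval L p) <= eta).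
  assert (T : Sm (cells n) (fun c => - (2 * (e / 16)) + - (2 * B) * (if bdec (bad c) then 1 else 0)) <=
    Sm (cells n) (fun x => cinf h n x + cinf (fun p => - h p) n x)).
  { apply Sm_le. intros c Hcc.
    set (p0 := (INR (fst c) / KN n, -1 + 2 * INR (snd c) / KN n)).
    assert (Hp0 : inCell n c p0) by apply cell_corner.
    assert (HB' : forall p, - B <= h p <= B) by (intro p; apply Rabs_le_iff; auto).
    destruct (cinf_spec h n c (- B)) as [_ m1]; [intros; apply HB'|].
    destruct (cinf_spec (fun p => - h p) n c (- B)) as [_ m2]; [intros p _; specialize (HB' p); lra|].
    destruct (bdec (bad c)) eqn:E.
    - specialize (m1 (- B) ltac:(intros; apply HB')).
      specialize (m2 (- B) ltac:(intros p _; specialize (HB' p); lra)). lra.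
    - apply bdecF in E.
      assert (G : forall p, inCell n c p -> Rabs (h p - h p0) <= e / 16).
      { intros p Hp. destruct (cell_diam n c p0 p Hp0 Hp) as [k1 k2].
        destruct (UO p0 p) as [|[L [HLL Hv]]]; auto.
        - apply (cell_box n c); auto.
        - apply (cell_box n c); auto.
        - split; [|lra]. eapply Rle_lt_trans; [apply k1|]. unfold Rdiv in *. lra.
        - exfalso. apply E. exists L, p0. auto. }
      specialize (m1 (h p0 - e / 16) ltac:(intros p Hp; specialize (G p Hp); apply Rabs_le_iff in G; lra)).
      specialize (m2 (- h p0 - e / 16) ltac:(intros p Hp; specialize (G p Hp); apply Rabs_le_iff in G; lra)). lra. }
  rewrite Sm_plus, Sm_cells_const, Sm_scal in T.
  pose proof (LC n eta ltac:(lra)) as LC'. fold bad in LC'.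
  change (Sm (cells n) (fun c => if bdec (bad c) then 1 else 0) <= C * (eta + / KN n) * KN n ^ 2) in LC'.
  assert (K2 : 0 < KN n ^ 2) by nra.
  apply Rle_trans with (2 / KN n ^ 2 * (- (2 * (e / 16)) * KN n ^ 2 + - (2 * B) * (C * (eta + / KN n) * KN n ^ 2))).
  - replace (2 / KN n ^ 2 * (- (2 * (e / 16)) * KN n ^ 2 + - (2 * B) * (C * (eta + / KN n) * KN n ^ 2))) with
      (- (e / 4) - 4 * B * C * (eta + / KN n)) by (field; lra).
    assert (4 * B * C * (eta + / KN n) <= 4 * (B + 1) * C * (2 * eta)); [|lra].
    apply Rmult_le_compat; try lra; nra.
  - apply Rmult_le_compat_l; [unfold Rdiv; apply Rmult_le_pos; [lra|left; now apply inv_pos]|].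
    eapply Rle_trans; [|apply T]. nra.
Qed.

Lemma lower_sum_mono h h' n b : (forall p, b <= h p) -> (forall p, h p <= h' p) -> lower_sum h n <= lower_sum h' n.
Proof.
  intros Hb Hh. rewrite !lower_sum_cells. pose proof (KN_ge1 n).
  apply Rmult_le_compat_l; [unfold Rdiv; apply Rmult_le_pos; [lra|left; apply inv_pos; nra]|].
  apply Sm_le. intros c _. destruct (cinf_spec h n c b) as [m1 _]; auto.
  destruct (cinf_spec h' n c b) as [_ m2]; [intros p _; apply Rle_trans with (h p); auto|].
  apply m2. intros p Hp. apply Rle_trans with (h p); auto.
Qed.

Lemma lower_sum_super h1 h2 h n b1 b2 : (forall p, b1 <= h1 p) -> (forall p, b2 <= h2 p) ->
  (forall p, h1 p + h2 p <= h p) -> lower_sum h1 n + lower_sum h2 n <= lower_sum h n.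
Proof.
  intros H1 H2 H. rewrite !lower_sum_cells, <- Rmult_plus_distr_l, <- Sm_plus. pose proof (KN_ge1 n).
  apply Rmult_le_compat_l; [unfold Rdiv; apply Rmult_le_pos; [lra|left; apply inv_pos; nra]|].
  apply Sm_le. intros c _. destruct (cinf_spec h1 n c b1) as [m1 _]; auto.
  destruct (cinf_spec h2 n c b2) as [m2 _]; auto.
  destruct (cinf_spec h n c (b1 + b2)) as [_ m3].
  { intros p _. specialize (H p). specialize (H1 p). specialize (H2 p). lra. }
  apply m3. intros p Hp. specialize (m1 p Hp). specialize (m2 p Hp). specialize (H p). lra.
Qed.

Lemma Sm_INR k : Sm (seq 0 k) INR = INR k * (INR k - 1) / 2.
Proof.
  induction k as [|k IH]; [simpl; field|]. rewrite seq_S, Sm_app, IH, S_INR. simpl. field.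
Qed.

(** T^q has area [lambda_q / 2], which makes [m_q] a probability measure. A cell inside it is
    recognised at its lower left corner, and each column loses [O(1)] cells. *)
Lemma area_lower q (hq : (3 <= q)%nat) B n : 0 <= B ->
  B * (lambda_q q / 2 - 3 / KN n) <= lower_sum (ext0 q (fun _ => B)) n.
Proof.
  intro HB. pose proof (lam_bounds q hq) as Hl. pose proof (KN_ge1 n) as HK.
  assert (HI : 0 < / KN n) by (apply inv_pos; lra).
  rewrite lower_sum_cells.
  assert (Hext : forall p, 0 <= ext0 q (fun _ => B) p).
  { intro p. destruct (classic (inTq q p)); [rewrite ext0_in|rewrite ext0_out]; auto; lra. }
  assert (T : Sm (cells n) (fun c => B * (1 - (if bdec (INR (snd c) <= KN n - lambda_q q * INR (fst c) / 2) then 1 else 0))) <=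
     Sm (cells n) (cinf (ext0 q (fun _ => B)) n)).
  { apply Sm_le. intros c Hc. destruct (cinf_spec (ext0 q (fun _ => B)) n c 0) as [_ m]; auto.
    destruct (bdec _) eqn:E.
    - rewrite Rminus_diag, Rmult_0_r. apply m; auto.
    - apply bdecF in E. apply m. intros p Hp. rewrite ext0_in; [lra|].
      pose proof (cell_box n c p Hc Hp) as [Bx By]. destruct (in_cells n c Hc) as [c1 c2].
      unfold inCell, in_closed in Hp. unfold Rdiv in *. unfold inTq.
      assert (i1 : 0 < INR (fst c)).
      { pose proof (pos_INR (fst c)). destruct (Req_EM_T (INR (fst c)) 0) as [Z|Z]; [|lra].
        rewrite Z in E. exfalso. apply E. lra. }
      assert (X : 2 * KN n - lambda_q q * INR (fst c) < 2 * INR (snd c)) by lra.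
      apply (Rmult_lt_compat_r (/ KN n)) in X; auto.
      replace ((2 * KN n - lambda_q q * INR (fst c)) * / KN n) with (2 - lambda_q q * (INR (fst c) * / KN n)) in X by (field; lra).
      assert (0 < INR (fst c) * / KN n) by nra.
      assert (lambda_q q * (INR (fst c) * / KN n) <= lambda_q q * fst p) by (apply Rmult_le_compat_l; lra).
      lra. }
  apply (Rmult_le_compat_l (2 / KN n ^ 2)) in T.
  2: { unfold Rdiv. apply Rmult_le_pos; [lra|left; apply inv_pos; nra]. }
  eapply Rle_trans; [|apply T]. rewrite Sm_scal.
  assert (S : KN n * (lambda_q q * (KN n - 1) / 4 - 1) <=
     Sm (cells n) (fun c => 1 - (if bdec (INR (snd c) <= KN n - lambda_q q * INR (fst c) / 2) then 1 else 0))).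
  { unfold cells. rewrite Sm_list_prod. simpl fst; simpl snd.
    apply Rle_trans with (Sm (seq 0 (Nat.pow 2 n)) (fun i => lambda_q q / 2 * INR i - 1)).
    - rewrite Sm_minus, Sm_scal, Sm_const, length_seq, Sm_INR. fold (KN n). right. field.
    - apply Sm_le. intros i Hi. rewrite Sm_minus, Sm_const, length_seq. fold (KN n).
      assert (INR i <= KN n). { apply in_seq in Hi. unfold KN. apply le_INR. lia. }
      assert (Sm (seq 0 (Nat.pow 2 n)) (fun j => if bdec (INR j <= KN n - lambda_q q * INR i / 2) then 1 else 0)
        <= (KN n - lambda_q q * INR i / 2) - 0 + 1).
      { apply Sm_indic_count; [|apply seq_NoDup]. intros l ND H'. pose proof (pos_INR i).
        apply nat_count; auto; [nra|]. intros j Hj. destruct (H' j Hj). pose proof (pos_INR j). lra. }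
      lra. }
  apply (Rmult_le_compat_l (B * (2 / KN n ^ 2))) in S.
  2: { apply Rmult_le_pos; auto. unfold Rdiv. apply Rmult_le_pos; [lra|left; apply inv_pos; nra]. }
  eapply Rle_trans; [|eapply Rle_trans; [apply S|right; ring]].
  replace (B * (2 / KN n ^ 2) * (KN n * (lambda_q q * (KN n - 1) / 4 - 1))) with
    (B * (lambda_q q / 2 - (lambda_q q / 2 + 2) * / KN n)) by (field; lra).
  apply Rmult_le_compat_l; auto. unfold Rdiv. nra.
Qed.

(** * Continuity of the truncated roof *)

Definition cont2 (F : R * R -> R) (p : R * R) : Prop :=
  forall e, 0 < e -> exists d, 0 < d /\ forall p', near d p p' -> Rabs (F p' - F p) < e.

Lemma near_min d1 d2 p p' : near (Rmin d1 d2) p p' -> near d1 p p' /\ near d2 p p'.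
Proof.
  unfold near. pose proof (Rmin_l d1 d2). pose proof (Rmin_r d1 d2). intros [h1 h2]. repeat split; lra.
Qed.

Lemma cont2_affine x y z p : cont2 (fun p => x * fst p + y * snd p + z) p.
Proof.
  intros e He. set (s := Rabs x + Rabs y + 1).
  pose proof (Rabs_pos x). pose proof (Rabs_pos y).
  assert (Hd : 0 < e / s) by (apply Rdiv_lt_0_compat; unfold s; lra).
  exists (e / s). split; auto. intros p' [h1 h2].
  replace (x * fst p' + y * snd p' + z - (x * fst p + y * snd p + z)) with
    (x * (fst p' - fst p) + y * (snd p' - snd p)) by ring.
  eapply Rle_lt_trans; [apply Rabs_triang|].
  assert (Rabs (x * (fst p' - fst p)) <= Rabs x * (e / s)) by (apply Rabs_mul_le; lra).
  assert (Rabs (y * (snd p' - snd p)) <= Rabs y * (e / s)) by (apply Rabs_mul_le; lra).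
  assert (s * (e / s) = e) by (field; unfold s; lra). unfold s in *. nra.
Qed.

Lemma cont2_mult F G p : cont2 F p -> cont2 G p -> cont2 (fun p => F p * G p) p.
Proof.
  intros HF HG e He.
  pose proof (Rabs_pos (F p)) as PF. pose proof (Rabs_pos (G p)) as PG.
  set (m := Rmin 1 (e / (2 * (Rabs (F p) + Rabs (G p) + 1)))).
  assert (Hm : 0 < m).
  { apply Rmin_pos; [lra|]. apply Rdiv_lt_0_compat; lra. }
  assert (Hm1 : m <= 1) by apply Rmin_l.
  assert (Hm2 : m * (Rabs (F p) + Rabs (G p) + 1) <= e / 2).
  { apply Rle_trans with (e / (2 * (Rabs (F p) + Rabs (G p) + 1)) * (Rabs (F p) + Rabs (G p) + 1)).
    - apply Rmult_le_compat_r; [lra|apply Rmin_r].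
    - right. field. lra. }
  destruct (HF m Hm) as [d1 [Hd1 D1]]. destruct (HG m Hm) as [d2 [Hd2 D2]].
  exists (Rmin d1 d2). split; [now apply Rmin_pos|]. intros p' Hp'. apply near_min in Hp'. destruct Hp' as [n1 n2].
  specialize (D1 p' n1). specialize (D2 p' n2).
  replace (F p' * G p' - F p * G p) with ((F p' - F p) * (G p' - G p) + F p * (G p' - G p) + (F p' - F p) * G p) by ring.
  assert (Rabs ((F p' - F p) * (G p' - G p)) <= m * 1) by (apply Rabs_mul_le; lra).
  assert (Rabs (F p * (G p' - G p)) <= Rabs (F p) * m) by (apply Rabs_mul_le; lra).
  assert (Rabs ((F p' - F p) * G p) <= m * Rabs (G p)) by (apply Rabs_mul_le; lra).
  pose proof (Rabs_triang ((F p' - F p) * (G p' - G p) + F p * (G p' - G p)) ((F p' - F p) * G p)).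
  pose proof (Rabs_triang ((F p' - F p) * (G p' - G p)) (F p * (G p' - G p))). lra.
Qed.

Lemma cont2_pos F p : cont2 F p -> 0 < F p -> exists d, 0 < d /\ forall p', near d p p' -> F p / 2 < F p'.
Proof.
  intros HF Hp. destruct (HF (F p / 2) ltac:(lra)) as [d [Hd D]]. exists d. split; auto.
  intros p' Hp'. specialize (D p' Hp'). apply Rabs_def2 in D. lra.
Qed.

Lemma cont2_inv F p : cont2 F p -> 0 < F p -> cont2 (fun p => / F p) p.
Proof.
  intros HF Hp e He. destruct (cont2_pos F p HF Hp) as [d1 [Hd1 D1]].
  assert (F2 : 0 < F p ^ 2) by nra.
  destruct (HF (e * F p ^ 2 / 2)) as [d2 [Hd2 D2]]. { apply Rdiv_lt_0_compat; [nra|lra]. }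
  exists (Rmin d1 d2). split; [now apply Rmin_pos|]. intros p' Hp'. apply near_min in Hp'. destruct Hp' as [n1 n2].
  specialize (D1 p' n1). specialize (D2 p' n2).
  assert (P : 0 < F p * F p') by nra.
  replace (/ F p' - / F p) with ((F p - F p') * / (F p * F p')) by (field; split; lra).
  rewrite Rabs_mult, Rabs_minus_sym, (Rabs_right (/ _)) by (left; now apply inv_pos).
  apply (Rmult_lt_reg_r (F p * F p')); auto. rewrite Rmult_assoc, Rinv_l, Rmult_1_r by lra.
  eapply Rlt_le_trans; [apply D2|].
  replace (e * F p ^ 2 / 2) with (e * (F p * (F p / 2))) by field.
  apply Rmult_le_compat_l; [lra|]. apply Rmult_le_compat_l; lra.
Qed.

Lemma near_list {X} (l : list X) (P : X -> R * R -> Prop) p :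
  (forall x, In x l -> exists d, 0 < d /\ forall p', near d p p' -> P x p') ->
  exists d, 0 < d /\ forall x, In x l -> forall p', near d p p' -> P x p'.
Proof.
  induction l as [|x l IH]; intro H.
  - exists 1. split; [lra|]. intros ? [].
  - destruct IH as [d1 [h1 D1]]. { intros; apply H; simpl; auto. }
    destruct (H x (or_introl eq_refl)) as [d2 [h2 D2]].
    exists (Rmin d1 d2). split; [now apply Rmin_pos|]. intros y Hy p' Hp'. apply near_min in Hp'.
    destruct Hp'. destruct Hy as [<-|Hy]; auto.
Qed.

Definition Tlines (q : nat) : list (R * R * R) :=
  ((1, 0, 0) :: (1, 0, -1) :: (0, 1, -1) :: (lambda_q q, 1, -1) :: nil).

Lemma Tlines_isline q L : In L (Tlines q) -> isline L.
Proof. unfold Tlines, isline. simpl. intros [<-|[<-|[<-|[<-|[]]]]]; simpl; lra. Qed.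

Lemma Tq_locally_const q p : (forall L, In L (Tlines q) -> lineval L p <> 0) ->
  exists d, 0 < d /\ forall p', near d p p' -> (inTq q p' <-> inTq q p).
Proof.
  intro H.
  destruct (near_list (Tlines q) (fun L p' => 0 < lineval L p' <-> 0 < lineval L p) p) as [d [Hd D]].
  { intros L HL. specialize (H L HL).
    destruct (Rlt_le_dec 0 (lineval L p)) as [h|h].
    - destruct (cont2_pos (lineval L) p) as [d [Hd D]]; auto; [apply cont2_affine|].
      exists d. split; auto. intros p' Hp'. specialize (D p' Hp'). split; lra.
    - destruct (cont2_pos (fun p => - fst (fst L) * fst p + - snd (fst L) * snd p + - snd L) p) as [d [Hd D]].
      + apply cont2_affine.
      + unfold lineval in *. lra.
      + exists d. split; auto. intros p' Hp'. specialize (D p' Hp'). unfold lineval in *. split; lra. }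
  destruct (near_list (Tlines q) (fun L p' => lineval L p' <> 0) p) as [d2 [Hd2 D2]].
  { intros L HL. specialize (H L HL).
    destruct (Rlt_le_dec 0 (lineval L p)) as [h|h].
    - destruct (cont2_pos (lineval L) p) as [d2 [Hd2 D2]]; auto; [apply cont2_affine|].
      exists d2. split; auto. intros p' Hp'. specialize (D2 p' Hp'). lra.
    - destruct (cont2_pos (fun p => - fst (fst L) * fst p + - snd (fst L) * snd p + - snd L) p) as [d2 [Hd2 D2]].
      + apply cont2_affine.
      + unfold lineval in *. lra.
      + exists d2. split; auto. intros p' Hp'. specialize (D2 p' Hp'). unfold lineval in *. lra. }
  exists (Rmin d d2). split; [now apply Rmin_pos|]. intros p' Hp'. apply near_min in Hp'. destruct Hp' as [n1 n2].
  pose proof (D (1, 0, 0) ltac:(simpl; tauto) p' n1) as E1.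
  pose proof (D (1, 0, -1) ltac:(simpl; tauto) p' n1) as E2.
  pose proof (D (0, 1, -1) ltac:(simpl; tauto) p' n1) as E3.
  pose proof (D (lambda_q q, 1, -1) ltac:(simpl; tauto) p' n1) as E4.
  unfold lineval in E1, E2, E3, E4; simpl in E1, E2, E3, E4. unfold inTq.
  split; intros [[h1 h2] [h3 h4]]; repeat split.
  - assert (0 < 1 * fst p + 0 * snd p + 0) by (apply E1; lra). lra.
  - apply Rnot_lt_le. intro. assert (0 < 1 * fst p' + 0 * snd p' + -1) by (apply E2; lra). lra.
  - assert (0 < lambda_q q * fst p + 1 * snd p + -1) by (apply E4; lra). lra.
  - apply Rnot_lt_le. intro. assert (0 < 0 * fst p' + 1 * snd p' + -1) by (apply E3; lra). lra.
  - assert (0 < 1 * fst p' + 0 * snd p' + 0) by (apply E1; lra). lra.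
  - apply Rnot_lt_le. intro. assert (0 < 1 * fst p + 0 * snd p + -1) by (apply E2; lra). lra.
  - assert (0 < lambda_q q * fst p' + 1 * snd p' + -1) by (apply E4; lra). lra.
  - apply Rnot_lt_le. intro. assert (0 < 0 * fst p + 1 * snd p + -1) by (apply E3; lra). lra.
Qed.

Lemma contoff_ext0 q g Ls : (forall L, In L (Tlines q) -> In L Ls) ->
  (forall p, inTq q p -> (forall L, In L Ls -> lineval L p <> 0) -> forall e, 0 < e ->
    exists d, 0 < d /\ forall p', inTq q p' -> near d p p' -> Rabs (g p' - g p) < e) ->
  contoff (ext0 q g) Ls.
Proof.
  intros HI Hg p _ Hp e He.
  destruct (Tq_locally_const q p) as [d1 [Hd1 D1]]; auto.
  destruct (classic (inTq q p)) as [T|T].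
  - destruct (Hg p T Hp e He) as [d2 [Hd2 D2]].
    exists (Rmin d1 d2). split; [now apply Rmin_pos|]. intros p' _ Hp'. apply near_min in Hp'. destruct Hp' as [n1 n2].
    assert (T' : inTq q p') by (apply D1; auto). rewrite !ext0_in by auto. auto.
  - exists d1. split; auto. intros p' _ Hp'. rewrite !ext0_out; auto.
    + rewrite Rminus_diag, Rabs_R0. auto.
    + intro T'. apply T. apply (D1 p'); auto.
Qed.

Lemma Rq_candidates q (hq : (3 <= q)%nat) B : 0 < B -> exists l : list (R * R),
  (forall w, In w l -> inLambda q w /\ 0 < snd w) /\
  forall p w, inTq q p -> inLambda q w -> 0 < zx (mat_g (fst p) (snd p)) w <= 1 ->
    0 < zsl (mat_g (fst p) (snd p)) w <= B -> In w l.
Proof.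
  intro HB. pose proof (lam_bounds q hq) as Hl. set (z := Mat 0 1 (-1) 0).
  destruct (enum_slopes q hq z B (- (B * (1 + B))) (B * (1 + B))) as [l [_ Hl']].
  { unfold z, det; simpl; ring. } { auto. }
  assert (Ez : forall w, zx z w = snd w) by (intro w; unfold zx, mapp, z; simpl; ring).
  exists l. split.
  - intros w Hw. apply Hl' in Hw. rewrite Ez in Hw. tauto.
  - intros p w [[Ha1 Ha2] [Hb1 Hb2]] Hw Hx Hs. apply Hl'. rewrite Ez.
    set (a := fst p) in *. set (b := snd p) in *.
    assert (Ex : zx (mat_g a b) w = a * fst w + b * snd w) by (unfold zx, mapp, mat_g; simpl; ring).
    assert (Es : zsl (mat_g a b) w * (a * zx (mat_g a b) w) = snd w).
    { rewrite (Rmult_comm a), <- Rmult_assoc, <- zsl_snd by lra. unfold mapp, mat_g; simpl. field. lra. }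
    set (s := zsl (mat_g a b) w) in *. set (x := zx (mat_g a b) w) in *.
    assert (Pax : 0 < a * x) by (apply Rmult_lt_0_compat; lra).
    assert (Hy : 0 < snd w) by (rewrite <- Es; apply Rmult_lt_0_compat; lra).
    assert (Hy1 : 1 <= snd w).
    { destruct (Lam_snd q hq w Hw) as [[h _]|h]; [lra|]. rewrite Rabs_right in h; lra. }
    assert (Hax : a * x <= a) by nra.
    assert (HyB : snd w <= B * a).
    { rewrite <- Es. apply Rmult_le_compat; lra. }
    assert (HyB' : snd w <= B) by nra.
    split; auto. split; auto.
    assert (Esl : zsl z w = - (fst w / snd w)).
    { unfold zsl, slope, mapp, z; simpl. field. lra. }
    rewrite Esl.
    assert (E : a * fst w = x - b * snd w) by lra.
    assert (Hb : Rabs b <= 1) by (apply Rabs_le; nra).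
    assert (Hax2 : Rabs (a * fst w) <= 1 + snd w).
    { rewrite E. apply Rabs_le_iff in Hb. apply Rabs_le. nra. }
    assert (Hf : Rabs (fst w) <= B * (1 + B) * snd w).
    { apply (Rmult_le_reg_l a); auto. rewrite <- (Rabs_right a) at 1 by lra. rewrite <- Rabs_mult.
      eapply Rle_trans; [apply Hax2|].
      apply Rle_trans with ((1 + B) * 1); [lra|].
      assert (1 <= B * a) by lra.
      replace (a * (B * (1 + B) * snd w)) with ((1 + B) * (B * a * snd w)) by ring.
      apply Rmult_le_compat_l; [lra|]. nra. }
    apply Rabs_le_iff. rewrite Rabs_Ropp. unfold Rdiv. rewrite Rabs_mult, Rabs_inv, (Rabs_right (snd w)) by lra.
    apply (Rmult_le_reg_r (snd w)); auto. rewrite Rmult_assoc, Rinv_l by lra. lra.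
Qed.

Lemma zsl_g a b w : 0 < a -> zx (mat_g a b) w <> 0 -> zsl (mat_g a b) w = snd w * / (a * zx (mat_g a b) w).
Proof.
  intros Ha Hx. unfold zsl, slope. fold (zx (mat_g a b) w).
  replace (snd (mapp (mat_g a b) w)) with (snd w / a) by (unfold mapp, mat_g; simpl; field; lra).
  field. split; lra.
Qed.

(** Below [B], [Rq] is the minimum of finitely many functions [snd w / (a x)], over those [w] whose
    image has first coordinate [x] in [(0, 1]]. Each is continuous there, and the set of active [w]
    changes only across the lines [x = 0] and [x = 1]. *)
Lemma minRq_cont q (hq : (3 <= q)%nat) B : 0 < B -> exists Ls,
  (forall L, In L Ls -> isline L) /\ contoff (ext0 q (fun p => Rmin (Rq q p) B)) Ls.
Proof.
  intro HB. destruct (Rq_candidates q hq B HB) as [l [Hl1 Hl2]].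
  exists (Tlines q ++ map (fun w => (fst w, snd w, -1)) l ++ map (fun w => (fst w, snd w, 0)) l). split.
  - intros L HL. rewrite !in_app_iff, !in_map_iff in HL.
    destruct HL as [HL|[[w [<- Hw]]|[w [<- Hw]]]]; [now apply Tlines_isline with q| |];
    destruct (Hl1 w Hw); right; simpl; lra.
  - apply contoff_ext0. { intros; apply in_app_iff; auto. }
    intros p T Hoff e He.
    assert (Ha : 0 < fst p) by (destruct T; lra).
    assert (Ex : forall p w, zx (mat_g (fst p) (snd p)) w = fst w * fst p + snd w * snd p + 0).
    { intros p' w. unfold zx, mapp, mat_g; simpl; ring. }
    set (act := fun w (p' : R * R) => 0 < zx (mat_g (fst p') (snd p')) w <= 1).
    destruct (near_list l (fun w p' => (act w p' <-> act w p) /\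
      (act w p -> 0 < fst p' -> Rabs (zsl (mat_g (fst p') (snd p')) w - zsl (mat_g (fst p) (snd p)) w) < e)) p) as [d [Hd D]].
    { intros w Hw. destruct (Hl1 w Hw) as [w1 w2].
      assert (N1 : fst w * fst p + snd w * snd p + -1 <> 0).
      { apply (Hoff (fst w, snd w, -1)). rewrite !in_app_iff, !in_map_iff. right; left. eauto. }
      assert (N0 : fst w * fst p + snd w * snd p + 0 <> 0).
      { apply (Hoff (fst w, snd w, 0)). rewrite !in_app_iff, !in_map_iff. right; right. eauto. }
      assert (CX := cont2_affine (fst w) (snd w) 0 p).
      destruct (Rlt_le_dec (fst w * fst p + snd w * snd p + 0) 0) as [h|h].
      - destruct (cont2_pos (fun p => - fst w * fst p + - snd w * snd p + 0) p (cont2_affine _ _ _ _)) as [d [Hd D]]; [lra|].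
        exists d. split; auto. intros p' Hp'. specialize (D p' Hp'). unfold act. rewrite !Ex. split; [split; intros; lra|intros; lra].
      - destruct (Rlt_le_dec 1 (fst w * fst p + snd w * snd p + 0)) as [h'|h'].
        + destruct (cont2_pos (fun p => fst w * fst p + snd w * snd p + -1) p (cont2_affine _ _ _ _)) as [d [Hd D]]; [lra|].
          exists d. split; auto. intros p' Hp'. specialize (D p' Hp'). unfold act. rewrite !Ex. split; [split; intros; lra|intros; lra].
        + destruct (cont2_pos (fun p => - fst w * fst p + - snd w * snd p + 1) p (cont2_affine _ _ _ _)) as [d1 [Hd1 D1]]; [lra|].
          destruct (cont2_pos _ p CX) as [d2 [Hd2 D2]]; [lra|].
          assert (CS : cont2 (fun p => snd w * / (fst p * (fst w * fst p + snd w * snd p + 0))) p).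
          { apply cont2_mult.
            - intros e' He'. exists 1. split; [lra|]. intros. rewrite Rminus_diag, Rabs_R0. auto.
            - apply cont2_inv; [|apply Rmult_lt_0_compat; lra]. apply cont2_mult; auto.
              intros e' He'. exists e'. split; auto. intros p' [hh _]. auto. }
          destruct (CS e He) as [d3 [Hd3 D3]].
          exists (Rmin (Rmin d1 d2) d3). split; [repeat apply Rmin_pos; auto|].
          intros p' Hp'. apply near_min in Hp'. destruct Hp' as [Hp' n3]. apply near_min in Hp'. destruct Hp' as [n1 n2].
          specialize (D1 p' n1). specialize (D2 p' n2). specialize (D3 p' n3). unfold act. rewrite !Ex. split.
          * split; intros; lra.
          * intros _ Hp'. rewrite !zsl_g by (auto; rewrite Ex; lra). rewrite !Ex. auto. }
    exists d. split; auto. intros p' T' Hp'.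
    assert (Ha' : 0 < fst p') by (destruct T'; lra).
    assert (K : forall p1 p2, inTq q p1 -> inTq q p2 ->
      (forall w, In w l -> act w p1 -> act w p2 /\ zsl (mat_g (fst p2) (snd p2)) w < zsl (mat_g (fst p1) (snd p1)) w + e) ->
      Rmin (Rq q p2) B < Rmin (Rq q p1) B + e).
    { intros p1 p2 T1 T2 HK. destruct (Rle_lt_dec B (Rq q p1)) as [h|h].
      - rewrite (Rmin_right (Rq q p1)) by auto. pose proof (Rmin_r (Rq q p2) B). lra.
      - rewrite (Rmin_left (Rq q p1)) by lra.
        destruct (Rq_spec q hq p1 T1) as [[u ([w [Hw ->]] & u2 & u3 & u4)] _].
        fold (zsl (mat_g (fst p1) (snd p1)) w) in u3, u4. unfold inStrip in u2. fold (zx (mat_g (fst p1) (snd p1)) w) in u2.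
        assert (Inw : In w l) by (apply (Hl2 p1 w); auto; lra).
        destruct (HK w Inw u2) as [A2 S2].
        assert (0 < zsl (mat_g (fst p2) (snd p2)) w).
        { destruct (Hl1 w Inw). rewrite zsl_g; [|destruct T2; lra|unfold act in A2; lra].
          apply Rmult_lt_0_compat; auto. apply inv_pos, Rmult_lt_0_compat; [destruct T2; lra|unfold act in A2; lra]. }
        pose proof (Rq_le q hq p2 w T2 Hw A2 H). pose proof (Rmin_l (Rq q p2) B). lra. }
    apply Rabs_def1.
    + assert (Rmin (Rq q p') B < Rmin (Rq q p) B + e); [|lra]. apply K; auto.
      intros w Hw A1. destruct (D w Hw p' Hp') as [h1 h2]. split; [now apply h1|].
      specialize (h2 A1 Ha'). apply Rabs_def2 in h2. lra.
    + assert (Rmin (Rq q p) B < Rmin (Rq q p') B + e); [|lra]. apply K; auto.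
      intros w Hw A1. destruct (D w Hw p' Hp') as [h1 h2]. assert (A2 : act w p) by now apply h1. split; auto.
      specialize (h2 A2 Ha'). apply Rabs_def2 in h2. lra.
Qed.

(** * Two-sided limits and the normalisation *)

Lemma FTRs_ex q (hq : (3 <= q)%nat) A I t l : det A = 1 -> enumv q A I t l -> exists phi, FTRs q A t l phi.
Proof.
  intros D [_ Hl]. exists (fun v => epsilon (inhabits (0, 0)) (FTR_is q A t (mapp A v))).
  intros v Hv. apply epsilon_spec. apply Hl in Hv. apply FTR_ex; auto; tauto.
Qed.

Lemma ratio_le_density q (hq : (3 <= q)%nat) kap A I al be e : is_density q kap -> det A = 1 -> al < be ->
  itv I al be -> 0 < e -> exists T, 1 <= T /\ forall t l, T <= t -> enumv q A I t l ->
    (be - al) * kap - e <= INR (length l) / t ^ 2 <= (be - al) * kap + e.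
Proof.
  intros DK D Hab HI He. destruct (DK A I al be e D Hab HI He) as [T [HT HT']].
  exists T. split; auto. intros t l Ht Hl. specialize (HT' t l Ht Hl). apply Rabs_le_iff in HT'. lra.
Qed.

Lemma KN_small q e : 0 < e -> exists N : nat, forall n, (N <= n)%nat -> lambda_q q / 2 - e <= lambda_q q / 2 - 3 / KN n.
Proof.
  intro He. destruct (KN_large (3 / e)) as [N HN]. exists N. intros n Hn. specialize (HN n Hn).
  pose proof (KN_ge1 n).
  assert (3 / KN n <= e); [|lra].
  apply (Rmult_le_reg_r (KN n)); [lra|]. unfold Rdiv. rewrite Rmult_assoc, Rinv_l by lra.
  apply (Rmult_le_compat_l e) in HN; [|lra]. replace (e * (3 / e)) with 3 in HN by (field; lra). lra.
Qed.

Lemma ext0_plus q f B p : ext0 q f p + ext0 q (fun _ => B) p = ext0 q (fun p => f p + B) p.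
Proof.
  destruct (classic (inTq q p)); [rewrite !ext0_in|rewrite !ext0_out]; auto. ring.
Qed.

Lemma ext0_neg q f p : ext0 q (fun p => - f p) p = - ext0 q f p.
Proof.
  destruct (classic (inTq q p)); [rewrite !ext0_in|rewrite !ext0_out]; auto. ring.
Qed.

Lemma ext0_bound q f B p : 0 <= B -> (forall p, inTq q p -> Rabs (f p) <= B) -> Rabs (ext0 q f p) <= B.
Proof.
  intros HB H. destruct (classic (inTq q p)); [rewrite ext0_in|rewrite ext0_out]; auto. rewrite Rabs_R0. auto.
Qed.

(* A lower bound for bounded functions that may be negative: shift by a constant B and use the known total count. *)
Lemma bounded_lower q (hq : (3 <= q)%nat) kap : 0 <= kap -> is_density q kap ->
  forall f B A I al be e, 0 <= B -> (forall p, inTq q p -> Rabs (f p) <= B) ->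
  det A = 1 -> al < be -> itv I al be -> 0 < e ->
  exists N, forall n, (N <= n)%nat -> exists T, 1 <= T /\ forall t l phi, T <= t ->
   enumv q A I t l -> FTRs q A t l phi ->
   (be - al) * (2 * kap / lambda_q q) * lower_sum (ext0 q f) n - e <= Sm l (fun v => f (phi v)) / t ^ 2.
Proof.
  intros Hk DK f B A I al be e HB Hf D Hab HI He. pose proof (lam_bounds q hq) as Hlam.
  set (K := (be - al) * (2 * kap / lambda_q q)).
  assert (HK : 0 <= K).
  { apply Rmult_le_pos; [lra|]. unfold Rdiv. apply Rmult_le_pos; [lra|left; apply inv_pos; lra]. }
  set (e1 := e / (3 * (K * B + 1))).
  assert (HKB : 0 <= K * B) by nra.
  assert (He1 : 0 < e1) by (apply Rdiv_lt_0_compat; lra).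
  assert (He1' : e1 * (K * B + 1) = e / 3) by (unfold e1; field; lra). clearbody e1.
  destruct (KN_small q e1 He1) as [N HN]. exists N. intros n Hn. specialize (HN n Hn).
  destruct (sum_lower q hq kap Hk DK (fun p => f p + B) n A I al be (e / 3)) as [T1 HT1]; auto; try lra.
  { intros p Hp. specialize (Hf p Hp). apply Rabs_le_iff in Hf. lra. }
  destruct (ratio_le_density q hq kap A I al be (e / (3 * (B + 1))) DK D Hab HI) as [T2 [HT2 HT2']].
  { apply Rdiv_lt_0_compat; lra. }
  exists (Rmax T1 T2). split; [eapply Rle_trans; [apply HT2|apply Rmax_r]|].
  intros t l phi Ht Hl HF.
  assert (h1 : T1 <= t) by (eapply Rle_trans; [apply Rmax_l|apply Ht]).
  assert (h2 : T2 <= t) by (eapply Rle_trans; [apply Rmax_r|apply Ht]).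
  specialize (HT1 t l phi h1 Hl HF). specialize (HT2' t l h2 Hl).
  rewrite Sm_plus, Sm_const in HT1. fold K in HT1.
  assert (LS : lower_sum (ext0 q f) n + lower_sum (ext0 q (fun _ => B)) n <= lower_sum (ext0 q (fun p => f p + B)) n).
  { apply (lower_sum_super _ _ _ n (- B) (- B)).
    - intro p. pose proof (ext0_bound q f B p HB Hf) as Q. apply Rabs_le_iff in Q. lra.
    - intro p. assert (Q : Rabs (ext0 q (fun _ => B) p) <= B).
      { apply ext0_bound; auto. intros; rewrite Rabs_right; lra. }
      apply Rabs_le_iff in Q. lra.
    - intro p. rewrite ext0_plus. lra. }
  pose proof (area_lower q hq B n HB) as AL.
  assert (AL2 : B * (lambda_q q / 2 - e1) <= lower_sum (ext0 q (fun _ => B)) n).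
  { eapply Rle_trans; [|apply AL]. apply Rmult_le_compat_l; auto. }
  assert (X : K * (lower_sum (ext0 q f) n + B * (lambda_q q / 2 - e1)) <= K * lower_sum (ext0 q (fun p => f p + B)) n).
  { apply Rmult_le_compat_l; lra. }
  assert (Y : K * (B * (lambda_q q / 2)) = B * ((be - al) * kap)) by (unfold K; field; lra).
  assert (Z : B * (INR (length l) / t ^ 2) <= B * ((be - al) * kap + e / (3 * (B + 1)))) by (apply Rmult_le_compat_l; lra).
  assert (V : B * (e / (3 * (B + 1))) <= e / 3).
  { apply (Rmult_le_reg_r (3 * (B + 1))); [lra|].
    replace (B * (e / (3 * (B + 1))) * (3 * (B + 1))) with (B * e) by (field; lra). nra. }
  unfold Rdiv in *. nra.
Qed.

(* The equidistribution constant kappa is normalised by the fact that the gaps fill up the interval. *)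
Lemma Rq_integral q (hq : (3 <= q)%nat) kap : 0 < kap -> is_density q kap ->
  mq_integral_is q (Rq q) (/ kap).
Proof.
  intros Hk DK. pose proof (lam_bounds q hq) as Hlam.
  assert (HI : itv (fun x => 0 <= x <= 1) 0 1) by (split; intros; lra).
  set (K := 2 * kap / lambda_q q).
  assert (HK : 0 < K) by (apply Rdiv_lt_0_compat; lra).
  assert (HmB : forall B p, 0 < B -> inTq q p -> Rabs (Rmin (Rq q p) B) <= B).
  { intros B p HB Hp. pose proof (Rq_pos q hq p Hp). apply Rabs_le. split; [|apply Rmin_r].
    apply Rle_trans with 0; [lra|]. apply Rmin_glb; lra. }
  assert (HR0 : forall p, 0 <= ext0 q (Rq q) p).
  { intro p. destruct (classic (inTq q p)); [rewrite ext0_in|rewrite ext0_out]; auto; [|lra].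
    left; now apply Rq_pos. }
  assert (Up : forall n, K * lower_sum (ext0 q (Rq q)) n <= 1).
  (* Exceeds every cell infimum of [Rq] at level [n], so truncating at [B] does not lower the n-th
     lower sum and [gaps_upper] can be used. *)
  { intro n. set (B := 1 + Sm (cells n) (cinf (ext0 q (Rq q)) n)).
    assert (Hc0 : forall c, 0 <= cinf (ext0 q (Rq q)) n c).
    { intro c. destruct (cinf_spec (ext0 q (Rq q)) n c 0) as [_ m]; auto. }
    assert (HB : 1 <= B).
    { unfold B. assert (0 <= Sm (cells n) (cinf (ext0 q (Rq q)) n)) by (apply Sm_nonneg; auto). lra. }
    assert (LE : lower_sum (ext0 q (Rq q)) n <= lower_sum (ext0 q (fun p => Rmin (Rq q p) B)) n).
    { rewrite !lower_sum_cells. pose proof (KN_ge1 n).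
      apply Rmult_le_compat_l; [unfold Rdiv; apply Rmult_le_pos; [lra|left; apply inv_pos; nra]|].
      apply Sm_le. intros c Hc.
      destruct (cinf_spec (ext0 q (fun p => Rmin (Rq q p) B)) n c (- B)) as [_ m].
      { intros p _. pose proof (ext0_bound q (fun p => Rmin (Rq q p) B) B p ltac:(lra)) as Q.
        specialize (Q (fun p => HmB B p ltac:(lra))). apply Rabs_le_iff in Q. lra. }
      apply m. intros p Hp.
      destruct (cinf_spec (ext0 q (Rq q)) n c 0) as [m1 _]; auto. specialize (m1 p Hp).
      destruct (classic (inTq q p)) as [T|T].
      - rewrite ext0_in in * by auto. apply Rmin_glb; auto.
        pose proof (Sm_one_le (cells n) c (cinf (ext0 q (Rq q)) n) ltac:(auto) Hc). unfold B. lra.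
      - rewrite ext0_out in * by auto. auto. }
    apply Rnot_lt_le. intro h. set (e := (K * lower_sum (ext0 q (Rq q)) n - 1) / 3).
    assert (He : 0 < e) by (unfold e; lra).
    destruct (sum_lower q hq kap ltac:(lra) DK (fun p => Rmin (Rq q p) B) n mat_id (fun x => 0 <= x <= 1) 0 1 e) as [T HT]; auto using det_id; try lra.
    { intros p Hp. pose proof (Rq_pos q hq p Hp). apply Rmin_glb; lra. }
    set (t := Rmax T (Rmax 1 (B / e))).
    assert (tT : T <= t) by apply Rmax_l.
    assert (t1 : 1 <= t) by (eapply Rle_trans; [|apply Rmax_r]; apply Rmax_l).
    assert (tB : B / e <= t) by (eapply Rle_trans; [|apply Rmax_r]; apply Rmax_r).
    destruct (enumv_ex q hq mat_id (fun x => 0 <= x <= 1) 0 1 t det_id HI ltac:(lra)) as [l Hl].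
    destruct (FTRs_ex q hq mat_id _ t l det_id Hl) as [phi HF].
    specialize (HT t l phi tT Hl HF).
    pose proof (gaps_upper q hq mat_id (fun x => 0 <= x <= 1) 0 1 t l phi B det_id ltac:(lra) HI ltac:(lra) ltac:(lra) Hl HF) as GU.
    assert (B / t ^ 2 <= e).
    { apply (Rmult_le_reg_r (t ^ 2)); [nra|]. unfold Rdiv. rewrite Rmult_assoc, Rinv_l by nra.
      apply (Rmult_le_compat_l e) in tB; [|lra]. replace (e * (B / e)) with B in tB by (field; lra).
      assert (t <= t ^ 2) by nra. nra. }
    fold K in HT. assert (K * lower_sum (ext0 q (Rq q)) n <= K * lower_sum (ext0 q (fun p => Rmin (Rq q p) B)) n)
      by (apply Rmult_le_compat_l; lra).
    unfold e in *. lra. }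
  (* The truncated gaps add up to at least [1 - e/4], while the lower bound for [- Rmin Rq B] caps
     their sum by an upper sum of the truncated roof; Riemann integrability leads back to lower
     sums. *)
  assert (Lo : forall e, 0 < e -> exists N, forall n, (N <= n)%nat -> 1 - e <= K * lower_sum (ext0 q (Rq q)) n).
  { intros e He.
    destruct (gaps_lower q hq mat_id (fun x => 0 <= x <= 1) 0 1 (e / 4) det_id ltac:(lra) HI ltac:(lra)) as (B & T1 & HB & HT1 & GL).
    destruct (minRq_cont q hq B HB) as [Ls [HLs CO]].
    set (F := fun p => Rmin (Rq q p) B) in *.
    destruct (riemann_off_lines (ext0 q F) Ls B) with (e := e / (4 * K)) as [N1 HN1]; auto.
    { intro p. apply ext0_bound; [lra|]. intros; now apply HmB. }
    { apply Rdiv_lt_0_compat; lra. }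
    destruct (bounded_lower q hq kap ltac:(lra) DK (fun p => - F p) B mat_id (fun x => 0 <= x <= 1) 0 1 (e / 4)) as [N2 HN2]; auto using det_id; try lra.
    { intros p Hp. rewrite Rabs_Ropp. now apply HmB. }
    exists (Nat.max N1 N2). intros n Hn.
    specialize (HN1 n ltac:(lia)). destruct (HN2 n ltac:(lia)) as [T2 [HT2 HT2']].
    set (t := Rmax T1 T2).
    assert (k1 : T1 <= t) by apply Rmax_l. assert (k2 : T2 <= t) by apply Rmax_r.
    destruct (enumv_ex q hq mat_id (fun x => 0 <= x <= 1) 0 1 t det_id HI ltac:(lra)) as [l Hl].
    destruct (FTRs_ex q hq mat_id _ t l det_id Hl) as [phi HF].
    specialize (GL t l phi k1 Hl HF). specialize (HT2' t l phi k2 Hl HF).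
    rewrite (Sm_ext l _ (fun v => (-1) * F (phi v))) in HT2' by (intros; ring). rewrite Sm_scal in HT2'.
    change (Sm l (fun v => Rmin (Rq q (phi v)) B)) with (Sm l (fun v => F (phi v))) in GL.
    assert (E1 : lower_sum (fun p => - ext0 q F p) n <= lower_sum (ext0 q (fun p => - F p)) n).
    { apply (lower_sum_mono _ _ n (- B)).
      - intro p. pose proof (ext0_bound q F B p ltac:(lra) (fun p => HmB B p HB)) as Q. apply Rabs_le_iff in Q. lra.
      - intro p. rewrite ext0_neg. lra. }
    assert (E2 : lower_sum (ext0 q F) n <= lower_sum (ext0 q (Rq q)) n).
    { apply (lower_sum_mono _ _ n (- B)).
      - intro p. pose proof (ext0_bound q F B p ltac:(lra) (fun p => HmB B p HB)) as Q. apply Rabs_le_iff in Q. lra.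
      - intro p. destruct (classic (inTq q p)); [rewrite !ext0_in|rewrite !ext0_out]; auto; [apply Rmin_l|lra]. }
    fold K in HT2'.
    assert (K * (- (e / (4 * K))) <= K * (lower_sum (ext0 q (Rq q)) n + lower_sum (ext0 q (fun p => - F p)) n)).
    { apply Rmult_le_compat_l; lra. }
    replace (K * (- (e / (4 * K)))) with (- (e / 4)) in H by (field; lra).
    unfold Rdiv in *. nra. }
  intros e He. destruct (Lo (kap * e / 2)) as [N HN]; [apply Rdiv_lt_0_compat; nra|].
  exists N. intros n Hn. specialize (HN n Hn). specialize (Up n).
  unfold Rdist. replace (2 / lambda_q q * lower_sum (ext0 q (Rq q)) n) with (/ kap * (K * lower_sum (ext0 q (Rq q)) n)).
  2: { unfold K. field. split; lra. }
  set (x := K * lower_sum (ext0 q (Rq q)) n) in *.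
  assert (Hik : 0 < / kap) by now apply inv_pos.
  apply Rle_lt_trans with (e / 2); [|lra]. 
  replace (e / 2) with (/ kap * (kap * e / 2)) by (field; lra).
  apply Rabs_le. split; nra.
Qed.

(** Lower bounds for [f] and [- f] trap the empirical sum between lower and upper sums at every
    large level. This gives the limit in [t], and it also shows that the lower sums are Cauchy,
    since two levels can be compared through one common empirical sum. *)
Lemma cont_integral q (hq : (3 <= q)%nat) kap f : 0 < kap -> is_density q kap ->
  bounded_on_Tq q f -> continuous_on_Tq q f ->
  exists v, Un_cv (fun n => lower_sum (ext0 q f) n) v /\
  forall A I al be e, det A = 1 -> al < be -> itv I al be -> 0 < e ->
   exists T, 1 <= T /\ forall t l phi, T <= t -> enumv q A I t l -> FTRs q A t l phi ->
     Rabs (Sm l (fun w => f (phi w)) / t ^ 2 - (be - al) * (2 * kap / lambda_q q) * v) <= e.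
Proof.
  intros Hk DK [B0 HB0] Hcont. pose proof (lam_bounds q hq) as Hlam.
  set (B := Rmax B0 0). assert (HB : 0 <= B) by apply Rmax_r.
  assert (Hf : forall p, inTq q p -> Rabs (f p) <= B).
  { intros p Hp. eapply Rle_trans; [apply HB0; auto|apply Rmax_l]. }
  assert (Hf' : forall p, inTq q p -> Rabs (- f p) <= B) by (intros; rewrite Rabs_Ropp; auto).
  assert (CO : contoff (ext0 q f) (Tlines q)).
  { apply contoff_ext0; auto. intros p Hp _ e He. destruct (Hcont p Hp e He) as [d [Hd HD]].
    exists d. split; auto. intros p' Hp' [n1 n2]. apply HD; auto. unfold dist_max.
    apply Rmax_lub_lt; rewrite Rabs_minus_sym; auto. }
  set (L := lower_sum (ext0 q f)).
  assert (Two : forall A I al be e, det A = 1 -> al < be -> itv I al be -> 0 < e ->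
    exists N, forall n, (N <= n)%nat -> exists T, 1 <= T /\ forall t l phi, T <= t -> enumv q A I t l -> FTRs q A t l phi ->
      Rabs (Sm l (fun w => f (phi w)) / t ^ 2 - (be - al) * (2 * kap / lambda_q q) * L n) <= e).
  { intros A I al be e D Hab HI He. set (K := (be - al) * (2 * kap / lambda_q q)).
    assert (HK : 0 < K).
    { apply Rmult_lt_0_compat; [lra|]. apply Rdiv_lt_0_compat; lra. }
    destruct (riemann_off_lines (ext0 q f) (Tlines q) B) with (e := e / (2 * K)) as [N0 HN0]; auto.
    { intro p. apply ext0_bound; auto. }
    { apply Tlines_isline. }
    { apply Rdiv_lt_0_compat; lra. }
    destruct (bounded_lower q hq kap ltac:(lra) DK f B A I al be (e / 2) HB Hf D Hab HI ltac:(lra)) as [N1 HN1].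
    destruct (bounded_lower q hq kap ltac:(lra) DK (fun p => - f p) B A I al be (e / 2) HB Hf' D Hab HI ltac:(lra)) as [N2 HN2].
    exists (Nat.max N0 (Nat.max N1 N2)). intros n Hn. specialize (HN0 n ltac:(lia)).
    destruct (HN1 n ltac:(lia)) as [T1 [HT1 HT1']]. destruct (HN2 n ltac:(lia)) as [T2 [HT2 HT2']].
    exists (Rmax T1 T2). split; [eapply Rle_trans; [apply HT1|apply Rmax_l]|].
    intros t l phi Ht Hl HF.
    assert (h1 : T1 <= t) by (eapply Rle_trans; [apply Rmax_l|apply Ht]).
    assert (h2 : T2 <= t) by (eapply Rle_trans; [apply Rmax_r|apply Ht]).
    specialize (HT1' t l phi h1 Hl HF). specialize (HT2' t l phi h2 Hl HF).
    rewrite (Sm_ext l (fun v => - f (phi v)) (fun v => (-1) * f (phi v))) in HT2' by (intros; ring). rewrite Sm_scal in HT2'.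
    assert (E1 : lower_sum (fun p => - ext0 q f p) n <= lower_sum (ext0 q (fun p => - f p)) n).
    { apply (lower_sum_mono _ _ n (- B)).
      - intro p. pose proof (ext0_bound q f B p HB Hf) as Q. apply Rabs_le_iff in Q. lra.
      - intro p. rewrite ext0_neg. lra. }
    fold K in HT1', HT2'. fold (L n) in *.
    assert (X : K * (- (e / (2 * K))) <= K * (L n + lower_sum (ext0 q (fun p => - f p)) n)).
    { apply Rmult_le_compat_l; [lra|]. unfold L in *. lra. }
    replace (K * (- (e / (2 * K)))) with (- (e / 2)) in X by (field; lra).
    apply Rabs_le. unfold Rdiv in *. unfold L in *. split; nra. }
  assert (HI : itv (fun x => 0 <= x <= 1) 0 1) by (split; intros; lra).
  assert (HK0 : 0 < 2 * kap / lambda_q q) by (apply Rdiv_lt_0_compat; lra).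
  assert (Cau : Cauchy_crit L).
  { intros e He.
    destruct (Two mat_id (fun x => 0 <= x <= 1) 0 1 (2 * kap / lambda_q q * e / 4) det_id ltac:(lra) HI) as [N HN].
    { apply Rdiv_lt_0_compat; [|lra]. apply Rmult_lt_0_compat; lra. }
    exists N. intros n m Hn Hm. destruct (HN n Hn) as [T1 [HT1 HT1']]. destruct (HN m Hm) as [T2 [HT2 HT2']].
    set (t := Rmax T1 T2).
    assert (k1 : T1 <= t) by apply Rmax_l. assert (k2 : T2 <= t) by apply Rmax_r.
    destruct (enumv_ex q hq mat_id (fun x => 0 <= x <= 1) 0 1 t det_id HI ltac:(lra)) as [l Hl].
    destruct (FTRs_ex q hq mat_id _ t l det_id Hl) as [phi HF].
    specialize (HT1' t l phi k1 Hl HF). specialize (HT2' t l phi k2 Hl HF).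
    apply Rabs_le_iff in HT1'. apply Rabs_le_iff in HT2'. unfold Rdist.
    apply Rle_lt_trans with (e / 2); [|lra]. apply Rabs_le.
    set (k := 2 * kap / lambda_q q) in *.
    generalize dependent (L n). generalize dependent (L m).
    generalize dependent (Sm l (fun w => f (phi w)) / t ^ 2). clearbody k. intros s y H2 x H1.
    split; apply (Rmult_le_reg_l k); auto; lra. }
  destruct (R_complete L Cau) as [v Hv]. exists v. split; auto.
  intros A I al be e D Hab HI' He.
  set (K := (be - al) * (2 * kap / lambda_q q)).
  assert (HK : 0 < K) by (apply Rmult_lt_0_compat; lra).
  destruct (Two A I al be (e / 2) D Hab HI' ltac:(lra)) as [N HN].
  destruct (Hv (e / (2 * K))) as [N' HN']; [apply Rdiv_lt_0_compat; lra|].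
  destruct (HN (Nat.max N N') ltac:(lia)) as [T [HT HT']].
  exists T. split; auto. intros t l phi Ht Hl HF. specialize (HT' t l phi Ht Hl HF). fold K in HT'.
  specialize (HN' (Nat.max N N') ltac:(lia)). unfold Rdist in HN'. apply Rabs_def2 in HN'.
  set (x := L (Nat.max N N')) in *.
  assert (Y : K * (e / (2 * K)) = e / 2) by (field; lra).
  assert (K * (x - v) <= K * (e / (2 * K))) by (apply Rmult_le_compat_l; lra).
  assert (K * - (e / (2 * K)) <= K * (x - v)) by (apply Rmult_le_compat_l; lra).
  apply Rabs_le_iff in HT'. apply Rabs_le. lra.
Qed.

Lemma enumerates_enumv q A I t l : det A = 1 -> enumerates (inF q A I t) l ->
  enumv q A I t (map (mapp (minv A)) l).
Proof.
  intros D [ND Hl]. split.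
  - apply FinFun.Injective_map_NoDup; auto. intros a b E. apply mapp_inj in E; auto. now rewrite det_minv.
  - intro v. rewrite in_map_iff. unfold zx, zsl. split.
    + intros [u [<- Hu]]. apply Hl in Hu. destruct Hu as ([w [Hw ->]] & h2 & h3).
      rewrite mapp_minv_l by auto. auto.
    + intros (h1 & h2 & h3). exists (mapp A v). split; [now apply mapp_minv_l|].
      apply Hl. split; [exists v; auto|]. split; auto.
Qed.

Theorem mainTheorem10 (q : nat) (hq : (3 <= q)%nat) (A : mat) (hA : det A = 1)
  (I : R -> Prop) (alpha beta : R) (hab : alpha < beta)
  (hI1 : forall x, alpha < x < beta -> I x)
  (hI2 : forall x, I x -> alpha <= x <= beta) :
  exists mR : R,
    0 < mR /\ mq_integral_is q (Rq q) mR /\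
    (* F_I(A Lambda_q, tau) is finite *)
    (forall tau, 0 < tau -> exists l, enumerates (inF q A I tau) l) /\
    (* N_I(A Lambda_q, tau) / tau^2 -> |I| / m_q(R_q) *)
    (forall eps, 0 < eps -> exists T, forall tau l, T < tau ->
       enumerates (inF q A I tau) l ->
       Rabs (INR (length l) / tau ^ 2 - (beta - alpha) / mR) < eps) /\
    (* FTR is defined on F_I *)
    (forall tau u, 0 < tau -> inF q A I tau u -> exists p, FTR_is q A tau u p) /\
    (* rho_{A Lambda_q, I, tau} -> m_q weakly *)
    (forall f : R * R -> R, bounded_on_Tq q f -> continuous_on_Tq q f ->
       exists L, mq_integral_is q f L /\
       forall eps, 0 < eps -> exists T, forall tau l (phi : R * R -> R * R),
         T < tau -> enumerates (inF q A I tau) l ->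
         (forall u, In u l -> FTR_is q A tau u (phi u)) ->
         Rabs (/ INR (length l) * lsum l (fun u => f (phi u)) - L) < eps).
Proof.
  destruct (kappa_ex q hq) as [kap [_ DK]].
  pose proof (density_pos q hq kap DK) as Hk. pose proof (lam_bounds q hq) as Hlam.
  assert (HI : itv I alpha beta) by (split; auto).
  (* [Rq_integral] identifies the integral of the roof with the inverse density, so the growth rate
     [(beta - alpha) kap] has the required form. *)
  exists (/ kap). split; [now apply inv_pos|]. split; [now apply Rq_integral|].
  split; [|split; [|split]].
  - intros tau Ht. destruct (enumv_ex q hq A I alpha beta tau hA HI Ht) as [l [ND Hl]].
    exists (map (mapp A) l). split.
    + apply FinFun.Injective_map_NoDup; auto. intros a b E. now apply mapp_inj in E.
    + intro u. rewrite in_map_iff. split.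
      * intros [v [<- Hv]]. apply Hl in Hv. destruct Hv as (h1 & h2 & h3).
        split; [exists v; auto|]. split; auto.
      * intros ([v [Hv ->]] & h2 & h3). exists v. split; auto. apply Hl. auto.
  - intros eps He. destruct (DK A I alpha beta (eps / 2) hA hab HI ltac:(lra)) as [T [HT HT']].
    exists T. intros tau l Ht Hl. apply (enumerates_enumv q A I tau l hA) in Hl.
    specialize (HT' tau _ ltac:(lra) Hl). rewrite length_map in HT'.
    unfold Rdiv at 2. rewrite Rinv_inv. lra.
  - intros tau u Ht ([v [Hv ->]] & h2 & h3). apply FTR_ex; auto.
  - intros f Hb Hc. destruct (cont_integral q hq kap f Hk DK Hb Hc) as [v [Hv EQ]].
    exists (2 / lambda_q q * v). split.
    { unfold mq_integral_is. apply CV_mult; auto. intros e He. exists 0%nat. intros.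
      unfold Rdist. now rewrite Rminus_diag, Rabs_R0. }
    intros eps He. set (w := beta - alpha). assert (Hw : 0 < w) by (unfold w; lra).
    set (M := 2 / lambda_q q * v).
    (* S / N - M = (S - M N) / N with N bounded below by w kap / 2 *)
    set (d := Rmin (w * kap / 2) (w * kap * eps / (8 * (Rabs M + 1)))).
    pose proof (Rabs_pos M) as HM. assert (Hwk : 0 < w * kap) by (apply Rmult_lt_0_compat; auto).
    assert (Hd : 0 < d).
    { apply Rmin_pos; [lra|]. apply Rdiv_lt_0_compat; [apply Rmult_lt_0_compat; lra|lra]. }
    assert (Hd1 : d <= w * kap / 2) by apply Rmin_l.
    assert (Hd2 : d * (Rabs M + 1) <= w * kap * eps / 8).
    { apply Rle_trans with (w * kap * eps / (8 * (Rabs M + 1)) * (Rabs M + 1)).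
      - apply Rmult_le_compat_r; [lra|apply Rmin_r].
      - right. field. lra. }
    clearbody d.
    destruct (EQ A I alpha beta d hA hab HI Hd) as [T1 [HT1 HT1']].
    destruct (DK A I alpha beta d hA hab HI Hd) as [T2 [HT2 HT2']].
    exists (Rmax T1 T2). intros tau l phi Ht Hl HF.
    assert (h1 : T1 <= tau) by (apply Rle_trans with (Rmax T1 T2); [apply Rmax_l|lra]).
    assert (h2 : T2 <= tau) by (apply Rle_trans with (Rmax T1 T2); [apply Rmax_r|lra]).
    pose proof (enumerates_enumv q A I tau l hA Hl) as Hl'.
    specialize (HT2' tau _ h2 Hl'). rewrite length_map in HT2'.
    assert (HF' : FTRs q A tau (map (mapp (minv A)) l) (fun x => phi (mapp A x))).
    { intros x Hx. apply in_map_iff in Hx. destruct Hx as [u [<- Hu]]. rewrite mapp_minv_r by auto. auto. }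
    specialize (HT1' tau _ _ h1 Hl' HF'). rewrite Sm_map in HT1'.
    rewrite (Sm_ext l _ (fun u => f (phi u))) in HT1' by (intros; now rewrite mapp_minv_r).
    rewrite lsum_Sm. set (S := Sm l (fun u => f (phi u))) in *. fold w in HT1', HT2'.
    replace (w * (2 * kap / lambda_q q) * v) with (w * kap * M) in HT1' by (unfold M; field; lra).
    assert (t2 : 0 < tau ^ 2) by nra.
    set (Nn := INR (length l) / tau ^ 2) in *. apply Rabs_le_iff in HT2'.
    assert (HN : w * kap / 2 <= Nn) by lra.
    assert (E : / INR (length l) * S - M = (S / tau ^ 2 - M * Nn) * / Nn).
    { unfold Nn. assert (INR (length l) <> 0).
      { intro Z. unfold Nn in HN. rewrite Z in HN. unfold Rdiv in HN at 2. lra. }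
      field. split; lra. }
    rewrite E, Rabs_mult, (Rabs_right (/ Nn)) by (left; apply inv_pos; lra).
    assert (A1 : Rabs (S / tau ^ 2 - M * Nn) <= w * kap * eps / 8).
    { replace (S / tau ^ 2 - M * Nn) with ((S / tau ^ 2 - w * kap * M) + M * (w * kap - Nn)) by ring.
      eapply Rle_trans; [apply Rabs_triang|].
      assert (Rabs (M * (w * kap - Nn)) <= Rabs M * d) by (apply Rabs_mul_le; [lra|apply Rabs_le; lra]).
      lra. }
    apply (Rmult_lt_reg_r Nn); [lra|]. rewrite Rmult_assoc, Rinv_l by lra. nra.
Qed.
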